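(* Let $V$ be a grading-restricted vertex superalgebra, $g$ an automorphism of $V$ and $W$ a lower-bounded generalized $g$-twisted $V$-module. Let $u\in V^{[\alpha]}$, $v\in V$ and $w\in W$, and let $M_{u,w}\in\mathbb Z_+$ be such that $x^{\alpha+M_{u, w}}(Y_{W}^{g})_{0}(u, x)w\in W[[x]]$. Then $$(x_{1}-x_{2})^{\alpha}(x_{1}-x_2)^{\mathcal{N}_{g}}Y_{W}^{g}(u, x_{1})(x_{1}-x_2)^{-\mathcal{N}_{g}}(Y^{g})_{WV}^{W}(w, x_{2})v$$ $$- (-1)^{|u||w|} (-x_{2}+x_{1})^{\alpha}(Y^{g})_{WV}^{W}(w, x_{2})(-x_{2}+x_1)^{\mathcal{N}_{g}}Y_{V}(u, x_1)(-x_{2}+x_1)^{-\mathcal{N}_{g}}v$$ $$= \sum_{k=0}^{M_{u, w}-1}\frac{1}{k!}x_1^{-1}\frac{\partial^{k}}{\partial x_{2}^{k}}\delta\left(\frac{ x_2}{x_1}\right)(Y^{g})_{WV}^{W}((Y_{W}^{g})_{\alpha+k, 0}(u)w, x_{2})v$$ and $$(x_{1}-x_{2})^{\alpha+M_{u, w}} (x_{1}-x_{2})^{\mathcal{N}_{g}}Y_{W}^{g}(u, x_{1}) (x_{1}-x_{2})^{-\mathcal{N}_{g}}(Y^{g})_{WV}^{W}(w, x_{2})v$$ $$=(-1)^{|u||w|} (-x_{2}+x_{1})^{\alpha+M_{u, w}}(Y^{g})_{WV}^{W}(w, x_{2})(-x_{2}+x_1)^{\mathcal{N}_{g}} Y_{V}(u,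 x_1)(-x_{2}+x_1)^{-\mathcal{N}_{g}}v.$$ In particular, when $g$ is semisimple (for example, when $g$ is of finite order), $$(x_{1}-x_{2})^{\alpha}Y_{W}^{g}(u, x_{1})(Y^{g})_{WV}^{W}(w, x_{2})v - (-1)^{|u||w|} (-x_{2}+x_{1})^{\alpha}(Y^{g})_{WV}^{W}(w, x_{2})Y_{V}(u, x_1)v$$ $$= \sum_{k=0}^{M_{u, w}-1}\frac{1}{k!}x_1^{-1}\frac{\partial^{k}}{\partial x_{2}^{k}}\delta\left(\frac{ x_2}{x_1}\right)(Y^{g})_{WV}^{W}((Y_{W}^{g})_{\alpha+k, 0}(u)w, x_{2})v$$ and $$(x_{1}-x_{2})^{\alpha+M_{u, w}} Y_{W}^{g}(u, x_{1}) (Y^{g})_{WV}^{W}(w, x_{2})v=(-1)^{|u||w|} (-x_{2}+x_{1})^{\alpha+M_{u, w}}(Y^{g})_{WV}^{W}(w, x_{2})Y_{V}(u, x_1)v.$$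
   Context: Conventions: $x,y,x_1,x_2$ and their logarithms are formal variables; $\delta(x)=\sum_{n\in\mathbb Z}x^n$. Expressions $(x_1-x_2)^n$ ($n\in\mathbb C$), $\log(x_1-x_2)=\log x_1+\log(1-x_2/x_1)$, etc. are expanded as power series in the second variable. For any operator or number $A$, $(-x_2+x_1)^A:=(x_2-x_1)^Ae^{\pi iA}$ (so $\log(-x_2+x_1)=\log(x_2-x_1)+\pi i$), expanded as a power series in $x_1$. $(x_1-x_2)^{\mathcal N_g}=e^{\log(x_1-x_2)\mathcal N_g}$, $(-x_2+x_1)^{\mathcal N_g}=e^{\log(-x_2+x_1)\mathcal N_g}$. For $z\in\mathbb C^\times$ and $p\in\mathbb Z$, $l_p(z)=\log|z|+i\arg z+2p\pi i$ with $0\le\arg z<2\pi$. $W\{x\}$ denotes formal series $\sum_{n\in\mathbb C}w_nx^n$, $w_n\in W$. Elements of $V$, $W$ are taken of pure parity, so $|\cdot|$ is defined. A grading-restricted vertex superalgebra is a $\frac{\mathbb Z}{2}$-graded complex vector space $V=\coprod_{n\in\frac{\mathbb Z}{2}}V_{(n)}$ with a linear map $Y_V:V\otimes V\to V[[x,x^{-1}]]$ and a vacuum $\mathbf 1\in V_{(0)}$ such that: (i) $\dim V_{(n)}<\infty$ and $V_{(n)}=0$ for $n$ sufficiently negative; with $L_V(0)v=nv$ for $v\in V_{(n)}$, $[L_V(0),Y_V(v,x)]=x\frac{d}{dx}Y_V(v,x)+Y_V(L_V(0)v,x)$; (ii) $Y_V(\mathbf 1,x)=1_V$ and $\lim_{x\to0}Y_V(u,x)\mathbf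 1=u$; (iii) with $L_V(-1)v=\lim_{x\to0}\frac{d}{dx}Y_V(v,x)\mathbf 1$, $\frac{d}{dx}Y_V(v,x)=Y_V(L_V(-1)v,x)=[L_V(-1),Y_V(v,x)]$; (iv) duality: with $|u|=0$ for $u\in\coprod_{n\in\mathbb Z}V_{(n)}$ and $|u|=1$ for $u\in\coprod_{n\in\mathbb Z+\frac12}V_{(n)}$, for $v\in V$, $v'\in V'$ (graded dual) the series $\langle v',Y_V(u_1,z_1)Y_V(u_2,z_2)v\rangle$, $(-1)^{|u_1||u_2|}\langle v',Y_V(u_2,z_2)Y_V(u_1,z_1)v\rangle$, $\langle v',Y_V(Y_V(u_1,z_1-z_2)u_2,z_2)v\rangle$ converge absolutely in $|z_1|>|z_2|>0$, $|z_2|>|z_1|>0$, $|z_2|>|z_1-z_2|>0$, respectively, to a common rational function with only possible poles at $z_1=0,z_2=0,z_1=z_2$. An automorphism $g$ of $V$ is a weight-preserving invertible linear map with $gY_V(u,x)v=Y_V(gu,x)gv$. A generalized $g$-twisted $V$-module is a $\mathbb C\times\mathbb Z_2\times\mathbb C/\mathbb Z$-graded space $W=\coprod_{n\in\mathbb C,s\in\mathbb Z_2,\alpha\in P_W}W_{[n]}^{s;[\alpha]}$ (weight, fermion number, $g$-weight; $P_W\subset\{\alpha:0\le\Re(\alpha)<1\}$), $|w|=s$ for $w$ of fermion number $s$, with operators $L_W(0),L_W(-1)$, an action of $g$, and a linear map $Y_W^g:V\otimes W\to W\{x\}[\log x]$ such that, writing $(Y_W^g)^p(v,z)$ for the result of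 substituting $x^n=e^{nl_p(z)}$, $\log x=l_p(z)$: (1) $(Y_W^g)^{p+1}(gv,z)w=(Y_W^g)^p(v,z)w$; (2) $Y_W^g(\mathbf 1,x)w=w$; (3) duality: for $u,v\in V$, $w\in W$, $w'\in W'$ (graded dual) there is $f(z_1,z_2)=\sum_{i,j,k,l=0}^Na_{ijkl}z_1^{m_i}z_2^{n_j}(\log z_1)^k(\log z_2)^l(z_1-z_2)^{-t}$ ($m_i,n_j\in\mathbb C$, $t\in\mathbb Z_+$) such that for all $p\in\mathbb Z$ the series $\langle w',(Y_W^g)^p(u,z_1)(Y_W^g)^p(v,z_2)w\rangle$, $(-1)^{|u||v|}\langle w',(Y_W^g)^p(v,z_2)(Y_W^g)^p(u,z_1)w\rangle$, $\langle w',(Y_W^g)^p(Y_V(u,z_1-z_2)v,z_2)w\rangle$ converge absolutely in $|z_1|>|z_2|>0$, $|z_2|>|z_1|>0$, $|z_2|>|z_1-z_2|>0$, and their sums equal the branch $f^{p,p}$ (obtained with $z_i^{m}=e^{ml_p(z_i)}$, $\log z_i=l_p(z_i)$) in $|z_1|>|z_2|>0$, in $|z_2|>|z_1|>0$, and in $|z_2|>|z_1-z_2|>0$, $|\arg z_1-\arg z_2|<\frac\pi2$, respectively; (4) $L_W(0)-n$ is nilpotent on each element of $W_{[n]}$; $[L_W(0),Y_W^g(v,x)]=x\frac d{dx}Y_W^g(v,x)+Y_W^g(L_V(0)v,x)$; $g-e^{2\pi i\alpha}$ is nilpotent on each element of $W^{[\alpha]}$; $gY_W^g(u,x)w=Y_W^g(gu,x)gw$;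 $|Y_W^g(u,x)w|=|u|+|w|$; (5) $\frac d{dx}Y_W^g(v,x)=[L_W(-1),Y_W^g(v,x)]$ (then also $=Y_W^g(L_V(-1)v,x)$). Here $W_{[n]}=\coprod_{s,\alpha}W_{[n]}^{s;[\alpha]}$ and $W^{[\alpha]}=\coprod_{n,s}W_{[n]}^{s;[\alpha]}$. It is lower-bounded if for some $B\in\mathbb R$, $W_{[n]}=0$ whenever $\Re(n)<B$. $V^{[\alpha]}$ is the generalized eigenspace of $g$ on $V$ with eigenvalue $e^{2\pi i\alpha}$, $0\le\Re(\alpha)<1$. On $V$ and on $W$, $\mathcal S_g$ acts on $V^{[\alpha]}$, $W^{[\alpha]}$ as multiplication by $\alpha$, and $\mathcal N_g=\frac1{2\pi i}\log(e^{-2\pi i\mathcal S_g}g)=\frac1{2\pi i}\sum_{j\ge1}\frac{(-1)^{j+1}}j(e^{-2\pi i\mathcal S_g}g-1)^j$ is (locally) nilpotent; thus $g=e^{2\pi i(\mathcal S_g+\mathcal N_g)}$. $(Y_W^g)_0(u,x)$ is the constant term of $Y_W^g(u,x)$ viewed as a power series in $\log x$; for $u\in V^{[\alpha]}$ its coefficients are defined by $(Y_{W}^{g})_{0}(u, x)w=\sum_{n\in \alpha+\mathbb{Z}}(Y_{W}^{g})_{n, 0}(u)w\,x^{-n-1}$. Twist vertex operator map: $(Y^g)_{WV}^W:W\otimes V\to W\{x\}[\log x]$, $$(Y^{g})_{WV}^{W}(w, x)v=(-1)^{|v||w|}e^{xL_{W}(-1)}Y_{W}^{g}(v, y)w\big|_{y^{n}=e^{\pi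 ni}x^{n},\; \log y=\log x+\pi i}.$$ *)

(* Defs.v *)
From mathcomp Require Import all_boot all_order all_algebra.
From mathcomp Require Import complex finmap.
From mathcomp Require Import all_classical all_reals all_analysis.

Set Implicit Arguments.
Unset Strict Implicit.
Unset Printing Implicit Defensive.

Import Order.TTheory GRing.Theory Num.Theory.

Local Open Scope classical_set_scope.
Local Open Scope ring_scope.

Definition cexp (R : realType) (z : R[i]) : R[i] :=
  (expR (complex.Re z) * cos (complex.Im z)
   +i* (expR (complex.Re z) * sin (complex.Im z)))%C.

Definition cpii (R : realType) : R[i] := (0 +i* (pi : R))%C.

Definition cabs (R : realType) (z : R[i]) : R := complex.Re `|z|.

Definition carg (R : realType) (z : R[i]) : R :=
  let t := acos (complex.Re z / cabs z) in
  if 0 <= complex.Im z then t else 2 * pi - t.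

(* The p-th value of the logarithm, l_p(z). *)
Definition clog (R : realType) (p : int) (z : R[i]) : R[i] :=
  (ln (cabs z) +i* (carg z + 2 * p%:~R * pi))%C.

Definition cbinom (R : realType) (n : R[i]) (j : nat) : R[i] :=
  (\prod_(i < j) (n - (i : nat)%:R)) / j`!%:R.

(* The strip containing the chosen representatives of C/Z. *)
Definition in_strip (R : realType) (alpha : R[i]) : Prop :=
  0 <= complex.Re alpha < 1.

Definition abs_convergent (R : realType) (T : choiceType) (f : T -> R[i]) :
    Prop :=
  summable [set: T] (fun t => (cabs (f t))%:E).

(* The sum of an absolutely convergent family, as the limit of the finite
   partial sums. *)
Definition sums_to (R : realType) (T : choiceType) (f : T -> R[i]) (s : R[i]) :
    Prop :=
  abs_convergent f /\
  forall e : R, 0 < e -> exists A : {fset T},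
    forall B : {fset T}, (A `<=` B)%fset -> cabs (\sum_(t <- B) f t - s) < e.

(* A direct sum decomposition M = \coprod_(i : I) M_i, given by its
   projections. *)
Record grading (R : realType) (I : choiceType) (M : lmodType R[i]) := Grading {
  gproj :> I -> {linear M -> M};
  gproj_idem : forall i j x, gproj i (gproj j x) = if i == j then gproj j x else 0;
  gproj_finite : forall x, finite_set [set i | gproj i x != 0];
  gproj_sum : forall x, x = \sum_(i \in [set: I]) gproj i x
}.

(* The subspace \coprod_(i in D) M_i, and the projection onto it. *)
Definition gsub (R : realType) (I : choiceType) (M : lmodType R[i])
    (G : grading I M) (D : set I) : set M :=
  [set x | forall i, ~ D i -> G i x = 0].

Definition gsubproj (R : realType) (I : choiceType) (M : lmodType R[i])
    (G : grading I M) (D : set I) (x : M) : M :=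
  \sum_(i \in D) G i x.

Definition in_graded_dual (R : realType) (I : choiceType) (M : lmodType R[i])
    (G : grading I M) (f : {scalar M}) : Prop :=
  exists s : seq I, forall i, i \notin s -> forall x, f (G i x) = 0.

Definition gen_eigenspace (R : realType) (M : lmodType R[i]) (h : M -> M)
    (c : R[i]) : set M :=
  [set x | exists n, iter n (fun y => h y - c *: y) x = 0].

(* For M = \coprod_alpha E alpha (alpha in the strip), the operator acting on
   each E alpha as the scalar phi alpha. *)
Definition act_by (R : realType) (M : lmodType R[i]) (E : R[i] -> set M)
    (phi : R[i] -> R[i]) (x : M) : M :=
  xget 0 [set y | exists r : seq (R[i] * M),
    [/\ forall p, p \in r -> in_strip p.1 /\ E p.1 p.2,
        x = \sum_(p <- r) p.2 &
        y = \sum_(p <- r) phi p.1 *: p.2]].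

(* exp (- 2 pi i S), where S acts on E alpha as alpha. *)
Definition exp_Sop (R : realType) (M : lmodType R[i]) (E : R[i] -> set M) :
    M -> M :=
  act_by E (fun alpha => cexp (- 2 * cpii R * alpha)).

(* N = (1 / 2 pi i) log (exp (- 2 pi i S) h); the index j is shifted by one. *)
Definition Nop (R : realType) (M : lmodType R[i]) (E : R[i] -> set M)
    (h : M -> M) (x : M) : M :=
  (2 * cpii R)^-1 *:
  \sum_(j \in [set: nat])
    ((-1) ^+ j / j.+1%:R) *: iter j.+1 (fun y => exp_Sop E (h y) - y) x.

(* The index m : int of the grading stands for the weight m / 2.
   YV u v n is the coefficient of x^n (not of x^(-n-1)) in Y_V(u, x) v. *)
Record vsa (R : realType) (V : lmodType R[i]) := Vsa {
  Vgr : grading int V;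
  vac : V;
  YV : V -> V -> int -> V
}.

Definition parV (R : realType) (V : lmodType R[i]) (A : vsa V) (s : bool) :
    set V :=
  gsub (Vgr A) [set m : int | odd `|m|%N = s].

Definition L0V (R : realType) (V : lmodType R[i]) (A : vsa V) (v : V) : V :=
  \sum_(m \in [set: int]) (m%:~R / 2) *: Vgr A m v.

Definition Lm1V (R : realType) (V : lmodType R[i]) (A : vsa V) (v : V) : V :=
  YV A v (vac A) 1.

Record is_vsa (R : realType) (V : lmodType R[i]) (A : vsa V) : Prop := IsVsa {
  YV_linear_l : forall v n, linear (fun u => YV A u v n);
  YV_linear_r : forall u n, linear (fun v => YV A u v n);
  vac_weight : gsub (Vgr A) [set 0] (vac A);
  Vgr_findim : forall m : int, exists s : seq V, forall v,
    gsub (Vgr A) [set m] v ->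
    exists c : nat -> R[i], v = \sum_(i < size s) c i *: nth 0 s i;
  Vgr_bounded : exists m0 : int, forall m, m < m0 -> forall v, Vgr A m v = 0;
  L0V_comm : forall u v n,
    L0V A (YV A u v n) - YV A u (L0V A v) n =
    n%:~R *: YV A u v n + YV A (L0V A u) v n;
  YV_vac : forall v n, YV A (vac A) v n = if n == 0 then v else 0;
  YV_creation : forall u, YV A u (vac A) 0 = u /\
    forall n : int, n < 0 -> YV A u (vac A) n = 0;
  Lm1V_der : forall u v n,
    (n + 1)%:~R *: YV A u v (n + 1) = YV A (Lm1V A u) v n;
  Lm1V_comm : forall u v n,
    (n + 1)%:~R *: YV A u v (n + 1) =
    Lm1V A (YV A u v n) - YV A u (Lm1V A v) n;
  YV_duality : forall (s1 s2 : bool) (u1 u2 v : V) (v' : {scalar V}),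
    parV A s1 u1 -> parV A s2 u2 -> in_graded_dual (Vgr A) v' ->
    exists (P : {poly {poly R[i]}}) (d1 d2 d12 : nat),
    let f z1 z2 :=
      (P.[z1%:P]).[z2] / (z1 ^+ d1 * z2 ^+ d2 * (z1 - z2) ^+ d12) in
    forall z1 z2 : R[i],
    [/\ `|z2| < `|z1| -> 0 < `|z2| ->
          sums_to (fun mn : int * int =>
            v' (YV A u1 (YV A u2 v mn.2) mn.1) * z1 ^ mn.1 * z2 ^ mn.2)
            (f z1 z2),
        `|z1| < `|z2| -> 0 < `|z1| ->
          sums_to (fun mn : int * int =>
            (-1) ^+ (s1 && s2) *
            v' (YV A u2 (YV A u1 v mn.1) mn.2) * z1 ^ mn.1 * z2 ^ mn.2)
            (f z1 z2) &
        `|z1 - z2| < `|z2| -> 0 < `|z1 - z2| ->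
          sums_to (fun mn : int * int =>
            v' (YV A (YV A u1 u2 mn.1) v mn.2) * (z1 - z2) ^ mn.1 * z2 ^ mn.2)
            (f z1 z2)]
}.

Record is_automorphism (R : realType) (V : lmodType R[i]) (A : vsa V)
    (g : {linear V -> V}) : Prop := IsAutomorphism {
  aut_bij : bijective g;
  aut_weight : forall m v, gsub (Vgr A) [set m] v -> gsub (Vgr A) [set m] (g v);
  aut_YV : forall u v n, g (YV A u v n) = YV A (g u) (g v) n
}.

Definition Vtw (R : realType) (V : lmodType R[i]) (g : V -> V)
    (alpha : R[i]) : set V :=
  gen_eigenspace g (cexp (2 * cpii R * alpha)).

Definition NV (R : realType) (V : lmodType R[i]) (g : V -> V) : V -> V :=
  Nop (Vtw g) g.

Definition aut_semisimple (R : realType) (V : lmodType R[i]) (g : V -> V) :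
    Prop :=
  forall v, exists r : seq (R[i] * V),
    (forall p, p \in r -> g p.2 = p.1 *: p.2) /\ v = \sum_(p <- r) p.2.

Definition aut_finite_order (R : realType) (V : lmodType R[i]) (g : V -> V) :
    Prop :=
  exists n, (0 < n)%N /\ forall v, iter n g v = v.

(* F a k is the coefficient of x^a (log x)^k. *)
Definition fs1 (R : realType) (M : Type) := R[i] -> nat -> M.

Definition fs1_deriv (R : realType) (M : lmodType R[i]) (F : fs1 R M) :
    fs1 R M :=
  fun a k => (a + 1) *: F (a + 1) k + k.+1%:R *: F (a + 1) k.+1.

Definition fs1_euler (R : realType) (M : lmodType R[i]) (F : fs1 R M) :
    fs1 R M :=
  fun a k => a *: F a k + k.+1%:R *: F a k.+1.

(* The value of x^a (log x)^k under x^n = e^{n l_p(z)}, log x = l_p(z). *)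
Definition ev_mono (R : realType) (p : int) (z a : R[i]) (k : nat) : R[i] :=
  cexp (a * clog p z) * clog p z ^+ k.

(* The grading index (n, s, alpha) is (weight, fermion number, g-weight).
   YW u w a k is the coefficient of x^a (log x)^k in Y_W^g(u, x) w. *)
Record twmod (R : realType) (V W : lmodType R[i]) := Twmod {
  Wgr : grading (R[i] * bool * R[i])%type W;
  L0W : {linear W -> W};
  Lm1W : {linear W -> W};
  gW : {linear W -> W};
  YW : V -> W -> fs1 R W
}.

(* Wwt is W_[n], Wtw is W^[alpha]. *)
Definition Wwt (R : realType) (V W : lmodType R[i]) (B : twmod V W)
    (n : R[i]) : set W :=
  gsub (Wgr B) [set i | i.1.1 = n].

Definition parW (R : realType) (V W : lmodType R[i]) (B : twmod V W)
    (s : bool) : set W :=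
  gsub (Wgr B) [set i | i.1.2 = s].

Definition Wtw (R : realType) (V W : lmodType R[i]) (B : twmod V W)
    (alpha : R[i]) : set W :=
  gsub (Wgr B) [set i | i.2 = alpha].

Definition NW (R : realType) (V W : lmodType R[i]) (B : twmod V W) : W -> W :=
  Nop (Wtw B) (gW B).

(* (Y_W^g)_{n,k}(u) w, the coefficient of x^(-n-1) (log x)^k. *)
Definition YWmode (R : realType) (V W : lmodType R[i]) (B : twmod V W)
    (n : R[i]) (k : nat) (u : V) (w : W) : W :=
  YW B u w (- n - 1) k.

(* The branch f^{p,p} of
   f(z1,z2) = \sum a_{ijkl} z1^{m_i} z2^{n_j} (log z1)^k (log z2)^l (z1-z2)^{-t}. *)
Definition branch (R : realType) (N : nat) (a : nat -> nat -> nat -> nat -> R[i])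
    (m n : nat -> R[i]) (t : nat) (p : int) (z1 z2 : R[i]) : R[i] :=
  (\sum_(i < N.+1) \sum_(j < N.+1) \sum_(k < N.+1) \sum_(l < N.+1)
     a i j k l * ev_mono p z1 (m i) k * ev_mono p z2 (n j) l) / (z1 - z2) ^+ t.

Record is_twmod (R : realType) (V W : lmodType R[i]) (A : vsa V) (g : V -> V)
    (B : twmod V W) : Prop := IsTwmod {
  YW_linear_l : forall w a k, linear (fun u => YW B u w a k);
  YW_linear_r : forall u a k, linear (fun w => YW B u w a k);
  YW_log : forall u w, exists K, forall a k, (K <= k)%N -> YW B u w a k = 0;
  Wgr_strip : forall i, ~ in_strip i.2 -> forall w, Wgr B i w = 0;
  (* An equality in the algebraic completion of W, i.e. componentwise. *)
  YW_equivariance : forall (p : int) (z : R[i]) v w i, z != 0 ->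
    \sum_(a \in [set: R[i]]) \sum_(k \in [set: nat])
      ev_mono (p + 1) z a k *: Wgr B i (YW B (g v) w a k) =
    \sum_(a \in [set: R[i]]) \sum_(k \in [set: nat])
      ev_mono p z a k *: Wgr B i (YW B v w a k);
  YW_vac : forall w a k,
    YW B (vac A) w a k = if (a == 0) && (k == 0%N) then w else 0;
  YW_duality : forall (s1 s2 : bool) (u v : V) (w : W) (w' : {scalar W}),
    parV A s1 u -> parV A s2 v -> in_graded_dual (Wgr B) w' ->
    exists (N : nat) (c : nat -> nat -> nat -> nat -> R[i])
      (m n : nat -> R[i]) (t : nat), (0 < t)%N /\
    forall (p : int) (z1 z2 : R[i]),
    [/\ `|z2| < `|z1| -> 0 < `|z2| ->
          sums_to (fun ab : R[i] * R[i] =>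
            \sum_(k \in [set: nat]) \sum_(l \in [set: nat])
              w' (YW B u (YW B v w ab.2 l) ab.1 k) *
              ev_mono p z1 ab.1 k * ev_mono p z2 ab.2 l)
            (branch N c m n t p z1 z2),
        `|z1| < `|z2| -> 0 < `|z1| ->
          sums_to (fun ab : R[i] * R[i] =>
            \sum_(k \in [set: nat]) \sum_(l \in [set: nat])
              (-1) ^+ (s1 && s2) *
              w' (YW B v (YW B u w ab.1 k) ab.2 l) *
              ev_mono p z1 ab.1 k * ev_mono p z2 ab.2 l)
            (branch N c m n t p z1 z2) &
        `|z1 - z2| < `|z2| -> 0 < `|z1 - z2| ->
          let F := fun jb : int * R[i] =>
            \sum_(l \in [set: nat])
              w' (YW B (YV A u v jb.1) w jb.2 l) *
              (z1 - z2) ^ jb.1 * ev_mono p z2 jb.2 l in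
          abs_convergent F /\
          (`|carg z1 - carg z2| < pi / 2 ->
             sums_to F (branch N c m n t p z1 z2))];
  L0W_nilp : forall n w, Wwt B n w ->
    exists N, iter N (fun y => L0W B y - n *: y) w = 0;
  L0W_comm : forall v w a k,
    L0W B (YW B v w a k) - YW B v (L0W B w) a k =
    fs1_euler (YW B v w) a k + YW B (L0V A v) w a k;
  gW_nilp : forall alpha w, Wtw B alpha w ->
    exists N, iter N (fun y => gW B y - cexp (2 * cpii R * alpha) *: y) w = 0;
  gW_YW : forall u w a k, gW B (YW B u w a k) = YW B (g u) (gW B w) a k;
  YW_parity : forall (s t : bool) u w a k, parV A s u -> parW B t w ->
    parW B (s (+) t) (YW B u w a k);
  Lm1W_der : forall v w a k,
    fs1_deriv (YW B v w) a k = Lm1W B (YW B v w a k) - YW B v (Lm1W B w) a k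
}.

Definition lower_bounded (R : realType) (V W : lmodType R[i]) (B : twmod V W) :
    Prop :=
  exists b : R, forall n, complex.Re n < b -> forall w, Wwt B n w -> w = 0.

(* y^n = e^{pi n i} x^n, log y = log x + pi i. *)
Definition subst_half_turn (R : realType) (M : lmodType R[i]) (F : fs1 R M) :
    fs1 R M :=
  fun a l => \sum_(k \in [set: nat])
    (cexp (cpii R * a) * 'C(k, l)%:R * cpii R ^+ (k - l)) *: F a k.

(* e^{xL} F(x) *)
Definition exp_x (R : realType) (M : lmodType R[i]) (L : M -> M) (F : fs1 R M) :
    fs1 R M :=
  fun a l => \sum_(j \in [set: nat]) (j`!%:R)^-1 *: iter j L (F (a - j%:R) l).

(* (Y^g)_{WV}^W(w, x) v, with the sign (-1)^{|v||w|} extended bilinearly from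
   elements of pure parity. *)
Definition YWV (R : realType) (V W : lmodType R[i]) (A : vsa V) (B : twmod V W)
    (w : W) (v : V) : fs1 R W :=
  fun a k => \sum_(s : bool) \sum_(t : bool)
    (-1) ^+ (s && t) *:
    exp_x (Lm1W B)
      (subst_half_turn
        (YW B (gsubproj (Vgr A) [set m : int | odd `|m|%N = s] v)
              (gsubproj (Wgr B) [set i | i.1.2 = t] w))) a k.

(* F a b k l is the coefficient of x1^a x2^b (log x1)^k (log x2)^l.  The sums
   over infinite index sets below are sums of finitely supported families. *)
Definition fs2 (R : realType) (M : Type) := R[i] -> R[i] -> nat -> nat -> M.

Definition mono (R : realType) (a0 b0 : R[i]) (k0 l0 : nat) : fs2 R R[i]^o :=
  fun a b k l => ((a == a0) && (b == b0) && (k == k0) && (l == l0))%:R.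

Definition swap12 (R : realType) (M : Type) (F : fs2 R M) : fs2 R M :=
  fun a b k l => F b a l k.

Definition fs2_mul (R : realType) (M : lmodType R[i]) (s : fs2 R R[i]^o)
    (F : fs2 R M) : fs2 R M :=
  fun a b k l => \sum_(p \in [set: R[i] * R[i]])
    \sum_(k' < k.+1) \sum_(l' < l.+1)
      s p.1 p.2 k' l' *: F (a - p.1) (b - p.2) (k - k')%N (l - l')%N.

Definition pow12 (R : realType) (n : R[i]) : fs2 R R[i]^o :=
  fun a b k l => \sum_(j \in [set: nat])
    ((-1) ^+ j * cbinom n j) *: mono (n - j%:R) j%:R 0 0 a b k l.

(* log (x1 - x2) = log x1 - \sum_(j >= 1) j^-1 x1^-j x2^j *)
Definition log12 (R : realType) : fs2 R R[i]^o :=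
  fun a b k l => mono 0 0 1 0 a b k l -
    \sum_(j \in [set: nat])
      (j.+1%:R)^-1 *: mono (- j.+1%:R) j.+1%:R 0 0 a b k l.

(* (- x2 + x1)^n = e^{pi i n} (x2 - x1)^n *)
Definition pow21 (R : realType) (n : R[i]) : fs2 R R[i]^o :=
  fun a b k l => cexp (cpii R * n) *: swap12 (pow12 n) a b k l.

(* log (- x2 + x1) = log (x2 - x1) + pi i *)
Definition log21 (R : realType) : fs2 R R[i]^o :=
  fun a b k l => swap12 (@log12 R) a b k l + cpii R *: mono 0 0 0 0 a b k l.

(* e^{L N} F = \sum_r (1 / r!) L^r N^r F *)
Definition fs2_exp (R : realType) (M : lmodType R[i]) (L : fs2 R R[i]^o)
    (N : M -> M) (F : fs2 R M) : fs2 R M :=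
  fun a b k l => \sum_(r \in [set: nat])
    (r`!%:R)^-1 *:
    iter r (fun G : fs2 R M =>
              fs2_mul L (fun a' b' k' l' => N (G a' b' k' l'))) F a b k l.

(* Coefficientwise application of a series in x1 (below: in x2) whose
   coefficients are linear maps. *)
Definition fs2_op1 (R : realType) (M N : lmodType R[i]) (Y : M -> fs1 R N)
    (F : fs2 R M) : fs2 R N :=
  fun a b k l => \sum_(c \in [set: R[i]]) \sum_(k' < k.+1)
    Y (F (a - c) b (k - k')%N l) c k'.

Definition fs2_op2 (R : realType) (M N : lmodType R[i]) (Y : M -> fs1 R N)
    (F : fs2 R M) : fs2 R N :=
  fun a b k l => \sum_(c \in [set: R[i]]) \sum_(l' < l.+1)
    Y (F a (b - c) k (l - l')%N) c l'.

Definition in_x2 (R : realType) (M : lmodType R[i]) (F : fs1 R M) : fs2 R M :=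
  fun a b k l => if (a == 0) && (k == 0%N) then F b l else 0.

Definition fs2_const (R : realType) (M : lmodType R[i]) (x : M) : fs2 R M :=
  fun a b k l => mono 0 0 0 0 a b k l *: x.

(* A Laurent series seen as a series with complex exponents. *)
Definition laurent (R : realType) (M : lmodType R[i]) (f : int -> M) : fs1 R M :=
  fun a k => if k == 0%N then \sum_(n \in [set n : int | n%:~R = a]) f n else 0.

Definition delta21 (R : realType) : fs2 R R[i]^o :=
  fun a b k l => \sum_(n \in [set: int]) mono (- n%:~R) n%:~R 0 0 a b k l.

Definition fs2_d2 (R : realType) (M : lmodType R[i]) (F : fs2 R M) : fs2 R M :=
  fun a b k l =>
    (b + 1) *: F a (b + 1) k l + l.+1%:R *: F a (b + 1) k l.+1.

(* (x1-x2)^n (x1-x2)^N Y_W(u,x1) (x1-x2)^-N Y_WV(w,x2) v *)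
Definition prod12 (R : realType) (V W : lmodType R[i]) (A : vsa V)
    (B : twmod V W) (n : R[i]) (u v : V) (w : W) : fs2 R W :=
  fs2_mul (pow12 n)
    (fs2_exp (@log12 R) (NW B)
      (fs2_op1 (YW B u)
        (fs2_exp (@log12 R) (fun x => - NW B x)
          (in_x2 (YWV A B w v))))).

(* (-x2+x1)^n Y_WV(w,x2) (-x2+x1)^N Y_V(u,x1) (-x2+x1)^-N v *)
Definition prod21 (R : realType) (V W : lmodType R[i]) (A : vsa V) (g : V -> V)
    (B : twmod V W) (n : R[i]) (u v : V) (w : W) : fs2 R W :=
  fs2_mul (pow21 n)
    (fs2_op2 (YWV A B w)
      (fs2_exp (@log21 R) (NV g)
        (fs2_op1 (fun v0 => laurent (YV A u v0))
          (fs2_exp (@log21 R) (fun x => - NV g x)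
            (fs2_const v))))).

(* (x1-x2)^n Y_W(u,x1) Y_WV(w,x2) v *)
Definition prod12_ss (R : realType) (V W : lmodType R[i]) (A : vsa V)
    (B : twmod V W) (n : R[i]) (u v : V) (w : W) : fs2 R W :=
  fs2_mul (pow12 n) (fs2_op1 (YW B u) (in_x2 (YWV A B w v))).

(* (-x2+x1)^n Y_WV(w,x2) Y_V(u,x1) v *)
Definition prod21_ss (R : realType) (V W : lmodType R[i]) (A : vsa V)
    (B : twmod V W) (n : R[i]) (u v : V) (w : W) : fs2 R W :=
  fs2_mul (pow21 n)
    (fs2_op2 (YWV A B w)
      (fs2_op1 (fun v0 => laurent (YV A u v0)) (fs2_const v))).

(* \sum_(k < M) (1/k!) x1^-1 (d/dx2)^k delta(x2/x1)
     Y_WV((Y_W)_{alpha+k,0}(u) w, x2) v *)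
Definition delta_sum (R : realType) (V W : lmodType R[i]) (A : vsa V)
    (B : twmod V W) (alpha : R[i]) (M : nat) (u v : V) (w : W) : fs2 R W :=
  fun a b k l => \sum_(j < M)
    (j`!%:R)^-1 *:
    fs2_mul (fs2_mul (mono (-1) 0 0 0) (iter j (@fs2_d2 R _) (@delta21 R)))
      (in_x2 (YWV A B (YWmode B (alpha + (j : nat)%:R) 0 u w) v)) a b k l.

(* x^n (Y_W)_0(u, x) w lies in W[[x]]. *)
Definition YW0_power_series (R : realType) (V W : lmodType R[i])
    (B : twmod V W) (n : R[i]) (u : V) (w : W) : Prop :=
  forall a, YW B u w a 0 != 0 -> exists j : nat, a + n = j%:R.

(* Main.v *)
From HB Require Import structures.
Require Import Defs.
From mathcomp Require Import all_boot all_order all_algebra.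
From mathcomp Require Import complex finmap.
From mathcomp Require Import all_classical all_reals all_analysis.
From mathcomp Require Import ring lra zify.

(** Write x1, x2 for the variables, N for the nilpotent operator of g and L for
    L(-1) on W.

    Two structural facts remove the logarithms. Equivariance under the monodromy
    of x gives Y(u, x) = Y_0(x^{-N} u, x) with Y_0 free of logarithms (YW_logE),
    and N is a derivation of all vertex operators because it is the logarithm of
    the unipotent part of an automorphism (N_YV, NW_YW). Hence conjugating
    Y(u, x1) by (x1 - x2)^N gives Y((x1 - x2)^N u, x1), whose logarithms combine
    to (1 - x2/x1)^N (prod12_formula). On the other side, the twist operator
    contributes (log x2 + pi i), which is exactly the leading part of
    log(-x2 + x1), and only (1 - x1/x2)^N remains (prod21_formula).

    What is left is an identity between log-free modes (core_identity), in which
    e^{x2 L} has been moved to the left of Y(u, x1); there the substitution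
    x1 -> x1 - x2 is absorbed by Chu-Vandermonde (bp_vandermonde, YW_Zs_coreA).
    This identity is the component form of duality for u, v acting on w, and not
    for u, w: the twist operator is defined through Y(v, x) w, so u meets v in the
    iterate Y(Y_V(u, x1) v, x2) and meets w in the product Y(v, x2) Y(u, x1) w.

    To prove it, evaluate duality at z2 = 1 and z1 = s > 0. After cancelling
    s^{-N} and s^{-al} the three series are a series in 1/s for s > 1, a series
    in s for s < 1, and, with s = 1 + x, a sum of series in x times the
    functions (1 + x)^al log(1 + x)^i / i!. All three equal e(log s)/(s - 1)^t
    for one exponential polynomial e. Since e times a power of s is also the sum
    of a power series in s, it is a polynomial (exppoly_rational): the powers and
    logarithms of s that the duality axiom allows do not occur. So the three
    series expand one rational function with poles at 0, 1 and infinity, and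
    comparing coefficients is the usual residue computation (delta_formula,
    expansions_delta). Functionals on one weight space of W separate its points,
    which lifts the scalar identity to W.

    The second identity of the theorem is the first for the logarithm alpha + M
    of the same eigenvalue, for which u has no singular modes on w and the sum of
    delta functions is empty. If g is semisimple then N = 0 and both exponentials
    are trivial; if g has finite order, projections built from roots of unity
    decompose V into eigenspaces. *)

Set Implicit Arguments.
Unset Strict Implicit.
Unset Printing Implicit Defensive.

Import Order.TTheory GRing.Theory Num.Theory numFieldNormedType.Exports.

Local Open Scope classical_set_scope.
Local Open Scope ring_scope.

(** * Polynomials acting on modules *)

Section LinearMaps.
Variables (K : fieldType) (M N : lmodType K) (f : M -> N) (hf : linear f).

Definition mklin : {linear M -> N} :=
  HB.pack f (GRing.isLinear.Build K M N *:%R f hf).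

Lemma lin0 : f 0 = 0. Proof. exact: (linear0 mklin). Qed.
Lemma linD x y : f (x + y) = f x + f y. Proof. exact: (linearD mklin). Qed.
Lemma linB x y : f (x - y) = f x - f y. Proof. exact: (linearB mklin). Qed.
Lemma linZ a x : f (a *: x) = a *: f x. Proof. by rewrite -[a *: x]addr0 hf lin0 addr0. Qed.
Lemma lin_sum I (r : seq I) (P : pred I) (E : I -> M) :
  f (\sum_(i <- r | P i) E i) = \sum_(i <- r | P i) f (E i).
Proof. exact: (linear_sum mklin). Qed.
End LinearMaps.

Lemma linear_iter (K : fieldType) (M : lmodType K) (h : M -> M) n :
  linear h -> linear (iter n h).
Proof.
by move=> hl; elim: n => [|n IH] a x y //=; rewrite IH hl.
Qed.

Definition polyact (K : fieldType) (M : lmodType K) (h : M -> M)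
  (p : {poly K}) (x : M) : M := \sum_(i < size p) p`_i *: iter i h x.

Section PolyAct.
Variables (K : fieldType) (M : lmodType K) (h : M -> M) (hl : linear h).
Local Notation act := (polyact h).

Lemma polyact_wide n (p : {poly K}) x : (size p <= n)%N ->
  act p x = \sum_(i < n) p`_i *: iter i h x.
Proof.
move=> hn; rewrite /polyact (big_ord_widen n (fun i => p`_i *: iter i h x) hn).
rewrite big_mkcond /=; apply: eq_bigr => i _; case: ltnP => // hi.
by rewrite nth_default // scale0r.
Qed.

Lemma polyactD (p q : {poly K}) x : act (p + q) x = act p x + act q x.
Proof.
have hm := size_polyD p q.
rewrite (@polyact_wide (maxn (size p) (size q)) (p + q) x) //.
rewrite (@polyact_wide (maxn (size p) (size q)) p x) ?leq_maxl //.
rewrite (@polyact_wide (maxn (size p) (size q)) q x) ?leq_maxr //.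
by rewrite -big_split /=; apply: eq_bigr => i _; rewrite coefD scalerDl.
Qed.

Lemma polyactC (c : K) x : act c%:P x = c *: x.
Proof.
by rewrite (@polyact_wide 1) ?size_polyC_leq1 // big_ord1 coefC eqxx.
Qed.

Lemma polyact0 x : act 0 x = 0.
Proof. by rewrite /polyact size_poly0 big_ord0. Qed.

Lemma polyactZ c (p : {poly K}) x : act (c *: p) x = c *: act p x.
Proof.
rewrite (@polyact_wide (size p)) ?size_scale_leq // /polyact scaler_sumr.
by apply: eq_bigr => i _; rewrite coefZ scalerA.
Qed.

Lemma polyactMX (p : {poly K}) x : act (p * 'X) x = act p (h x).
Proof.
have hs : (size (p * 'X)%R <= (size p).+1)%N.
  by rewrite (leq_trans (size_polyMleq _ _)) // size_polyX addn2.
rewrite (polyact_wide _ hs) big_ord_recl coefMX eqxx scale0r add0r.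
rewrite /polyact; apply: eq_bigr => i _.
by rewrite lift0 coefMX /= -iterSr.
Qed.

Lemma polyact_linear p : linear (act p).
Proof.
move=> a x y; rewrite /polyact scaler_sumr -big_split /=.
apply: eq_bigr => i _; rewrite (linear_iter _ hl) scalerDr.
by rewrite !scalerA mulrC.
Qed.

Lemma polyactM (p q : {poly K}) x : act (p * q) x = act p (act q x).
Proof.
elim/poly_ind: q x => [|q c IH] x.
  by rewrite mulr0 !polyact0 (lin0 (polyact_linear p)).
rewrite mulrDr mulrA 2!polyactD !polyactMX IH (linD (polyact_linear p)).
by rewrite (mulrC p) mul_polyC; have -> := polyactZ c p x; rewrite polyactC (linZ (polyact_linear p)).
Qed.

Lemma polyact_X x : act 'X x = h x.
Proof. by rewrite -['X]mul1r polyactMX polyactC scale1r. Qed.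

Lemma polyact_XsubC c n x :
  act (('X - c%:P) ^+ n) x = iter n (fun y => h y - c *: y) x.
Proof.
elim: n => [|n IH]; first by rewrite expr0 polyactC scale1r.
by rewrite exprS polyactM IH -polyCN polyactD polyact_X polyactC scaleNr.
Qed.

Lemma polyact_dvd (p q : {poly K}) x : p %| q -> act p x = 0 -> act q x = 0.
Proof.
move=> /dvdpP [r ->] h0; rewrite polyactM h0.
by rewrite (lin0 (polyact_linear r)).
Qed.

Lemma polyactB (p q : {poly K}) x : act (p - q) x = act p x - act q x.
Proof.
by rewrite polyactD -[- q]scaleN1r; have -> := polyactZ (-1) q x;
  rewrite scaleN1r.
Qed.
End PolyAct.

(** The Chinese remainder theorem for powers of distinct linear factors. It makes
    an operator that is scalar on generalized eigenspaces act on any finite set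
    of vectors as a polynomial in the operator that defines these spaces. *)
Lemma poly_crt (K : fieldType) (s : seq K) (phi : K -> K) (n : nat) :
  exists S : {poly K}, forall c, c \in s ->
    ('X - c%:P) ^+ n %| S - (phi c)%:P.
Proof.
elim: s => [|c s [S hS]]; first by exists 0.
case: (boolP (c \in s)) => [hc|hc].
  by exists S => d; rewrite inE => /orP [/eqP ->|]; exact: hS.
pose Q := \prod_(d <- s) ('X - d%:P) ^+ n.
have hQ : coprimep Q (('X - c%:P) ^+ n).
  rewrite /Q; elim: (s) hc => [|d r IH]; first by rewrite big_nil coprime1p.
  rewrite inE negb_or => /andP [hcd hcr]; rewrite big_cons coprimepMl IH // andbT.
  apply/coprimep_expl/coprimep_expr; rewrite coprimep_XsubC root_XsubC.
  by [].
case/Bezout_eq1_coprimepP: hQ => [[A B] /= hAB].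
exists (S + ((phi c)%:P - S) * (A * Q)) => d; rewrite inE => /orP [/eqP ->|hd].
  have -> : S + ((phi c)%:P - S) * (A * Q) - (phi c)%:P =
    (S - (phi c)%:P) * (B * ('X - c%:P) ^+ n).
    have -> : A * Q = 1 - B * ('X - c%:P) ^+ n by rewrite -hAB addrK.
    by ring.
  by rewrite dvdp_mull // dvdp_mull.
rewrite addrAC dvdp_add ?hS // dvdp_mull // dvdp_mull //.
rewrite /Q; elim: (s) hd => [|e r IH] //; rewrite inE big_cons.
by move=> /orP [/eqP ->|/IH h]; [rewrite dvdp_mulr|rewrite dvdp_mull].
Qed.

(** * Logarithms of unipotent operators *)

Lemma fsumE (I : choiceType) (M : zmodType) (s : seq I) (f : I -> M) :
  uniq s -> (forall i, i \notin s -> f i = 0) ->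
  \sum_(i \in [set: I]) f i = \sum_(i <- s) f i.
Proof.
move=> us hs; rewrite (fsbigE s) //; last by move=> i _; exact: hs.
by apply: eq_bigl => i; rewrite in_setT.
Qed.

Lemma fsum_nat (M : zmodType) n (f : nat -> M) :
  (forall i, (n <= i)%N -> f i = 0) ->
  \sum_(i \in [set: nat]) f i = \sum_(i < n) f i.
Proof.
move=> h; rewrite (@fsumE _ _ (iota 0 n)) ?iota_uniq //.
  by rewrite -[X in iota _ X]subn0 -/(index_iota 0 n) big_mkord.
by move=> i; rewrite mem_iota add0n leq0n /= -leqNgt; exact: h.
Qed.

Lemma fsum_inj (I : choiceType) (M : zmodType) n (e : nat -> I) (f : I -> M) :
  {in gtn n &, injective e} ->
  (forall i, (forall j, (j < n)%N -> i <> e j) -> f i = 0) ->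
  \sum_(i \in [set: I]) f i = \sum_(j < n) f (e j).
Proof.
move=> einj h; rewrite (@fsumE _ _ (map e (iota 0 n))).
- by rewrite big_map -[X in iota _ X]subn0 -/(index_iota 0 n) big_mkord.
- rewrite map_inj_in_uniq ?iota_uniq // => i j; rewrite !mem_iota !add0n /=.
  exact: einj.
- move=> i hi; apply: h => j hj he; move/negP: hi; apply.
  by rewrite he map_f // mem_iota.
Qed.

Lemma fsum_at (I : choiceType) (M : zmodType) (i0 : I) (f : I -> M) :
  (forall i, i <> i0 -> f i = 0) -> \sum_(i \in [set: I]) f i = f i0.
Proof.
move=> h; rewrite (@fsumE _ _ [:: i0]) ?big_seq1 // => i.
by rewrite inE => /eqP; exact: h.
Qed.

Lemma sum_trunc (M : zmodType) m n (f : nat -> M) : (n <= m)%N ->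
  (forall i, (n <= i)%N -> f i = 0) -> \sum_(i < m) f i = \sum_(i < n) f i.
Proof.
move=> hnm h; rewrite (big_ord_widen m f hnm) [RHS]big_mkcond /=.
by apply: eq_bigr => i _; case: ltnP => // /h.
Qed.

Section VectorPolynomials.
Variables (K : numFieldType) (M : lmodType K).

(** By invertibility of the Vandermonde matrix of 0, ..., n-1. *)
Lemma vandermonde_eq0 n (m : nat -> M) :
  (forall p : nat, \sum_(i < n) p%:R ^+ i *: m i = 0) ->
  forall i, (i < n)%N -> m i = 0.
Proof.
move=> h e he; pose a : 'rV[K]_n := \row_i i%:R.
have hV : Vandermonde n a \in unitmx.
  rewrite unitmxE det_Vandermonde unitfE; apply/prodf_neq0 => i _.
  apply/prodf_neq0 => j hij; rewrite !mxE subr_eq0 eqr_nat.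
  by rewrite neq_ltn hij orbT.
pose T := invmx (Vandermonde n a); pose e' := Ordinal he.
have hT (i : 'I_n) : \sum_(j < n) T j e' * (j : nat)%:R ^+ i = (i == e')%:R.
  have := congr1 (fun A : 'M[K]_n => A i e') (mulmxV hV); rewrite !mxE => <-.
  by apply: eq_bigr => j _; rewrite !mxE mulrC.
have : \sum_(j < n) T j e' *: (\sum_(i < n) (j : nat)%:R ^+ i *: m i) = 0.
  by rewrite big1 // => j _; rewrite h scaler0.
under eq_bigr do rewrite scaler_sumr.
rewrite exchange_big /= (bigD1 e') //= [X in _ + X]big1 ?addr0 => [|i hi].
  under eq_bigr do rewrite scalerA.
  by rewrite -scaler_suml (hT e') eqxx scale1r.
under eq_bigr do rewrite scalerA.
by rewrite -scaler_suml hT (negbTE hi) scale0r.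
Qed.

(** Many operator identities below are first obtained for the p-th power of an
    automorphism or for p turns around the origin, with p a natural number; as
    both sides are polynomial in p, the coefficients of p^e agree, and e = 1
    gives the identity for the logarithm. *)
Lemma vpoly_eq0 (I : Type) (r : seq I) (P : I -> {poly K}) (m : I -> M) :
  (forall p : nat, \sum_(i <- r) (P i).[p%:R] *: m i = 0) ->
  forall e, \sum_(i <- r) (P i)`_e *: m i = 0.
Proof.
move=> h e; pose D := (\max_(i <- r) size (P i) + e.+1)%N.
have hD : forall s, (\max_(i <- s) size (P i) <= D)%N -> forall x : K,
    \sum_(i <- s) (P i).[x] *: m i =
    \sum_(k < D) x ^+ k *: \sum_(i <- s) (P i)`_k *: m i.
  elim=> [|i s IH] hs x.
    by rewrite big_nil big1 // => k _; rewrite big_nil scaler0.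
  move: hs; rewrite big_cons geq_max => /andP [hi hs].
  rewrite big_cons IH //; under [RHS]eq_bigr do rewrite big_cons scalerDr.
  rewrite big_split /=; congr (_ + _); rewrite (horner_coef_wide _ hi).
  by rewrite scaler_suml; apply: eq_bigr => k _; rewrite scalerA mulrC.
apply: (@vandermonde_eq0 D (fun k => \sum_(i <- r) (P i)`_k *: m i)).
  by move=> p; rewrite -hD ?leq_addr.
by rewrite /D addnS ltnS leq_addl.
Qed.
End VectorPolynomials.

(** The polynomial binom(n + X, j), whose coefficients are those of
    (1 + x)^n log(1 + x)^i / i! in x^j. *)
Definition bp (K : fieldType) (n : K) (j : nat) : {poly K} :=
  (j`!%:R)^-1 *: \prod_(i < j) ('X + (n - (i : nat)%:R)%:P).

Section BinomialPolynomials.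
Variable (K : numFieldType).
Implicit Types (n x : K) (j : nat).

Lemma bp0 n : bp n 0 = 1.
Proof. by rewrite /bp big_ord0 fact0 invr1 scale1r. Qed.

Lemma bpS n j :
  bp n j.+1 = (j.+1%:R)^-1 *: (('X + (n - j%:R)%:P) * bp n j).
Proof.
rewrite /bp big_ord_recr /= factS natrM invfM -scalerAr scalerA.
by rewrite [_ * ('X + _)]mulrC.
Qed.

Lemma natS_neq0 j : j.+1%:R != 0 :> K. Proof. by rewrite pnatr_eq0. Qed.

Lemma bpS' n j : j.+1%:R *: bp n j.+1 = ('X + (n - j%:R)%:P) * bp n j.
Proof. by rewrite bpS scalerA divff ?scale1r // natS_neq0. Qed.

Lemma bp_nat j (p : nat) : (bp (0 : K) j).[p%:R] = 'C(p, j)%:R.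
Proof.
elim: j => [|j IH]; first by rewrite bp0 hornerC bin0.
apply: (mulfI (natS_neq0 j)).
have := congr1 (horner^~ p%:R) (bpS' (0 : K) j); rewrite /= hornerZ => ->.
rewrite hornerM IH hornerD hornerX hornerC -natrM mul_bin_left natrM.
case: (leqP j p) => hjp; first by rewrite natrB // sub0r.
by rewrite bin_small // !mulr0.
Qed.

Lemma coef_XDC (c : K) (p : {poly K}) i :
  (('X + c%:P) * p)`_i = (if i is k.+1 then p`_k else 0) + c * p`_i.
Proof. by rewrite mulrDl coefD coefXM coefCM; case: i. Qed.

Lemma bp_coef0 j : (bp (0 : K) j)`_0 = (j == 0%N)%:R.
Proof.
elim: j => [|j IH]; first by rewrite bp0 coefC.
rewrite bpS coefZ coef_XDC /= add0r IH.
by case: j {IH} => [|j]; rewrite ?subr0 ?mul0r ?mulr0.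
Qed.

Lemma bp_coef1 j :
  (bp (0 : K) j)`_1 = if j is i.+1 then (-1) ^+ i / i.+1%:R else 0.
Proof.
case: j => [|j]; first by rewrite bp0 coefC.
elim: j => [|j IH].
  by rewrite bpS bp0 mulr1 subr0 addr0 coefZ coefX mulr1 expr0 mul1r.
rewrite bpS coefZ coef_XDC bp_coef0 IH /= add0r sub0r mulNr mulrCA divff ?natS_neq0 // mulr1 exprS mulN1r.
by rewrite mulrC.
Qed.
End BinomialPolynomials.

Section Unipotent.
Variables (K : numFieldType).

(** The logarithm of id + d on vectors killed by d^n. *)
Definition logop (M : lmodType K) (d : M -> M) (n : nat) (x : M) : M :=
  \sum_(j < n) (bp (0 : K) j)`_1 *: iter j d x.

(** The p-th power of U = 1 + d, written polynomially in p. *)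
Lemma iter_unip (M : lmodType K) (d : M -> M) (hd : linear d) (U : M -> M)
  (hU : forall x, U x = d x + x) n x p : iter n d x = 0 ->
  iter p U x = \sum_(j < n) (bp (0 : K) j).[p%:R] *: iter j d x.
Proof.
move=> hn; have h0 i : (n <= i)%N -> iter i d x = 0.
  move=> hi; rewrite -(subnK hi) iterD hn.
  by rewrite (lin0 (linear_iter _ hd)).
rewrite -(@sum_trunc _ (n + p.+1) n
  (fun j => (bp (0 : K) j).[p%:R] *: iter j d x)) ?leq_addr //; last first.
  by move=> i hi; rewrite h0 // scaler0.
rewrite (@sum_trunc _ (n + p.+1) p.+1
  (fun j => (bp (0 : K) j).[p%:R] *: iter j d x)) ?leq_addl //; last first.
  by move=> i hi; rewrite bp_nat bin_small // scale0r.
elim: p => [|p IH] /=.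
  by rewrite big_ord1 bp_nat bin0 scale1r.
pose c (p j : nat) : K := 'C(p, j)%:R.
have e (q r : nat) : \sum_(j < q) (bp (0 : K) j).[r%:R] *: iter j d x =
    \sum_(j < q) c r j *: iter j d x.
  by apply: eq_bigr => j _; rewrite bp_nat.
rewrite IH !e hU (lin_sum hd).
rewrite (eq_bigr (fun j : 'I_p.+1 => c p j *: iter j.+1 d x)); last first.
  by move=> j _; rewrite (linZ hd).
rewrite [RHS]big_ord_recl [X in _ + X = _]big_ord_recl /= addrCA.
rewrite /c !bin0; congr (_ + _).
rewrite big_ord_recr [RHS]big_ord_recr /= addrAC -big_split /= !binn.
congr (_ + _); apply: eq_bigr => i _.
by rewrite /bump /= !add1n binS natrD scalerDl addrC.
Qed.

Lemma nilp_ge (M : lmodType K) (d : M -> M) (hd : linear d) n i x :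
  iter n d x = 0 -> (n <= i)%N -> iter i d x = 0.
Proof.
move=> hn hi; rewrite -(subnK hi) iterD hn.
by rewrite (lin0 (linear_iter _ hd)).
Qed.

Section Derivation.
Variables (M1 M2 M3 : lmodType K).
Variables (d1 : M1 -> M1) (d2 : M2 -> M2) (d3 : M3 -> M3).
Variables (l1 : linear d1) (l2 : linear d2) (l3 : linear d3).
Variable Phi : M1 -> M2 -> M3.
Hypothesis (Phil : forall y, linear (Phi^~ y)) (Phir : forall x, linear (Phi x)).
Hypothesis hPhi : forall x y,
  d3 (Phi x y) + Phi x y = Phi (d1 x + x) (d2 y + y).

Lemma unip_nilp n1 n2 x y : iter n1 d1 x = 0 -> iter n2 d2 y = 0 ->
  iter (n1 + n2) d3 (Phi x y) = 0.
Proof.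
move: {2}(n1 + n2)%N (erefl (n1 + n2)%N) => s hs.
elim: s n1 n2 x y hs => [|s IH] n1 n2 x y hs h1 h2.
  have hx : x = 0 by move: hs h1; case: n1.
  by rewrite hx (lin0 (Phil y)) (lin0 (linear_iter _ l3)).
case: n1 hs h1 => [|n1] hs h1.
  have hx : x = 0 := h1.
  by rewrite hx (lin0 (Phil y)) (lin0 (linear_iter _ l3)).
case: n2 hs h2 => [|n2] hs h2.
  have hy : y = 0 := h2.
  by rewrite hy (lin0 (Phir x)) (lin0 (linear_iter _ l3)).
rewrite addSn iterSr.
have -> : d3 (Phi x y) = Phi (d1 x) (d2 y + y) + Phi x (d2 y).
  have := hPhi x y; rewrite (linD (Phil _)) (linD (Phir x)) addrA => h.
  by apply: (addIr (Phi x y)); rewrite h.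
rewrite (linD (linear_iter _ l3)).
have hs1 : (n1 + n2.+1)%N = s by move: hs; rewrite addSn => -[].
have hd2 : iter n2.+1 d2 (d2 y + y) = 0.
  rewrite (linD (linear_iter _ l2)) h2 addr0 -iterSr.
  by rewrite (@nilp_ge _ _ l2 n2.+1).
rewrite (IH n1 n2.+1 _ _ hs1) ?add0r //; last by rewrite -iterSr.
by rewrite addnS -addSn (IH n1.+1 n2) // -?iterSr // addSn -addnS.
Qed.

(** log(U (x) U) = log U (x) 1 + 1 (x) log U: compare the linear coefficients
    in p of U^p applied to both sides. *)
Lemma logop_derivation n1 n2 n3 x y :
  iter n1 d1 x = 0 -> iter n2 d2 y = 0 -> iter n3 d3 (Phi x y) = 0 ->
  logop d3 n3 (Phi x y) = Phi (logop d1 n1 x) y + Phi x (logop d2 n2 y).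
Proof.
move=> h1 h2 h3.
pose U1 z := d1 z + z; pose U2 z := d2 z + z; pose U3 z := d3 z + z.
have hU p : iter p U3 (Phi x y) = Phi (iter p U1 x) (iter p U2 y).
  by elim: p => //= p ->; rewrite /U3 hPhi.
pose I := ('I_n3 + 'I_n1 * 'I_n2)%type.
pose P (i : I) : {poly K} := match i with
  | inl j => bp 0 j | inr jk => - (bp 0 jk.1 * bp 0 jk.2) end.
pose m (i : I) : M3 := match i with
  | inl j => iter j d3 (Phi x y)
  | inr jk => Phi (iter jk.1 d1 x) (iter jk.2 d2 y) end.
have : forall p : nat, \sum_(i : I) (P i).[p%:R] *: m i = 0.
  move=> p; rewrite big_sumType /=.
  rewrite -(@iter_unip _ d3 l3 U3 (fun=> erefl) n3 (Phi x y) p h3) hU.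
  rewrite (@iter_unip _ d1 l1 U1 (fun=> erefl) n1 x p h1).
  rewrite (@iter_unip _ d2 l2 U2 (fun=> erefl) n2 y p h2).
  rewrite (lin_sum (Phil _)) /=.
  rewrite -?(pair_big_dep xpredT (fun _ => xpredT) (fun (j : 'I_n1) (k : 'I_n2) =>
    (- (bp 0 j * bp 0 k)).[p%:R] *: Phi (iter j d1 x) (iter k d2 y))) /=.
  rewrite -big_split big1 //= => j _.
  rewrite (linZ (Phil _)) (lin_sum (Phir _)) scaler_sumr -big_split big1 //=.
  move=> k _; rewrite (linZ (Phir _)) scalerA hornerN hornerM.
  by rewrite scaleNr subrr.
move=> /vpoly_eq0 /(_ 1%N); rewrite big_sumType /= => /eqP.
rewrite addr_eq0 => /eqP hE; rewrite /logop hE.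
rewrite -(pair_big_dep xpredT (fun _ => xpredT) (fun (j : 'I_n1) (k : 'I_n2) =>
    (- (bp (0:K) j * bp 0 k))`_1 *: Phi (iter j d1 x) (iter k d2 y))) /=.
have hjk (j k : nat) : (- (bp (0 : K) j * bp 0 k))`_1 =
   - ((j == 0%N)%:R * (bp 0 k)`_1) - ((bp 0 j)`_1 * (k == 0%N)%:R).
  by rewrite coefN coefM big_ord_recl big_ord1 /= !bp_coef0 opprD.
under eq_bigr => j _. under eq_bigr => k _ do rewrite hjk scalerDl !scaleNr.
  over.
under eq_bigr do rewrite big_split /= !sumrN.
rewrite big_split /= !sumrN -opprD opprK addrC {hE P m}.
move: @I => _; congr (_ + _).
  rewrite (lin_sum (Phil _)); apply: eq_bigr => j _; rewrite (linZ (Phil _)).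
  case: n2 h2 => [|n2] h2.
    by move: h2 => /= ->; rewrite big_ord0 (lin0 (Phir _)) scaler0.
  rewrite big_ord_recl /= mulr1 big1 ?addr0 // => k _.
  by rewrite mulr0 scale0r.
case: n1 h1 => [|n1] h1.
  by move: h1 => /= ->; rewrite big_ord0 (lin0 (Phil _)).
rewrite big_ord_recl /= [X in _ + X]big1 ?addr0; last first.
  by move=> j _; rewrite big1 // => k _; rewrite mul0r scale0r.
rewrite (lin_sum (Phir _)); apply: eq_bigr => k _.
by rewrite mul1r (linZ (Phir _)).
Qed.
End Derivation.
End Unipotent.

Section ExpS.
Variables (R : realType) (M : lmodType R[i]) (h : M -> M) (hl : linear h).
Local Notation C := R[i].

Lemma gen_eigenP c (x : M) :
  gen_eigenspace h c x <-> exists n, polyact h (('X - c%:P) ^+ n) x = 0.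
Proof.
by split=> -[n hn]; exists n; rewrite -?polyact_XsubC // polyact_XsubC.
Qed.

Lemma gen_eigen_uniform (s : seq (C * M)) :
  (forall p, p \in s -> gen_eigenspace h p.1 p.2) ->
  exists n, forall p, p \in s -> polyact h (('X - p.1%:P) ^+ n) p.2 = 0.
Proof.
elim: s => [|p s IH] hs; first by exists 0%N.
have [n hn] : exists n, forall p, p \in s ->
    polyact h (('X - p.1%:P) ^+ n) p.2 = 0.
  by apply: IH => q hq; apply: hs; rewrite inE hq orbT.
have [m hm] := (gen_eigenP p.1 p.2).1 (hs p (mem_head _ _)).
exists (maxn m n) => q; rewrite inE => /orP [/eqP ->|hq].
  by apply: (polyact_dvd hl _ hm); rewrite dvdp_exp2l // leq_maxl.
by apply: (polyact_dvd hl _ (hn q hq)); rewrite dvdp_exp2l // leq_maxr.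
Qed.

Lemma gen_eigen_linear c a x y : gen_eigenspace h c x -> gen_eigenspace h c y ->
  gen_eigenspace h c (a *: x + y).
Proof.
move=> /gen_eigenP [n hn] /gen_eigenP [m hm]; apply/gen_eigenP.
exists (maxn n m); rewrite (polyact_linear hl).
have hx := polyact_dvd hl (dvdp_exp2l ('X - c%:P) (leq_maxl n m)) hn.
have hy := polyact_dvd hl (dvdp_exp2l ('X - c%:P) (leq_maxr n m)) hm.
by rewrite hx hy scaler0 addr0.
Qed.

(** A polynomial in h that acts on the generalized eigenspace of each c in s as
    the scalar psi c, up to the exponent n: every operator that is scalar on
    generalized eigenspaces is locally such a polynomial. *)
Lemma interp_act (psi : C -> C) n S (s : seq (C * M)) :
  (forall p, p \in s -> polyact h (('X - p.1%:P) ^+ n) p.2 = 0) ->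
  (forall c, c \in map fst s -> ('X - c%:P) ^+ n %| S - (psi c)%:P) ->
  polyact h S (\sum_(p <- s) p.2) = \sum_(p <- s) psi p.1 *: p.2.
Proof.
move=> hs hS; rewrite (lin_sum (polyact_linear hl S)); apply: eq_big_seq => p hp.
have := polyact_dvd hl (hS p.1 (map_f _ hp)) (hs p hp).
by rewrite polyactB // polyactC => /eqP; rewrite subr_eq0 => /eqP.
Qed.

(** A vector has many decompositions into generalized eigenvectors, but an
    operator that is scalar on each generalized eigenspace takes the same value
    on all of them, since it is locally a polynomial in h. *)
Lemma gen_eigen_indep (psi : C -> C) (r s : seq (C * M)) :
  (forall p, p \in r -> gen_eigenspace h p.1 p.2) ->
  (forall p, p \in s -> gen_eigenspace h p.1 p.2) ->
  \sum_(p <- r) p.2 = \sum_(p <- s) p.2 ->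
  \sum_(p <- r) psi p.1 *: p.2 = \sum_(p <- s) psi p.1 *: p.2.
Proof.
move=> hr hs e.
have [n hn] : exists n, forall p, p \in r ++ s ->
    polyact h (('X - p.1%:P) ^+ n) p.2 = 0.
  by apply: gen_eigen_uniform => p; rewrite mem_cat => /orP [/hr|/hs].
have [S hS] := poly_crt (map fst (r ++ s)) psi n.
rewrite -(@interp_act psi n S r) ?e; first last.
- by move=> c hc; apply: hS; rewrite map_cat mem_cat hc.
- by move=> p hp; apply: hn; rewrite mem_cat hp.
rewrite (@interp_act psi n S s) // => [p hp|c hc].
- by apply: hn; rewrite mem_cat hp orbT.
- by apply: hS; rewrite map_cat mem_cat hc orbT.
Qed.

Variable (E : C -> set M).
Local Notation e2 a := (cexp (2 * cpii R * a)).
Hypothesis hE : forall alpha x, in_strip alpha -> E alpha x ->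
  gen_eigenspace h (e2 alpha) x.
Hypothesis hspan : forall x, exists r : seq (C * M),
  (forall p, p \in r -> in_strip p.1 /\ E p.1 p.2) /\ x = \sum_(p <- r) p.2.
Hypothesis cexpN : forall z : C, cexp (- z) = (cexp z)^-1.

(** The operator e^{-2 pi i S} can be computed from any decomposition into
    generalized eigenvectors of h, not only from one indexed by the strip. *)
Lemma exp_SopE (s : seq (C * M)) x :
  (forall p, p \in s -> gen_eigenspace h p.1 p.2) -> x = \sum_(p <- s) p.2 ->
  exp_Sop E x = \sum_(p <- s) p.1^-1 *: p.2.
Proof.
move=> hs ->; rewrite /exp_Sop /act_by; apply: xget_unique.
  have [r [hr er]] := hspan (\sum_(p <- s) p.2).
  exists r; split => //.
  rewrite (@gen_eigen_indep (fun c => c^-1) s [seq (e2 p.1, p.2) | p <- r]) //.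
  - by rewrite big_map; apply: eq_bigr => p _; rewrite -cexpN !mulNr.
  - by move=> _ /mapP [p hp ->] /=; have [h1 h2] := hr p hp; exact: hE.
  - by rewrite big_map.
move=> y [r [hr er ->]].
rewrite (@gen_eigen_indep (fun c => c^-1) s [seq (e2 p.1, p.2) | p <- r]) //.
- by rewrite big_map; apply: eq_bigr => p _; rewrite -cexpN !mulNr.
- by move=> _ /mapP [p hp ->] /=; have [h1 h2] := hr p hp; exact: hE.
- by rewrite big_map.
Qed.

Lemma gen_span x : exists s : seq (C * M),
  (forall p, p \in s -> (exists a, p.1 = e2 a) /\ gen_eigenspace h p.1 p.2) /\
  x = \sum_(p <- s) p.2.
Proof.
have [r [hr er]] := hspan x; exists [seq (e2 p.1, p.2) | p <- r]; split.
  move=> _ /mapP [p hp ->] /=; have [h1 h2] := hr p hp.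
  by split; [exists p.1|exact: hE].
by rewrite big_map.
Qed.

Lemma exp_Sop_linear : linear (exp_Sop E).
Proof.
move=> a x y; have [s [hs es]] := gen_span x; have [t [ht et]] := gen_span y.
rewrite (@exp_SopE ([seq (p.1, a *: p.2) | p <- s] ++ t)).
- rewrite big_cat /= big_map (@exp_SopE s x) // => [|p /hs [] //].
  rewrite (@exp_SopE t y) // => [|p /ht [] //].
  rewrite scaler_sumr; congr (_ + _); apply: eq_bigr => p _ /=.
  by rewrite !scalerA mulrC.
- move=> p; rewrite mem_cat => /orP [/mapP [q hq ->]|/ht [] //] /=.
  have [_ h1] := hs q hq; rewrite -[X in gen_eigenspace _ _ X]addr0.
  by apply: gen_eigen_linear => //; exists 0%N.
- by rewrite big_cat /= big_map -scaler_sumr -es -et.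
Qed.

Lemma exp_Sop_eigen c x : gen_eigenspace h c x -> exp_Sop E x = c^-1 *: x.
Proof.
move=> hx; rewrite (@exp_SopE [:: (c, x)]) ?big_seq1 // => p.
by rewrite inE => /eqP ->.
Qed.

(** The unipotent part e^{-2 pi i S} h of h, minus the identity. *)
Definition dop (x : M) : M := exp_Sop E (h x) - x.

Lemma dop_linear : linear dop.
Proof.
move=> a x y; rewrite /dop hl exp_Sop_linear scalerBr opprD addrACA.
by [].
Qed.

Lemma gen_eigen_h c x : gen_eigenspace h c x -> gen_eigenspace h c (h x).
Proof.
move=> /gen_eigenP [n hn]; apply/gen_eigenP; exists n.
rewrite -(polyact_X h x) -polyactM // mulrC polyactM // hn.
by rewrite (lin0 (polyact_linear hl _)).
Qed.

Lemma gen_eigen_shift c x n : gen_eigenspace h c x ->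
  gen_eigenspace h c (iter n (fun y => h y - c *: y) x).
Proof.
move=> hx; elim: n => //= n IH; rewrite addrC -scaleNr.
by apply: gen_eigen_linear => //; apply: gen_eigen_h.
Qed.

Lemma dop_iter c x n : c != 0 -> gen_eigenspace h c x ->
  iter n dop x = c^-1 ^+ n *: iter n (fun y => h y - c *: y) x.
Proof.
move=> hc hx; elim: n => [|n IH]; first by rewrite expr0 scale1r.
rewrite [LHS]/= IH (linZ dop_linear) exprSr -scalerA; congr (_ *: _) => /=.
have hy := gen_eigen_shift n hx; set y := iter n _ _ in hy *.
rewrite /dop (exp_Sop_eigen (gen_eigen_h hy)) scalerBr scalerA mulVf //.
by rewrite scale1r.
Qed.

Lemma dop_nilp x : (forall a : C, e2 a != 0) -> exists n, iter n dop x = 0.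
Proof.
move=> he; have [s [hs ->]] := gen_span x.
elim: s hs => [|p s IH] hs; first by exists 0%N; rewrite big_nil.
have [n hn] : exists n, iter n dop (\sum_(q <- s) q.2) = 0.
  by apply: IH => q hq; apply: hs; rewrite inE hq orbT.
have [[a ha] hp] := hs p (mem_head _ _); have [m hm] := hp.
exists (m + n)%N; rewrite big_cons (linD (linear_iter _ dop_linear)).
rewrite (nilp_ge dop_linear hn) ?leq_addl // addr0.
apply: (nilp_ge dop_linear _ (leq_addr n m)).
by rewrite (@dop_iter p.1) ?hm ?scaler0 // ha.
Qed.

Lemma NopE x n : iter n dop x = 0 ->
  Nop E h x = (2 * cpii R)^-1 *: logop dop n x.
Proof.
move=> hn; rewrite /Nop /logop; congr (_ *: _).
have -> : \sum_(j < n) (bp (0 : C) j)`_1 *: iter j dop x =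
    \sum_(j < n.+1) (bp (0 : C) j)`_1 *: iter j dop x.
  by rewrite big_ord_recr /= hn scaler0 addr0.
rewrite big_ord_recl /= bp_coef1 scale0r add0r.
rewrite (@fsum_nat _ n) => [|i hi].
  by apply: eq_bigr => i _; rewrite /bump leq0n add1n bp_coef1.
have h0 : iter i.+1 dop x = 0 := nilp_ge dop_linear hn (leqW hi).
by rewrite -[X in _ *: X]/(iter i.+1 dop x) h0 scaler0.
Qed.

Lemma Nop_linear : (forall a : C, e2 a != 0) -> linear (Nop E h).
Proof.
move=> he a x y; have [n hn] := dop_nilp x he; have [m hm] := dop_nilp y he.
have hx := nilp_ge dop_linear hn (leq_addr m n).
have hy := nilp_ge dop_linear hm (leq_addl n m).
rewrite !(@NopE _ (n + m)) //; last first.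
  by rewrite (linear_iter _ dop_linear) hx hy scaler0 addr0.
rewrite (scalerA a) (mulrC a) -scalerA -scalerDr; congr (_ *: _).
rewrite /logop scaler_sumr -big_split /=; apply: eq_bigr => j _.
by rewrite (linear_iter _ dop_linear) scalerDr !scalerA mulrC.
Qed.

(** N raises the dop-filtration, hence is locally nilpotent. *)
Lemma Nop_nilp x n : (forall a : C, e2 a != 0) -> iter n dop x = 0 ->
  iter n (Nop E h) x = 0.
Proof.
move=> he; elim: n x => [//|n IH] x hn; rewrite iterSr; apply: IH.
rewrite (@NopE _ _ hn) (linZ (linear_iter _ dop_linear)).
rewrite /logop (lin_sum (linear_iter _ dop_linear)).
rewrite big1 ?scaler0 // => j _; rewrite (linZ (linear_iter _ dop_linear)).
rewrite -iterD bp_coef1; case: (nat_of_ord j) => [|i]; first by rewrite scale0r.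
by rewrite (nilp_ge dop_linear hn) ?scaler0 // addnS ltnS leq_addr.
Qed.
End ExpS.

(** * The complex exponential and logarithm *)

Section ComplexExp.
Variable R : realType.
Local Notation C := R[i].
Local Notation e2 a := (cexp (2 * cpii R * a)).

Lemma cexpD (a b : C) : cexp (a + b) = cexp a * cexp b.
Proof.
case: a b => [a1 a2] [b1 b2]; rewrite /cexp /= expRD cosD sinD.
by apply/eqP; rewrite eq_complex /=; apply/andP; split; apply/eqP; ring.
Qed.

Lemma cexp0 : cexp (0 : C) = 1.
Proof.
rewrite /cexp /= expR0 cos0 sin0.
by apply/eqP; rewrite eq_complex /= mulr1 mulr0 !eqxx.
Qed.

Lemma cexp_neq0 (a : C) : cexp a != 0.
Proof.
apply/eqP => h; have := cexpD a (- a); rewrite h mul0r subrr cexp0.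
by move/eqP; rewrite oner_eq0.
Qed.

Lemma cexpN (a : C) : cexp (- a) = (cexp a)^-1.
Proof.
apply: (mulfI (cexp_neq0 a)).
by rewrite -cexpD subrr cexp0 divff ?cexp_neq0.
Qed.

Lemma cexpMn (a : C) n : cexp (a * n%:R) = cexp a ^+ n.
Proof.
elim: n => [|n IH]; first by rewrite mulr0 cexp0.
by rewrite -addn1 natrD mulrDr mulr1 cexpD IH exprD expr1.
Qed.

Lemma cexpMz (a : C) (n : int) : cexp (a * n%:~R) = cexp a ^ n.
Proof.
case: n => n; first by rewrite cexpMn.
by rewrite {1}NegzE mulrNz mulrN cexpN cexpMn.
Qed.

Lemma cexp_pii : cexp (cpii R) = -1.
Proof.
rewrite /cexp /cpii /= expR0 cospi sinpi.
by apply/eqP; rewrite eq_complex /= mulr0 mul1r oppr0 !eqxx.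
Qed.

Lemma two_cpii (a b : R) :
  2 * cpii R * (a +i* b)%C = (- (2 * pi * b) +i* (2 * pi * a))%C.
Proof.
by apply/eqP; rewrite eq_complex /cpii /=; apply/andP; split; apply/eqP; ring.
Qed.

Lemma cpii_neq0 : cpii R != 0.
Proof.
rewrite /cpii eq_complex /= negb_and; apply/orP; right.
by rewrite gt_eqF // pi_gt0.
Qed.

Lemma e2_int (n : int) : e2 n%:~R = 1.
Proof.
by rewrite cexpMz [2 * _]mulrC -[2]/(2%:R) cexpMn cexp_pii sqrrN expr1n exp1rz.
Qed.

Lemma cos_eq1_0 (t : R) : 0 <= t < 2 * pi -> cos t = 1 -> t = 0.
Proof.
move=> /andP [t0 t2] hc; apply/eqP; rewrite eq_le t0 andbT leNgt.
apply/negP => tp; have hs : 0 < sin (t / 2).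
  by apply: sin_gt0_pi; rewrite divr_gt0 // ltr_pdivrMr // mulrC.
have := cos_mulr2n (t / 2); rewrite mulr2n -splitr hc.
have := cos2Dsin2 (t / 2); move: hs; set c := cos _; set s := sin _.
move=> hs h1 h2; have : s ^+ 2 = 0 by move: h1 h2; rewrite mulr2n; lra.
by move/eqP; rewrite expf_eq0 /= gt_eqF.
Qed.

Lemma e2_eq1 (z : C) : e2 z = 1 -> exists n : int, z = n%:~R.
Proof.
case: z => a b; rewrite two_cpii /cexp /= => /eqP; rewrite eq_complex /=.
move=> /andP [/eqP h1 /eqP h2].
have he : expR (- (2 * pi * b)) = 1.
  have : expR (- (2 * pi * b)) ^+ 2 = 1.
    have hxyz (x y z : R) : y ^+ 2 + z ^+ 2 = 1 ->
        x ^+ 2 = (x * y) ^+ 2 + (x * z) ^+ 2.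
      by move=> h; rewrite !exprMn -mulrDr h mulr1.
    rewrite (hxyz _ _ _ (cos2Dsin2 (2 * pi * a))) h1 h2.
    by rewrite expr1n expr0n addr0.
  move/eqP; rewrite sqrf_eq1 => /orP [/eqP //|/eqP h].
  by have := expR_gt0 (- (2 * pi * b)); rewrite h; lra.
have hb : b = 0.
  have /expR_inj : expR (- (2 * pi * b)) = expR 0 by rewrite he expR0.
  move/eqP; rewrite oppr_eq0 !mulf_eq0 pnatr_eq0 /= gt_eqF ?pi_gt0 //=.
  by move/eqP.
exists (Num.floor a); rewrite he mul1r in h1; rewrite {}hb {b h2 he}.
have hf := floor_itv a.
pose t := 2 * pi * (a - (Num.floor a)%:~R).
have ht : t = 0.
  apply: cos_eq1_0.
    have hp := @pi_gt0 R; apply/andP; split.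
      by rewrite /t mulr_ge0 ?subr_ge0 ?mulr_ge0 ?(ltW hp) //; case/andP: hf.
    rewrite /t -[X in _ < X]mulr1 ltr_pM2l ?mulr_gt0 //.
    by case/andP: hf => _; rewrite intrD ltrBlDl.
  rewrite -[RHS]h1.
  have := e2_int (Num.floor a).
  have -> : (Num.floor a)%:~R = ((Num.floor a)%:~R +i* 0)%C :> C.
    by rewrite -[RHS]/((Num.floor a)%:~R%:C)%C rmorph_int.
  rewrite two_cpii /cexp mulr0 oppr0 /= expR0 !mul1r => /eqP.
  rewrite eq_complex /= => /andP [/eqP hc /eqP hs].
  by rewrite /t mulrBr cosB hc hs mulr1 mulr0 addr0.
move/eqP: ht; rewrite /t !mulf_eq0 pnatr_eq0 /= gt_eqF ?pi_gt0 //= subr_eq0.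
by move/eqP => ha; rewrite {1}ha -[LHS]/((Num.floor a)%:~R%:C)%C rmorph_int.
Qed.

Lemma polar (x y : R) : x ^+ 2 + y ^+ 2 = 1 ->
  exists t, [/\ 0 <= t < 2 * pi, cos t = x & sin t = y].
Proof.
move=> h; have hx : -1 <= x <= 1.
  rewrite -ler_norml -(@ler_pXn2r _ 2) ?nnegrE // expr1n real_normK ?num_real //.
  by rewrite -h lerDl sqr_ge0.
have hc : cos (acos x) = x by apply: acosK; rewrite in_itv.
have hs : sin (acos x) = `|y|.
  by rewrite sin_acos // -h addrC addKr sqrtr_sqr.
have h0 := acos_ge0 hx; have hpi := acos_lepi hx; have p0 := @pi_gt0 R.
case: (leP 0 y) => hy.
  exists (acos x); split => //; last by rewrite hs ger0_norm.
  by rewrite h0 (le_lt_trans hpi) //; lra.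
exists (2 * pi - acos x); split.
- have ha : 0 < acos x.
    rewrite lt_neqAle h0 andbT eq_sym; apply/eqP => e.
    by move: hs; rewrite e sin0 => /eqP; rewrite eq_sym normr_eq0 lt_eqF.
  by apply/andP; split; lra.
- by rewrite addrC mulr_natl cosD2pi cosN.
- by rewrite addrC mulr_natl sinD2pi sinN hs ltr0_norm // opprK.
Qed.

(** The representative is chosen in the strip by removing the integer part of
    the argument. *)
Lemma e2_surj (c : C) : c != 0 -> exists2 alpha, in_strip alpha & e2 alpha = c.
Proof.
case: c => x y hc; pose r := Num.sqrt (x ^+ 2 + y ^+ 2).
have r2 : r ^+ 2 = x ^+ 2 + y ^+ 2 by rewrite sqr_sqrtr // addr_ge0 ?sqr_ge0.
have r0 : 0 < r.
  rewrite sqrtr_gt0 lt_neqAle addr_ge0 ?sqr_ge0 // andbT eq_sym.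
  rewrite paddr_eq0 ?sqr_ge0 // !expf_eq0 /=; apply: contra hc => /andP [a b].
  by rewrite eq_complex /= a b.
have rn := lt0r_neq0 r0; have p0 := @pi_gt0 R.
have [t [ht ct st]] : exists t,
    [/\ 0 <= t < 2 * pi, cos t = x / r & sin t = y / r].
  apply: polar; rewrite !expr_div_n -mulrDl -r2 divff //.
  by rewrite expf_neq0.
have p2 : 0 < 2 * pi :> R by rewrite mulr_gt0.
exists ((t / (2 * pi)) +i* (- (ln r / (2 * pi))))%C.
  rewrite /in_strip /= divr_ge0 ?(ltW p2) //=; last by case/andP: ht.
  by rewrite ltr_pdivrMr // mul1r; case/andP: ht.
rewrite two_cpii /cexp /= mulrN opprK ![2 * pi * (_ / _)]mulrC.
rewrite !divfK ?(lt0r_neq0 p2) // ct st lnK ?posrE //.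
by rewrite ![r * _]mulrC !divfK.
Qed.

Lemma cabs_real (x : R) : 0 <= x -> cabs x%:C%C = x.
Proof. by move=> hx; rewrite /cabs ger0_norm //= ler0c. Qed.

Lemma clog_real (p : int) (x : R) : 0 < x ->
  clog p x%:C%C = (ln x)%:C%C + 2 * cpii R * p%:~R.
Proof.
move=> hx; rewrite /clog /carg /= cabs_real ?(ltW hx) // lexx divff ?lt0r_neq0 //.
rewrite acos1 add0r.
have -> : p%:~R = (p%:~R +i* 0)%C :> C.
  by rewrite -[RHS]/(p%:~R%:C)%C rmorph_int.
rewrite two_cpii; apply/eqP; rewrite eq_complex /=.
by apply/andP; split; apply/eqP; ring.
Qed.

Lemma carg_real (x : R) : 0 < x -> carg x%:C%C = 0.
Proof.
by move=> hx; rewrite /carg /= cabs_real ?(ltW hx) // lexx divff ?lt0r_neq0 // acos1.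
Qed.

Lemma ev_mono_real (x : R) (a : C) k : 0 < x ->
  ev_mono 0 x%:C%C a k = cexp (a * (ln x)%:C%C) * (ln x)%:C%C ^+ k.
Proof. by move=> hx; rewrite /ev_mono clog_real // mulr0 addr0. Qed.

Lemma ev_mono1 (a : C) k : ev_mono 0 (1 : C) a k = (k == 0%N)%:R.
Proof.
have -> : (1 : C) = (1 : R)%:C%C by [].
rewrite ev_mono_real // ln1 mulr0 cexp0 mul1r expr0n.
by [].
Qed.
End ComplexExp.

(** * Taylor expansion of powers and logarithms *)

Section Cabs.
Variable R : realType.
Implicit Types z y : R[i].

Lemma cabsE z : (cabs z)%:C%C = `|z|.
Proof. by rewrite /cabs normc_def. Qed.

Lemma cabs_ge0 z : 0 <= cabs z.
Proof. by rewrite -ler0c cabsE. Qed.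

Lemma cabsD z y : cabs (z + y) <= cabs z + cabs y.
Proof. by rewrite -lecR rmorphD !cabsE ler_normD. Qed.

Lemma cabsM z y : cabs (z * y) = cabs z * cabs y.
Proof. by apply: complexI; rewrite rmorphM !cabsE normrM. Qed.

Lemma cabsN z : cabs (- z) = cabs z.
Proof. by apply: complexI; rewrite !cabsE normrN. Qed.

Lemma cabsB z y : cabs (z - y) = cabs (y - z).
Proof. by rewrite -cabsN opprB. Qed.

Lemma cabs0 : cabs (0 : R[i]) = 0.
Proof. by apply: complexI; rewrite cabsE normr0. Qed.

Lemma cabs1 : cabs (1 : R[i]) = 1.
Proof. by apply: complexI; rewrite cabsE normr1. Qed.

Lemma cabs_eq0 z : cabs z = 0 -> z = 0.
Proof. by move=> h; apply/eqP; rewrite -normr_eq0 -cabsE h. Qed.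

Lemma cabsX z n : cabs (z ^+ n) = cabs z ^+ n.
Proof. by elim: n => [|n IH]; rewrite ?cabs1 // !exprS cabsM IH. Qed.

Lemma cabs_sum I (r : seq I) (P : pred I) (F : I -> R[i]) :
  cabs (\sum_(i <- r | P i) F i) <= \sum_(i <- r | P i) cabs (F i).
Proof.
elim/big_rec2: _ => [|i y z _ h]; first by rewrite cabs0.
by apply: (le_trans (cabsD _ _)); rewrite lerD2l.
Qed.

Lemma cabs_rc (x : R) : cabs x%:C%C = `|x|.
Proof.
apply: complexI; rewrite cabsE normc_def /= expr0n addr0.
by rewrite sqrtr_sqr.
Qed.

Lemma cabs_Re z : `|complex.Re z| <= cabs z.
Proof. by rewrite -lecR cabsE normc_ge_Re. Qed.

Lemma cabs_Im z : `|complex.Im z| <= cabs z.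
Proof.
rewrite -ler_sqr ?nnegrE ?cabs_ge0 // real_normK ?num_real //.
have := add_Re2_Im2 z; rewrite -cabsE -rmorphXn => /complexI <-.
by rewrite lerDr sqr_ge0.
Qed.

Lemma cabs_le z : cabs z <= `|complex.Re z| + `|complex.Im z|.
Proof.
rewrite {1}(complexE z); apply: (le_trans (cabsD _ _)).
rewrite cabsM !cabs_rc.
have -> : cabs 'i%C = 1 :> R.
  by apply: complexI; rewrite cabsE normc_def /= expr0n add0r expr1n sqrtr1.
by rewrite mul1r.
Qed.

Lemma cabs_cexp z : cabs (cexp z) = expR (complex.Re z).
Proof.
apply: complexI; rewrite cabsE normc_def /cexp /= !exprMn -mulrDr cos2Dsin2.
by rewrite mulr1 sqrtr_sqr ger0_norm ?expR_ge0.
Qed.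

Lemma cabs_lt_eq0 z : (forall e : R, 0 < e -> cabs z < e) -> z = 0.
Proof.
move=> h; apply: cabs_eq0; apply/eqP; rewrite eq_le cabs_ge0 andbT leNgt.
by apply/negP => /h; rewrite ltxx.
Qed.
End Cabs.

Section Taylor.
Variable R : realType.
Local Notation C := R[i].
Local Notation rc x := (x%:C%C).

(** Componentwise, so that the real mean value theorem bounds each part. *)
Definition cderiv (f : R -> C) (x : R) (d : C) : Prop :=
  is_derive x (1 : R) (fun t => complex.Re (f t)) (complex.Re d) /\
  is_derive x (1 : R) (fun t => complex.Im (f t)) (complex.Im d).

Lemma cderiv_cst (c : C) x : cderiv (fun=> c) x 0.
Proof. by split; exact: is_derive_cst. Qed.

Lemma cderivD f g x a b : cderiv f x a -> cderiv g x b ->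
  cderiv (fun t => f t + g t) x (a + b).
Proof.
move=> [f1 f2] [g1 g2]; split.
  have := is_deriveD f1 g1; congr is_derive.
    by apply: funext => t; rewrite fctE; case: (f t) (g t) => [? ?] [? ?].
  by case: a b {f1 f2 g1 g2} => [? ?] [? ?].
have := is_deriveD f2 g2; congr is_derive.
  by apply: funext => t; rewrite fctE; case: (f t) (g t) => [? ?] [? ?].
by case: a b {f1 f2 g1 g2} => [? ?] [? ?].
Qed.

Lemma cderivM f g x a b : cderiv f x a -> cderiv g x b ->
  cderiv (fun t => f t * g t) x (a * g x + f x * b).
Proof.
move=> [f1 f2] [g1 g2]; split.
  have h := is_deriveB (is_deriveM f1 g1) (is_deriveM f2 g2).
  have := h; congr is_derive.
    by apply: funext => t; rewrite !fctE; case: (f t) (g t) => [? ?] [? ?].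
  by case: (f x) (g x) a b {h f1 f2 g1 g2} => [? ?] [? ?] [? ?] [? ?] /=;
    rewrite /GRing.scale /=; ring.
have h := is_deriveD (is_deriveM f1 g2) (is_deriveM f2 g1).
have := h; congr is_derive.
  by apply: funext => t; rewrite !fctE; case: (f t) (g t) => [? ?] [? ?].
by case: (f x) (g x) a b {h f1 f2 g1 g2} => [? ?] [? ?] [? ?] [? ?] /=;
  rewrite /GRing.scale /=; ring.
Qed.

Lemma cderiv_rc (f : R -> R) x (d : R) : is_derive x (1 : R) f d ->
  cderiv (fun t => rc (f t)) x (rc d).
Proof. by move=> h; split => //=; exact: is_derive_cst. Qed.

Lemma cderiv_sum n (f : nat -> R -> C) (a : nat -> C) x :
  (forall i, (i < n)%N -> cderiv (f i) x (a i)) ->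
  cderiv (fun t => \sum_(i < n) f i t) x (\sum_(i < n) a i).
Proof.
elim: n => [|n IH] h.
  rewrite big_ord0; under eq_fun do rewrite big_ord0.
  exact: cderiv_cst.
rewrite big_ord_recr; under eq_fun do rewrite big_ord_recr /=.
by apply: cderivD; [apply: IH => i hi; apply: h; exact: ltnW|exact: h].
Qed.

Lemma cderivX n x : cderiv (fun t => rc t ^+ n.+1) x (n.+1%:R * rc x ^+ n).
Proof.
have hid : cderiv (fun t => rc t) x 1 by apply: (cderiv_rc (is_derive_id x _)).
elim: n => [|n IH]; first by rewrite expr0 mulr1; under eq_fun do rewrite expr1.
have := cderivM hid IH.
under [X in cderiv X _ _]eq_fun do rewrite -exprS.
by congr cderiv; rewrite !exprS -[n.+2]addn1 natrD; ring.
Qed.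

(** The mean value theorem applied to the real and to the imaginary part, hence
    the factor 2. *)
Lemma cmvt (f f' : R -> C) (K : R) n :
  (forall x : R, 0 <= x <= 1 -> cderiv f x (f' x)) -> f 0 = 0 -> 0 <= K ->
  (forall x : R, 0 <= x <= 1 -> cabs (f' x) <= K * x ^+ n) ->
  forall x : R, 0 <= x <= 1 -> cabs (f x) <= 2 * K * x ^+ n.+1.
Proof.
move=> hf f0 K0 hK x /andP [x0 x1].
have real_mvt (g g' : R -> R) : g 0 = 0 ->
    (forall y : R, 0 <= y <= 1 -> is_derive y (1 : R) g (g' y)) ->
    (forall y : R, 0 <= y <= 1 -> `|g' y| <= cabs (f' y)) ->
    `|g x| <= K * x ^+ n.+1.
  move=> g0 hg hg'; have [->|xn] := eqVneq x 0.
    by rewrite g0 normr0 expr0n mulr0.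
  have xp : 0 < x by rewrite lt_neqAle eq_sym xn.
  have [||c hc] := @MVT R g g' 0 x xp.
  - move=> y; rewrite in_itv /= => /andP [y0 yx]; apply: hg.
    by rewrite (ltW y0) (le_trans (ltW yx)).
  - apply: continuous_in_subspaceT => y; rewrite inE /= in_itv /= => /andP [y0 yx].
    apply: differentiable_continuous; apply/derivable1_diffP.
    by have [] := hg y; rewrite ?y0 ?(le_trans yx).
  rewrite g0 !subr0 => ->; move: hc; rewrite in_itv /= => /andP [c0 cx].
  have c01 : 0 <= c <= 1 by rewrite (ltW c0) (le_trans (ltW cx)).
  rewrite normrM (ger0_norm x0) exprSr mulrA ler_wpM2r //.
  apply: (le_trans (hg' _ c01)); apply: (le_trans (hK _ c01)).
  by rewrite ler_wpM2l // lerXn2r ?nnegrE // ltW.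
apply: (le_trans (cabs_le _)).
have -> : 2 * K * x ^+ n.+1 = K * x ^+ n.+1 + K * x ^+ n.+1 by ring.
apply: lerD.
  apply: (real_mvt (fun t => complex.Re (f t)) (fun t => complex.Re (f' t))).
  - by rewrite f0.
  - by move=> y /hf [].
  - by move=> y _; exact: cabs_Re.
apply: (real_mvt (fun t => complex.Im (f t)) (fun t => complex.Im (f' t))).
- by rewrite f0.
- by move=> y /hf [].
- by move=> y _; exact: cabs_Im.
Qed.

(** (1 + x)^a log(1 + x)^i / i!. These functions are closed under differentiation
    up to lowering a by one, which drives the Taylor expansion below. *)
Definition plog (a : C) (i : nat) (x : R) : C :=
  cexp (a * rc (ln (1 + x))) * rc (ln (1 + x)) ^+ i / i`!%:R.

Lemma cderiv_cexp (a : C) (l : R -> R) (x d : R) : is_derive x (1 : R) l d ->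
  cderiv (fun t => cexp (a * rc (l t))) x (a * rc d * cexp (a * rc (l x))).
Proof.
case: a => a b hl; rewrite /cexp.
have hal : is_derive x (1 : R) (fun t => a * l t) (a * d).
  by have := is_deriveZ a hl.
have hbl : is_derive x (1 : R) (fun t => b * l t) (b * d).
  by have := is_deriveZ b hl.
have he : is_derive x (1 : R) (fun t => expR (a * l t)) (a * d * expR (a * l x)).
  have := is_derive1_comp (f := expR) (g := fun t => a * l t)
    (is_derive_expR _) hal.
  by rewrite [expR (a * l x) * _]mulrC.
have hc : is_derive x (1 : R) (fun t => cos (b * l t)) (b * d * - sin (b * l x)).
  have := is_derive1_comp (f := cos) (g := fun t => b * l t)
    (is_derive_cos _) hbl.
  by rewrite [- sin (b * l x) * _]mulrC.
have hs : is_derive x (1 : R) (fun t => sin (b * l t)) (b * d * cos (b * l x)).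
  have := is_derive1_comp (f := sin) (g := fun t => b * l t)
    (is_derive_sin _) hbl.
  by rewrite [cos (b * l x) * _]mulrC.
split => /=.
  have := is_deriveM he hc; congr is_derive.
    by apply: funext => t /=; rewrite fctE !mulr0 subr0 add0r.
  by rewrite /GRing.scale /= !mulr0 !subr0 !add0r; ring.
have := is_deriveM he hs; congr is_derive.
  by apply: funext => t /=; rewrite fctE !mulr0 subr0 add0r.
by rewrite /GRing.scale /= !mulr0 !subr0 !add0r; ring.
Qed.

Lemma ln1D_derive (x : R) : 0 <= x ->
  is_derive x (1 : R) (fun t => ln (1 + t)) (1 + x)^-1.
Proof.
move=> x0; have h1 : 0 < 1 + x by rewrite ltr_pwDl.
have hid : is_derive x (1 : R) (fun t : R => 1 + t) 1.
  have := is_deriveD (is_derive_cst (1 : R) x 1) (is_derive_id x (1 : R)).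
  by rewrite add0r.
have := is_derive1_comp (f := @ln R) (g := fun t : R => 1 + t)
  (is_derive1_ln h1) hid.
by rewrite mulr1.
Qed.

Lemma cexp_plog (a : C) (x : R) : 0 <= x ->
  cexp ((a - 1) * rc (ln (1 + x))) = rc (1 + x)^-1 * cexp (a * rc (ln (1 + x))).
Proof.
move=> x0; have h1 : 0 < 1 + x by rewrite ltr_pwDl.
rewrite mulrBl mul1r cexpD cexpN mulrC; congr (_ * _).
rewrite /cexp /= cos0 sin0 mulr1 mulr0 lnK ?posrE //.
by rewrite -[LHS]/((rc (1 + x))^-1) fmorphV.
Qed.

Lemma plog_deriv a i (x : R) : 0 <= x ->
  cderiv (plog a i) x
    (a * plog (a - 1) i x + (if i is k.+1 then plog (a - 1) k x else 0)).
Proof.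
move=> x0; have hl := ln1D_derive x0.
have h1 := cderiv_cexp a hl.
have h2 : cderiv (fun t => rc (ln (1 + t)) ^+ i / i`!%:R) x
    (if i is k.+1 then rc (1 + x)^-1 * rc (ln (1 + x)) ^+ k / k`!%:R else 0).
  case: i => [|k].
    by under eq_fun do rewrite expr0; exact: cderiv_cst.
  elim: k => [|k IH].
    under eq_fun do rewrite expr1 divr1.
    by rewrite expr0 mulr1 fact0 divr1; exact: cderiv_rc.
  have := cderivM (cderivM (cderiv_rc hl) IH) (cderiv_cst (k.+2%:R^-1) x).
  set l := rc (ln (1 + x)); set m := rc (1 + x)^-1.
  have e (z : C) : z * (z ^+ k.+1 / k.+1`!%:R) * k.+2%:R^-1 =
      z ^+ k.+2 / k.+2`!%:R.
    by rewrite mulrA -exprS -mulrA -invfM -natrM mulnC -factS.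
  under [X in cderiv X _ _]eq_fun do rewrite e.
  congr cderiv; rewrite -/l mulr0 addr0.
  rewrite [k.+1`! in RHS]factS [k.+1`!]factS !natrM.
  have f0 : k`!%:R != 0 :> C by rewrite pnatr_eq0 -lt0n fact_gt0.
  have n1 := natS_neq0 C k; have n2 := natS_neq0 C k.+1.
  rewrite -[k.+2%:R]natr1 in n2 *; move: (k.+1%:R) (k`!%:R) n1 n2 f0 => q r q0 q1 r0.
  by rewrite exprS; clearbody l m; field; rewrite r0 q0 q1.
have := cderivM h1 h2.
rewrite /plog.
under [X in cderiv X _ _]eq_fun do rewrite mulrA.
congr cderiv; rewrite cexp_plog //.
by case: i {h2} => [|k]; [rewrite mulr0 !addr0|]; ring.
Qed.

(** Taylor's formula for (1 + x)^a log(1 + x)^i / i! at 0, to finite order,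
    by integrating the estimate of the same kind for the derivative. *)
Lemma plog_taylor N a i : exists K : R, 0 <= K /\
  forall x : R, 0 <= x <= 1 ->
    cabs (plog a i x - \sum_(j < N) (bp a j)`_i * rc x ^+ j) <= K * x ^+ N.
Proof.
elim: N a i => [|N IH] a i.
  exists (expR `|complex.Re a|); split; first exact: expR_ge0.
  move=> x /andP [x0 x1]; rewrite big_ord0 subr0 expr0 mulr1 /plog !cabsM.
  have l0 : 0 <= ln (1 + x) by rewrite ln_ge0 // lerDl.
  have l1 : ln (1 + x) <= 1.
    by apply: le_trans x1; apply: le_ln1Dx; apply: lt_le_trans x0; rewrite ltrN10.
  rewrite cabs_cexp cabsX cabs_rc (ger0_norm l0) -mulrA -[leRHS]mulr1.
  apply: ler_pM; rewrite ?expR_ge0 ?mulr_ge0 ?exprn_ge0 ?cabs_ge0 //.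
    rewrite ler_expR; case: (a) => r s /=; rewrite mulr0 subr0.
    apply: (le_trans (ler_norm _)); rewrite normrM (ger0_norm l0).
    by rewrite ler_piMr.
  rewrite -[leRHS]mulr1; apply: ler_pM; rewrite ?exprn_ge0 ?cabs_ge0 //.
    by rewrite exprn_ile1.
  have -> : (i`!%:R)^-1 = rc (i`!%:R)^-1 :> C by rewrite fmorphV rmorph_nat.
  by rewrite cabs_rc ger0_norm ?invr_ge0 ?ler0n // invf_le1 ?ler1n ?ltr0n fact_gt0.
have [K1 [K10 h1]] := IH (a - 1) i.
have [K2 [K20 h2]] : exists K : R, 0 <= K /\ forall x : R, 0 <= x <= 1 ->
    cabs ((if i is k.+1 then plog (a - 1) k x else 0) -
      \sum_(j < N) (if i is k.+1 then (bp (a - 1) j)`_k else 0) * rc x ^+ j)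
    <= K * x ^+ N.
  case: i {h1} => [|k]; last exact: IH.
  exists 0; split => // x _; rewrite big1 ?subrr ?cabs0 ?mul0r // => j _.
  by rewrite mul0r.
exists (2 * (cabs a * K1 + K2)); split.
  by rewrite mulr_ge0 // addr_ge0 // mulr_ge0 // cabs_ge0.
pose f' x := a * plog (a - 1) i x + (if i is k.+1 then plog (a - 1) k x else 0)
  - \sum_(j < N) (bp a j.+1)`_i * (j.+1%:R * rc x ^+ j).
apply: (@cmvt _ f').
- move=> x /andP [x0 _]; rewrite /f'; apply: cderivD; first exact: plog_deriv.
  have e : (fun t : R => - \sum_(j < N.+1) (bp a j)`_i * rc t ^+ j) =
     (fun t : R => - (bp a 0)`_i +
        - \sum_(j < N) (bp a j.+1)`_i * rc t ^+ j.+1).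
    apply: funext => t; rewrite big_ord_recl expr0 mulr1 opprD; congr (_ - _).
  rewrite e -[X in cderiv _ _ X]add0r; apply: cderivD.
    exact: cderiv_cst.
  have hs := cderiv_sum (n := N) (x := x)
    (f := fun j t => (bp a j.+1)`_i * rc t ^+ j.+1)
    (a := fun j => (bp a j.+1)`_i * (j.+1%:R * rc x ^+ j)).
  have := cderivM (cderiv_cst (-1) x) (hs _).
  rewrite mul0r add0r mulN1r; under [X in cderiv X _ _]eq_fun do rewrite mulN1r.
  apply=> j _; have := cderivM (cderiv_cst (bp a j.+1)`_i x) (cderivX j x).
  by rewrite mul0r add0r.
- rewrite /plog addr0 ln1 mulr0 cexp0 mul1r.
  rewrite big_ord_recl expr0 mulr1 bp0 coefC big1 ?addr0; last first.
    by move=> j _; rewrite expr0n /= mulr0.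
  by case: (i) => [|k]; rewrite ?expr0 ?fact0 ?divr1 ?subrr // expr0n mul0r subrr.
- by rewrite addr_ge0 // mulr_ge0 // cabs_ge0.
- move=> x hx; have x01 := hx.
  have -> : f' x = a * (plog (a - 1) i x -
        \sum_(j < N) (bp (a - 1) j)`_i * rc x ^+ j) +
      ((if i is k.+1 then plog (a - 1) k x else 0) -
      \sum_(j < N) (if i is k.+1 then (bp (a - 1) j)`_k else 0) * rc x ^+ j).
    rewrite /f' mulrBr addrACA -opprD; congr (_ - _).
    rewrite mulr_sumr -big_split /=; apply: eq_bigr => j _.
    have -> : (bp a j.+1)`_i * (j.+1%:R * rc x ^+ j) =
       (j.+1%:R *: bp a j.+1)`_i * rc x ^+ j.
      by rewrite coefZ mulrCA mulrA.
    have -> : j.+1%:R *: bp a j.+1 = ('X + a%:P) * bp (a - 1) j.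
      rewrite /bp factS natrM invfM scalerA mulrA divff ?natS_neq0 // mul1r.
      rewrite -scalerAr; congr (_ *: _); rewrite big_ord_recl /= subr0.
      congr (_ * _); apply: eq_bigr => k _.
      by rewrite /bump /= add1n -addn1 natrD opprD addrAC addrA.
    by rewrite coef_XDC mulrDl addrC mulrA; case: (i).
  apply: (le_trans (cabsD _ _)); rewrite mulrDl cabsM -mulrA.
  by apply: lerD; [rewrite ler_wpM2l ?cabs_ge0 ?h1|exact: h2].
Qed.
End Taylor.

(** * Asymptotic expansions and power series *)

Section Asymptotics.
Variable R : realType.
Local Notation C := R[i].
Local Notation rc x := (x%:C%C).

(** F has the asymptotic expansion sum_j g_j x^j at 0+. Expansions to
    every finite order compare the factors (1 + x)^a log(1 + x)^i with convergent
    power series. *)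
Definition asy (F : R -> C) (g : nat -> C) : Prop :=
  forall N, exists (K d : R) (P : {poly C}),
    [/\ 0 <= K, 0 < d <= 1, forall j, (j < N)%N -> P`_j = g j &
        forall x, 0 < x < d -> cabs (F x - P.[rc x]) <= K * x ^+ N].

Lemma poly_bounded (P : {poly C}) : exists K : R, 0 <= K /\
  forall x : R, 0 <= x <= 1 -> cabs P.[rc x] <= K.
Proof.
exists (\sum_(i < size P) cabs P`_i); split.
  by apply: sumr_ge0 => i _; exact: cabs_ge0.
move=> x /andP [x0 x1]; rewrite horner_coef; apply: (le_trans (cabs_sum _ _ _)).
apply: ler_sum => i _; rewrite cabsM cabsX cabs_real //.
by rewrite -[leRHS]mulr1 ler_wpM2l ?cabs_ge0 // exprn_ile1.
Qed.

Lemma poly_small (P : {poly C}) N : (forall j, (j < N)%N -> P`_j = 0) ->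
  exists K : R, 0 <= K /\
    forall x : R, 0 <= x <= 1 -> cabs P.[rc x] <= K * x ^+ N.
Proof.
move=> hP; have [K [K0 hK]] := poly_bounded (drop_poly N P).
exists K; split => // x /andP [x0 x1].
have -> : P = drop_poly N P * 'X^N.
  rewrite -[LHS](poly_take_drop N) [take_poly N P](_ : _ = 0) ?add0r //.
  by apply/polyP => j; rewrite coef_take_poly coef0; case: ltnP => // /hP.
rewrite hornerM hornerXn cabsM cabsX (cabs_real x0).
by rewrite ler_wpM2r ?exprn_ge0 // hK // x0.
Qed.

Lemma asy_eq0 (F : R -> C) g (d : R) : 0 < d ->
  (forall x, 0 < x < d -> F x = 0) -> asy F g -> forall n, g n = 0.
Proof.
move=> d0 hF hg n; elim/ltn_ind: n => n IH.
have [K [e [P [K0 /andP [e0 e1] hP hx]]]] := hg n.+1.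
have hP0 j : (j < n)%N -> P`_j = 0 by move=> hj; rewrite hP ?IH // ltnW.
have hsm j : (j < n.+1)%N -> (P - (P`_n)%:P * 'X^n)`_j = 0.
  rewrite ltnS leq_eqVlt coefB coefCM coefXn => /orP [/eqP ->|hj].
    by rewrite eqxx mulr1 subrr.
  by rewrite (hP0 _ hj) (ltn_eqF hj) mulr0 subrr.
have [K2 [K20 hK2]] := poly_small hsm.
rewrite -hP //; apply: cabs_lt_eq0 => t t0.
pose x := Num.min (Num.min d e / 2) (t / (2 * (K + K2 + 1))).
have m0 : 0 < Num.min d e by rewrite lt_min d0.
have k0 : 0 < K + K2 + 1 by rewrite ltr_wpDl // addr_ge0.
have x0 : 0 < x by rewrite lt_min !divr_gt0 // mulr_gt0.
have xm : x < Num.min d e.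
  by rewrite (le_lt_trans (_ : _ <= Num.min d e / 2)) ?ge_min ?lexx //; lra.
have [xd xe] : x < d /\ x < e by apply/andP; rewrite -lt_min.
have x01 : 0 <= x <= 1 by rewrite (ltW x0) (le_trans (ltW xe)).
have h1 := hx x; rewrite x0 xe hF ?x0 // sub0r cabsN in h1.
have h2 := hK2 x x01.
have : cabs (P`_n) * x ^+ n <= (K + K2) * x ^+ n.+1.
  have -> : cabs P`_n * x ^+ n = cabs (P.[rc x] - (P - (P`_n)%:P * 'X^n).[rc x]).
    rewrite hornerD hornerN hornerM hornerC hornerXn opprB addrC subrK.
    by rewrite cabsM cabsX cabs_real ?(ltW x0).
  apply: (le_trans (cabsD _ _)); rewrite cabsN mulrDl; apply: lerD => //.
  exact: h1.
rewrite exprS mulrA ler_pM2r ?exprn_gt0 // => h3.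
apply: (le_lt_trans h3); have : x <= t / (2 * (K + K2 + 1)).
  by rewrite ge_min lexx orbT.
rewrite ler_pdivlMr ?mulr_gt0 // => h4.
have : 0 <= K + K2 by rewrite addr_ge0.
by move: h4 t0 x0; set k := K + K2; nra.
Qed.

Lemma asyD F G f g : asy F f -> asy G g ->
  asy (fun x => F x + G x) (fun n => f n + g n).
Proof.
move=> hF hG N; have [K [d [P [K0 /andP [d0 d1] hP hx]]]] := hF N.
have [L [e [Q [L0 /andP [e0 e1] hQ hy]]]] := hG N.
exists (K + L), (Num.min d e), (P + Q); split.
- exact: addr_ge0.
- by rewrite lt_min d0 e0 ge_min d1.
- by move=> j hj; rewrite coefD hP // hQ.
- move=> x /andP [x0]; rewrite lt_min => /andP [xd xe].
  rewrite hornerD opprD addrACA mulrDl; apply: (le_trans (cabsD _ _)).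
  by apply: lerD; [apply: hx|apply: hy]; rewrite x0.
Qed.

Lemma asyM F G f g : asy F f -> asy G g ->
  asy (fun x => F x * G x) (fun n => \sum_(i < n.+1) f i * g (n - i)%N).
Proof.
move=> hF hG N; have [K [d [P [K0 /andP [d0 d1] hP hx]]]] := hF N.
have [L [e [Q [L0 /andP [e0 e1] hQ hy]]]] := hG N.
have [A [A0 hA]] := poly_bounded P; have [B [B0 hB]] := poly_bounded Q.
exists (K * (B + L) + A * L), (Num.min d e), (P * Q); split.
- by rewrite addr_ge0 ?mulr_ge0 // addr_ge0.
- by rewrite lt_min d0 e0 ge_min d1.
- move=> j hj; rewrite coefM; apply: eq_bigr => i _.
  by rewrite hP ?hQ // (leq_ltn_trans _ hj) // ?leq_subr // -ltnS.
- move=> x /andP [x0]; rewrite lt_min => /andP [xd xe].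
  have x01 : 0 <= x <= 1 by rewrite (ltW x0) (le_trans (ltW xd)).
  have xN1 : x ^+ N <= 1 by case/andP: x01 => ? ?; rewrite exprn_ile1.
  have xN0 : 0 <= x ^+ N by case/andP: x01 => ? ?; rewrite exprn_ge0.
  have h1 := hx x; have h2 := hy x; rewrite x0 xd in h1; rewrite x0 xe in h2.
  have -> : F x * G x - (P * Q).[rc x] =
     (F x - P.[rc x]) * G x + P.[rc x] * (G x - Q.[rc x]) by rewrite hornerM; ring.
  apply: (le_trans (cabsD _ _)); rewrite !cabsM mulrDl; apply: lerD.
    rewrite mulrAC; apply: ler_pM; rewrite ?cabs_ge0 ?h1 //.
    have -> : G x = Q.[rc x] + (G x - Q.[rc x]) by rewrite addrC subrK.
    apply: (le_trans (cabsD _ _)); apply: lerD; first exact: hB.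
    by apply: (le_trans (h2 isT)); rewrite -[leRHS]mulr1 ler_wpM2l.
  by rewrite -mulrA; apply: ler_pM; rewrite ?cabs_ge0 ?hA ?h2.
Qed.

Lemma asyZ c F f : asy F f -> asy (fun x => c * F x) (fun n => c * f n).
Proof.
move=> hF N; have [K [d [P [K0 hd hP hx]]]] := hF N.
exists (cabs c * K), d, (c *: P); split => //.
- by rewrite mulr_ge0 ?cabs_ge0.
- by move=> j hj; rewrite coefZ hP.
- move=> x hx'; rewrite hornerZ -mulrBr cabsM -mulrA.
  by rewrite ler_wpM2l ?cabs_ge0 // hx.
Qed.

Lemma asy0 : asy (fun=> 0) (fun=> 0).
Proof.
move=> N; exists 0, 1, 0; split; rewrite ?ltr01 ?lexx //.
  by move=> j _; rewrite coef0.
by move=> x _; rewrite horner0 subrr cabs0 mul0r.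
Qed.

Lemma asy_sum n (F : nat -> R -> C) f :
  (forall i, (i < n)%N -> asy (F i) (f i)) ->
  asy (fun x => \sum_(i < n) F i x) (fun k => \sum_(i < n) f i k).
Proof.
elim: n => [|n IH] h.
  rewrite [X in asy X _](_ : _ = fun=> 0); last by apply: funext => x; rewrite big_ord0.
  rewrite [X in asy _ X](_ : _ = fun=> 0); last by apply: funext => x; rewrite big_ord0.
  exact: asy0.
rewrite [X in asy X _](_ : _ = fun x => \sum_(j < n) F j x + F n x); last first.
  by apply: funext => x; rewrite big_ord_recr.
rewrite [X in asy _ X](_ : _ = fun k => \sum_(j < n) f j k + f n k); last first.
  by apply: funext => x; rewrite big_ord_recr.
by apply: asyD; [apply: IH => j hj; apply: h; exact: ltnW|exact: h].
Qed.

Lemma asy_uniq F G f g (d : R) : 0 < d -> (forall x, 0 < x < d -> F x = G x) ->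
  asy F f -> asy G g -> f =1 g.
Proof.
move=> d0 h hf hg n; apply/eqP; rewrite -subr_eq0; apply/eqP.
have := asyD hf (asyZ (-1) hg).
move=> /(asy_eq0 d0) => /(_ _ n); rewrite mulN1r; apply=> x /h ->.
by rewrite mulN1r subrr.
Qed.

Lemma asy_Xn k : asy (fun x => rc x ^+ k) (fun n => (n == k)%:R).
Proof.
move=> N; exists 0, 1, 'X^k; split; rewrite ?ltr01 ?lexx //.
  by move=> j _; rewrite coefXn.
by move=> x _; rewrite hornerXn subrr cabs0 mul0r.
Qed.

Lemma asy_shift k F f : asy F f ->
  asy (fun x => rc x ^+ k * F x) (fun n => if (k <= n)%N then f (n - k)%N else 0).
Proof.
move=> h; have := asyM (asy_Xn k) h; congr asy; apply: funext => n.
case: ifPn => hk.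
  rewrite (bigD1 (Ordinal (hk : (k < n.+1)%N))) //= eqxx mul1r big1 ?addr0 //.
  by move=> i; rewrite -val_eqE /= => /negbTE ->; rewrite mul0r.
rewrite big1 // => i _; rewrite (_ : _ == k = false) ?mul0r //.
by apply: contraNF hk => /eqP <-; rewrite -ltnS.
Qed.

Lemma asy_plog a i : asy (plog a i) (fun j => (bp a j)`_i).
Proof.
move=> N; have [K [K0 hK]] := plog_taylor N a i.
exists K, 1, (\poly_(j < N) (bp a j)`_i); split; rewrite ?ltr01 ?lexx //.
  by move=> j hj; rewrite coef_poly hj.
move=> x /andP [x0 x1]; rewrite horner_poly.
by apply: hK; rewrite !ltW.
Qed.

(** Conditional convergence, in the order of the exponents. *)
Definition psum (g : nat -> C) (z s : C) : Prop :=
  forall e : R, 0 < e -> exists K, forall k, (K <= k)%N ->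
    cabs (\sum_(i < k) g i * z ^+ i - s) < e.

Lemma psum_uniq g z s t : psum g z s -> psum g z t -> s = t.
Proof.
move=> hs ht; apply/eqP; rewrite -subr_eq0; apply/eqP.
apply: cabs_lt_eq0 => e e0; have e2 : 0 < e / 2 by rewrite divr_gt0.
have [K hK] := hs _ e2; have [L hL] := ht _ e2.
have h1 := hK _ (leq_maxl K L); have h2 := hL _ (leq_maxr K L).
rewrite cabsB in h1; set x := \sum_(i < _) _ in h1 h2.
have -> : s - t = (s - x) + (x - t) by rewrite addrA subrK.
by apply: (le_lt_trans (cabsD _ _)); rewrite (splitr e) ltrD.
Qed.

Lemma psumD f g z s t : psum f z s -> psum g z t ->
  psum (fun n => f n + g n) z (s + t).
Proof.
move=> hs ht e e0; have e2 : 0 < e / 2 by rewrite divr_gt0.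
have [K hK] := hs _ e2; have [L hL] := ht _ e2.
exists (maxn K L) => k; rewrite geq_max => /andP [h1 h2].
under eq_bigr do rewrite mulrDl.
rewrite big_split /= opprD addrACA (splitr e).
by apply: (le_lt_trans (cabsD _ _)); rewrite ltrD ?hK ?hL.
Qed.

Lemma psumZ c f z s : psum f z s -> psum (fun n => c * f n) z (c * s).
Proof.
move=> hs e e0; have c0 : 0 < cabs c + 1 by rewrite ltr_wpDl ?cabs_ge0.
have [K hK] := hs _ (divr_gt0 e0 c0); exists K => k /hK.
under [\sum_(i < k) c * f i * _]eq_bigr do rewrite -mulrA.
rewrite -mulr_sumr -mulrBr cabsM ltr_pdivlMr // mulrC.
apply: le_lt_trans; rewrite ler_wpM2r ?cabs_ge0 //.
by rewrite lerDl.
Qed.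

Lemma psum_fin g z D : (forall n, (D <= n)%N -> g n = 0) ->
  psum g z (\sum_(i < D) g i * z ^+ i).
Proof.
move=> h e e0; exists D => k hk.
rewrite (@sum_trunc _ k D (fun i => g i * z ^+ i)) // ?subrr ?cabs0 // => i hi.
by rewrite h // mul0r.
Qed.

Lemma psum_shift g z s : psum g z s ->
  psum (fun n => if n is m.+1 then g m else 0) z (z * s).
Proof.
move=> hs e e0; have c0 : 0 < cabs z + 1 by rewrite ltr_wpDl ?cabs_ge0.
have [K hK] := hs _ (divr_gt0 e0 c0); exists K.+1 => -[//|k] /hK.
rewrite big_ord_recl /= mul0r add0r.
under [\sum_(i < k) g i * z ^+ _.+1]eq_bigr do rewrite exprS mulrCA.
rewrite -mulr_sumr -mulrBr cabsM ltr_pdivlMr // mulrC.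
apply: le_lt_trans; rewrite ler_wpM2r ?cabs_ge0 //.
by rewrite lerDl.
Qed.

Lemma psum_scale g z q s : psum g (z * q) s ->
  psum (fun n => g n * q ^+ n) z s.
Proof.
move=> hs e /hs [K hK]; exists K => k /hK.
by under eq_bigr do rewrite exprMn [z ^+ _ * _]mulrC mulrA.
Qed.

(** The terms of a convergent series are bounded, which gives geometric decay at
    smaller radii. *)
Lemma psum_bounded g (x : R) s : 0 < x -> psum g (rc x) s ->
  exists B : R, 0 <= B /\ forall n, cabs (g n) * x ^+ n <= B.
Proof.
move=> x0 hs; have [K hK] := hs 1 ltr01.
exists (2 + \sum_(i < K) cabs (g i) * x ^+ i).
have h0 : 0 <= \sum_(i < K) cabs (g i) * x ^+ i.
  by apply: sumr_ge0 => i _; rewrite mulr_ge0 ?cabs_ge0 // exprn_ge0 ?ltW.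
split; first by rewrite addr_ge0.
move=> n; case: (ltnP n K) => hn.
  rewrite (bigD1 (Ordinal hn)) //= addrCA lerDl addr_ge0 //.
  by apply: sumr_ge0 => i _; rewrite mulr_ge0 ?cabs_ge0 // exprn_ge0 ?ltW.
apply: (@le_trans _ _ 2); last by rewrite lerDl.
have h1 := hK _ hn; have h2 := hK _ (leqW hn).
rewrite -[x in x ^+ n](cabs_real (ltW x0)) -cabsX -cabsM.
have -> : g n * rc x ^+ n = (\sum_(i < n.+1) g i * rc x ^+ i - s) -
   (\sum_(i < n) g i * rc x ^+ i - s).
  by rewrite big_ord_recr /= opprB addrA subrK addrC addKr.
apply: (le_trans (cabsD _ _)); rewrite cabsN.
by rewrite (_ : 2 = 1 + 1) // lerD ?ltW.
Qed.

(** A power series convergent near 0 is its own asymptotic expansion. *)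
Lemma psum_asy (F : R -> C) g (d : R) : 0 < d ->
  (forall x, 0 < x < d -> psum g (rc x) (F x)) -> asy F g.
Proof.
move=> d0 h N; pose x0 := Num.min d 1 / 2.
have m0 : 0 < Num.min d 1 by rewrite lt_min d0 ltr01.
have x00 : 0 < x0 by rewrite divr_gt0.
have xm : x0 < Num.min d 1 by rewrite /x0; lra.
have [xd x1] : x0 < d /\ x0 < 1 by apply/andP; rewrite -lt_min.
have [B [B0 hB]] := psum_bounded x00 (h x0 (introT andP (conj x00 xd))).
clearbody x0.
exists (2 * B / x0 ^+ N), (x0 / 2), (\poly_(j < N) g j).
split; first by rewrite divr_ge0 ?mulr_ge0 // exprn_ge0 // ltW.
- by rewrite divr_gt0 //=; lra.
- by move=> j hj; rewrite coef_poly hj.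
move=> x /andP [xp xh]; rewrite horner_poly.
have tail k : (N <= k)%N ->
   cabs (\sum_(i < k) g i * rc x ^+ i - \sum_(i < N) g i * rc x ^+ i) <=
   2 * B / x0 ^+ N * x ^+ N.
  move=> hk; have -> : \sum_(i < k) g i * rc x ^+ i =
     \sum_(i < N) g i * rc x ^+ i + \sum_(i < k - N) g (N + i)%N * rc x ^+ (N + i).
    by rewrite -[in LHS](subnKC hk) big_split_ord.
  rewrite addrC addKr; apply: (le_trans (cabs_sum _ _ _)).
  pose r := x / x0; have r0 : 0 < r by rewrite divr_gt0.
  have r2 : r < 1 / 2 by rewrite /r ltr_pdivrMr //; lra.
  have hterm i : cabs (g (N + i)%N * rc x ^+ (N + i)) <= B * r ^+ N * r ^+ i.
    rewrite cabsM cabsX (cabs_real (ltW xp)) -mulrA -exprD /r expr_div_n.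
    have xN : 0 < x0 ^+ (N + i) by rewrite exprn_gt0.
    rewrite mulrA ler_pdivlMr // mulrAC ler_wpM2r ?hB //.
    by rewrite exprn_ge0 ?ltW.
  apply: (@le_trans _ _ (\sum_(i < k - N) B * r ^+ N * r ^+ i)).
    by apply: ler_sum => i _; exact: hterm.
  rewrite -mulr_sumr.
  have hgeo n : \sum_(i < n) r ^+ i <= 2 - 2 * r ^+ n.
    elim: n => [|n IH]; first by rewrite big_ord0 expr0; lra.
    rewrite big_ord_recr /= exprSr.
    have : 0 < r ^+ n by rewrite exprn_gt0.
    by move: IH r2; set s := \sum_(i < n) _; set t := r ^+ n; nra.
  have hg2 n : \sum_(i < n) r ^+ i <= 2.
    by apply: (le_trans (hgeo n)); rewrite lerBlDr lerDl mulr_ge0 ?exprn_ge0 ?ltW.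
  have -> : 2 * B / x0 ^+ N * x ^+ N = B * r ^+ N * 2.
    by rewrite /r expr_div_n; ring.
  by rewrite ler_wpM2l // mulr_ge0 // exprn_ge0 // ltW.
rewrite leNgt; apply/negP => hlt.
set T := \sum_(i < N) _ in hlt.
have xd' : x < d by lra.
have e0 : 0 < cabs (F x - T) - 2 * B / x0 ^+ N * x ^+ N by rewrite subr_gt0.
have [K hK] := h x (introT andP (conj xp xd')) _ e0.
have h1 := hK _ (leq_maxl K N); have h2 := tail _ (leq_maxr K N).
rewrite cabsB in h1.
have := cabsD (F x - \sum_(i < maxn K N) g i * rc x ^+ i)
  (\sum_(i < maxn K N) g i * rc x ^+ i - T).
rewrite addrA subrK leNgt => /negP; apply.
by rewrite -[X in _ < X](subrK (2 * B / x0 ^+ N * x ^+ N)) ltr_leD.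
Qed.

Lemma psum_eq0 g (d : R) : 0 < d -> (forall x, 0 < x < d -> psum g (rc x) 0) ->
  forall n, g n = 0.
Proof.
by move=> d0 h; apply: (asy_eq0 (F := fun=> 0) d0) => //; exact: psum_asy h.
Qed.
End Asymptotics.

(** * Exponential polynomials *)

Section ExpPoly.
Variable R : realType.
Local Notation C := R[i].
Local Notation rc x := (x%:C%C).

Definition expmono (m : C) (k : nat) (t : R) : C := cexp (m * rc t) * rc t ^+ k.

(** Exponential polynomials; in s = e^t these are the finite sums of
    s^m (log s)^k. *)
Definition exppoly (e : R -> C) : Prop :=
  exists r : seq (C * (C * nat)),
    forall t, e t = \sum_(p <- r) p.1 * expmono p.2.1 p.2.2 t.

Lemma exppoly_mono m k : exppoly (expmono m k).
Proof. by exists [:: (1, (m, k))] => t; rewrite big_seq1 mul1r. Qed.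

Lemma exppoly_ext e f : e =1 f -> exppoly e -> exppoly f.
Proof. by move=> h [r hr]; exists r => t; rewrite -h hr. Qed.

Lemma exppolyD e f : exppoly e -> exppoly f -> exppoly (fun t => e t + f t).
Proof.
by move=> [r hr] [s hs]; exists (r ++ s) => t; rewrite big_cat hr hs.
Qed.

Lemma exppoly0 : exppoly (fun=> 0).
Proof. by exists [::] => t; rewrite big_nil. Qed.

Lemma exppoly_sum n (e : nat -> R -> C) :
  (forall i, (i < n)%N -> exppoly (e i)) ->
  exppoly (fun t => \sum_(i < n) e i t).
Proof.
elim: n => [|n IH] h.
  by apply: exppoly_ext exppoly0 => t; rewrite big_ord0.
apply: (exppoly_ext (e := fun t => \sum_(i < n) e i t + e n t)).
  by move=> t; rewrite big_ord_recr.
by apply: exppolyD; [apply: IH => i hi; apply: h; exact: ltnW|exact: h].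
Qed.

Lemma exppolyZ c e : exppoly e -> exppoly (fun t => c * e t).
Proof.
move=> [r hr]; exists [seq (c * p.1, p.2) | p <- r] => t.
by rewrite big_map hr mulr_sumr; apply: eq_bigr => p _; rewrite mulrA.
Qed.

Lemma expmonoM m k n l t :
  expmono m k t * expmono n l t = expmono (m + n) (k + l) t.
Proof. by rewrite /expmono mulrACA -cexpD -mulrDl -exprD. Qed.

Lemma exppolyM e f : exppoly e -> exppoly f -> exppoly (fun t => e t * f t).
Proof.
move=> [r hr] [s hs].
exists [seq (p.1 * q.1, (p.2.1 + q.2.1, (p.2.2 + q.2.2)%N)) | p <- r, q <- s].
move=> t; rewrite big_allpairs_dep hr mulr_suml; apply: eq_bigr => p _.
by rewrite hs mulr_sumr; apply: eq_bigr => q _ /=; rewrite -expmonoM; ring.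
Qed.

Lemma exppoly_expR n : exppoly (fun t => rc (expR t) ^+ n).
Proof.
apply: exppoly_ext (exppoly_mono n%:R 0) => t.
rewrite /expmono expr0 mulr1 mulrC cexpMn; congr (_ ^+ _).
by rewrite /cexp /= cos0 sin0 mulr1 mulr0.
Qed.

Local Notation Fun := (R -> C^o).
Definition tshift (f : Fun) : Fun := fun t => f (t - 1).

Lemma tshift_linear : linear tshift.
Proof. by move=> a f g; apply: funext. Qed.

Lemma iter_tshift n f t : iter n tshift f t = f (t - n%:R).
Proof.
elim: n t => [|n IH] t; first by rewrite subr0.
by rewrite /= /tshift IH -natr1 opprD addrA addrAC.
Qed.

Lemma polyact_tshift Q f t :
  polyact tshift Q f t = \sum_(i < size Q) Q`_i * f (t - i%:R).
Proof.
rewrite /polyact fct_sumE; apply: eq_bigr => i _.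
by rewrite -iter_tshift.
Qed.

Lemma expmono_annih m k j : (j <= k)%N ->
  polyact tshift (('X - (cexp (- m))%:P) ^+ k.+1) (expmono m j) = 0.
Proof.
elim: k j => [|k IH] j.
  rewrite leqn0 => /eqP ->.
  rewrite expr1 polyactB ?polyact_X ?polyactC.
  apply: funext => t.
  rewrite -[LHS]/(expmono m 0 (t - 1) - cexp (- m) * expmono m 0 t).
  rewrite /expmono !expr0 !mulr1 rmorphB mulrBr cexpD mulr1 mulrC.
  exact: subrr.
move=> hj; rewrite exprSr polyactM; last exact: tshift_linear.
rewrite polyactB ?polyact_X ?polyactC; try exact: tshift_linear.
have -> : tshift (expmono m j) - cexp (- m) *: (expmono m j : Fun) =
   \sum_(i < j) (cexp (- m) * ((-1) ^+ (j - i) * 'C(j, i)%:R)) *: (expmono m i : Fun).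
  apply: funext => t; rewrite fct_sumE.
  rewrite -[LHS]/(expmono m j (t - 1) - cexp (- m) * expmono m j t).
  rewrite /expmono rmorphB rmorph1 mulrBr mulr1 cexpD.
  have -> : (rc t - 1) ^+ j = \sum_(i < j.+1) ((-1) ^+ (j - i) * rc t ^+ i) *+ 'C(j, i).
    by rewrite addrC exprDn.
  rewrite big_ord_recr /= subnn expr0 mul1r binn mulr1n.
  set E := cexp (m * _); set D := cexp (- m).
  have -> : forall x y : C, E * D * (x + y) - D * (E * y) = E * D * x.
    by move=> x y; ring.
  rewrite mulr_sumr; apply: eq_bigr => i _.
  rewrite -[RHS]/(D * ((-1) ^+ (j - i) * 'C(j, i)%:R) * (E * rc t ^+ i)).
  by rewrite -mulr_natr; ring.
rewrite (lin_sum (polyact_linear tshift_linear _)) big1 // => i _.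
rewrite (linZ (polyact_linear tshift_linear _)) IH ?scaler0 //.
by rewrite -ltnS (leq_trans (ltn_ord i)).
Qed.

(** Translation by 1 acts on the exponential polynomials with exponent m and
    degree at most k by a Jordan block of eigenvalue e^{-m}, so the product of
    the corresponding powers of X - e^{-m} annihilates their sum. *)
Lemma exppoly_annih e : exppoly e -> exists Q : {poly C}, Q`_0 != 0 /\
  forall t, \sum_(i < size Q) Q`_i * e (t - i%:R) = 0.
Proof.
move=> [r hr].
have [Q [Q0 hQ]] : exists Q : {poly C}, Q`_0 != 0 /\
    polyact tshift Q (\sum_(p <- r) p.1 *: (expmono p.2.1 p.2.2 : Fun)) = 0.
  elim: r {hr} => [|p r [Q [Q0 hQ]]].
    exists 1; rewrite coefC oner_neq0; split => //.
    by rewrite big_nil polyactC scaler0.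
  pose P := ('X - (cexp (- p.2.1))%:P) ^+ p.2.2.+1.
  exists (Q * P); split.
    rewrite coefM big_ord1 subnn mulf_neq0 // /P.
    have -> : forall q : {poly C}, q`_0 = q.[0] by move=> q; rewrite horner_coef0.
    rewrite horner_exp hornerXsubC expf_neq0 // sub0r oppr_eq0.
    exact: cexp_neq0.
  rewrite big_cons (linD (polyact_linear tshift_linear _)).
  have hl := tshift_linear.
  rewrite polyactM // (linZ (polyact_linear hl _)) expmono_annih // scaler0.
  rewrite (lin0 (polyact_linear hl _)) add0r mulrC polyactM // hQ.
  exact: (lin0 (polyact_linear hl _)).
exists Q; split => // t; have := congr1 (fun f : Fun => f t) hQ.
rewrite /= polyact_tshift => h; rewrite -[RHS]h; apply: eq_bigr => i _.
congr (_ * _); rewrite hr fct_sumE; apply: eq_bigr => p _.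
by [].
Qed.

(** Continuation by the recurrence: Q_0 e(t) = - sum_(i > 0) Q_i e(t - i). *)
Lemma exppoly_eq0 e : exppoly e -> (forall t, t < 0 -> e t = 0) ->
  forall t, e t = 0.
Proof.
move=> he h0; have [Q [Q0 hQ]] := exppoly_annih he.
have h n t : t < n%:R -> e t = 0.
  elim: n t => [|n IH] t ht; first exact: h0.
  have := hQ t; have : (0 < size Q)%N.
    by rewrite lt0n size_poly_eq0; apply: contraNneq Q0 => ->; rewrite coef0.
  case: (size Q) => // m _; rewrite big_ord_recl big1 ?addr0 => [|i _].
    by rewrite subr0 => /eqP; rewrite mulf_eq0 (negbTE Q0) => /eqP.
  rewrite lift0 IH ?mulr0 // -natr1.
  have : 0 <= (i : nat)%:R :> R by rewrite ler0n.
  by move: ht; rewrite -natr1; lra.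
move=> t; apply: (h (Num.truncn `|t|).+1); apply: (le_lt_trans (ler_norm t)).
by have /andP [] := truncn_itv (normr_ge0 t).
Qed.

(** A power series in s = e^t that is an exponential polynomial is a
    polynomial: dilation s -> s / exp 1 has an annihilating polynomial Q, so
    g_n Q(e^(-n)) = 0, and Q(e^(-n)) tends to Q(0) <> 0. *)
Lemma exppoly_rational e g : exppoly e ->
  (forall t : R, t < 0 -> psum g (rc (expR t)) (e t)) ->
  exists D, (forall n, (D <= n)%N -> g n = 0) /\
    forall t, e t = \sum_(i < D) g i * rc (expR t) ^+ i.
Proof.
move=> he hg; have [Q [Q0 hQ]] := exppoly_annih he.
have hgQ n : g n * Q.[rc (expR (-1)) ^+ n] = 0.
  move: n; apply: (psum_eq0 (d := 1)) => // x /andP [x0 x1].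
  pose t := ln x; have ht : t < 0 by rewrite ln_lt0 // x0.
  have ex : expR t = x by rewrite lnK ?posrE.
  rewrite -[X in psum _ _ X](hQ t) -ex.
  have hs m : psum (fun n => g n * \sum_(i < m) Q`_i * (rc (expR (-1)) ^+ n) ^+ i)
     (rc (expR t)) (\sum_(i < m) Q`_i * e (t - i%:R)).
    elim: m => [|m IH].
      rewrite big_ord0; move=> eps e0; exists 0%N => k _.
      by rewrite big1 ?subrr ?cabs0 // => i _; rewrite big_ord0 mulr0 mul0r.
    rewrite big_ord_recr /=.
    have hm : psum (fun n => g n * (rc (expR (- 1)) ^+ m) ^+ n) (rc (expR t)) (e (t - m%:R)).
      apply: psum_scale; have := hg (t - m%:R).
      rewrite expRD rmorphM -mulN1r mulrC expRM_natl rmorphXn.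
      by apply; have : 0 <= m%:R :> R by []; lra.
    have := psumD IH (psumZ Q`_m hm).
    congr psum; apply: funext => n; rewrite big_ord_recr mulrDr /=.
    by congr (_ + _); rewrite -!exprM mulnC; ring.
  have := hs (size Q); congr psum; apply: funext => n.
  by rewrite horner_coef.
have [D hD] : exists D, forall n, (D <= n)%N -> g n = 0.
  have [K [K0 hK]] := poly_small (P := Q - (Q`_0)%:P) (N := 1)
    (fun j hj => ltac:(by move: hj; rewrite ltnS leqn0 => /eqP ->;
       rewrite coefB coefC eqxx subrr)).
  have Qp : 0 < cabs Q`_0.
    rewrite lt_neqAle cabs_ge0 andbT eq_sym; apply: contra Q0 => /eqP h.
    by rewrite (cabs_eq0 h).
  exists (Num.truncn (K / cabs Q`_0)).+1 => n hn; apply/eqP.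
  have := hgQ n; move/eqP; rewrite mulf_eq0 => /orP [//|/eqP hz].
  have n0 : 0 <= n%:R :> R by rewrite ler0n.
  have xn0 : 0 <= expR (- (n%:R : R)) <= 1 by rewrite expR_ge0 /= expR_le1; lra.
  have := hK _ xn0; rewrite hornerD hornerN hornerC.
  have -> : rc (expR (- n%:R)) = rc (expR (-1)) ^+ n :> C.
    by rewrite -rmorphXn -expRM_natl mulrN1.
  rewrite hz sub0r cabsN expr1 => hle; exfalso.
  have hKn : K / cabs Q`_0 < n%:R.
    have /andP [_ h1] := truncn_itv (divr_ge0 K0 (cabs_ge0 Q`_0)).
    by apply: (lt_le_trans h1); rewrite ler_nat.
  rewrite ltr_pdivrMr // in hKn.
  have hen : expR (- n%:R) * (1 + n%:R) <= 1 :> R.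
    rewrite expRN mulrC ler_pdivrMr ?expR_gt0 // mul1r; exact: expR_ge1Dx.
  have ep : 0 < expR (- n%:R) :> R by exact: expR_gt0.
  by move: hle hKn hen ep Qp K0; set E := expR _; set q := cabs _;
    set nn := n%:R; nra.
exists D; split => // t.
apply/eqP; rewrite -subr_eq0; apply/eqP.
apply: (exppoly_eq0 (e := fun t => e t - \sum_(i < D) g i * rc (expR t) ^+ i)).
  apply: exppolyD => //.
  apply: (exppoly_ext (e := fun t => (-1) * \sum_(i < D) g i * rc (expR t) ^+ i)).
    by move=> s; rewrite mulN1r.
  apply: exppolyZ.
  apply: (exppoly_sum (e := fun i t => g i * rc (expR t) ^+ i)) => i _.
  by apply: exppolyZ; exact: exppoly_expR.
move=> s hs; rewrite (psum_uniq (hg s hs) (psum_fin _ hD)).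
exact: subrr.
Qed.
End ExpPoly.

(** * Three expansions of a rational function *)

Section Binomials.
Variable R : realType.
Local Notation C := R[i].
Implicit Types (c : C) (j k : nat).

Lemma cbinom0 c : cbinom c 0 = 1.
Proof. by rewrite /cbinom big_ord0 fact0 divr1. Qed.

Lemma cbinomS c j : j.+1%:R * cbinom c j.+1 = (c - j%:R) * cbinom c j.
Proof.
rewrite /cbinom big_ord_recr /= factS natrM invfM.
set P := \prod_(i < j) _; set f := (_`!%:R)^-1.
rewrite [P * _]mulrC -mulrA [X in _ * (_ * X)]mulrCA !mulrA [_ * (c - _)]mulrC.
by rewrite -!mulrA mulVKf ?natS_neq0 // mulrCA [X in _ * X]mulrA mulrA
   -?mulrA ?mulVKf ?natS_neq0.
Qed.

Lemma cbinom_pascal c j : cbinom (c + 1) j.+1 = cbinom c j.+1 + cbinom c j.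
Proof.
elim: j => [|j IH].
  apply: (mulfI (natS_neq0 C 0)).
  by rewrite mulrDr !cbinomS !cbinom0; ring.
apply: (mulfI (natS_neq0 C j.+1)); rewrite mulrDr !cbinomS IH mulrDr.
have h := cbinomS c j; have e : j.+1%:R = j%:R + 1 :> C by rewrite -natr1.
have -> : (c + 1 - j.+1%:R) * cbinom c j = (c - j%:R) * cbinom c j.
  by rewrite e; congr (_ * _); ring.
by rewrite -h; ring.
Qed.

Lemma cbinom_nat (n j : nat) : cbinom (n%:R : C) j = 'C(n, j)%:R.
Proof.
elim: n j => [|n IH] [|j]; rewrite ?cbinom0 ?bin0 //.
  elim: j => [|j IH].
    by apply: (mulfI (natS_neq0 C 0)); rewrite cbinomS subrr mul0r bin0n mulr0.
  apply: (mulfI (natS_neq0 C j.+1)).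
  by rewrite cbinomS IH bin0n !mulr0.
by rewrite -natr1 cbinom_pascal !IH binS natrD.
Qed.

Lemma cbinomN c k : cbinom (- c) k = (-1) ^+ k * cbinom (c + k%:R - 1) k.
Proof.
elim: k c => [|k IH] c; first by rewrite !cbinom0 mulr1.
apply: (mulfI (natS_neq0 C k)); rewrite cbinomS IH mulrCA.
have : k.+1%:R * cbinom (c + k.+1%:R - 1) k.+1 =
   (c + k%:R) * cbinom (c + k%:R - 1) k.
  have -> : c + k.+1%:R - 1 = c + k%:R by rewrite -natr1; ring.
  case: k {IH} => [|k]; first by rewrite cbinomS !cbinom0 subr0.
  have hs := cbinomS (c + k.+1%:R) k.+1.
  have h2 := cbinomS (c + k.+1%:R - 1) k.
  have h3 := cbinom_pascal (c + k.+1%:R - 1) k; rewrite subrK in h3.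
  rewrite hs h3.
  move: h2; set X := cbinom _ k.+1; set Y := cbinom _ k.
  rewrite -!natr1 => h2.
  have -> : (c + (k%:R + 1) - (k%:R + 1)) = c by ring.
  have hY : c * Y = (k%:R + 1) * X by rewrite h2; congr (_ * _); ring.
  by rewrite mulrDr hY; ring.
by move=> h; rewrite [RHS]mulrCA h exprS; ring.
Qed.

Lemma bp_coef0_cbinom c j : (bp c j)`_0 = cbinom c j.
Proof.
elim: j => [|j IH]; first by rewrite bp0 coefC cbinom0.
apply: (mulfI (natS_neq0 C j)); rewrite cbinomS -IH -coefZ bpS' coef_XDC.
by rewrite add0r.
Qed.

(** Coefficients of x^m in (1 + x)^n, expanded at infinity and at 0, and their
    difference for n < 0, a derivative of the delta function. *)
Definition cinf (n m : int) : C := if n - m is Posz k then cbinom n%:~R k else 0.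
Definition czero (n m : int) : C := if m is Posz k then cbinom n%:~R k else 0.
Definition cdelta (n m : int) : C :=
  if n is Negz k then (-1) ^ (m + 1 + k%:Z) * cbinom (- 1 - m%:~R) k else 0.

Lemma cinfS n m : cinf (n + 1) m - cinf n m = cinf n (m - 1).
Proof.
rewrite /cinf.
have -> : n - (m - 1) = n + 1 - m by lia.
case e : (n - m) => [k|k].
  have -> : n + 1 - m = k.+1 by lia.
  by rewrite intrD cbinom_pascal addrK.
case e1 : (n + 1 - m) => [k1|k1]; last by rewrite subrr.
have -> : k1 = 0%N by lia.
by rewrite !cbinom0 subr0.
Qed.

Lemma czeroS n m : czero (n + 1) m - czero n m = czero n (m - 1).
Proof.
rewrite /czero; case: m => [[|k]|k].
- by rewrite !cbinom0 subrr.
- have -> : k.+1%:Z - 1 = k by lia.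
  by rewrite intrD cbinom_pascal addrAC subrr add0r.
- have -> : Negz k - 1 = Negz k.+1 by lia.
  by rewrite subrr.
Qed.

Lemma cinf_czero n m : cinf n m - czero n m = cdelta n m.
Proof.
rewrite /cinf /czero /cdelta; case: n => n.
  case: m => m.
    case e : (n%:Z - m%:Z) => [k|k].
      have -> : n = (k + m)%N by lia.
      rewrite -[(k + m)%N%:~R]/((k + m)%:R) !cbinom_nat.
      have -> : 'C(k + m, m) = 'C(k + m, k) by rewrite -bin_sub ?leq_addl // addnK.
      by rewrite subrr.
    rewrite -[n%:~R]/(n%:R) cbinom_nat bin_small ?subrr //; lia.
  case e : (n%:Z - Negz m) => [k|k]; last by rewrite subrr.
  rewrite -[n%:~R]/(n%:R) cbinom_nat bin_small ?subr0 //; lia.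
rewrite NegzE; case: m => m.
  case e : (- n.+1%:Z - m%:Z) => [k|k]; first lia.
  rewrite sub0r mulrNz cbinomN.
  have -> : - 1 - m%:~R = - (m.+1%:R) :> C by rewrite -natr1 -[m%:~R]/(m%:R); ring.
  rewrite cbinomN.
  have -> : (-1) ^ (m%:Z + 1 + n%:Z) = (-1) ^+ (m + 1 + n) :> C by [].
  have -> : n.+1%:~R + m%:R - 1 = (n + m)%N%:R :> C.
    by rewrite -[_%:~R]/(n.+1%:R) -natr1 natrD; ring.
  have -> : m.+1%:R + n%:R - 1 = (n + m)%N%:R :> C by rewrite -natr1 natrD; ring.
  rewrite !cbinom_nat.
  have -> : 'C(n + m, m) = 'C(n + m, n) by rewrite -bin_sub ?leq_addl // addnK.
  rewrite mulrA -exprD addn1 -addnA addnn -mul2n exprD exprM sqrrN expr1n expr1n.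
  by rewrite mulr1 exprS mulN1r mulNr.
rewrite subr0.
have -> : -1 - (Negz m)%:~R = m%:R :> C.
  by rewrite NegzE mulrNz -[m.+1%:~R]/(m.+1%:R) -natr1; ring.
case e : (- n.+1%:Z - Negz m) => [k|k].
  have em : m = (k + n)%N by lia.
  rewrite mulrNz cbinomN em cbinom_nat.
  have -> : n.+1%:~R + k%:R - 1 = (k + n)%N%:R :> C.
    by rewrite -[_%:~R]/(n.+1%:R) -natr1 natrD; ring.
  rewrite cbinom_nat.
  have -> : 'C(k + n, k) = 'C(k + n, n) by rewrite -bin_sub ?leq_addr // addKn.
  congr (_ * _).
  have -> : Negz (k + n) + 1 + n%:Z = - k%:Z by lia.
  by rewrite -exprnN -exprVn invrN1.
by rewrite cbinom_nat bin_small ?mulr0 //; lia.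
Qed.
End Binomials.

Section Windows.
Variable R : realType.
Local Notation C := R[i].
Local Notation rc x := (x%:C%C).

(** The sums over Z below have finite support, inside a window that is enlarged
    as needed. *)
Definition zsum (L : nat) (F : int -> C) : C :=
  \sum_(k < L + L) F (k%:Z - L%:Z).

Lemma zsumB L F G : zsum L (fun n => F n - G n) = zsum L F - zsum L G.
Proof. by rewrite /zsum -sumrB. Qed.

Lemma eq_zsum L F G : (forall n, F n = G n) -> zsum L F = zsum L G.
Proof. by move=> h; apply: eq_bigr. Qed.

Lemma zsumE L F : (forall n : int, n < - L%:Z -> F n = 0) ->
  (forall n : int, L%:Z <= n -> F n = 0) ->
  zsum L F = \sum_(n \in [set: int]) F n.
Proof.
move=> h1 h2; have aux (n : int) : (forall j, (j < L + L)%N -> n <> j%:Z - L%:Z) -> F n = 0.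
  move=> hn; case: (ltP n (- L%:Z)) => [/h1 //|h3].
  case: (leP L%:Z n) => [/h2 //|h4]; exfalso.
  by have := hn (absz (n + L%:Z)%R); lia.
rewrite (@fsum_inj _ _ (L + L) (fun k => k%:Z - L%:Z)) //.
by move=> i j _ _; lia.
Qed.

(** Multiplication of the generating series by x - 1. *)
Definition Delta (f : int -> C) (n : int) : C := f (n - 1) - f n.

Lemma zsum_by_parts L c f : c (- L%:Z) * f (- L%:Z - 1) = 0 ->
  c L%:Z * f (L%:Z - 1) = 0 ->
  zsum L (fun n => c n * Delta f n) = zsum L (fun n => (c (n + 1) - c n) * f n).
Proof.
move=> h1 h2; rewrite /zsum.
have -> : \sum_(k < L + L) c (k%:Z - L%:Z) * Delta f (k%:Z - L%:Z) =
  \sum_(k < L + L) c (k%:Z - L%:Z) * f (k%:Z - L%:Z - 1) -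
  \sum_(k < L + L) c (k%:Z - L%:Z) * f (k%:Z - L%:Z).
  by rewrite -sumrB; apply: eq_bigr => k _; rewrite /Delta mulrBr.
have -> : \sum_(k < L + L) (c (k%:Z - L%:Z + 1) - c (k%:Z - L%:Z)) * f (k%:Z - L%:Z) =
  \sum_(k < L + L) c (k%:Z - L%:Z + 1) * f (k%:Z - L%:Z) -
  \sum_(k < L + L) c (k%:Z - L%:Z) * f (k%:Z - L%:Z).
  by rewrite -sumrB; apply: eq_bigr => k _; rewrite mulrBl.
congr (_ - _).
pose F k := c (k%:Z - L%:Z) * f (k%:Z - L%:Z - 1).
rewrite (eq_bigr (fun k : 'I_(L + L) => F k)) //.
have -> : \sum_(k < L + L) F k = \sum_(k < L + L) F k.+1.
  apply: (addIr (F (L + L)%N)).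
  have e2 : F (L + L)%N = 0.
    by rewrite /F; have -> : (L + L)%N%:Z - L%:Z = L%:Z by lia.
  have e0 : F 0%N = 0 by rewrite /F sub0r.
  rewrite -(big_ord_recr (L + L) (fun k : 'I_(L + L).+1 => F k)) /=.
  by rewrite big_ord_recl /= e0 add0r e2 addr0.
apply: eq_bigr => k _; rewrite /F.
have -> : k.+1%:Z - L%:Z - 1 = k%:Z - L%:Z by lia.
by have -> : k.+1%:Z - L%:Z = k%:Z - L%:Z + 1 by lia.
Qed.

Lemma iter_Delta_sub t f g n :
  iter t Delta (fun n => f n - g n) n = iter t Delta f n - iter t Delta g n.
Proof.
elim: t n => [//|t IH] n; rewrite /= /Delta !IH; ring.
Qed.

Lemma iter_Delta_above t f (N : int) : (forall n, N < n -> f n = 0) ->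
  forall n, N + t%:Z < n -> iter t Delta f n = 0.
Proof.
move=> h; elim: t => [|t IH] n hn; first by apply: h; lia.
by rewrite /= /Delta !IH ?subrr //; lia.
Qed.

Lemma iter_Delta_below t f (B : int) : (forall n, n < B -> f n = 0) ->
  forall n, n < B -> iter t Delta f n = 0.
Proof.
move=> h; elim: t => [|t IH] n hn; first by apply: h; lia.
by rewrite /= /Delta !IH ?subrr //; lia.
Qed.

Lemma zsum_cinf t L f (N m : int) : (forall n, N < n -> f n = 0) ->
  N + t%:Z < L%:Z - 1 -> - L%:Z < m - t%:Z ->
  zsum L (fun n => cinf R n m * iter t Delta f n) =
  zsum L (fun n => cinf R n (m - t%:Z) * f n).
Proof.
move=> hf; elim: t m => [|t IH] m h1 h2.
  by apply: eq_zsum => n; rewrite subr0.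
rewrite [LHS]zsum_by_parts.
- under eq_zsum do rewrite cinfS.
  rewrite IH; [|lia|lia].
  by apply: eq_zsum => n; congr (cinf _ _ _ * _); lia.
- rewrite /cinf; case e : (_ - _) => [k|k]; last by rewrite mul0r.
  by lia.
- rewrite -[X in _ * X]/(iter t Delta f (L%:Z - 1)).
  by rewrite (iter_Delta_above hf) ?mulr0 //; lia.
Qed.

Lemma zsum_czero t L f (N B m : int) : (forall n, N < n -> f n = 0) ->
  (forall n, n < B -> f n = 0) -> N + t%:Z < L%:Z - 1 -> - L%:Z <= B ->
  zsum L (fun n => czero R n m * iter t Delta f n) =
  zsum L (fun n => czero R n (m - t%:Z) * f n).
Proof.
move=> hf hB; elim: t m => [|t IH] m h1 h2.
  by apply: eq_zsum => n; rewrite subr0.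
rewrite [LHS]zsum_by_parts.
- under eq_zsum do rewrite czeroS.
  rewrite IH; [|lia|lia].
  by apply: eq_zsum => n; congr (czero _ _ _ * _); lia.
- rewrite -[X in _ * X]/(iter t Delta f (- L%:Z - 1)).
  by rewrite (iter_Delta_below _ hB) ?mulr0 //; lia.
- rewrite -[X in _ * X]/(iter t Delta f (L%:Z - 1)).
  by rewrite (iter_Delta_above hf) ?mulr0 //; lia.
Qed.

(** If p, supported below, and q, supported above, become the same finite
    sequence after t differences, then expanding sum_n p_n (1 + x)^n at infinity
    and the rational function it represents at 0 differ by the principal part
    of q. *)
Lemma delta_formula t L p q (N B m : int) :
  (forall n, N < n -> p n = 0) -> (forall n, n < B -> q n = 0) ->
  (forall n, iter t Delta p n = iter t Delta q n) ->
  0 <= N -> B <= 0 -> N + t%:Z < L%:Z - 1 -> - L%:Z < m -> - L%:Z <= B ->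
  zsum L (fun n => cinf R n m * p n) -
  zsum L (fun n => czero R n (m + t%:Z) * iter t Delta q n) =
  zsum L (fun n => cdelta R n m * q n).
Proof.
move=> hp hq hpq N0 B0 h1 h2 h3.
(* The principal part of q. The differences of p - G and q - G are supported in
   degrees n >= 0, where the two expansions of (1 + x)^n agree. *)
pose G (n : int) := if n < 0 then q n else 0.
have GN n : N < n -> G n = 0.
  by move=> hn; rewrite /G ifF //; apply/negP; lia.
have GB n : n < B -> G n = 0 by move=> hn; rewrite /G; case: ifP => // _; exact: hq.
have e1 : zsum L (fun n => cinf R n m * (p n - G n)) =
    zsum L (fun n => czero R n (m + t%:Z) * iter t Delta (fun n => q n - G n) n).
  have em : m = m + t%:Z - t%:Z by rewrite addrK.
  rewrite [in LHS]em -(@zsum_cinf t L (fun n => p n - G n) N); first last.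
  - by lia.
  - by lia.
  - by move=> n hn; rewrite hp // GN // subrr.
  apply: eq_zsum => n; rewrite !iter_Delta_sub hpq -iter_Delta_sub.
  case: (ltP n 0) => hn.
    rewrite (@iter_Delta_below t _ 0) ?mulr0 // => k hk.
    by rewrite /G hk subrr.
  congr (_ * _); apply/eqP; rewrite -subr_eq0 cinf_czero.
  by move: hn; case: (n).
have e2 : zsum L (fun n => czero R n (m + t%:Z) * iter t Delta G n) =
    zsum L (fun n => czero R n m * G n).
  by rewrite (@zsum_czero t L G N B) // addrK.
have e3 : zsum L (fun n => czero R n (m + t%:Z) * iter t Delta (fun n => q n - G n) n)
   = zsum L (fun n => czero R n (m + t%:Z) * iter t Delta q n) -
     zsum L (fun n => czero R n m * G n).
  rewrite -e2 -zsumB; apply: eq_zsum => n.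
  by rewrite iter_Delta_sub mulrBr.
have e4 : zsum L (fun n => cinf R n m * (p n - G n)) =
   zsum L (fun n => cinf R n m * p n) - zsum L (fun n => cinf R n m * G n).
  by rewrite -zsumB; apply: eq_zsum => n; rewrite mulrBr.
have e5 : zsum L (fun n => cdelta R n m * q n) =
   zsum L (fun n => cinf R n m * G n) - zsum L (fun n => czero R n m * G n).
  rewrite -zsumB; apply: eq_zsum => n; rewrite -mulrBl cinf_czero /G.
  by case: n => n //; rewrite mul0r mul0r.
by move: e1; rewrite e3 e4 e5 => h; apply/eqP; rewrite -subr_eq0; apply/eqP;
  move: h => /eqP; rewrite -subr_eq0 => /eqP h; rewrite -[RHS]h; ring.
Qed.
End Windows.

Section CoreFormal.
Variable R : realType.
Local Notation C := R[i].
Local Notation rc x := (x%:C%C).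

Lemma psum_ext (f g : nat -> C) z s : f =1 g -> psum f z s -> psum g z s.
Proof. by move=> h; congr psum; apply: funext. Qed.

(** A difference of coefficients multiplies the sum by z - 1, so t differences
    clear the pole of order t at z = 1. *)
Lemma psum_Delta_below t (f : int -> C) B z s : (forall n, n < B -> f n = 0) ->
  psum (fun k => f (B + k%:Z)) z s ->
  psum (fun k => iter t (@Delta R) f (B + k%:Z)) z ((z - 1) ^+ t * s).
Proof.
move=> hB hs; elim: t => [|t IH]; first by rewrite expr0 mul1r.
rewrite exprS -mulrA mulrBl.
have := psumD (psum_shift IH) (psumZ (-1) IH); rewrite mulN1r mul1r.
apply: psum_ext => -[|k]; rewrite /= /Delta mulN1r.
  by rewrite [X in _ = X - _](iter_Delta_below _ hB) //; lia.
by congr (_ - _); congr (iter _ _ _ _); lia.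
Qed.

Lemma psum_Delta_above t (f : int -> C) N z s : (forall n, N < n -> f n = 0) ->
  psum (fun k => f (N - k%:Z)) z s ->
  psum (fun k => iter t (@Delta R) f (N + t%:Z - k%:Z)) z ((1 - z) ^+ t * s).
Proof.
move=> hN hs; elim: t => [|t IH].
  by rewrite expr0 mul1r; apply: psum_ext hs => k; congr f; lia.
rewrite exprS -mulrA mulrBl mul1r.
have := psumD IH (psumZ (-1) (psum_shift IH)); rewrite mulN1r.
apply: psum_ext => -[|k]; rewrite /= /Delta mulN1r.
  rewrite -!/(iter t (@Delta R) f _).
  rewrite (@iter_Delta_above _ t f N hN (N + t.+1%:Z - 0)); last by lia.
  by congr (_ - _); congr (iter _ _ _ _); lia.
by congr (_ - _); congr (iter _ _ _ _); lia.
Qed.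

Lemma cexp_ln (x : R) (c : int) : 0 < x -> cexp (c%:~R * rc (ln x)) = rc x ^ c.
Proof.
move=> hx; rewrite mulrC cexpMz.
have -> // : cexp (rc (ln x)) = rc x.
by rewrite /cexp /= cos0 sin0 mulr1 mulr0 lnK ?posrE.
Qed.

(** The three expansions of e(log s)/(s - 1)^t, for s > 1, for s < 1, and for
    s = 1 + x with x small, satisfy the delta function identity. *)
Lemma expansions_delta (alpha : C) (t I J M0 : nat) (p q : int -> C)
  (r : nat -> int -> C) (e : R -> C) (rho : nat -> R -> C) :
  (exists N : nat, forall n : int, N%:Z < n -> p n = 0) ->
  (forall n : int, n < - M0%:Z -> q n = 0) ->
  (forall i (j : int), j < - J%:Z -> r i j = 0) ->
  exppoly e ->
  (forall N : nat, (forall n : int, N%:Z < n -> p n = 0) -> forall tau : R,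
    0 < tau -> psum (fun k => p (N%:Z - k%:Z)) (rc (expR (- tau)))
      (rc (expR (- tau)) ^+ N * (e tau / (rc (expR tau) - 1) ^+ t))) ->
  (forall tau : R, tau < 0 ->
    psum (fun k => q (- M0%:Z + k%:Z)) (rc (expR tau))
      (rc (expR tau) ^+ M0 * (e tau / (rc (expR tau) - 1) ^+ t))) ->
  (forall i, (i < I)%N -> forall x : R, 0 < x < 1 ->
    psum (fun k => r i (- J%:Z + k%:Z)) (rc x) (rho i x)) ->
  (forall x : R, 0 < x < 1 ->
    rc x ^+ t * \sum_(i < I) plog alpha i x * rho i x =
    rc x ^+ J * e (ln (1 + x))) ->
  forall m : int, exists K0, forall K, (K0 <= K)%N ->
    \sum_(k < K) cbinom (m + k%:Z)%:~R k * p (m + k%:Z) -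
    \sum_(j < K) \sum_(i < I) (bp alpha j)`_i * r i (m - j%:Z) =
    \sum_(k < K) (-1) ^ (m + 1 + k%:Z) * cbinom (-1 - m%:~R) k * q (- k%:Z - 1).
Proof.
move=> [N1 hp] hq hr he Hp Hq Hr Hr' m.
(* F collects the coefficients of e as a Laurent polynomial in s: its series for
   s < 1 is known, and exppoly_rational makes it finite. *)
pose F := iter t (@Delta R) q.
have FB n : n < - M0%:Z -> F n = 0 by apply: iter_Delta_below.
have hne (tau : R) : tau != 0 -> rc (expR tau) - 1 != 0.
  move=> h0; rewrite subr_eq0; apply: contra h0 => /eqP.
  move=> h; have /= h1 := congr1 (@complex.Re R) h.
  by apply/eqP/expR_inj; rewrite expR0.
have [D [hD hE]] : exists D, (forall k, (D <= k)%N -> F (- M0%:Z + k%:Z) = 0) /\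
    forall tau, rc (expR tau) ^+ M0 * e tau =
      \sum_(k < D) F (- M0%:Z + k%:Z) * rc (expR tau) ^+ k.
  apply: (exppoly_rational (e := fun tau => rc (expR tau) ^+ M0 * e tau)
    (g := fun k => F (- M0%:Z + k%:Z))).
    by apply: exppolyM he; exact: exppoly_expR.
  move=> tau htau; have := psum_Delta_below t hq (Hq tau htau).
  have hs := expf_neq0 t (hne tau (ltr0_neq0 htau)).
  by rewrite mulrCA; set y := (_ - 1) ^+ t in hs *; rewrite [y * _]mulrC divfK.
pose N := maxn N1 D.
have hpN (n : int) : N%:Z < n -> p n = 0 by move=> hn; apply: hp; lia.
have FD (n : int) : N%:Z < n + M0%:Z -> F n = 0.
  move=> hn; have -> : n = - M0%:Z + (absz (n + M0%:Z)%R)%:Z by lia.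
  by apply: hD; lia.
(* In the variable 1/s, both sides are the coefficients of e for s > 1. *)
have hpq (n : int) : iter t (@Delta R) p n = F n.
  case: (leP n (N + t)%N%:Z) => hn; last first.
    by rewrite FD ?(iter_Delta_above hpN) //; lia.
  have -> : n = N%:Z + t%:Z - (absz (N%:Z + t%:Z - n)%R)%:Z by lia.
  apply/eqP; rewrite -subr_eq0; apply/eqP; move: (absz _) => k {n hn}.
  apply: (@psum_eq0 R (fun k => iter t (@Delta R) p (N%:Z + t%:Z - k%:Z) -
    F (N%:Z + t%:Z - k%:Z)) 1) => // x /andP [x0 x1].
  pose tau := - ln x; have htau : 0 < tau by rewrite oppr_gt0 ln_lt0 // x0.
  have ex : expR (- tau) = x by rewrite opprK lnK ?posrE.
  have es : rc x * rc (expR tau) = 1.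
    by rewrite -rmorphM -ex -expRD addNr expR0.
  have h1 := psum_Delta_above t hpN (Hp N hpN tau htau); rewrite ex in h1.
  have hfin (l : nat) : (N + t + M0 < l)%N -> F (N%:Z + t%:Z - l%:Z) = 0.
    by move=> hk; apply: FB; lia.
  have h2 := psum_fin (rc x) hfin.
  have -> : 0 = (1 - rc x) ^+ t * (rc x ^+ N * (e tau / (rc (expR tau) - 1) ^+ t))
     + (-1) * \sum_(i < (N + t + M0).+1) F (N%:Z + t%:Z - i%:Z) * rc x ^+ i.
    have -> : 1 - rc x = rc x * (rc (expR tau) - 1) by rewrite mulrBr es mulr1.
    have hs := expf_neq0 t (hne tau (lt0r_neq0 htau)).
    rewrite exprMn; set y := (rc (expR tau) - 1) ^+ t in hs *.
    have -> : rc x ^+ t * y * (rc x ^+ N * (e tau / y)) =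
       rc x ^+ (N + t) * e tau by rewrite exprD; field.
    have -> : e tau = rc x ^+ M0 * (rc (expR tau) ^+ M0 * e tau).
      by rewrite mulrA -exprMn es expr1n mul1r.
    rewrite hE mulrA -exprD.
    rewrite -(@sum_trunc _ (N + t + M0).+1 D
      (fun k => F (- M0%:Z + k%:Z) * rc (expR tau) ^+ k)); first last.
    - by move=> i hi; rewrite hD ?mul0r.
    - by rewrite /N; lia.
    rewrite mulr_sumr mulN1r (reindex_inj rev_ord_inj) /=.
    rewrite -sumrB big1 // => i _; apply/eqP; rewrite subr_eq0; apply/eqP.
    have -> : - M0%:Z + (N + t + M0 - i)%N%:Z = N%:Z + t%:Z - i%:Z.
      by have := ltn_ord i; lia.
    rewrite mulrCA; congr (_ * _).
    have {1}-> : (N + t + M0)%N = (i + (N + t + M0 - i))%N by have := ltn_ord i; lia.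
    by rewrite exprD -mulrA -exprMn es expr1n mulr1.
  have := psumD h1 (psumZ (-1) h2); apply: psum_ext => j.
  by rewrite mulN1r.
(* The coefficient of x^n in x^J e(log(1 + x)), from the third expansion and from
   the Laurent polynomial. *)
have hS (n : nat) : (if (t <= n)%N then \sum_(i < I) \sum_(j < (n - t).+1)
      (bp alpha j)`_i * r i (- J%:Z + (n - t - j)%N%:Z) else 0) =
    (if (J <= n)%N then \sum_(k < D) F (- M0%:Z + k%:Z) *
      cbinom (- M0%:Z + k%:Z)%:~R (n - J) else 0).
  apply: (asy_uniq (F := fun x => rc x ^+ t * \sum_(i < I) plog alpha i x * rho i x)
     (G := fun x => rc x ^+ J * \sum_(k < D) F (- M0%:Z + k%:Z) *
        plog (- M0%:Z + k%:Z)%:~R 0 x) (d := 1)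
     (f := fun n => if (t <= n)%N then \sum_(i < I) \sum_(j < (n - t).+1)
      (bp alpha j)`_i * r i (- J%:Z + (n - t - j)%N%:Z) else 0)
     (g := fun n => if (J <= n)%N then \sum_(k < D) F (- M0%:Z + k%:Z) *
      cbinom (- M0%:Z + k%:Z)%:~R (n - J) else 0)) => //.
  - move=> x hx; rewrite Hr' //; congr (_ * _).
    have /andP [x0 _] := hx; have h1x : 0 < 1 + x by rewrite ltr_wpDr ?ltW.
    have hn0 : rc (1 + x) != 0.
      by apply/eqP => /(congr1 (@complex.Re R)) /= h; move: h1x; rewrite h ltxx.
    have := hE (ln (1 + x)); rewrite lnK ?posrE // => hE1.
    apply: (mulfI (expf_neq0 M0 hn0)); rewrite hE1 mulr_sumr.
    apply: eq_bigr => k _; rewrite mulrCA; congr (_ * _).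
    rewrite /plog expr0 mulr1 fact0 divr1 cexp_ln //.
    by rewrite [X in _ = X * _]exprnP -expfzDr // addrA subrr add0r.
  - apply: (@asy_shift R t _ (fun n => \sum_(i < I) \sum_(j < n.+1)
      (bp alpha j)`_i * r i (- J%:Z + (n - j)%N%:Z))).
    apply: (asy_sum (F := fun i x => plog alpha i x * rho i x)
      (f := fun i n => \sum_(j < n.+1)
      (bp alpha j)`_i * r i (- J%:Z + (n - j)%N%:Z))) => i hi.
    apply: (asyM (f := fun j => (bp alpha j)`_i)
      (g := fun k => r i (- J%:Z + k%:Z))); first exact: asy_plog.
    by apply: (psum_asy (d := 1)) => // x; exact: Hr.
  - apply: (@asy_shift R J _ (fun n => \sum_(k < D) F (- M0%:Z + k%:Z) *
      cbinom (- M0%:Z + k%:Z)%:~R n)).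
    apply: (asy_sum (F := fun k x => F (- M0%:Z + k%:Z) *
        plog (- M0%:Z + k%:Z)%:~R 0 x) (f := fun k n => F (- M0%:Z + k%:Z) *
      cbinom (- M0%:Z + k%:Z)%:~R n)) => k _.
    apply: asyZ.
    rewrite [X in asy _ X](_ : _ = fun j => (bp (- M0%:Z + k%:Z)%:~R j)`_0).
      exact: asy_plog.
    by apply: funext => j; rewrite bp_coef0_cbinom.
pose L := (absz m + N + t + M0 + D + 3)%N.
have hZ (n : nat) : (if (J <= n)%N then \sum_(k < D) F (- M0%:Z + k%:Z) *
      cbinom (- M0%:Z + k%:Z)%:~R (n - J) else 0) =
   zsum L (fun k => czero R k (n%:Z - J%:Z) * F k).
  rewrite zsumE; first last.
  - by move=> k hk; rewrite FD ?mulr0 //; lia.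
  - by move=> k hk; rewrite FB ?mulr0 //; lia.
  case: ifPn => hn; last first.
    rewrite fsbig1 // => k _; rewrite /czero.
    by case e1 : (n%:Z - J%:Z) => [a|a]; rewrite ?mul0r //; lia.
  have aux (k : int) : (forall j, (j < D)%N -> k <> - M0%:Z + j%:Z) ->
      czero R k (n%:Z - J%:Z) * F k = 0.
    move=> hk; case: (ltP k (- M0%:Z)) => [/FB ->|h3]; first by rewrite mulr0.
    have ek : k = - M0%:Z + (absz (k + M0%:Z)%R)%:Z by lia.
    case: (ltnP (absz (k + M0%:Z)%R) D) => [/hk //|/hD]; rewrite -ek => ->.
    by rewrite mulr0.
  rewrite (@fsum_inj _ _ D (fun k => - M0%:Z + k%:Z)) //; last by move=> i j _ _; lia.
  apply: eq_bigr => k _; rewrite mulrC; congr (_ * _).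
  have -> : n%:Z - J%:Z = (n - J)%N by lia.
  by [].
exists (absz m + N + M0 + J + 1)%N => K hK.
have hSm : \sum_(j < K) \sum_(i < I) (bp alpha j)`_i * r i (m - j%:Z) =
    zsum L (fun n => czero R n (m + t%:Z) * F n).
  case: (ltP (m + t%:Z + J%:Z) 0) => hm.
    rewrite /zsum big1 => [|j _].
      rewrite big1 // => k _; rewrite /czero.
      by case e1 : (m + t%:Z) => [a|a]; rewrite ?mul0r //; lia.
    by rewrite big1 // => i _; rewrite hr ?mulr0 //; lia.
  have := hS (absz (m + t%:Z + J%:Z)%R); rewrite hZ.
  have -> : (absz (m + t%:Z + J%:Z)%R)%:Z - J%:Z = m + t%:Z by lia.
  move=> <-; case: ifPn => ht; last first.
    rewrite big1 // => j _; rewrite big1 // => i _.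
    by rewrite hr ?mulr0 //; lia.
  rewrite exchange_big; apply: eq_bigr => i _.
  rewrite (@sum_trunc _ K (absz (m + t%:Z + J%:Z)%R - t).+1
    (fun j => (bp alpha j)`_i * r i (m - j%:Z))); first last.
  - by move=> j hj; rewrite hr ?mulr0 //; lia.
  - by lia.
  by apply: eq_bigr => j _; congr (_ * r i _); have := ltn_ord j; lia.
have := @delta_formula R t L p q N%:Z (- M0%:Z) m hpN hq hpq.
rewrite -hSm => /(_ _ _ _ _ _) hd.
have <- : zsum L (fun n => cinf R n m * p n) =
    \sum_(k < K) cbinom (m + k%:Z)%:~R k * p (m + k%:Z).
  rewrite zsumE; first last.
  - by move=> n hn; rewrite hpN ?mulr0 //; lia.
  - move=> n hn; rewrite /cinf.
    by case e1 : (n - m) => [a|a]; rewrite ?mul0r //; lia.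
  have aux (n : int) : (forall j, (j < K)%N -> n <> m + j%:Z) ->
      cinf R n m * p n = 0.
    move=> hn; rewrite /cinf; case e1 : (n - m) => [a|a]; last by rewrite mul0r.
    case: (ltnP a K) => ha; first by have := hn a ha; lia.
    by rewrite hpN ?mulr0 //; lia.
  rewrite (@fsum_inj _ _ K (fun k => m + k%:Z)) //; last by move=> i j _ _; lia.
  apply: eq_bigr => k _; congr (_ * _); rewrite /cinf.
  by have -> : m + k%:Z - m = k by lia.
have <- : zsum L (fun n => cdelta R n m * q n) =
    \sum_(k < K) (-1) ^ (m + 1 + k%:Z) * cbinom (-1 - m%:~R) k * q (- k%:Z - 1).
  rewrite zsumE; first last.
  - move=> n hn; rewrite /cdelta; case: n hn => n hn; first by rewrite mul0r.
    by lia.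
  - by move=> n hn; rewrite hq ?mulr0 //; lia.
  have aux (n : int) : (forall j, (j < K)%N -> n <> - j%:Z - 1) ->
      cdelta R n m * q n = 0.
    move=> hn; rewrite /cdelta; case: n hn => n hn; first by rewrite mul0r.
    case: (ltnP n K) => ha; first by have := hn n ha; lia.
    by rewrite hq ?mulr0 //; lia.
  rewrite (@fsum_inj _ _ K (fun k => - k%:Z - 1)) //; last by move=> i j _ _; lia.
  apply: eq_bigr => k _; congr (_ * _).
  by have -> : - k%:Z - 1 = Negz k by lia.
by apply: hd; lia.
Qed.
End CoreFormal.

(** * The derivation N of a vertex superalgebra *)

Section Grading.
Variables (R : realType) (I : choiceType) (M : lmodType R[i]) (G : grading I M).

Lemma gproj_seq x : exists s : seq I, uniq s /\ x = \sum_(i <- s) G i x /\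
  (forall i, i \notin s -> G i x = 0).
Proof.
have /finite_seqP [s hs] := gproj_finite G x; exists (undup s).
have h i : i \notin undup s -> G i x = 0.
  move=> hi; apply: contrapT => h0; move/negP: hi; apply.
  rewrite mem_undup; have : [set i | G i x != 0] i by apply/eqP.
  by rewrite hs.
split; first exact: undup_uniq.
by split => //; rewrite {1}(gproj_sum G x) (fsumE (undup_uniq s) h).
Qed.

Lemma grading_ind (P : M -> Prop) : P 0 -> (forall x y, P x -> P y -> P (x + y)) ->
  forall x, (forall i, P (G i x)) -> P x.
Proof.
move=> P0 PD x h; have [s [_ [-> _]]] := gproj_seq x.
by elim: s => [|i s IH]; rewrite ?big_nil // big_cons; apply: PD.
Qed.

Lemma grading_eq0 x : (forall i, G i x = 0) -> x = 0.
Proof.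
move=> h; apply: (@grading_ind (fun z => z = 0)) => // y z -> ->.
exact: addr0.
Qed.

Lemma gproj_same i x : G i (G i x) = G i x.
Proof. by rewrite gproj_idem eqxx. Qed.

Lemma gproj_diff i j x : i != j -> G i (G j x) = 0.
Proof. by move=> h; rewrite gproj_idem (negbTE h). Qed.

Lemma gsub_proj D i x : D i -> gsub G D (G i x).
Proof.
move=> Di j Dj; rewrite gproj_diff //.
by apply/eqP => e; apply: Dj; rewrite e.
Qed.

Lemma gsub_linear D a x y : gsub G D x -> gsub G D y -> gsub G D (a *: x + y).
Proof. by move=> hx hy i Di; rewrite linearP hx // hy // scaler0 addr0. Qed.

Lemma gsub1E i x : gsub G [set i] x -> G i x = x.
Proof.
move=> h; rewrite [RHS](gproj_sum G) (fsum_at (i0 := i)) // => j hj.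
Qed.

Lemma gsubprojE D x : gsub G D x -> gsubproj G D x = x.
Proof.
move=> h; rewrite /gsubproj [RHS](gproj_sum G); apply: fsbig_widen => //.
by move=> i [_ hi] /=; apply: h.
Qed.

Lemma gsubproj0 D D' x : gsub G D x -> (forall i, D' i -> ~ D i) ->
  gsubproj G D' x = 0.
Proof. by move=> h hD; rewrite /gsubproj fsbig1 // => i /hD /h. Qed.
End Grading.

Record good_decomp (R : realType) (M : lmodType R[i]) (h : M -> M)
  (E : R[i] -> set M) : Prop := GoodDecomp {
  gd_lin : linear h;
  gd_eig : forall alpha x, in_strip alpha -> E alpha x ->
    gen_eigenspace h (cexp (2 * cpii R * alpha)) x;
  gd_span : forall x, exists r : seq (R[i] * M),
    (forall p, p \in r -> in_strip p.1 /\ E p.1 p.2) /\ x = \sum_(p <- r) p.2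
}.

Section NopGood.
Variable R : realType.
Local Notation C := R[i].

Let he (a : C) : cexp (2 * cpii R * a) != 0. Proof. exact: cexp_neq0. Qed.

Section One.
Variables (M : lmodType C) (h : M -> M) (E : C -> set M) (G : good_decomp h E).

Lemma gNop_linear : linear (Nop E h).
Proof.
exact: (Nop_linear (gd_lin G) (gd_eig G) (gd_span G) (@cexpN R) he).
Qed.

Lemma gNop_nilp x : exists n, iter n (Nop E h) x = 0.
Proof.
have [n hn] := dop_nilp (gd_lin G) (gd_eig G) (gd_span G) (@cexpN R) x he.
exists n.
exact: (Nop_nilp (gd_lin G) (gd_eig G) (gd_span G) (@cexpN R) he hn).
Qed.

Lemma gdop_linear : linear (dop h E).
Proof. exact: (dop_linear (gd_lin G) (gd_eig G) (gd_span G) (@cexpN R)). Qed.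

Lemma gdop_nilp x : exists n, iter n (dop h E) x = 0.
Proof. exact: (dop_nilp (gd_lin G) (gd_eig G) (gd_span G) (@cexpN R) x he). Qed.

Lemma gNopE x n : iter n (dop h E) x = 0 ->
  Nop E h x = (2 * cpii R)^-1 *: logop (dop h E) n x.
Proof. exact: (NopE (gd_lin G) (gd_eig G) (gd_span G) (@cexpN R)). Qed.

Lemma gdop_eigen c x : gen_eigenspace h c x -> dop h E x + x = c^-1 *: h x.
Proof.
move=> hx; rewrite /dop subrK.
apply: (exp_Sop_eigen (gd_lin G) (gd_eig G) (gd_span G) (@cexpN R)).
exact: (gen_eigen_h (gd_lin G)).
Qed.

Lemma ggen_ind (P : M -> Prop) : P 0 -> (forall x y, P x -> P y -> P (x + y)) ->
  (forall alpha x, in_strip alpha ->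
     gen_eigenspace h (cexp (2 * cpii R * alpha)) x -> E alpha x -> P x) ->
  forall x, P x.
Proof.
move=> P0 PD hP x; have [r [hr ->]] := gd_span G x.
elim: r hr => [|p r IH] hr; first by rewrite big_nil.
rewrite big_cons; apply: PD.
  have [h1 h2] := hr p (mem_head _ _).
  exact: (hP _ _ h1 (gd_eig G h1 h2) h2).
by apply: IH => q hq; apply: hr; rewrite inE hq orbT.
Qed.
End One.

Lemma iter_scaled (M : lmodType C) (h : M -> M) (hl : linear h) (c : C) n x :
  c != 0 -> iter n (fun y => c^-1 *: h y - y) x =
  c^-1 ^+ n *: iter n (fun y => h y - c *: y) x.
Proof.
move=> c0; elim: n => [|n IH] /=; first by rewrite scale1r.
rewrite IH (linZ hl) exprS -scalerA [in RHS]scalerBr [in RHS]scalerBr.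
by congr (_ - _); rewrite !scalerA mulrAC mulVf // mul1r.
Qed.

Section Three.
Variables (M1 M2 M3 : lmodType C).
Variables (h1 : M1 -> M1) (E1 : C -> set M1) (G1 : good_decomp h1 E1).
Variables (h2 : M2 -> M2) (E2 : C -> set M2) (G2 : good_decomp h2 E2).
Variables (h3 : M3 -> M3) (E3 : C -> set M3) (G3 : good_decomp h3 E3).
Variable Phi : M1 -> M2 -> M3.
Hypothesis (Phil : forall y, linear (Phi^~ y)) (Phir : forall x, linear (Phi x)).
Hypothesis hPhi : forall x y, h3 (Phi x y) = Phi (h1 x) (h2 y).

(** After rescaling by the eigenvalues the three operators are unipotent and
    unip_nilp applies. *)
Lemma gen_eigen_Phi c1 c2 x y : c1 != 0 -> c2 != 0 ->
  gen_eigenspace h1 c1 x -> gen_eigenspace h2 c2 y ->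
  gen_eigenspace h3 (c1 * c2) (Phi x y).
Proof.
move=> n1 n2 [m1 k1] [m2 k2]; have c12 : c1 * c2 != 0 by rewrite mulf_neq0.
have lin (M : lmodType C) (h : M -> M) (c : C) : linear h ->
    linear (fun y => c^-1 *: h y - y).
  move=> hl a z t; rewrite hl scalerDr scalerBr opprD addrACA.
  by rewrite !scalerA mulrC.
exists (m1 + m2)%N.
have := @unip_nilp C M1 M2 M3 (fun y => c1^-1 *: h1 y - y)
  (fun y => c2^-1 *: h2 y - y) (fun y => (c1 * c2)^-1 *: h3 y - y)
  (lin _ _ _ (gd_lin G2)) (lin _ _ _ (gd_lin G3)) Phi Phil Phir _ m1 m2 x y.
have l1 := gd_lin G1; have l2 := gd_lin G2; have l3 := gd_lin G3.
rewrite !iter_scaled ?k1 ?k2 ?scaler0 //.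
move=> /(_ _ erefl erefl) => hh.
have /eqP : (c1 * c2)^-1 ^+ (m1 + m2) *:
    iter (m1 + m2) (fun y => h3 y - (c1 * c2) *: y) (Phi x y) = 0.
  apply: hh => z t; rewrite !subrK hPhi (linZ (Phil _)) (linZ (Phir _)) scalerA.
  by rewrite invfM.
by rewrite scaler_eq0 expf_eq0 invr_eq0 (negbTE c12) andbF /= => /eqP.
Qed.

(** The unipotent parts satisfy U(x (x) y) = U x (x) U y, because the semisimple
    parts do; then take logarithms. *)
Lemma Nop_derivation x y :
  Nop E3 h3 (Phi x y) = Phi (Nop E1 h1 x) y + Phi x (Nop E2 h2 y).
Proof.
have L0 b : Phi 0 b = 0 := lin0 (Phil b).
have R0 a : Phi a 0 = 0 := lin0 (Phir a).
have LD a a' b : Phi (a + a') b = Phi a b + Phi a' b := linD (Phil b) a a'.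
have RD a b b' : Phi a (b + b') = Phi a b + Phi a b' := linD (Phir a) b b'.
have LZ c a b : Phi (c *: a) b = c *: Phi a b := linZ (Phil b) c a.
have RZ c a b : Phi a (c *: b) = c *: Phi a b := linZ (Phir a) c b.
have hd x0 y0 : dop h3 E3 (Phi x0 y0) + Phi x0 y0 =
    Phi (dop h1 E1 x0 + x0) (dop h2 E2 y0 + y0).
  move: x0; apply: (ggen_ind G1).
  - by rewrite (lin0 (gdop_linear G1)) !addr0 !L0 (lin0 (gdop_linear G3)) addr0.
  - move=> a b ha hb.
    have <- : dop h1 E1 a + a + (dop h1 E1 b + b) = dop h1 E1 (a + b) + (a + b).
      by rewrite (linD (gdop_linear G1)) addrACA.
    by rewrite !LD (linD (gdop_linear G3)) addrACA ha hb !LD.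
  move=> al1 x0 _ hx0 _; move: y0; apply: (ggen_ind G2).
  - by rewrite (lin0 (gdop_linear G2)) !addr0 !R0 (lin0 (gdop_linear G3)) addr0.
  - move=> a b ha hb.
    have <- : dop h2 E2 a + a + (dop h2 E2 b + b) = dop h2 E2 (a + b) + (a + b).
      by rewrite (linD (gdop_linear G2)) addrACA.
    by rewrite !RD (linD (gdop_linear G3)) addrACA ha hb !RD.
  move=> al2 y0 _ hy0 _.
  rewrite (gdop_eigen G1 hx0) (gdop_eigen G2 hy0).
  rewrite (gdop_eigen G3 (gen_eigen_Phi (cexp_neq0 _) (cexp_neq0 _) hx0 hy0)).
  by rewrite hPhi LZ RZ scalerA invfM.
have [n1 hn1] := gdop_nilp G1 x; have [n2 hn2] := gdop_nilp G2 y.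
have hn3 := unip_nilp (gdop_linear G2) (gdop_linear G3) Phil Phir hd hn1 hn2.
rewrite (gNopE G1 hn1) (gNopE G2 hn2) (gNopE G3 hn3).
rewrite LZ RZ -scalerDr; congr (_ *: _).
exact: (logop_derivation (gdop_linear G1) (gdop_linear G2) (gdop_linear G3)).
Qed.
End Three.

Section Spanning.
Variables (M : lmodType C) (h : M -> M) (hl : linear h).

(** Primary decomposition of a vector annihilated by a product of linear
    factors, one factor at a time. *)
Lemma primary_decomp (r : seq C) x :
  polyact h (\prod_(z <- r) ('X - z%:P)) x = 0 ->
  exists s : seq (C * M), (forall p, p \in s -> gen_eigenspace h p.1 p.2) /\
    x = \sum_(p <- s) p.2.
Proof.
elim: r x => [|z r IH] x.
  by rewrite big_nil polyactC scale1r => ->; exists [::]; rewrite big_nil.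
rewrite big_cons mulrC polyactM // => /IH [s [hs es]].
have key y0 : gen_eigenspace h z y0 ->
    polyact h ('X - z%:P) x = y0 + \sum_(p <- s) p.2 ->
    exists s' : seq (C * M), (forall p, p \in s' -> gen_eigenspace h p.1 p.2) /\
      gen_eigenspace h z (polyact h ('X - z%:P) (x - \sum_(p <- s') p.2)).
  elim: s x y0 {es} hs => [|[c y] s IHs] x y0 hs hy0.
    rewrite big_nil addr0 => e; exists [::]; split => //.
    by rewrite big_nil subr0 e.
  have hs2 : forall p, p \in s -> gen_eigenspace h p.1 p.2.
    by move=> p hp; apply: hs; rewrite inE hp orbT.
  have hy : gen_eigenspace h c y := hs (c, y) (mem_head _ _).
  rewrite big_cons /= => e.
  have [ecz|ncz] := eqVneq c z.
    apply: (IHs x (y0 + y) hs2); last by rewrite e addrA.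
    by rewrite -[y0]scale1r; apply: gen_eigen_linear => //; rewrite -ecz.
  have [n hn] := (gen_eigenP hl c y).1 hy.
  have hcop : coprimep ('X - z%:P) (('X - c%:P) ^+ n).
    by apply: coprimep_expr; rewrite coprimep_XsubC root_XsubC // eq_sym.
  have /Bezout_eq1_coprimepP [[A B] /= hAB] := hcop.
  pose xc := polyact h A y.
  have hxc : polyact h ('X - z%:P) xc = y.
    have h1 : polyact h 1 y = y by rewrite polyactC scale1r.
    rewrite -polyactM // mulrC -[RHS]h1.
    apply/eqP; rewrite -subr_eq0 -polyactB // -hAB opprD addrA subrr add0r.
    by rewrite -mulNr polyactM // hn (lin0 (polyact_linear hl _)).
  have hgxc : gen_eigenspace h c xc.
    apply/(gen_eigenP hl); exists n; rewrite -polyactM // mulrC polyactM // hn.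
    exact: (lin0 (polyact_linear hl _)).
  have [|s' [hs' hz]] := IHs (x - xc) y0 hs2 hy0.
    by rewrite (linB (polyact_linear hl _)) e hxc addrCA addrAC subrr add0r.
  exists ((c, xc) :: s'); split.
    by move=> p; rewrite inE => /orP [/eqP -> //|]; exact: hs'.
  by rewrite big_cons /= opprD addrA.
have [||s' [hs' hz]] := key 0; first by exists 0%N.
  by rewrite add0r.
exists ((z, x - \sum_(p <- s') p.2) :: s'); split; last first.
  by rewrite big_cons /= subrK.
move=> p; rewrite inE => /orP [/eqP -> /=|]; last exact: hs'.
have [n hn] := (gen_eigenP hl z _).1 hz; apply/(gen_eigenP hl); exists n.+1.
by rewrite exprSr polyactM.
Qed.

(** Over an algebraically closed field P splits into linear factors; injectivity
    of h excludes the eigenvalue 0, so that every eigenvalue is an exponential. *)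
Lemma annihilated_decomp (P : {poly C}) x : injective h -> P != 0 ->
  polyact h P x = 0 ->
  exists s : seq (C * M), (forall p, p \in s -> in_strip p.1 /\
    gen_eigenspace h (cexp (2 * cpii R * p.1)) p.2) /\ x = \sum_(p <- s) p.2.
Proof.
move=> hinj P0 hP; have [r er] := closed_field_poly_normal P.
have : polyact h (\prod_(z <- r) ('X - z%:P)) x = 0.
  have : lead_coef P *: polyact h (\prod_(z <- r) ('X - z%:P)) x = 0.
    by have := polyactZ h (lead_coef P) (\prod_(z <- r) ('X - z%:P)) x; rewrite -er hP => <-.
  by move/eqP; rewrite scaler_eq0 lead_coef_eq0 (negbTE P0) /= => /eqP.
move=> /primary_decomp [s [hs ->]].
elim: s hs => [|p s IH] hs; first by exists [::]; rewrite !big_nil.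
have [s' [hs' es']] : exists s : seq (C * M), (forall p, p \in s -> in_strip p.1 /\
    gen_eigenspace h (cexp (2 * cpii R * p.1)) p.2) /\
    \sum_(p <- s) p.2 = \sum_(p <- s) p.2.
  by exists [::].
have {s' hs' es'} [s' [hs' es']] : exists s' : seq (C * M),
    (forall p, p \in s' -> in_strip p.1 /\
    gen_eigenspace h (cexp (2 * cpii R * p.1)) p.2) /\
    \sum_(p <- s) p.2 = \sum_(p <- s') p.2.
  by apply: IH => q hq; apply: hs; rewrite inE hq orbT.
have hp := hs p (mem_head _ _); rewrite big_cons es'.
have [p0|pn0] := eqVneq p.1 0.
  exists s'; split => //; rewrite (_ : p.2 = 0) ?add0r //.
  have [n] := hp; rewrite p0.
  elim: n => [//|n IHn] /= hn; apply: IHn; apply: hinj.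
  by move: hn; rewrite scale0r subr0 (lin0 hl).
have [alpha ha e] := e2_surj pn0.
exists ((alpha, p.2) :: s'); split; last by rewrite big_cons.
by move=> q; rewrite inE => /orP [/eqP -> /=|]; [rewrite e|exact: hs'].
Qed.
End Spanning.
End NopGood.

Section VsaFacts.
Variables (R : realType) (V : lmodType R[i]) (A : vsa V) (hA : is_vsa A).
Local Notation C := R[i].
Local Notation vhom m := (gsub (Vgr A) [set m]).

Lemma L0V_proj m x : Vgr A m (L0V A x) = (m%:~R / 2) *: Vgr A m x.
Proof.
have [s [us [es hs]]] := gproj_seq (Vgr A) x.
rewrite /L0V (fsumE us) => [|i /hs ->]; last by rewrite scaler0.
rewrite linear_sum; case: (boolP (m \in s)) => hm.
  rewrite (bigD1_seq m) //= linearZ /= gproj_same big1 ?addr0 // => i hi.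
  by rewrite linearZ /= gproj_diff ?scaler0 // eq_sym.
rewrite hs // scaler0 big_seq big1 // => i hi.
rewrite linearZ /= gproj_diff ?scaler0 //.
by apply: contraNneq hm => ->.
Qed.

Lemma L0V_hom m x : vhom m x -> L0V A x = (m%:~R / 2) *: x.
Proof.
move=> hx; rewrite /L0V (fsum_at (i0 := m)); first by rewrite gsub1E.
by move=> i hi; rewrite hx ?scaler0.
Qed.

Lemma int_inj_C (m n : int) : m%:~R = n%:~R :> C -> m = n.
Proof. by move/eqP; rewrite eqr_int => /eqP. Qed.

Lemma YV_weight a b u v n : vhom a u -> vhom b v ->
  vhom (a + b + 2 * n) (YV A u v n).
Proof.
move=> hu hv m hm; have := L0V_comm hA u v n.
rewrite (L0V_hom hu) (L0V_hom hv) (linZ (YV_linear_r hA u n)).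
rewrite (linZ (YV_linear_l hA v n)) => h.
have : Vgr A m (L0V A (YV A u v n)) =
    ((a + b + 2 * n)%:~R / 2) *: Vgr A m (YV A u v n).
  move/eqP: h; rewrite subr_eq => /eqP ->.
  rewrite -scalerDl -scalerDl linearZ /=; congr (_ *: _).
  by rewrite !intrD intrM; field.
rewrite L0V_proj => /eqP; rewrite -subr_eq0 -scalerBl scaler_eq0 => /orP [|/eqP //].
rewrite -mulrBl mulf_eq0 invr_eq0 pnatr_eq0 orbF subr_eq0 => /eqP /int_inj_C e.
by case: hm.
Qed.

Lemma YV_parity s t u v n : parV A s u -> parV A t v ->
  parV A (s (+) t) (YV A u v n).
Proof.
move=> hu hv.
have : forall u v, (forall i, u = Vgr A i u -> v = v -> True) -> True by [].
move=> _.
apply: (@grading_ind _ _ _ (Vgr A) (fun u => parV A (s (+) t) (YV A u v n))).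
- by move=> i _; rewrite (lin0 (YV_linear_l hA v n)) linear0.
- by move=> x y hx hy i hi; rewrite (linD (YV_linear_l hA v n)) linearD /= hx // hy // addr0.
move=> a.
apply: (@grading_ind _ _ _ (Vgr A) (fun v => parV A (s (+) t) (YV A _ v n))).
- by move=> i _; rewrite (lin0 (YV_linear_r hA _ n)) linear0.
- by move=> x y hx hy i hi; rewrite (linD (YV_linear_r hA _ n)) linearD /= hx // hy // addr0.
move=> b i hi.
have [ea|na] := pselect (odd (absz a) = s); last first.
  by rewrite hu // (lin0 (YV_linear_l hA _ n)) linear0.
have [eb|nb] := pselect (odd (absz b) = t); last first.
  by rewrite hv // (lin0 (YV_linear_r hA _ n)) linear0.
have := @YV_weight a b (Vgr A a u) (Vgr A b v) n.
apply; [exact: gsub_proj|exact: gsub_proj|] => /= e.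
by apply: hi; rewrite /= e -ea -eb; lia.
Qed.

Lemma YV_trunc_hom a b : exists J : nat, forall u v, vhom a u -> vhom b v ->
  forall n : int, n < - J%:Z -> YV A u v n = 0.
Proof.
have [m0 hm0] := Vgr_bounded hA.
exists (absz (a + b - m0)%R) => u v hu hv n hn.
rewrite -(gsub1E (@YV_weight a b u v n hu hv)); apply: hm0.
by lia.
Qed.

Lemma YV_trunc u v : exists J : nat, forall n : int, n < - J%:Z -> YV A u v n = 0.
Proof.
apply: (@grading_ind _ _ _ (Vgr A)
  (fun u => exists J : nat, forall n : int, n < - J%:Z -> YV A u v n = 0)).
- by exists 0%N => n _; exact: (lin0 (YV_linear_l hA v n)).
- move=> x y [J hJ] [K hK]; exists (maxn J K) => n hn.
  by rewrite (linD (YV_linear_l hA v n)) hJ ?hK ?addr0 //; lia.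
move=> a; apply: (@grading_ind _ _ _ (Vgr A)
  (fun v => exists J : nat, forall n : int, n < - J%:Z -> YV A _ v n = 0)).
- by exists 0%N => n _; exact: (lin0 (YV_linear_r hA _ n)).
- move=> x y [J hJ] [K hK]; exists (maxn J K) => n hn.
  by rewrite (linD (YV_linear_r hA _ n)) hJ ?hK ?addr0 //; lia.
move=> b; have [J hJ] := YV_trunc_hom a b; exists J => n.
by apply: hJ; apply: gsub_proj.
Qed.

Variables (g : {linear V -> V}) (hg : is_automorphism A g).

Lemma g_linear : linear g. Proof. exact: linearP. Qed.

Lemma g_proj m v : Vgr A m (g v) = g (Vgr A m v).
Proof.
apply: (@grading_ind _ _ _ (Vgr A) (fun v => Vgr A m (g v) = g (Vgr A m v))).
- by rewrite !linear0.
- by move=> x y hx hy; rewrite !linearD /= hx hy.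
move=> i; have hi := aut_weight hg (@gsub_proj _ _ _ (Vgr A) [set i] i v erefl).
have [<-|ne] := eqVneq i m; first by rewrite gproj_same (gsub1E hi).
rewrite (gproj_diff (Vgr A)) 1?eq_sym // linear0; apply: hi => /= e.
by rewrite e eqxx in ne.
Qed.

(** Weight spaces are finite-dimensional, so the powers of g applied to a
    homogeneous vector are linearly dependent. *)
Lemma hom_annihilated m v : vhom m v -> exists2 P : {poly C}, P != 0 &
  polyact g P v = 0.
Proof.
move=> hv; have [s hs] := Vgr_findim hA m; pose d := size s.
have hgi i : vhom m (iter i g v).
  by elim: i => //= i IH; exact: (aut_weight hg).
have /boolp.choice [c hc] : forall i, exists c : nat -> C,
    iter i g v = \sum_(j < d) c j *: nth 0 s j.
  by move=> i; have [c hc] := hs _ (hgi i); exists c.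
pose B : 'M[C]_(d.+1, d) := \matrix_(i, j) c i j.
have : kermx B != 0.
  rewrite -mxrank_eq0 mxrank_ker -lt0n subn_gt0.
  by rewrite (leq_ltn_trans (rank_leq_col B)).
move=> /rowV0Pn [a /sub_kermxP haB a0].
exists (\poly_(i < d.+1) a 0 (inord i)).
  apply: contra a0 => /eqP hP; apply/eqP/rowP => i; rewrite !mxE.
  have := congr1 (fun p : {poly C} => p`_i) hP.
  by rewrite coef_poly coef0 ltn_ord inord_val.
rewrite (polyact_wide _ _ (size_poly _ _)).
under eq_bigr => i _ do rewrite coef_poly ltn_ord inord_val hc scaler_sumr.
rewrite exchange_big big1 // => j _.
under eq_bigr do rewrite scalerA.
rewrite -scaler_suml.
have -> : \sum_i a 0 i * c i j = (a *m B) 0 j.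
  by rewrite mxE; apply: eq_bigr => i _; rewrite mxE.
by rewrite haB mxE scale0r.
Qed.

Lemma V_good : good_decomp g (Vtw g).
Proof.
split => //; first exact: g_linear.
move=> x; apply: (@grading_ind _ _ _ (Vgr A) (fun x => exists r : seq (R[i] * V),
    (forall p, p \in r -> in_strip p.1 /\ Vtw g p.1 p.2) /\ x = \sum_(p <- r) p.2)).
- by exists [::]; rewrite big_nil.
- move=> y z [r [hr ->]] [s [hs ->]]; exists (r ++ s); rewrite big_cat.
  by split => // p; rewrite mem_cat => /orP [/hr|/hs].
move=> i; have [P P0 hP] := hom_annihilated (@gsub_proj _ _ _ (Vgr A) [set i] i x erefl).
apply: (annihilated_decomp g_linear _ P0 hP).
exact: (bij_inj (aut_bij hg)).
Qed.

Local Notation N := (NV g).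

Lemma N_linear : linear N. Proof. exact: (gNop_linear V_good). Qed.

Lemma N_nilp v : exists n, iter n N v = 0. Proof. exact: (gNop_nilp V_good). Qed.

(** As g is an automorphism, N is a derivation of the vertex operators. *)
Lemma N_YV u v n : N (YV A u v n) = YV A (N u) v n + YV A u (N v) n.
Proof.
apply: (Nop_derivation V_good V_good V_good (Phi := fun u v => YV A u v n)).
- by move=> y; exact: YV_linear_l.
- by move=> x; exact: YV_linear_r.
- by move=> x y; exact: (aut_YV hg).
Qed.

Lemma N_comm (f : V -> V) v : linear f -> (forall x, f (g x) = g (f x)) ->
  N (f v) = f (N v).
Proof.
move=> hf hfg.
have hS x : exp_Sop (Vtw g) (f x) = f (exp_Sop (Vtw g) x).
  move: x; apply: (ggen_ind V_good).
  - by rewrite (lin0 hf) (lin0 (exp_Sop_linear g_linear (gd_eig V_good)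
      (gd_span V_good) (@cexpN R))) (lin0 hf).
  - move=> x y hx hy; rewrite !(linD (exp_Sop_linear g_linear (gd_eig V_good)
      (gd_span V_good) (@cexpN R)), linD hf) hx hy.
    by [].
  move=> al x _ hx _.
  have hfx : gen_eigenspace g (cexp (2 * cpii R * al)) (f x).
    have [n hn] := hx; exists n.
    have -> : iter n (fun y => g y - cexp (2 * cpii R * al) *: y) (f x) =
      f (iter n (fun y => g y - cexp (2 * cpii R * al) *: y) x).
      elim: n {hn} => //= n ->.
      by rewrite (linB hf) (linZ hf) hfg.
    by rewrite hn (lin0 hf).
  have hEig := exp_Sop_eigen g_linear (gd_eig V_good) (gd_span V_good) (@cexpN R).
  by rewrite (hEig _ _ hx) (hEig _ _ hfx) (linZ hf).
have hd x : dop g (Vtw g) (f x) = f (dop g (Vtw g) x).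
  by rewrite /dop (linB hf) -hS hfg.
have [n hn] := gdop_nilp V_good v.
have hit j x : iter j (dop g (Vtw g)) (f x) = f (iter j (dop g (Vtw g)) x).
  by elim: j => //= j ->; rewrite hd.
have hfn : iter n (dop g (Vtw g)) (f v) = 0 by rewrite hit hn (lin0 hf).
rewrite /NV (gNopE V_good hn) (gNopE V_good hfn) (linZ hf); congr (_ *: _).
rewrite /logop (lin_sum hf); apply: eq_bigr => j _.
by rewrite (linZ hf) hit.
Qed.

Lemma N_proj m v : N (Vgr A m v) = Vgr A m (N v).
Proof. by apply: N_comm => [|x]; [exact: linearP|exact: g_proj]. Qed.

Lemma N_hom m v : vhom m v -> vhom m (N v).
Proof.
by move=> hv; rewrite -(gsub1E hv) N_proj; exact: gsub_proj.
Qed.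

Lemma N_parity s v : parV A s v -> parV A s (N v).
Proof. by move=> hv i hi; rewrite -N_proj hv // (lin0 N_linear). Qed.

Lemma N_Vtw c v : gen_eigenspace g c v -> gen_eigenspace g c (N v).
Proof.
move=> [n hn]; exists n.
have hl : linear (iter n (fun y => g y - c *: y)).
  apply: linear_iter => a x y; rewrite linearP scalerDr opprD addrACA scalerBr.
  by rewrite !scalerA mulrC.
rewrite -N_comm ?hn ?(lin0 N_linear) // => x.
by elim: (n) => //= k ->; rewrite linearB (linZ g_linear).
Qed.

(** On a genuine eigenvector the unipotent part of g is the identity. *)
Lemma N_semisimple : aut_semisimple g -> forall v, N v = 0.
Proof.
move=> hss v; have [r [hr ->]] := hss v.
rewrite (lin_sum N_linear) big_seq big1 // => p hp.
have hgp := hr p hp.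
have hge : gen_eigenspace g p.1 p.2 by exists 1%N; rewrite /= hgp subrr.
have [p0|pn0] := eqVneq p.1 0.
  have -> : p.2 = 0.
    by apply: (bij_inj (aut_bij hg)); rewrite hgp p0 scale0r linear0.
  exact: (lin0 N_linear).
have hd : iter 1 (dop g (Vtw g)) p.2 = 0.
  apply/eqP; rewrite /= -subr_eq0 subr0; apply/eqP.
  apply: (addIr p.2); rewrite (gdop_eigen V_good hge) hgp scalerA mulVf //.
  by rewrite scale1r add0r.
rewrite /NV (gNopE V_good hd) /logop big_ord1 bp_coef1 scale0r scaler0.
by [].
Qed.
End VsaFacts.

(** * Modes of a twisted module *)

Section TwmodFacts.
Variables (R : realType) (V W : lmodType R[i]) (A : vsa V) (hA : is_vsa A).
Variables (g : {linear V -> V}) (hg : is_automorphism A g).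
Variables (B : twmod V W) (hB : is_twmod A g B) (hlb : lower_bounded B).
Local Notation C := R[i].
Local Notation rc x := (x%:C%C).
Local Notation vhom m := (gsub (Vgr A) [set m]).
Local Notation N := (NV g).
Local Notation e2 a := (cexp (2 * cpii R * a)).

Let Yl w a k : linear (fun u => YW B u w a k) := YW_linear_l hB w a k.
Let Yr u a k : linear (fun w => YW B u w a k) := YW_linear_r hB u a k.

Lemma L0W_linear : linear (L0W B). Proof. exact: linearP. Qed.
Lemma gW_linear : linear (gW B). Proof. exact: linearP. Qed.

Lemma Wwt_proj i w : Wwt B i.1.1 (Wgr B i w).
Proof. exact: gsub_proj. Qed.

Lemma Wwt_gen n w : Wwt B n w -> gen_eigenspace (L0W B) n w.
Proof. exact: (L0W_nilp hB). Qed.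

(** L(0) - n is locally nilpotent on the weight space of weight n, and distinct
    generalized eigenspaces are independent. *)
Lemma gen_Wwt c x : gen_eigenspace (L0W B) c x -> Wwt B c x.
Proof.
move=> hx; have [s [us [es hs]]] := gproj_seq (Wgr B) x.
have := @gen_eigen_indep R W (L0W B) L0W_linear (fun z => (z == c)%:R)
  [:: (c, x)] [seq (i.1.1, Wgr B i x) | i <- s].
rewrite !big_map !big_seq1 /= eqxx scale1r => -> //; first last.
- by move=> _ /mapP [i hi ->] /=; apply/Wwt_gen/Wwt_proj.
- by move=> p; rewrite inE => /eqP ->.
move=> j hj; rewrite linear_sum /= big1 // => i _; rewrite linearZ /=.
have [eij|nij] := eqVneq j i; last by rewrite gproj_diff ?scaler0.
have [e|_] := eqVneq i.1.1 c; last by rewrite scale0r.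
by case: hj; rewrite /= eij.
Qed.

(** By the commutator formula, L(0) minus the expected weight sends y_{a,k}(v) w to
    y_{a,k}(v)(L(0) - n) w plus a multiple of y_{a,k+1}(v) w, and both operations
    are nilpotent. *)
Lemma YW_weight n m v w a k : Wwt B n w -> vhom m v ->
  Wwt B (a + m%:~R / 2 + n) (YW B v w a k).
Proof.
move=> hw hv; apply: gen_Wwt; have [r hr] := Wwt_gen hw.
set om := _ + n.
have stepE w' k' : L0W B (YW B v w' a k') - om *: YW B v w' a k' =
    YW B v (L0W B w' - n *: w') a k' + k'.+1%:R *: YW B v w' a k'.+1.
  have /eqP := L0W_comm hB v w' a k'.
  rewrite (L0V_hom hv) (linZ (Yl _ _ _)) subr_eq => /eqP ->.
  rewrite /fs1_euler (linB (Yr _ _ _)) (linZ (Yr _ _ _)) /om !scalerDl.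
  set p := a *: _; set q := _ *: YW B v w' a k'.+1; set t := _ *: YW B v w' a k'.
  set y := YW B v (L0W B w') a k'; set z := n *: _.
  apply/eqP; rewrite subr_eq; apply/eqP.
  by rewrite [RHS](AC (3*3) (4*3*5*1*(2*6))) /= addNr addr0.
elim: r w {hw} hr k => [|r IH] w hr k.
  by rewrite /= in hr; rewrite hr (lin0 (Yr _ _ _)); exists 0%N.
have [K hK] := YW_log hB v w.
have [d hd] : exists d, (K <= k + d)%N by exists K; rewrite leq_addl.
elim: d k hd => [|d IHd] k hd.
  by rewrite hK; [exists 0%N|rewrite addn0 in hd].
have h1 : gen_eigenspace (L0W B) om (YW B v (L0W B w - n *: w) a k).
  by apply: IH; rewrite -iterSr.
have h2 : gen_eigenspace (L0W B) om (YW B v w a k.+1).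
  by apply: IHd; rewrite addSnnS.
have [j hj] := gen_eigen_linear L0W_linear k.+1%:R h2 h1.
by exists j.+1; rewrite iterSr stepE addrC.
Qed.

Arguments YW_weight {n m v w} a k _ _.

(** The real part of the weight of y_{a,k}(v) w grows with that of a, and the
    weights of W are bounded below. *)
Lemma YW_trunc v w : exists b : R, forall a k, complex.Re a < b ->
  YW B v w a k = 0.
Proof.
apply: (@grading_ind _ _ _ (Vgr A) (fun v => exists b : R, forall a k,
  complex.Re a < b -> YW B v w a k = 0)).
- by exists 0 => a k _; exact: (lin0 (Yl _ _ _)).
- move=> x y [b hb] [c hc]; exists (Num.min b c) => a k.
  rewrite lt_min => /andP [h1 h2].
  by rewrite (linD (Yl _ _ _)) hb ?hc ?addr0.
move=> m; apply: (@grading_ind _ _ _ (Wgr B) (fun w => exists b : R, forall a k,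
  complex.Re a < b -> YW B _ w a k = 0)).
- by exists 0 => a k _; exact: (lin0 (Yr _ _ _)).
- move=> x y [b hb] [c hc]; exists (Num.min b c) => a k.
  rewrite lt_min => /andP [h1 h2].
  by rewrite (linD (Yr _ _ _)) hb ?hc ?addr0.
move=> i; have [b hb] := hlb.
exists (b - complex.Re (m%:~R / 2 + i.1.1 : C)) => a k ha.
have hvm : vhom m (Vgr A m v) by exact: gsub_proj.
have := YW_weight a k (@Wwt_proj i w) hvm.
apply: hb; rewrite -addrA.
by move: ha; case: (a) (_ / 2 + _) => [a1 a2] [c1 c2] /=; rewrite ltrBrDr.
Qed.

Lemma W_good : good_decomp (gW B) (Wtw B).
Proof.
split; first exact: gW_linear.
  by move=> alpha x _; exact: (gW_nilp hB).
move=> x; apply: (@grading_ind _ _ _ (Wgr B) (fun x => exists r : seq (R[i] * W),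
    (forall p, p \in r -> in_strip p.1 /\ Wtw B p.1 p.2) /\ x = \sum_(p <- r) p.2)).
- by exists [::]; rewrite big_nil.
- move=> y z [r [hr ->]] [s [hs ->]]; exists (r ++ s); rewrite big_cat.
  by split => // p; rewrite mem_cat => /orP [/hr|/hs].
move=> i; have [hi|hi] := pselect (in_strip i.2); last first.
  by exists [::]; rewrite big_nil (Wgr_strip hB).
exists [:: (i.2, Wgr B i x)]; rewrite big_seq1; split => // p.
by rewrite inE => /eqP -> /=; split => //; exact: gsub_proj.
Qed.

Lemma NW_linear : linear (NW B). Proof. exact: (gNop_linear W_good). Qed.
Lemma NW_nilp w : exists n, iter n (NW B) w = 0.
Proof. exact: (gNop_nilp W_good). Qed.

Lemma NW_YW u w a k :
  NW B (YW B u w a k) = YW B (N u) w a k + YW B u (NW B w) a k.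
Proof.
apply: (Nop_derivation (V_good hA hg) W_good W_good
  (Phi := fun u w => YW B u w a k)).
- by move=> y; exact: Yl.
- by move=> x; exact: Yr.
- by move=> x y; exact: (gW_YW hB).
Qed.

(** Only one power of x maps a vector of fixed weight to a given weight, so
    equivariance can be read off coefficientwise at the points z = e^s, where
    the p-th branch of the logarithm is s + 2 pi i p. *)
Lemma equivariance_hom m n u w i a (p : nat) (s : R) K : vhom m u -> Wwt B n w ->
  i.1.1 = a + m%:~R / 2 + n ->
  (forall k, (K <= k)%N -> YW B u w a k = 0) ->
  (forall k, (K <= k)%N -> YW B (g u) w a k = 0) ->
  e2 a *: \sum_(k < K) (rc s + 2 * cpii R * p.+1%:R) ^+ k *:
    Wgr B i (YW B (g u) w a k) =
  \sum_(k < K) (rc s + 2 * cpii R * p%:R) ^+ k *: Wgr B i (YW B u w a k).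
Proof.
move=> hu hw hi hK1 hK2.
have hgu : vhom m (g u) := aut_weight hg hu.
pose z := rc (expR s).
have z0 : z != 0.
  apply/eqP => /(congr1 (@complex.Re R)) /= /eqP.
  by rewrite expR_eq0.
have ez q : clog q z = rc s + 2 * cpii R * q%:~R.
  by rewrite clog_real ?expR_gt0 // expRK.
have hfs q v : vhom m v -> (forall k, (K <= k)%N -> YW B v w a k = 0) ->
   \sum_(a0 \in [set: C]) \sum_(k \in [set: nat])
      ev_mono q z a0 k *: Wgr B i (YW B v w a0 k) =
   cexp (a * clog q z) *: \sum_(k < K) clog q z ^+ k *: Wgr B i (YW B v w a k).
  move=> hv hK; rewrite (fsum_at (i0 := a)).
    rewrite (fsum_nat (n := K)) => [|k hk]; last by rewrite hK // linear0 scaler0.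
    by rewrite scaler_sumr; apply: eq_bigr => k _; rewrite scalerA.
  move=> a0 ha0; rewrite fsbig1 // => k _; rewrite (YW_weight a0 k hw hv) ?scaler0 //.
  move=> /= e; apply: ha0; move: e; rewrite hi => /addIr /addIr.
  by [].
have := YW_equivariance hB p u w i z0; rewrite !hfs // => h.
have e1 : (p%:Z + 1)%:~R = p.+1%:R :> C by rewrite -natr1 intrD.
have e0 : p%:Z%:~R = p%:R :> C by [].
move: h; rewrite !ez e1 e0 => h.
apply: (scalerI (cexp_neq0 (a * (rc s + 2 * cpii R * p%:R)))).
rewrite -h scalerA -cexpD; congr (cexp _ *: _).
by rewrite -natr1; ring.
Qed.

Section HomLog.
Variables (m : int) (n : C) (w : W) (i : R[i] * bool * R[i]) (a al : C).
Hypotheses (hw : Wwt B n w) (hi : i.1.1 = a + m%:~R / 2 + n).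

Let c := e2 (a + al).
Let d (u : V) : V := (e2 al)^-1 *: g u - u.
Let y k u := Wgr B i (YW B u w a k).

Let ylin k : linear (y k).
Proof. by move=> b x z; rewrite /y Yl linearP. Qed.

Let dlin : linear d.
Proof.
move=> b x z; rewrite /d linearP scalerDr scalerBr opprD addrACA.
by rewrite !scalerA mulrC.
Qed.

Let dhom u : vhom m u -> vhom m (d u).
Proof.
move=> hu; rewrite /d addrC -scaleN1r.
apply: (@gsub_linear _ _ _ (Vgr A) _ (-1)) => //.
rewrite -[X in gsub _ _ X]addr0; apply: gsub_linear; last by move=> j _; rewrite linear0.
exact: (aut_weight hg).
Qed.

Let ygU k u : y k (g u) = e2 al *: y k (d u + u).
Proof.
by rewrite /d subrK (linZ (ylin k)) scalerA divff ?scale1r // cexp_neq0.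
Qed.

(** One more turn around the origin undoes U = 1 + d, up to the scalar c. *)
Lemma hom_step (p : nat) (s : R) K u : vhom m u ->
  (forall k, (K <= k)%N -> YW B u w a k = 0) ->
  (forall k, (K <= k)%N -> YW B (d u) w a k = 0) ->
  c *: \sum_(k < K) (rc s + 2 * cpii R * p.+1%:R) ^+ k *: y k (d u + u) =
  \sum_(k < K) (rc s + 2 * cpii R * p%:R) ^+ k *: y k u.
Proof.
move=> hu h1 h2; rewrite -(equivariance_hom p s hu hw hi h1); last first.
  move=> k hk; have -> : g u = e2 al *: (d u + u).
    by rewrite /d subrK scalerA divff ?scale1r // cexp_neq0.
  by rewrite (linZ (Yl _ _ _)) (linD (Yl _ _ _)) h1 // h2 // addr0 scaler0.
rewrite /c mulrDr cexpD -scalerA; congr (_ *: _); rewrite scaler_sumr.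
apply: eq_bigr => k _.
by rewrite -[Wgr B i (YW B (g u) w a k)]/(y k (g u)) ygU !scalerA mulrC.
Qed.

(** Induction along the filtration by powers of d: modulo lower terms, a
    polynomial in log x would be multiplied by c != 1 under a shift of its
    variable, which its leading coefficient forbids. *)
Lemma hom_zero : c != 1 -> forall r u, vhom m u -> iter r d u = 0 ->
  forall k, y k u = 0.
Proof.
move=> hc; elim=> [|r IH] u hu hr k.
  by rewrite /= in hr; rewrite hr (lin0 (ylin k)).
have hd q : y q (d u) = 0 by apply: IH; [exact: dhom|rewrite -iterSr].
have [K1 hK1] := YW_log hB u w; have [K2 hK2] := YW_log hB (d u) w.
pose K := maxn K1 K2.
have h1 q : (K <= q)%N -> YW B u w a q = 0.
  by rewrite geq_max => /andP [hq _]; exact: hK1.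
have h2 q : (K <= q)%N -> YW B (d u) w a q = 0.
  by rewrite geq_max => /andP [_ hq]; exact: hK2.
pose b : C := 2 * cpii R.
pose P (q : nat) : {poly C} := c *: ('X + b%:P) ^+ q - 'X^q.
have hP e : \sum_(q < K) (P q)`_e *: y q u = 0.
  apply: (vpoly_eq0 (P := fun q : 'I_K => P q) (m := fun q : 'I_K => y q u)) => p.
  have := hom_step 0 p%:R hu h1 h2.
  rewrite mulr0 addr0 mulr1 rmorph_nat => /eqP; rewrite -subr_eq0 => /eqP h.
  rewrite -[RHS]h scaler_sumr -sumrB; apply: eq_bigr => q _.
  rewrite (linD (ylin q)) hd add0r scalerA -scalerBl; congr (_ *: _).
  by rewrite /P hornerD hornerN hornerZ horner_exp hornerXn hornerD hornerX hornerC.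
(* From the top power of log x downwards. *)
have key j : forall e, (K <= e + j)%N -> y e u = 0.
  elim: j => [|j IHj] e he; first by rewrite addn0 in he; rewrite /y h1 // linear0.
  case: (ltnP e K) => heK; last by rewrite /y h1 // linear0.
  have := hP e; rewrite (bigD1 (Ordinal heK)) //= big1 ?addr0 => [|q hq].
    have -> : (P e)`_e = c - 1.
      rewrite /P coefB coefZ coefXn eqxx.
      have -> : 'X + b%:P = 'X - (- b)%:P by rewrite polyCN opprK.
      have hm := monicP (monic_exp e (monicXsubC (- b))).
      by rewrite /lead_coef size_exp_XsubC /= in hm; rewrite hm mulr1.
    by move/eqP; rewrite scaler_eq0 subr_eq0 (negbTE hc) => /eqP.
  case: (ltngtP q e) => hqe.
  - rewrite /P coefB coefZ coefXn gtn_eqF // subr0 nth_default ?mulr0 ?scale0r //.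
    have -> : 'X + b%:P = 'X - (- b)%:P by rewrite polyCN opprK.
    by rewrite size_exp_XsubC.
  - by rewrite IHj ?scaler0 //; lia.
  - by move: hq; rewrite -val_eqE /= hqe eqxx.
by apply: (key K); rewrite leq_addl.
Qed.

Lemma hom_bound r u : iter r d u = 0 ->
  exists K, forall j k, (K <= k)%N -> YW B (iter j d u) w a k = 0.
Proof.
elim: r u => [|r IH] u hr.
  rewrite /= in hr; exists 0%N => j k _; rewrite hr (lin0 (linear_iter _ dlin)).
  exact: (lin0 (Yl _ _ _)).
have [K1 hK1] := IH (d u) (etrans (esym (iterSr r d u)) hr).
have [K2 hK2] := YW_log hB u w.
exists (maxn K1 K2) => -[|j] k; rewrite geq_max => /andP [h1 h2].
  exact: hK2.
by rewrite iterSr; exact: hK1.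
Qed.

(** For c = 1, shifting log x by 2 pi i p in Y(U^p u, x) gives back Y(u, x). Both
    the shift and U^p are polynomial in p, and the linear coefficients in p give
    2 pi i d/d(log x) = - log U. *)
Lemma hom_log : c = 1 -> forall r u, vhom m u -> iter r d u = 0 ->
  forall k, k.+1%:R *: y k.+1 u = - y k ((2 * cpii R)^-1 *: logop d r u).
Proof.
move=> hc r u hu hr k; have [K hK] := hom_bound hr.
pose U x := d x + x.
have hUl : linear U.
  by move=> b x z; rewrite /U dlin [b *: (d x + x)]scalerDr; exact: addrACA.
have hUK p : forall j q, (K <= q)%N -> YW B (iter p U (iter j d u)) w a q = 0.
  elim: p => [|p IH] j q hq; first exact: hK.
  by rewrite iterSr /U (linD (linear_iter p hUl)) -iterS (linD (Yl _ _ _)) !IH ?addr0.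
have hUhom p : vhom m (iter p U u).
  elim: p => //= p IH; rewrite /U -[d _]scale1r; apply: gsub_linear => //.
  exact: dhom.
have hUd p : d (iter p U u) = iter p U (d u).
  by elim: p => //= p IH; rewrite {1}/U (linD dlin) IH.
pose b : C := 2 * cpii R.
have hshift (s : nat) p : \sum_(q < K) (s%:R + b * p%:R) ^+ q *: y q (iter p U u) =
    \sum_(q < K) s%:R ^+ q *: y q u.
  elim: p => [|p IH].
    by apply: eq_bigr => q _; rewrite mulr0 addr0.
  rewrite -IH; have := hom_step p s%:R (hUhom p) (hUK p 0%N).
  rewrite hc scale1r rmorph_nat; apply=> q hq.
  by rewrite hUd; exact: (hUK p 1%N).
(* The linear coefficient in p of hshift. *)
have hder (s : nat) : \sum_(q < K) s%:R ^+ q *: y q (logop d r u) +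
    \sum_(q < K) (q%:R * s%:R ^+ q.-1 * b) *: y q u = 0.
  pose I := ('I_K * 'I_r + 'I_K)%type.
  pose L : {poly C} := b *: 'X + s%:R%:P.
  pose P (x : I) : {poly C} := match x with
    | inl qj => L ^+ qj.1 * bp 0 qj.2 | inr q => - (s%:R ^+ q)%:P end.
  pose v (x : I) : W := match x with
    | inl qj => y qj.1 (iter qj.2 d u) | inr q => y q u end.
  have : forall p : nat, \sum_(x : I) (P x).[p%:R] *: v x = 0.
    move=> p; rewrite big_sumType /=.
    rewrite -(pair_big_dep xpredT (fun _ => xpredT) (fun (q : 'I_K) (j : 'I_r) =>
      (L ^+ q * bp 0 j).[p%:R] *: y q (iter j d u))) /=.
    have -> : \sum_(q < K) (- (s%:R ^+ q)%:P).[p%:R] *: y q u =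
        - \sum_(q < K) s%:R ^+ q *: y q u.
      by rewrite -sumrN; apply: eq_bigr => q _; rewrite hornerN hornerC scaleNr.
    rewrite -(hshift s p) -sumrB big1 // => q _.
    rewrite (iter_unip dlin (U := U) (fun=> erefl) p hr) (lin_sum (ylin q)).
    rewrite scaler_sumr -sumrB big1 // => j _.
    rewrite (linZ (ylin q)) scalerA hornerM horner_exp hornerD hornerZ hornerX.
    by rewrite hornerC [b * _ + _]addrC subrr.
  move=> /vpoly_eq0 /(_ 1%N); rewrite big_sumType /=.
  rewrite -(pair_big_dep xpredT (fun _ => xpredT) (fun (q : 'I_K) (j : 'I_r) =>
      (L ^+ q * bp (0 : C) j)`_1 *: y q (iter j d u))) /=.
  rewrite [X in _ + X]big1 ?addr0 => [h|q _]; last first.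
    by rewrite coefN coefC oppr0 scale0r.
  rewrite -[RHS]h -big_split /=; apply: eq_bigr => q _.
  have hL0 : (L ^+ q)`_0 = s%:R ^+ q.
    by rewrite -horner_coef0 horner_exp hornerD hornerZ hornerX mulr0 add0r hornerC.
  have hL1 : (L ^+ q)`_1 = q%:R * s%:R ^+ q.-1 * b.
    rewrite -[LHS]mulr1n -[1%N]/(0.+1) -coef_deriv -horner_coef0 deriv_exp.
    rewrite hornerMn hornerM horner_exp /L derivD derivZ derivX derivC addr0.
    rewrite !hornerD !hornerZ hornerX mulr0 add0r hornerC hornerC mulr1.
    by rewrite -mulr_natl mulrA mulrAC.
  have hj (j : nat) : (L ^+ q * bp (0 : C) j)`_1 =
     s%:R ^+ q * (bp 0 j)`_1 + (j == 0%N)%:R * (q%:R * s%:R ^+ q.-1 * b).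
    by rewrite coefM big_ord_recl big_ord1 /= hL0 hL1 bp_coef0 [X in _ + X]mulrC.
  under [RHS]eq_bigr do rewrite hj scalerDl.
  rewrite big_split /=; congr (_ + _).
    rewrite /logop (lin_sum (ylin q)) scaler_sumr; apply: eq_bigr => j _.
    by rewrite (linZ (ylin q)) scalerA.
  case: r hr {I P v hj h} => [|r] hr.
    by rewrite /= in hr; rewrite big_ord0 hr (lin0 (ylin q)) scaler0.
  rewrite big_ord_recl /= mul1r big1 ?addr0 // => j _.
  by rewrite mul0r scale0r.
have hy0 q : (K <= q)%N -> y q u = 0.
  by move=> hq; rewrite /y (hK 0%N) // linear0.
have hlog q : (K <= q)%N -> y q (logop d r u) = 0.
  move=> hq; rewrite /logop (lin_sum (ylin q)) big1 // => j _.
  by rewrite (linZ (ylin q)) /y hK // linear0 scaler0.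
(* hder is a polynomial identity in s. *)
have hvan q : (q < K)%N -> y q (logop d r u) + (q.+1%:R * b) *: y q.+1 u = 0.
  apply: (vandermonde_eq0
    (m := fun q => y q (logop d r u) + (q.+1%:R * b) *: y q.+1 u)) => s.
  rewrite -[RHS](hder s); under eq_bigr do rewrite scalerDr.
  rewrite big_split /=; congr (_ + _).
  pose f q := (q%:R * (s%:R : C) ^+ q.-1 * b) *: y q u.
  rewrite -[RHS]/(\sum_(q < K) f q).
  have -> : \sum_(q < K) f q = \sum_(q < K) f q.+1.
    transitivity (\sum_(q < K.+1) f q).
      by rewrite big_ord_recr /= {3}/f hy0 // scaler0 addr0.
    by rewrite big_ord_recl {1}/f !mul0r scale0r add0r.
  by apply: eq_bigr => j _; rewrite /f scalerA mulrCA mulrA.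
have b0 : b != 0 by rewrite mulf_neq0 ?pnatr_eq0 // cpii_neq0.
rewrite (linZ (ylin k)); case: (ltnP k K) => hk; last first.
  by rewrite hy0 ?(leqW hk) // hlog // !scaler0 oppr0.
have /eqP := hvan k hk; rewrite addr_eq0 => /eqP ->.
rewrite scalerN opprK scalerA; congr (_ *: _).
by rewrite -/b mulrCA mulVf ?mulr1.
Qed.
End HomLog.

Lemma dop_gen al u : gen_eigenspace g (e2 al) u ->
  dop g (Vtw g) u = (e2 al)^-1 *: g u - u.
Proof.
move=> hu; apply: (addIr u).
by rewrite (gdop_eigen (V_good hA hg) hu) subrK.
Qed.

Lemma iter_dop_gen al u j : gen_eigenspace g (e2 al) u ->
  iter j (dop g (Vtw g)) u = iter j (fun z => (e2 al)^-1 *: g z - z) u.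
Proof.
elim: j u => // j IH u hu; rewrite !iterSr (dop_gen hu); apply: IH.
have hgu := gen_eigen_h (g_linear g) hu.
rewrite addrC -scaleN1r; apply: gen_eigen_linear => //; first exact: g_linear.
rewrite -[X in gen_eigenspace _ _ X]addr0.
apply: gen_eigen_linear => //; [exact: g_linear|by exists 0%N].
Qed.

Lemma gen_proj al m u : gen_eigenspace g (e2 al) u ->
  gen_eigenspace g (e2 al) (Vgr A m u).
Proof.
move=> [n hn]; exists n.
have -> : iter n (fun y => g y - e2 al *: y) (Vgr A m u) =
   Vgr A m (iter n (fun y => g y - e2 al *: y) u).
  have hP : linear (Vgr A m) := linearP _.
  by elim: n {hn} => //= n ->; rewrite (linB hP) (linZ hP) (g_proj hg).
by rewrite hn linear0.
Qed.

(** The monodromy of x^a on the eigenspace of e^{2 pi i al} is e^{2 pi i (a + al)}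
    up to unipotent factors, and equivariance asks it to be trivial. *)
Lemma YW_exponents al u w a k : Vtw g al u ->
  (forall n : int, a + al != n%:~R) -> YW B u w a k = 0.
Proof.
move=> hu ha.
have hc : e2 (a + al) != 1.
  apply/eqP => /e2_eq1 [n hn]; have := ha n; rewrite hn eqxx //.
have [s [us [-> hs]]] := gproj_seq (Vgr A) u.
rewrite (lin_sum (Yl _ _ _)) big1 // => m _.
apply: (@grading_ind _ _ _ (Wgr B) (fun w => YW B (Vgr A m u) w a k = 0)).
- exact: (lin0 (Yr _ _ _)).
- by move=> x z hx hz; rewrite (linD (Yr _ _ _)) hx hz addr0.
move=> j; apply: (@grading_eq0 _ _ _ (Wgr B)) => i.
have hm : vhom m (Vgr A m u) by exact: gsub_proj.
have [hi|ni] := pselect (i.1.1 = a + m%:~R / 2 + j.1.1); last first.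
  exact: (YW_weight a k (@Wwt_proj j w) hm i ni).
have hg' := gen_proj m hu.
have [r hr] := gdop_nilp (V_good hA hg) (Vgr A m u).
apply: (hom_zero (@Wwt_proj j w) hi hc (r := r) hm).
by rewrite -iter_dop_gen.
Qed.

(** The infinitesimal form of Y(u, x) = Y_0(x^{-N} u, x). *)
Lemma YW_logS u w a k : k.+1%:R *: YW B u w a k.+1 = - YW B (N u) w a k.
Proof.
move: u; apply: (ggen_ind (V_good hA hg)).
- by rewrite (lin0 (N_linear hA hg)) !(lin0 (Yl _ _ _)) scaler0 oppr0.
- move=> x z hx hz; rewrite (linD (N_linear hA hg)) !(linD (Yl _ _ _)).
  by rewrite scalerDr hx hz opprD.
move=> al u _ hu _.
have [[n hn]|hne] := pselect (exists n : int, a + al = n%:~R); last first.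
  have hE (n : int) : a + al != n%:~R by apply/eqP => h; apply: hne; exists n.
  have huN : Vtw g al (N u) := N_Vtw hA hg hu.
  by rewrite (YW_exponents w k.+1 hu hE) (YW_exponents w k huN hE) scaler0 oppr0.
have [s [us [-> hs]]] := gproj_seq (Vgr A) u.
rewrite (lin_sum (N_linear hA hg)) !(lin_sum (Yl _ _ _)) scaler_sumr -sumrN.
apply: eq_bigr => m _.
apply: (@grading_ind _ _ _ (Wgr B) (fun w => k.+1%:R *: YW B (Vgr A m u) w a k.+1 =
  - YW B (N (Vgr A m u)) w a k)).
- by rewrite !(lin0 (Yr _ _ _)) scaler0 oppr0.
- by move=> x z hx hz; rewrite !(linD (Yr _ _ _)) scalerDr hx hz opprD.
move=> j; apply/eqP; rewrite -subr_eq0 opprK; apply/eqP.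
apply: (@grading_eq0 _ _ _ (Wgr B)) => i.
have hm : vhom m (Vgr A m u) by exact: gsub_proj.
rewrite linearD linearZ /=.
have [hi|ni] := pselect (i.1.1 = a + m%:~R / 2 + j.1.1); last first.
  rewrite (YW_weight a k.+1 (@Wwt_proj j w) hm i ni) scaler0 add0r.
  exact: (YW_weight a k (@Wwt_proj j w) (N_hom hA hg hm) i ni).
have hg' := gen_proj m hu.
have [r hr] := gdop_nilp (V_good hA hg) (Vgr A m u).
have hr' := hr; rewrite (iter_dop_gen _ hg') in hr'.
have hc : e2 (a + al) = 1 by rewrite hn e2_int.
rewrite (hom_log (@Wwt_proj j w) hi hc hm hr') /NV (gNopE (V_good hA hg) hr).
rewrite /logop; apply/eqP; rewrite addrC subr_eq0; apply/eqP.
congr (Wgr B i (YW B (_ *: _) _ _ _)); apply: eq_bigr => q _.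
by rewrite (iter_dop_gen q hg').
Qed.

(** The whole dependence on log x is through x^{-N} u, so that it suffices to
    know the log-free modes. *)
Lemma YW_logE u w a k :
  YW B u w a k = ((-1) ^+ k / k`!%:R) *: YW B (iter k N u) w a 0.
Proof.
elim: k u => [|k IH] u; first by rewrite expr0 fact0 divr1 scale1r.
have k0 := natS_neq0 C k; apply: (scalerI k0).
rewrite YW_logS IH -iterSr scalerA -scaleNr; congr (_ *: _).
rewrite exprS factS natrM invfM mulN1r.
by rewrite [RHS]mulrCA [X in _ = _ * X]mulrA mulfV // mul1r mulNr.
Qed.

(** The L(-1)-derivative property for log-free modes: the coefficient of log x
    contributes the term with N. *)
Lemma Lm1W_YW u w a : YW B u (Lm1W B w) a 0 =
  Lm1W B (YW B u w a 0) - (a + 1) *: YW B u w (a + 1) 0 +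
  YW B (N u) w (a + 1) 0.
Proof.
have := Lm1W_der hB u w a 0; rewrite /fs1_deriv YW_logS => h.
rewrite -addrA; apply/eqP; rewrite -subr_eq; apply/eqP.
by rewrite opprD opprK h addrC subrK.
Qed.
End TwmodFacts.

(** * Separating functionals and unconditional sums *)

Section Functionals.
Variables (R : realType) (M : lmodType R[i]).
Local Notation C := R[i].

Lemma mkscalar (f : M -> C) : (forall a x y, f (a *: x + y) = a * f x + f y) ->
  exists F : {scalar M}, forall x, F x = f x.
Proof.
move=> hf.
pose F : {scalar M} := HB.pack f (GRing.isLinear.Build C M C *%R f hf).
by exists F.
Qed.

(** The kernel of the functional is a subspace maximal among those avoiding x, so
    it has codimension one. *)
Lemma separating_functional (x : M) : x != 0 -> exists f : {scalar M}, f x != 0.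
Proof.
move=> x0.
pose P (H : set M) := (forall a y z, H y -> H z -> H (a *: y + z)) /\ ~ H x.
have [H [[Hl Hx] Hmax]] : exists H, P H /\ forall H', H `<` H' -> ~ P H'.
  apply: Zorn_bigcup => F FP tot; split; last first.
    by case=> H HF Hx; case: (FP _ HF) => _; apply.
  move=> a y z [H1 F1 y1] [H2 F2 z2].
  have [s|s] := tot _ _ F1 F2.
    by exists H2 => //; apply: (FP _ F2).1 => //; apply: s.
  by exists H1 => //; apply: (FP _ F1).1 => //; apply: s.
have H0 : H 0.
  apply: contrapT => h0; apply: (Hmax [set 0]).
    rewrite properEneq; split; last first.
      move=> y hy; exfalso; apply: h0.
      by have := Hl (-1) y y hy hy; rewrite scaleN1r addNr.
    by apply/eqP => E; apply: h0; rewrite E.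
  split; first by move=> a y z /= -> ->; rewrite scaler0 addr0.
  by move=> /= E; rewrite E eqxx in x0.
have HZ a y : H y -> H (a *: y) by move=> hy; have := Hl a y 0 hy H0; rewrite addr0.
have HD y z : H y -> H z -> H (y + z).
  by move=> hy hz; have := Hl 1 y z hy hz; rewrite scale1r.
(* By maximality H and any y outside H span x. *)
have ex y : exists l : C, H (y - l *: x).
  case: (pselect (H y)) => hy; first by exists 0; rewrite scale0r subr0.
  pose H' : set M := [set z | exists a, H (z - a *: y)].
  have H'y : H' y by exists 1; rewrite scale1r subrr.
  have [a ha] : H' x.
    apply: contrapT => hx; apply: (Hmax H').
      rewrite properEneq; split; last by move=> z hz; exists 0; rewrite scale0r subr0.
      by apply/eqP => E; apply: hy; rewrite E.
    split=> // b z t [c hc] [d hd]; exists (b * c + d).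
    have := Hl b _ _ hc hd; congr H.
    by rewrite scalerBr scalerDl scalerA opprD addrACA.
  have a0 : a != 0.
    by apply/eqP => E; apply: Hx; move: ha; rewrite E scale0r subr0.
  exists a^-1; have := HZ (- a^-1) _ ha; congr H.
  by rewrite scalerBr scalerA mulNr mulVf // scaleN1r opprK addrC scaleNr.
have uniq y l m : H (y - l *: x) -> H (y - m *: x) -> l = m.
  move=> h1 h2; apply/eqP; rewrite -subr_eq0; apply/negP => /negP d0.
  apply: Hx; have := HZ (l - m)^-1 _ (Hl (-1) _ _ h1 h2); congr H.
  rewrite scaleN1r opprB addrA subrK -scalerBl.
  by rewrite scalerA mulVf // scale1r.
have [f hf] := choice ex.
have [F FE] : exists F : {scalar M}, forall y, F y = f y.
  apply: mkscalar => a y z; apply: (uniq (a *: y + z)) => //.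
  have := Hl a _ _ (hf y) (hf z); congr H.
  by rewrite scalerBr scalerDl scalerA opprD addrACA.
exists F; rewrite FE; apply/eqP => E; apply: Hx.
by have := hf x; rewrite E scale0r subr0.
Qed.

End Functionals.

Lemma sum_antidiag (M : zmodType) (F : nat -> nat -> M) r :
  \sum_(n < r) \sum_(i < n.+1) F i (n - i)%N =
  \sum_(i < r) \sum_(k < r - i) F i k.
Proof.
elim: r => [|r IH]; first by rewrite !big_ord0.
rewrite big_ord_recr /= IH [RHS](eq_bigr (fun i : 'I_r.+1 =>
  \sum_(k < r - i) F i k + F i (r - i)%N)); last first.
  by move=> i _; rewrite subSn ?big_ord_recr //= -ltnS ltn_ord.
by rewrite big_split /= [in RHS]big_ord_recr /= subnn big_ord0 addr0.
Qed.

Lemma sum_square_antidiag (M : zmodType) (F : nat -> nat -> M) r :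
  (forall i k, (r <= i + k)%N -> F i k = 0) ->
  \sum_(i < r) \sum_(k < r) F i k = \sum_(n < r) \sum_(i < n.+1) F i (n - i)%N.
Proof.
move=> h; rewrite sum_antidiag; apply: eq_bigr => i _.
rewrite (sum_trunc (leq_subr i r)) // => k hk.
by apply: h; rewrite -leq_subLR.
Qed.

Lemma sum_exp_pow (K : numFieldType) (x y : K) n :
  \sum_(i < n.+1) x ^+ i / i`!%:R * (y ^+ (n - i) / (n - i)`!%:R) =
  (x + y) ^+ n / n`!%:R.
Proof.
rewrite [x + y]addrC exprDn mulr_suml; apply: eq_bigr => i _.
have hi : (i <= n)%N by rewrite -ltnS.
have := bin_fact hi => /(congr1 (fun k => k%:R : K)); rewrite !natrM => E.
have f0 k : k`!%:R != 0 :> K by rewrite pnatr_eq0 -lt0n fact_gt0.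
rewrite -mulr_natr -E; field.
by rewrite !f0 /= pnatr_eq0 -lt0n bin_gt0.
Qed.

Lemma exp_cancel (K : numFieldType) (M N : lmodType K) (h : M -> M)
  (phi : M -> N) (x : K) (u : M) r : linear h -> linear phi -> (0 < r)%N ->
  iter r h u = 0 ->
  \sum_(i < r) (x ^+ i / i`!%:R) *:
    \sum_(k < r) ((- x) ^+ k / k`!%:R) *: phi (iter k h (iter i h u)) = phi u.
Proof.
move=> hl pl r0 hr.
under eq_bigr => i _ do rewrite scaler_sumr.
rewrite (sum_square_antidiag (F := fun i k =>
  x ^+ i / i`!%:R *: ((- x) ^+ k / k`!%:R *: phi (iter k h (iter i h u))))).
  case: r r0 hr => // r _ hr; rewrite big_ord_recl [X in _ + X]big1 ?addr0; last first.
    move=> n _.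
    rewrite (eq_bigr (fun i : 'I_(lift ord0 n).+1 =>
      (x ^+ i / i`!%:R * ((- x) ^+ (lift ord0 n - i) / (lift ord0 n - i)`!%:R)) *:
      phi (iter (lift ord0 n) h u))).
      by rewrite -scaler_suml sum_exp_pow subrr expr0n /= mul0r scale0r.
    by move=> i _; rewrite scalerA -iterD subnK // -ltnS.
  by rewrite big_ord1 /= !expr0 fact0 divr1 !scale1r.
move=> i k hik; rewrite -iterD (nilp_ge hl hr) ?(lin0 pl) ?scaler0 //.
by rewrite addnC.
Qed.

Section CSum.
Variable R : realType.
Local Notation C := R[i].
Local Notation rc x := (x%:C%C).

(** Unconditional convergence over an arbitrary index set, the form in which
    the duality axiom is stated. *)
Definition csum (T : choiceType) (f : T -> C) (s : C) : Prop :=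
  forall e : R, 0 < e -> exists A : {fset T},
    forall B : {fset T}, (A `<=` B)%fset -> cabs (\sum_(t <- B) f t - s) < e.

Lemma csum_ext (T : choiceType) (f h : T -> C) s : f =1 h -> csum f s -> csum h s.
Proof. by move=> E; have -> : f = h by apply/funext. Qed.

Lemma csumD (T : choiceType) (f h : T -> C) s t : csum f s -> csum h t ->
  csum (fun x => f x + h x) (s + t).
Proof.
move=> hf hh e e0; have e2 : 0 < e / 2 by rewrite divr_gt0.
have [A hA] := hf _ e2; have [A' hA'] := hh _ e2.
exists (A `|` A')%fset => B hB.
rewrite big_split opprD addrACA /=; apply: (le_lt_trans (cabsD _ _)).
rewrite [e]splitr; apply: ltrD; [apply: hA|apply: hA'];
  apply: fsubset_trans hB; [exact: fsubsetUl|exact: fsubsetUr].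
Qed.

Lemma csumZ (T : choiceType) c (f : T -> C) s : csum f s ->
  csum (fun x => c * f x) (c * s).
Proof.
move=> hf e e0.
have K0 : 0 < cabs c + 1 by rewrite ltr_wpDl ?cabs_ge0.
have [A hA] := hf (e / (cabs c + 1)) (divr_gt0 e0 K0).
exists A => B /hA; rewrite ltr_pdivlMr // => h.
rewrite -mulr_sumr -mulrBr cabsM mulrC.
by apply: le_lt_trans h; rewrite ler_wpM2l ?cabs_ge0 // lerDl.
Qed.

Lemma csum0 (T : choiceType) : csum (fun _ : T => 0) 0.
Proof. by move=> e e0; exists fset0 => B _; rewrite big1 // subrr cabs0. Qed.

Lemma csum_sum (T : choiceType) n (f : nat -> T -> C) s :
  (forall i, (i < n)%N -> csum (f i) (s i)) ->
  csum (fun x => \sum_(i < n) f i x) (\sum_(i < n) s i).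
Proof.
elim: n => [|n IH] h.
  by rewrite big_ord0; apply: csum_ext (csum0 T) => x; rewrite big_ord0.
rewrite big_ord_recr; apply: csum_ext (csumD (IH _) (h n _)) => //.
  by move=> x; rewrite big_ord_recr.
by move=> i hi; apply: h; apply: ltnW.
Qed.

(** When only countably many terms survive, enumerated by the exponent, the
    unconditional sum is the sum of a power series. *)
Lemma csum_psum (T : choiceType) (f : T -> C) s (e : nat -> T) g z :
  injective e -> (forall t, (forall k, t <> e k) -> f t = 0) ->
  (forall k, f (e k) = g k * z ^+ k) -> csum f s -> psum g z s.
Proof.
move=> ei f0 fe hs eps eps0; have [A hA] := hs _ eps0.
have hidx t : exists k, (exists k, t = e k) -> t = e k.
  by case: (pselect (exists k, t = e k)) => [[k hk]|h]; [exists k|exists 0%N].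
have [idx hi] := choice hidx.
exists (\max_(t <- A) (idx t).+1) => k hk.
pose D := [fset e i | i in iota 0 k]%fset.
have -> : \sum_(i < k) g i * z ^+ i = \sum_(t <- (D `|` A)%fset) f t; last first.
  by apply: hA; rewrite fsubsetUr.
have -> : \sum_(i < k) g i * z ^+ i = \sum_(t <- D) f t.
  rewrite (perm_big [seq e i | i <- iota 0 k]) /=; last first.
    apply: uniq_perm => //; first by rewrite map_inj_uniq ?iota_uniq.
    move=> t; apply/idP/idP.
      by case/imfsetP=> i /= hi' ->; apply: map_f.
    by case/mapP=> i hi' ->; apply/imfsetP; exists i.
  rewrite big_map -[in RHS](subn0 k) -/(index_iota 0 k) big_mkord.
  by apply: eq_bigr => i _.
apply: big_fset_incl; first exact: fsubsetUl.
move=> t ht nD; case: (pselect (exists k, t = e k)) => [hex|h]; last first.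
  by apply: f0 => j hj; apply: h; exists j.
have tA : t \in A by move: ht; rewrite inE (negbTE nD).
case/negP: nD; rewrite (hi _ hex); apply/imfsetP; exists (idx t) => //=.
rewrite mem_iota add0n; apply: leq_trans hk.
by rewrite (big_rem t tA) /= leq_maxl.
Qed.

End CSum.

Section CoreFormalUniform.
Variable R : realType.
Local Notation C := R[i].
Local Notation rc x := (x%:C%C).

(** The terms beyond a bound depending only on the supports vanish, so one
    truncation serves all functionals at once. *)
Lemma expansions_delta_uniform (alpha : C) (t I J M0 N1 : nat) (p q : int -> C)
  (r : nat -> int -> C) (e : R -> C) (rho : nat -> R -> C) :
  (forall n : int, N1%:Z < n -> p n = 0) ->
  (forall n : int, n < - M0%:Z -> q n = 0) ->
  (forall i (j : int), j < - J%:Z -> r i j = 0) ->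
  exppoly e ->
  (forall N : nat, (forall n : int, N%:Z < n -> p n = 0) -> forall tau : R,
    0 < tau -> psum (fun k => p (N%:Z - k%:Z)) (rc (expR (- tau)))
      (rc (expR (- tau)) ^+ N * (e tau / (rc (expR tau) - 1) ^+ t))) ->
  (forall tau : R, tau < 0 ->
    psum (fun k => q (- M0%:Z + k%:Z)) (rc (expR tau))
      (rc (expR tau) ^+ M0 * (e tau / (rc (expR tau) - 1) ^+ t))) ->
  (forall i, (i < I)%N -> forall x : R, 0 < x < 1 ->
    psum (fun k => r i (- J%:Z + k%:Z)) (rc x) (rho i x)) ->
  (forall x : R, 0 < x < 1 ->
    rc x ^+ t * \sum_(i < I) plog alpha i x * rho i x =
    rc x ^+ J * e (ln (1 + x))) ->
  forall (m : int) K, (`|m| + N1 + M0 + J + 1 <= K)%N ->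
    \sum_(k < K) cbinom (m + k%:Z)%:~R k * p (m + k%:Z) -
    \sum_(j < K) \sum_(i < I) (bp alpha j)`_i * r i (m - j%:Z) =
    \sum_(k < K) (-1) ^ (m + 1 + k%:Z) * cbinom (-1 - m%:~R) k * q (- k%:Z - 1).
Proof.
move=> hp hq hr he Hp Hq Hr Hr' m K hK.
have [K0 h] := expansions_delta (ex_intro _ N1 hp) hq hr he Hp Hq Hr Hr' m.
have := h (maxn K K0) (leq_maxr _ _).
rewrite (sum_trunc (leq_maxl K K0)
  (f := fun k => cbinom (m + k%:Z)%:~R k * p (m + k%:Z))); last first.
  by move=> k hk; rewrite hp ?mulr0 //; lia.
rewrite (sum_trunc (leq_maxl K K0)
  (f := fun j => \sum_(i < I) (bp alpha j)`_i * r i (m - j%:Z))); last first.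
  by move=> k hk; apply: big1 => i _; rewrite hr ?mulr0 //; lia.
rewrite (sum_trunc (leq_maxl K K0)
  (f := fun k => (-1) ^ (m + 1 + k%:Z) * cbinom (-1 - m%:~R) k * q (- k%:Z - 1))) //.
by move=> k hk; rewrite hq ?mulr0 //; lia.
Qed.

Lemma exppoly_shift k : exppoly (fun t : R => (rc (expR t) - 1) ^+ k).
Proof.
elim: k => [|k IH].
  by apply: exppoly_ext (exppoly_expR R 0) => t; rewrite !expr0.
have h : exppoly (fun t : R => rc (expR t) ^+ 1 + (-1) * rc (expR t) ^+ 0).
  by apply: exppolyD; [exact: exppoly_expR|apply: exppolyZ; exact: exppoly_expR].
by apply: exppoly_ext (exppolyM h IH) => t; rewrite expr1 expr0 mulr1 exprS.
Qed.

End CoreFormalUniform.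

(** * The log-free identity *)

Section Core.
Variables (R : realType) (V W : lmodType R[i]) (A : vsa V) (hA : is_vsa A).
Variables (g : {linear V -> V}) (hg : is_automorphism A g).
Variables (B : twmod V W) (hB : is_twmod A g B) (hlb : lower_bounded B).
Local Notation C := R[i].
Local Notation rc x := (x%:C%C).
Local Notation vhom m := (gsub (Vgr A) [set m]).
Local Notation N := (NV g).

Let Yl w a k : linear (fun u => YW B u w a k) := YW_linear_l hB w a k.
Let Yr u a k : linear (fun w => YW B u w a k) := YW_linear_r hB u a k.
Let Nl : linear N := N_linear hA hg.

Lemma exppoly_branch n (c : nat -> nat -> nat -> nat -> C) (m m' : nat -> C) :
  exppoly (fun tau : R => \sum_(i < n) \sum_(j < n) \sum_(k < n) \sum_(l < n)
    c i j k l * ev_mono 0 (rc (expR tau)) (m i) k * ev_mono 0 1 (m' j) l).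
Proof.
apply: (exppoly_sum (e := fun i tau => \sum_(j < n) \sum_(k < n) \sum_(l < n)
    c i j k l * ev_mono 0 (rc (expR tau)) (m i) k * ev_mono 0 1 (m' j) l)) => i _.
apply: (exppoly_sum (e := fun j tau => \sum_(k < n) \sum_(l < n)
    c i j k l * ev_mono 0 (rc (expR tau)) (m i) k * ev_mono 0 1 (m' j) l)) => j _.
apply: (exppoly_sum (e := fun k tau => \sum_(l < n)
    c i j k l * ev_mono 0 (rc (expR tau)) (m i) k * ev_mono 0 1 (m' j) l)) => k _.
apply: (exppoly_sum (e := fun l tau =>
    c i j k l * ev_mono 0 (rc (expR tau)) (m i) k * ev_mono 0 1 (m' j) l)) => l _.
apply: exppoly_ext; last exact: (exppolyZ (c i j k l * ev_mono 0 1 (m' j) l)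
  (exppoly_mono (m i) k)).
by move=> tau; rewrite ev_mono_real ?expR_gt0 // expRK mulrAC.
Qed.

Lemma normc_rc (x : R) : 0 <= x -> `|rc x| = rc x.
Proof. by move=> x0; rewrite ger0_norm // lecR. Qed.

(** Duality at z2 = 1 and z1 = e^tau real, on the branch p = 0. The common
    function of z1 and log z1 becomes an exponential polynomial in tau, and
    all powers of log z2 disappear; the logarithms log z1 are kept explicit
    through e^{- tau N}. *)
Lemma dual_point (U v : V) (w : W) (F : {scalar W}) (i : R[i] * bool * R[i])
  (su sv : bool) r :
  (forall x, F (Wgr B i x) = F x) -> (forall j x, j != i -> F (Wgr B j x) = 0) ->
  parV A su U -> parV A sv v -> iter r N U = 0 ->
  exists E t, [/\ exppoly E,
    forall tau : R, 0 < tau -> csum (fun ab : C * C =>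
      cexp (ab.1 * rc tau) * \sum_(k < r) (- rc tau) ^+ k / k`!%:R *
        F (YW B (iter k N U) (YW B v w ab.2 0) ab.1 0))
      (E tau / (rc (expR tau) - 1) ^+ t),
    forall tau : R, tau < 0 -> csum (fun ab : C * C =>
      cexp (ab.1 * rc tau) * \sum_(k < r) (- rc tau) ^+ k / k`!%:R *
        ((-1) ^+ (su && sv) * F (YW B v (YW B (iter k N U) w ab.1 0) ab.2 0)))
      (E tau / (rc (expR tau) - 1) ^+ t) &
    forall x : R, 0 < x < 1 -> csum (fun jb : int * C =>
      F (YW B (YV A U v jb.1) w jb.2 0) * rc x ^ jb.1)
      (E (ln (1 + x)) / rc x ^+ t)].
Proof.
move=> hFi hFj hU hv hr.
have gd : in_graded_dual (Wgr B) F.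
  by exists [:: i] => j; rewrite inE => hj x; exact: hFj.
have [n [c [m [m' [t [_ D]]]]]] := YW_duality hB w hU hv gd.
exists (fun tau => \sum_(i < n.+1) \sum_(j < n.+1) \sum_(k < n.+1) \sum_(l < n.+1)
    c i j k l * ev_mono 0 (rc (expR tau)) (m i) k * ev_mono 0 1 (m' j) l), t.
have logE a k y : YW B U y a k = ((-1) ^+ k / k`!%:R) *: YW B (iter k N U) y a 0.
  exact: (YW_logE hA hg hB).
have log0 a k y : (r <= k)%N -> YW B U y a k = 0.
  by move=> hk; rewrite logE (nilp_ge Nl hr hk) (lin0 (Yl _ _ _)) scaler0.
split; first exact: exppoly_branch.
- move=> tau tau0; have [D1 _ _] := D 0 (rc (expR tau)) 1.
  have [] := D1; rewrite ?normr1 ?ltr01 // ?normc_rc ?expR_ge0 //.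
    by rewrite -[1]/(rc 1) ltcR expR_gt1.
  move=> _; apply: csum_ext => -[a b] /=; rewrite (fsum_nat (n := r)); last first.
    move=> k hk; rewrite (fsum_at (i0 := 0%N)) => [|l _].
      by rewrite log0 // linear0 !mul0r.
    by rewrite log0 // linear0 !mul0r.
  rewrite mulr_sumr; apply: eq_bigr => k _; rewrite (fsum_at (i0 := 0%N)).
    rewrite ev_mono1 eqxx mulr1 ev_mono_real ?expR_gt0 // expRK logE scalarZ.
    by rewrite -[- rc tau]mulN1r exprMn; ring.
  by move=> [|l] // _; rewrite ev_mono1 mulr0.
- move=> tau tau0; have [_ D1 _] := D 0 (rc (expR tau)) 1.
  have [] := D1; rewrite ?normr1 ?ltr01 // ?normc_rc ?expR_ge0 //.
  + by rewrite -[1]/(rc 1) ltcR expR_lt1.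
  + by rewrite -[0]/(rc 0) ltcR expR_gt0.
  move=> _; apply: csum_ext => -[a b] /=; rewrite (fsum_nat (n := r)); last first.
    move=> k hk; rewrite (fsum_at (i0 := 0%N)) => [|l _].
      by rewrite log0 // (lin0 (Yr _ _ _)) linear0 mulr0 !mul0r.
    by rewrite log0 // (lin0 (Yr _ _ _)) linear0 mulr0 !mul0r.
  rewrite mulr_sumr; apply: eq_bigr => k _; rewrite (fsum_at (i0 := 0%N)).
    rewrite ev_mono1 eqxx mulr1 ev_mono_real ?expR_gt0 // expRK logE.
    rewrite (linZ (Yr _ _ _)) scalarZ.
    by rewrite -[- rc tau]mulN1r [(-1 * rc tau) ^+ k]exprMn; ring.
  by move=> [|l] // _; rewrite ev_mono1 mulr0.
- move=> x /andP[x0 x1]; have [_ _ D1] := D 0 (rc (1 + x)) 1.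
  have e1 : rc (1 + x) - 1 = rc x by rewrite rmorphD /= addrC addKr.
  have x1' : 0 < 1 + x by lra.
  have [] := D1; rewrite e1 ?normr1 // ?normc_rc ?ltW //.
  + by rewrite -[1]/(rc 1) ltcR.
  + by rewrite -[0]/(rc 0) ltcR.
  have c1 : carg (1 : C) = 0 by exact: (carg_real (ltr01 : 0 < (1 : R))).
  move=> _; rewrite c1 carg_real // subrr normr0.
  case=> [|_]; first by rewrite divr_gt0 ?pi_gt0.
  rewrite /branch e1 lnK ?posrE //; apply: csum_ext => -[j b] /=.
  rewrite (fsum_at (i0 := 0%N)); first by rewrite ev_mono1 mulr1.
  by move=> [|l] // _; rewrite ev_mono1 mulr0.
Qed.

Lemma rc_expR (t : R) : rc (expR t) = cexp (rc t).
Proof. by rewrite /cexp /= cos0 sin0 mulr1 mulr0. Qed.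

Lemma Re_sub_int (x : C) (y : R) : exists n : nat, forall z : int, n%:Z < z ->
  complex.Re (x - z%:~R) < y.
Proof.
exists (Num.truncn `|complex.Re x - y|).+1 => z hz.
rewrite raddfB /= -(rmorph_int (real_complex R)) /= ltrBlDl -ltrBlDr.
have := truncnS_gt `|complex.Re x - y|; set t := (_.+1) in hz * => ht.
apply: (le_lt_trans (ler_norm _)); apply: (lt_trans ht).
by rewrite -[t%:R]/(t%:Z%:~R) ltr_int.
Qed.

(** Applying duality to e^{tau N} u instead of u cancels the logarithms in the
    first two products, and turns the third into a sum over the functions
    (1 + x)^al log(1 + x)^i / i!. Functionals concentrated in one weight reduce
    the identity in W to one between scalar sequences. *)
Lemma core_identity_hom mu mv su sv al u v n w (a : int) (b : C) :
  Vtw g al u -> vhom mu u -> parV A su u -> vhom mv v -> parV A sv v ->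
  Wwt B n w ->
  exists K0, forall K I, (K0 <= K)%N -> (K0 <= I)%N ->
  \sum_(q < K) cbinom (a + q%:Z)%:~R q *:
     YW B u (YW B v w (b - q%:R) 0) (a%:~R + q%:R - al) 0 -
  \sum_(j < K) \sum_(i < I) (bp al j)`_i *:
     YW B (YV A (iter i N u) v (a - j%:Z)) w (b - al + j%:R) 0 =
  (-1) ^+ (su && sv) *:
  \sum_(k < K) ((-1) ^ (a + 1 + k%:Z) * cbinom (-1 - a%:~R) k) *:
     YW B v (YW B u w (- al - k%:R - 1) 0) (b + a%:~R + 1 + k%:R) 0.
Proof.
move=> hual hmu hsu hmv hsv hw.
have [r0 hr0] := N_nilp hA hg u.
pose r := r0.+1; have hr : iter r N u = 0 by rewrite iterS hr0 (lin0 Nl).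
have hNh i : vhom mu (iter i N u) by elim: i => //= i; exact: (N_hom hA hg).
have hNs i : parV A su (iter i N u) by elim: i => //= i; exact: (N_parity hA hg).
have hNr i : iter r N (iter i N u) = 0.
  by rewrite -iterD (nilp_ge Nl hr) ?leq_addr.
have [J hJ] := YV_trunc_hom hA mu mv.
have [bv hbv] := YW_trunc hB hlb v w.
have [bu hbu] := YW_trunc hB hlb u w.
have [N1 hN1] := Re_sub_int (b + a%:~R) bv.
have [M0 hM0] := Re_sub_int (- al) bu.
exists (maxn r (`|a| + N1 + M0 + J + 1)) => K I; rewrite !geq_max.
move=> /andP[rK hK] /andP[rI _].
apply/eqP; rewrite -subr_eq0; apply/eqP.
rewrite [X in _ - X - _](eq_bigr (fun j : 'I_K => \sum_(i < r) (bp al j)`_i *: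
    YW B (YV A (iter i N u) v (a - j%:Z)) w (b - al + j%:R) 0)); last first.
  move=> j _; rewrite (sum_trunc rI (f := fun i => (bp al j)`_i *:
    YW B (YV A (iter i N u) v (a - j%:Z)) w (b - al + j%:R) 0)) // => i hi.
  by rewrite (nilp_ge Nl hr hi) (lin0 (YV_linear_l hA _ _)) (lin0 (Yl _ _ _)) scaler0.
have wtY n' m v' w' x := @YW_weight _ _ _ _ _ _ hB n' m v' w' x 0.
set X := (X in X = 0).
(* All the terms of X have the weight W0, and the weight relates the exponents
   of x1 and x2 in each product. *)
pose W0 : C := a%:~R - al + mu%:~R / 2 + (b + mv%:~R / 2 + n).
have wt12 (x y : C) i : i.1.1 = W0 ->
    x + y != a%:~R + b - al -> Wgr B i (YW B u (YW B v w y 0) x 0) = 0.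
  move=> hi hxy; have := wtY _ _ _ _ x (wtY _ _ _ _ y hw hmv) hmu.
  apply; rewrite /= hi /W0 => E; move/eqP: hxy; apply.
  have -> : x + y = x + mu%:~R / 2 + (y + mv%:~R / 2 + n) -
    (mu%:~R / 2 + mv%:~R / 2 + n) by ring.
  by rewrite -E; ring.
have wt21 (x y : C) i : i.1.1 = W0 ->
    x + y != a%:~R + b - al -> Wgr B i (YW B v (YW B u w x 0) y 0) = 0.
  move=> hi hxy; have := wtY _ _ _ _ y (wtY _ _ _ _ x hw hmu) hmv.
  apply; rewrite /= hi /W0 => E; move/eqP: hxy; apply.
  have -> : x + y = y + mv%:~R / 2 + (x + mu%:~R / 2 + n) -
    (mu%:~R / 2 + mv%:~R / 2 + n) by ring.
  by rewrite -E; ring.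
have wt0 i0 (j : int) (y : C) i : i.1.1 = W0 -> j%:~R + y != a%:~R + b - al ->
    Wgr B i (YW B (YV A (iter i0 N u) v j) w y 0) = 0.
  move=> hi hxy.
  have := wtY _ _ _ _ y hw (@YV_weight _ _ _ hA _ _ _ _ j (hNh i0) hmv).
  apply; rewrite /= hi /W0 !rmorphD rmorphM /= => E; move/eqP: hxy; apply.
  have -> : j%:~R + y = y + (mu%:~R + mv%:~R + 2 * j%:~R) / 2 + n -
    (mu%:~R / 2 + mv%:~R / 2 + n) by field.
  by rewrite -E; ring.
have XW0 i : i.1.1 <> W0 -> Wgr B i X = 0.
  move=> ni; rewrite /X !linearB linearZ !linear_sum /=.
  rewrite !big1 ?scaler0 ?addr0 ?subr0 // => q _.
  - rewrite linearZ /= (wtY _ _ _ _ _ (wtY _ _ _ _ _ hw hmu) hmv) ?scaler0 //=.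
    by move=> E; apply: ni; rewrite E /W0; ring.
  - rewrite linear_sum big1 ?oppr0 // => i0 _; rewrite linearZ /=.
    rewrite (wtY _ _ _ _ _ hw (@YV_weight _ _ _ hA _ _ _ _ _ (hNh i0) hmv)) ?scaler0 //=.
    move=> E; apply: ni; rewrite E /W0 !rmorphD rmorphM rmorphB /=.
    by rewrite -[(q%:Z)%:~R]/(q%:R); field.
  - rewrite linearZ /= (wtY _ _ _ _ _ (wtY _ _ _ _ _ hw hmv) hmu) ?scaler0 //=.
    by move=> E; apply: ni; rewrite E /W0; ring.
apply: (@grading_eq0 _ _ _ (Wgr B)) => i; have [hi|ni] := eqVneq i.1.1 W0; last first.
  by apply: XW0; apply/eqP.
apply: contrapT => /eqP X0; have [f hf] := separating_functional X0.
have [F FE] : exists F : {scalar W}, forall x, F x = f (Wgr B i x).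
  by apply: mkscalar => c x y; rewrite linearP /= linearD linearZ.
have hFi x : F (Wgr B i x) = F x by rewrite !FE gproj_same.
have hFj j x : j != i -> F (Wgr B j x) = 0.
  by move=> hj; rewrite FE gproj_diff 1?eq_sym // linear0.
move/negP: hf; apply; rewrite -FE.
have Fl : linear (F : W -> C^o) by move=> c x y; rewrite linearP.
have Fu (y : W) (x : C) : linear (fun z => F (YW B z y x 0) : C^o).
  by move=> c z t; rewrite Yl Fl.
have Fv (z x : C) : linear (fun t => F (YW B v (YW B t w x 0) z 0) : C^o).
  by move=> c t t'; rewrite Yl Yr Fl.
have dual k : exists Et : (R -> C) * nat, [/\ exppoly Et.1,
    forall tau : R, 0 < tau -> csum (fun ab : C * C =>
      cexp (ab.1 * rc tau) * \sum_(k' < r) (- rc tau) ^+ k' / k'`!%:R *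
        F (YW B (iter k' N (iter k N u)) (YW B v w ab.2 0) ab.1 0))
      (Et.1 tau / (rc (expR tau) - 1) ^+ Et.2),
    forall tau : R, tau < 0 -> csum (fun ab : C * C =>
      cexp (ab.1 * rc tau) * \sum_(k' < r) (- rc tau) ^+ k' / k'`!%:R *
        ((-1) ^+ (su && sv) *
         F (YW B v (YW B (iter k' N (iter k N u)) w ab.1 0) ab.2 0)))
      (Et.1 tau / (rc (expR tau) - 1) ^+ Et.2) &
    forall x : R, 0 < x < 1 -> csum (fun jb : int * C =>
      F (YW B (YV A (iter k N u) v jb.1) w jb.2 0) * rc x ^ jb.1)
      (Et.1 (ln (1 + x)) / rc x ^+ Et.2)].
  by have [E [t h]] := dual_point w hFi hFj (hNs k) hsv (hNr k); exists (E, t).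
have {dual} [D hD] := choice dual.
pose t := (\sum_(k < r) (D k).2)%N.
have tD k : (k < r)%N -> ((D k).2 <= t)%N.
  by move=> hk; rewrite /t (bigD1 (Ordinal hk)) //= leq_addr.
(* The exponential polynomial of the product with the logarithms cancelled and
   x1^al split off, over the common denominator (z1 - 1)^t. *)
pose e (tau : R) : C := cexp (al * rc tau) * \sum_(k < r)
  (rc tau ^+ k / k`!%:R * ((D k).1 tau * (rc (expR tau) - 1) ^+ (t - (D k).2))).
have ee : exppoly e.
  have h0 := exppoly_mono (R := R) al 0.
  have h : exppoly (fun tau => \sum_(k < r)
    (rc tau ^+ k / k`!%:R * ((D k).1 tau * (rc (expR tau) - 1) ^+ (t - (D k).2)))).
    apply: (exppoly_sum (e := fun k tau => (rc tau ^+ k / k`!%:R *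
      ((D k).1 tau * (rc (expR tau) - 1) ^+ (t - (D k).2))))) => k _.
    have [h1 _ _ _] := hD k.
    have := exppolyZ (k`!%:R)^-1 (exppolyM (exppoly_mono (R := R) 0 k)
      (exppolyM h1 (exppoly_shift R (t - (D k).2)%N))).
    apply: exppoly_ext => tau; rewrite /expmono mul0r cexp0 mul1r.
    by rewrite mulrA [_ * rc tau ^+ k]mulrC.
  by apply: exppoly_ext (exppolyM h0 h) => tau; rewrite /expmono expr0 mulr1.
have eE (tau : R) : rc (expR tau) - 1 != 0 ->
    \sum_(k < r) (rc tau ^+ k / k`!%:R *
      ((D k).1 tau / (rc (expR tau) - 1) ^+ (D k).2)) =
    cexp (- al * rc tau) * (e tau / (rc (expR tau) - 1) ^+ t).
  move=> s0; rewrite /e -!mulrA mulrA -cexpD mulNr addNr cexp0 mul1r mulr_suml.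
  apply: eq_bigr => k _; rewrite -!mulrA; congr (_ * (_ * (_ * _))).
  apply: (mulIf (x := (rc (expR tau) - 1) ^+ t)); first by rewrite expf_neq0.
  rewrite divfK ?expf_neq0 // -[in LHS](subnK (tD k _)) // exprD mulrCA.
  by rewrite mulVf ?mulr1 ?expf_neq0.
have s1 (tau : R) : tau != 0 -> rc (expR tau) - 1 != 0.
  move=> t0; rewrite -[1]/(rc 1) -rmorphB /= -[0]/(rc 0).
  by rewrite (inj_eq (@complexI R)) subr_eq0 -(expR0 R) (inj_eq (@expR_inj R)).
have D12 (tau : R) : 0 < tau -> csum (fun ab : C * C =>
    cexp (ab.1 * rc tau) * F (YW B u (YW B v w ab.2 0) ab.1 0))
    (cexp (- al * rc tau) * (e tau / (rc (expR tau) - 1) ^+ t)).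
  move=> tau0; have sn : rc (expR tau) - 1 != 0 by apply: s1; rewrite gt_eqF.
  rewrite -(eE tau sn).
  have := csum_sum (n := r) (fun k _ =>
    csumZ (rc tau ^+ k / k`!%:R) (let: And4 _ h _ _ := hD k in h tau tau0)).
  apply: csum_ext => -[x y] /=.
  rewrite -(exp_cancel (rc tau) Nl (Fu (YW B v w y 0) x) (ltn0Sn _) hr) mulr_sumr.
  by apply: eq_bigr => k _; rewrite mulrCA.
have D21 (tau : R) : tau < 0 -> csum (fun ab : C * C =>
    cexp (ab.1 * rc tau) * ((-1) ^+ (su && sv) *
      F (YW B v (YW B u w ab.1 0) ab.2 0)))
    (cexp (- al * rc tau) * (e tau / (rc (expR tau) - 1) ^+ t)).
  move=> tau0; have sn : rc (expR tau) - 1 != 0 by apply: s1; rewrite lt_eqF.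
  rewrite -(eE tau sn).
  have := csum_sum (n := r) (fun k _ =>
    csumZ (rc tau ^+ k / k`!%:R) (let: And4 _ _ h _ := hD k in h tau tau0)).
  apply: csum_ext => -[x y] /=.
  rewrite -(exp_cancel (rc tau) Nl (Fv y x) (ltn0Sn _) hr) !mulr_sumr.
  apply: eq_bigr => k _.
  set c := (_ / _).
  pose S : C := \sum_(k' < r) (- rc tau) ^+ k' / k'`!%:R *
    F (YW B v (YW B (iter k' N (iter k N u)) w x 0) y 0).
  have -> : \sum_(k' < r) (- rc tau) ^+ k' / k'`!%:R * ((-1) ^+ (su && sv) *
      F (YW B v (YW B (iter k' N (iter k N u)) w x 0) y 0)) = (-1) ^+ (su && sv) * S.
    by rewrite mulr_sumr; apply: eq_bigr => k' _; rewrite mulrCA.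
  by rewrite -[X in _ = _ * (_ * X)]/(c * S) mulrCA; congr (_ * _); rewrite mulrCA.
have expo x y : (forall z : int, x + al != z%:~R) -> YW B u y x 0 = 0.
  by move=> h; exact: (YW_exponents hA hg hB _ _ hual h).
(* The three sequences compared by the delta function identity. *)
pose p (z : int) : C := F (YW B u (YW B v w (b + a%:~R - z%:~R) 0) (z%:~R - al) 0).
pose q (z : int) : C := (-1) ^+ (su && sv) *
  F (YW B v (YW B u w (z%:~R - al) 0) (b + a%:~R - z%:~R) 0).
pose rr k (z : int) : C :=
  F (YW B (YV A (iter k N u) v z) w (b + a%:~R - al - z%:~R) 0).
have p0 (z : int) : N1%:Z < z -> p z = 0.
  by move=> hz; rewrite /p (hbv _ _ (hN1 _ hz)) (lin0 (Yr _ _ _)) linear0.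
have q0 (z : int) : z < - M0%:Z -> q z = 0.
  move=> hz; rewrite /q hbu ?(lin0 (Yr _ _ _)) ?linear0 ?mulr0 //.
  by rewrite addrC -[z]opprK mulrNz; apply: hM0; rewrite ltrNr.
have r0' k (z : int) : z < - J%:Z -> rr k z = 0.
  by move=> hz; rewrite /rr (hJ _ _ (hNh k) hmv) // (lin0 (Yl _ _ _)) linear0.
have F12 x y : (forall z : int, p z != 0 -> x = z%:~R - al -> y = b + a%:~R - z%:~R -> False) ->
    F (YW B u (YW B v w y 0) x 0) = 0.
  move=> h; have [E|hxy] := eqVneq (x + y) (a%:~R + b - al); last first.
    by rewrite FE wt12 ?linear0.
  have [[z hz]|hz] := pselect (exists z : int, x + al = z%:~R); last first.
    by rewrite expo ?linear0 // => z; apply/eqP => hz'; apply: hz; exists z.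
  have ex : x = z%:~R - al by rewrite -hz addrK.
  have ey : y = b + a%:~R - z%:~R by rewrite -hz -[y](addKr x) E; ring.
  by have [pz|pz] := eqVneq (p z) 0; [rewrite ex ey|case: (h z)].
have F21 x y : (forall z : int, q z != 0 -> x = z%:~R - al -> y = b + a%:~R - z%:~R -> False) ->
    F (YW B v (YW B u w x 0) y 0) = 0.
  move=> h; have [E|hxy] := eqVneq (x + y) (a%:~R + b - al); last first.
    by rewrite FE wt21 ?linear0.
  have [[z hz]|hz] := pselect (exists z : int, x + al = z%:~R); last first.
    by rewrite expo ?(lin0 (Yr _ _ _)) ?linear0 // => z; apply/eqP => hz'; apply: hz; exists z.
  have ex : x = z%:~R - al by rewrite -hz addrK.
  have ey : y = b + a%:~R - z%:~R by rewrite -hz -[y](addKr x) E; ring.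
  have [|pz] := eqVneq (q z) 0; last by case: (h z).
  by rewrite ex ey => /eqP; rewrite mulf_eq0 signr_eq0 => /eqP.
have rc_exp (tau : R) n' : rc (expR tau) ^+ n' = cexp (rc tau * n'%:R).
  by rewrite rc_expR cexpMn.
have cc (tau : R) (x y : C) :
    x * cexp (al * rc tau) * (cexp (- al * rc tau) * y) = x * y.
  by rewrite -mulrA [_ * (_ * y)]mulrA -cexpD mulNr subrr cexp0 mul1r.
have Hp (n' : nat) : (forall z : int, n'%:Z < z -> p z = 0) -> forall tau : R,
    0 < tau -> psum (fun k => p (n'%:Z - k%:Z)) (rc (expR (- tau)))
      (rc (expR (- tau)) ^+ n' * (e tau / (rc (expR tau) - 1) ^+ t)).
  move=> hp tau tau0.
  have h := csumZ (rc (expR (- tau)) ^+ n' * cexp (al * rc tau)) (D12 _ tau0).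
  rewrite cc in h.
  apply: (csum_psum (e := fun k : nat => ((n'%:Z - k%:Z)%:~R - al : C,
    b + a%:~R - (n'%:Z - k%:Z)%:~R : C))) h => [k k' []|[x y] hxy|k] /=.
  - by move/addIr/int_inj_C => E _; lia.
  - rewrite F12 ?mulr0 // => z pz ex ey.
    have hz : z <= n'%:Z by rewrite leNgt; apply/negP => /hp E; rewrite E eqxx in pz.
    apply: (hxy (absz (n'%:Z - z))); rewrite gez0_abs ?subr_ge0 // opprB addrCA subrr addr0.
    by rewrite ex ey.
  - rewrite -/(p _) mulrA mulrC; congr (_ * _).
    by rewrite !rc_exp -!cexpD; congr cexp; rewrite rmorphB rmorphN /=
      -[n'%:Z%:~R]/(n'%:R) -[k%:Z%:~R]/(k%:R); ring.
have Hq (tau : R) : tau < 0 -> psum (fun k => q (- M0%:Z + k%:Z)) (rc (expR tau))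
      (rc (expR tau) ^+ M0 * (e tau / (rc (expR tau) - 1) ^+ t)).
  move=> tau0.
  have h := csumZ (rc (expR tau) ^+ M0 * cexp (al * rc tau)) (D21 _ tau0).
  rewrite cc in h.
  apply: (csum_psum (e := fun k : nat => ((- M0%:Z + k%:Z)%:~R - al : C,
    b + a%:~R - (- M0%:Z + k%:Z)%:~R : C))) h => [k k' []|[x y] hxy|k] /=.
  - by move/addIr/int_inj_C => E _; lia.
  - rewrite F21 ?mulr0 // => z pz ex ey.
    have hz : - M0%:Z <= z by rewrite leNgt; apply/negP => /q0 E; rewrite E eqxx in pz.
    apply: (hxy (absz (z + M0%:Z))); rewrite gez0_abs; last by lia.
    by rewrite [z + _]addrC addKr ex ey.
  - rewrite -/(q _) mulrA mulrC; congr (_ * _).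
    by rewrite !rc_exp -!cexpD; congr cexp; rewrite rmorphD rmorphN /=
      -[M0%:Z%:~R]/(M0%:R) -[k%:Z%:~R]/(k%:R); ring.
have Hr k : (k < r)%N -> forall x : R, 0 < x < 1 ->
    psum (fun j => rr k (- J%:Z + j%:Z)) (rc x)
      (rc x ^+ J * ((D k).1 (ln (1 + x)) / rc x ^+ (D k).2)).
  move=> _ x hx; have [_ _ _ h3] := hD k; have h := csumZ (rc x ^+ J) (h3 _ hx).
  have x0 : rc x != 0 by rewrite -[0]/(rc 0) (inj_eq (@complexI R)); case/andP: hx => /lt0r_neq0.
  apply: (csum_psum (e := fun j : nat => (- J%:Z + j%:Z : int,
    b + a%:~R - al - (- J%:Z + j%:Z)%:~R : C))) h => [j j' []|[z y] hxy|j] /=.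
  - by move=> E _; lia.
  - suff -> : F (YW B (YV A (iter k N u) v z) w y 0) = 0 by rewrite mul0r mulr0.
    have [hz|hz] := ltP z (- J%:Z).
      by rewrite (hJ _ _ (hNh k) hmv) // (lin0 (Yl _ _ _)) linear0.
    rewrite FE wt0 ?linear0 //; apply/eqP => E.
    apply: (hxy (absz (z + J%:Z))); rewrite gez0_abs; last by lia.
    rewrite [z + _]addrC addKr; congr pair; rewrite -[y](addKr z%:~R) E; ring.
  - rewrite -/(rr _ _) mulrCA; congr (_ * _).
    by rewrite -[rc x ^+ J]/(rc x ^ J%:Z) -expfzDr // addrA subrr add0r.
have Hr' (x : R) : 0 < x < 1 -> rc x ^+ t * \sum_(k < r) plog al k x *
    (rc x ^+ J * ((D k).1 (ln (1 + x)) / rc x ^+ (D k).2)) =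
    rc x ^+ J * e (ln (1 + x)).
  move=> /andP[x0 x1]; have xC : rc x != 0.
    by rewrite -[0]/(rc 0) (inj_eq (@complexI R)) lt0r_neq0.
  rewrite /e lnK ?posrE; last by lra.
  have -> : rc (1 + x) - 1 = rc x by rewrite rmorphD /= addrC addKr.
  rewrite !mulr_sumr; apply: eq_bigr => k _; rewrite /plog.
  have := subnK (tD k (ltn_ord k)); set m := (t - _)%N => <-.
  have mk : rc x ^+ (D k).2 != 0 by rewrite expf_neq0.
  have fk : k`!%:R != 0 :> C by rewrite pnatr_eq0 -lt0n fact_gt0.
  rewrite exprD; field; by rewrite fk mk.
have := expansions_delta_uniform p0 q0 r0' ee Hp Hq Hr Hr' hK.
move=> /eqP; rewrite -subr_eq0 => /eqP <-.
apply/eqP; rewrite /X [F _](linearB F) [F (_ - _)](linearB F) scalarZ !(linear_sum F) /=. congr (_ - _ - _).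
- apply: eq_bigr => k _; rewrite scalarZ /p; congr (_ * F (YW B u (YW B v w _ 0) _ 0)).
    by rewrite rmorphD /= -[k%:Z%:~R]/(k%:R); ring.
  by rewrite rmorphD.
- apply: eq_bigr => k _; rewrite linear_sum; apply: eq_bigr => k' _.
  rewrite scalarZ /rr; congr (_ * F (YW B _ w _ 0)).
  by rewrite rmorphB /= -[k%:Z%:~R]/(k%:R); ring.
- rewrite mulr_sumr; apply: eq_bigr => k _; rewrite scalarZ /q mulrCA.
  congr (_ * (_ * F (YW B v (YW B u w _ 0) _ 0))).
    by rewrite rmorphB rmorphN /= -[k%:Z%:~R]/(k%:R); ring.
  by rewrite rmorphB rmorphN /= -[k%:Z%:~R]/(k%:R); ring.
Qed.

End Core.

Section LinearSums.
Variables (K : fieldType) (M N : lmodType K).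
Lemma linear_fsum (I : Type) (r : seq I) (P : pred I) (f : I -> M -> N) :
  (forall i, linear (f i)) -> linear (fun x => \sum_(i <- r | P i) f i x).
Proof.
move=> h c x y; rewrite scaler_sumr -big_split; apply: eq_bigr => i _.
exact: h.
Qed.
Lemma linear_fscale (a : K) (f : M -> N) : linear f -> linear (fun x => a *: f x).
Proof. by move=> h c x y; rewrite h scalerDr !scalerA mulrC. Qed.
Lemma linear_fsub (f h : M -> N) : linear f -> linear h ->
  linear (fun x => f x - h x).
Proof. by move=> hf hh c x y; rewrite hf hh scalerBr opprD addrACA. Qed.
End LinearSums.

Section CoreGeneral.
Variables (R : realType) (V W : lmodType R[i]) (A : vsa V) (hA : is_vsa A).
Variables (g : {linear V -> V}) (hg : is_automorphism A g).
Variables (B : twmod V W) (hB : is_twmod A g B) (hlb : lower_bounded B).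
Local Notation C := R[i].
Local Notation vhom m := (gsub (Vgr A) [set m]).
Local Notation N := (NV g).

Let Yl w a k : linear (fun u => YW B u w a k) := YW_linear_l hB w a k.
Let Yr u a k : linear (fun w => YW B u w a k) := YW_linear_r hB u a k.
Let Nl : linear N := N_linear hA hg.

(** The three terms of the log-free identity: coefficients in products of
    u and v acting one after the other, in the iterate, and in the opposite
    product. *)
Definition coreA (al : C) (a : int) (b : C) K u v w : W :=
  \sum_(q < K) cbinom (a + q%:Z)%:~R q *:
     YW B u (YW B v w (b - q%:R) 0) (a%:~R + q%:R - al) 0.
Definition coreB (al : C) (a : int) (b : C) K u v w : W :=
  \sum_(j < K) \sum_(i < K) (bp al j)`_i *:
     YW B (YV A (iter i N u) v (a - j%:Z)) w (b - al + j%:R) 0.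
Definition coreC (al : C) (a : int) (b : C) K u v w : W :=
  \sum_(k < K) ((-1) ^ (a + 1 + k%:Z) * cbinom (-1 - a%:~R) k) *:
     YW B v (YW B u w (- al - k%:R - 1) 0) (b + a%:~R + 1 + k%:R) 0.
Definition coreD (s : C) al a b K u v w : W :=
  coreA al a b K u v w - coreB al a b K u v w - s *: coreC al a b K u v w.

Lemma coreD_linear_u s al a b K v w : linear (fun u => coreD s al a b K u v w).
Proof.
apply: linear_fsub; first apply: linear_fsub.
- by apply: linear_fsum => q; apply: linear_fscale => c x y; rewrite Yl.
- apply: linear_fsum => j; apply: linear_fsum => i; apply: linear_fscale => c x y.
  by rewrite (linear_iter i Nl) (YV_linear_l hA) Yl.
- apply: linear_fscale; apply: linear_fsum => k; apply: linear_fscale => c x y.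
  by rewrite Yl Yr.
Qed.

Lemma coreD_linear_v s al a b K u w : linear (fun v => coreD s al a b K u v w).
Proof.
apply: linear_fsub; first apply: linear_fsub.
- by apply: linear_fsum => q; apply: linear_fscale => c x y; rewrite Yl Yr.
- apply: linear_fsum => j; apply: linear_fsum => i; apply: linear_fscale => c x y.
  by rewrite (YV_linear_r hA) Yl.
- by apply: linear_fscale; apply: linear_fsum => k; apply: linear_fscale => c x y;
    rewrite Yl.
Qed.

Lemma coreD_linear_w s al a b K u v : linear (coreD s al a b K u v).
Proof.
apply: linear_fsub; first apply: linear_fsub.
- by apply: linear_fsum => q; apply: linear_fscale => c x y; rewrite !Yr.
- by apply: linear_fsum => j; apply: linear_fsum => i; apply: linear_fscale => c x y;
    rewrite Yr.
- by apply: linear_fscale; apply: linear_fsum => k; apply: linear_fscale => c x y;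
    rewrite !Yr.
Qed.

Lemma eventually_grading_ind (M : lmodType C) (I : choiceType) (G : grading I M)
  (f : nat -> M -> W) : (forall K, linear (f K)) -> forall x,
  (forall i, exists K0, forall K, (K0 <= K)%N -> f K (G i x) = 0) ->
  exists K0, forall K, (K0 <= K)%N -> f K x = 0.
Proof.
move=> fl; apply: (@grading_ind _ _ _ G (fun x =>
  exists K0, forall K, (K0 <= K)%N -> f K x = 0)).
  by exists 0%N => K _; exact: lin0.
move=> x y [K0 h] [K1 h']; exists (maxn K0 K1) => K; rewrite geq_max => /andP[k0 k1].
by rewrite (linD (fl K)) h // h' // addr0.
Qed.

Lemma parV_proj s m u : parV A s u -> parV A s (Vgr A m u).
Proof.
move=> hu i hi; have [e|ne] := eqVneq i m; last by rewrite gproj_diff.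
by rewrite -e gproj_same hu.
Qed.

(** Both sides are linear in u, v, w, so homogeneous vectors suffice; the
    projections to weight spaces preserve eigenvalue and parity. *)
Lemma core_identity su sv al u v w (a : int) (b : C) :
  Vtw g al u -> parV A su u -> parV A sv v ->
  exists K0, forall K, (K0 <= K)%N ->
    coreA al a b K u v w - coreB al a b K u v w =
    (-1) ^+ (su && sv) *: coreC al a b K u v w.
Proof.
move=> hu hsu hsv.
suff [K0 h] : exists K0, forall K, (K0 <= K)%N ->
    coreD ((-1) ^+ (su && sv)) al a b K u v w = 0.
  by exists K0 => K /h /eqP; rewrite subr_eq0 => /eqP.
apply: (eventually_grading_ind (G := Vgr A)
  (f := fun K u => coreD _ al a b K u v w)) => [K|mu]; first exact: coreD_linear_u.
apply: (eventually_grading_ind (G := Vgr A)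
  (f := fun K v => coreD _ al a b K _ v w)) => [K|mv]; first exact: coreD_linear_v.
apply: (eventually_grading_ind (G := Wgr B)
  (f := fun K w => coreD _ al a b K _ _ w)) => [K|i]; first exact: coreD_linear_w.
have [K0 h] := @core_identity_hom _ _ _ _ hA _ hg _ hB hlb mu mv su sv al (Vgr A mu u) (Vgr A mv v)
  i.1.1 (Wgr B i w) a b (gen_proj hg mu hu) (@gsub_proj _ _ _ _ [set mu] mu u erefl) (parV_proj _ hsu)
  (@gsub_proj _ _ _ _ [set mv] mv v erefl) (parV_proj _ hsv) (Wwt_proj _ _).
by exists K0 => K hK; apply/eqP; rewrite subr_eq0; apply/eqP/h.
Qed.

End CoreGeneral.

(** * Binomial and exponential identities *)

Section BinomialIdentities.
Variable R : realType.
Local Notation C := R[i].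

Lemma cbinom_vandermonde (x y : C) j :
  \sum_(i < j.+1) cbinom x i * cbinom y (j - i) = cbinom (x + y) j.
Proof.
elim: j => [|j IH]; first by rewrite big_ord1 !cbinom0 mulr1.
apply: (mulfI (natS_neq0 C j)); rewrite cbinomS -IH !mulr_sumr.
pose s i := i%:R * (cbinom x i * cbinom y (j.+1 - i)) : C.
pose t i := (j.+1 - i)%:R * (cbinom x i * cbinom y (j.+1 - i)) : C.
rewrite (eq_bigr (fun i : 'I_j.+2 => s i + t i)); last first.
  move=> i _; rewrite /s /t -mulrDl -natrD subnKC // -ltnS; exact: ltn_ord.
rewrite big_split /= big_ord_recl {1}/s mul0r add0r [X in _ + X]big_ord_recr /=.
rewrite {2}/t subnn mul0r addr0 -big_split; apply: eq_bigr => i _ /=.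
rewrite /s /t /bump /= add1n subSS subSn -1?ltnS //.
have -> : (i.+1)%:R * (cbinom x i.+1 * cbinom y (j - i)) =
    (x - i%:R) * (cbinom x i * cbinom y (j - i)) by rewrite mulrA cbinomS mulrA.
have -> : (j - i).+1%:R * (cbinom x i * cbinom y (j - i).+1) =
    (y - (j - i)%:R) * (cbinom x i * cbinom y (j - i)).
  by rewrite mulrCA cbinomS mulrCA.
rewrite -mulrDl; congr (_ * _); rewrite natrB -1?ltnS //; ring.
Qed.

Lemma bp_eval (n x : C) j : (bp n j).[x] = cbinom (n + x) j.
Proof.
rewrite /bp /cbinom hornerZ horner_prod mulrC; congr (_ / _).
by apply: eq_bigr => i _; rewrite hornerD hornerX hornerC; ring.
Qed.

Lemma poly_nat_eq (p q : {poly C}) : (forall k : nat, p.[k%:R] = q.[k%:R]) -> p = q.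
Proof.
move=> h; apply/eqP; rewrite -subr_eq0; apply/eqP.
apply: (@roots_geq_poly_eq0 _ _ [seq k%:R | k <- iota 0 (size (p - q))]).
- by apply/allP => _ /mapP [k _ ->]; rewrite rootE !hornerE h subrr.
- rewrite map_inj_uniq ?iota_uniq // => i j /eqP.
  by rewrite eqr_nat => /eqP.
- by rewrite size_map size_iota.
Qed.

(** The logarithmic derivative of (1 + t) ^ (n + X) is log (1 + t). *)
Lemma bp_deriv (n : C) j :
  (bp n j)^`() = \sum_(i < j.+1) (bp (0 : C) i)`_1 *: bp n (j - i).
Proof.
pose e i : C := (bp (0 : C) i)`_1.
have eS i : i.+1%:R * e i.+1 = (-1) ^+ i.
  by rewrite /e bp_coef1 mulrC divfK // natS_neq0.
have e0 : e 0%N = 0 by rewrite /e bp_coef1.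
rewrite -/(e _); elim: j => [|j IH].
  by rewrite bp0 big_ord1 -/(e _) e0 scale0r derivC.
have n0 := natS_neq0 C j.
apply: (scalerI n0); rewrite -derivZ bpS' derivM derivD derivX derivC addr0 mul1r IH.
have stepE i : (i < j.+1)%N -> ('X + (n - j%:R)%:P) * (e i *: bp n (j - i)) =
    ((j.+1 - i)%:R * e i) *: bp n (j.+1 - i) - (i%:R * e i) *: bp n (j - i).
  move=> hi; have -> : (j.+1 - i = (j - i).+1)%N by rewrite subSn.
  have -> : ((j - i).+1%:R * e i) *: bp n (j - i).+1 =
      e i *: (('X + (n - (j - i)%:R)%:P) * bp n (j - i)).
    by rewrite -bpS' [RHS]scalerA [e i * _]mulrC.
  rewrite -scalerAr [i%:R * _]mulrC -[(e i * i%:R) *: _]scalerA -scalerBr.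
  congr (_ *: _); rewrite -mul_polyC -mulrBl; congr (_ * _).
  by rewrite natrB -1?ltnS // -addrA -rmorphB /=; congr (_ + _%:P); ring.
rewrite mulr_sumr (eq_bigr _ (fun i _ => stepE _ (ltn_ord i))) big_split /= sumrN.
rewrite scaler_sumr (eq_bigr (fun i : 'I_j.+2 => ((j.+1 - i)%:R * e i) *: bp n (j.+1 - i) +
    (i%:R * e i) *: bp n (j.+1 - i))); last first.
  by move=> i _; rewrite scalerA -scalerDl -mulrDl -natrD subnK // -ltnS.
rewrite big_split /= [X in _ = X + _]big_ord_recr /= subnn mul0r scale0r addr0.
rewrite addrCA; congr (_ + _).
rewrite [X in _ - X]big_ord_recl [X in _ = X]big_ord_recl /= !mul0r !scale0r !add0r.
under [X in _ - X]eq_bigr => i _ do rewrite eS.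
under [X in _ = X]eq_bigr => i _ do rewrite eS.
rewrite [X in _ = X]big_ord_recl /= expr0 scale1r subSS subn0; congr (_ + _).
rewrite -sumrN; apply: eq_bigr => i _; rewrite /bump /= !add1n subSS.
by rewrite exprS mulN1r scaleNr.
Qed.

Lemma bp_coefS (n : C) j q : q.+1%:R * (bp n j)`_q.+1 =
  \sum_(i < j.+1) (bp (0 : C) i)`_1 * (bp n (j - i))`_q.
Proof.
have := congr1 (fun p : {poly C} => p`_q) (bp_deriv n j).
rewrite coef_deriv coef_sum => /esym E; rewrite mulr_natl -E.
by apply: eq_bigr => i _; rewrite coefZ.
Qed.

(** Chu-Vandermonde, with one upper index shifted by the polynomial variable. *)
Lemma bp_vandermonde (n a : C) Q :
  \sum_(j < Q.+1) bp n j * ((-1) ^+ (Q - j) *: bp (n - a - j%:R - 1) (Q - j)) =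
  (cbinom (a + Q%:R) Q)%:P.
Proof.
apply: poly_nat_eq => k; rewrite hornerC horner_sum.
have -> : a + Q%:R = n + k%:R + (a - n - k%:R + Q%:R) by ring.
rewrite -cbinom_vandermonde; apply: eq_bigr => j _.
rewrite hornerM bp_eval hornerZ bp_eval; congr (_ * _).
have -> : n - a - j%:R - 1 + k%:R = - (a - n - k%:R + j%:R + 1) by ring.
rewrite cbinomN signrMK; congr cbinom; rewrite natrB -1?ltnS //; ring.
Qed.

End BinomialIdentities.

Section DividedPowers.
Variables (K : numFieldType).
Local Notation fi k := ((k`!%:R : K)^-1).

Lemma fi_bin r k : (k <= r)%N -> fi r * 'C(r, k)%:R = fi k * fi (r - k).
Proof.
move=> hk; have f0 n : n`!%:R != 0 :> K by rewrite pnatr_eq0 -lt0n fact_gt0.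
rewrite -(bin_fact hk) !natrM; field.
by rewrite !f0 /= pnatr_eq0 -lt0n bin_gt0 hk.
Qed.

Lemma iter_leibniz (S : lmodType K) (T : S -> S) (G : nat -> nat -> S) :
  linear T -> (forall i j, T (G i j) = G i.+1 j + G i j.+1) -> forall r i j,
  fi r *: iter r T (G i j) =
  \sum_(k < r.+1) (fi k * fi (r - k)) *: G (i + k)%N (j + (r - k))%N.
Proof.
move=> Tl hG r i j.
have h : iter r T (G i j) = \sum_(k < r.+1) 'C(r, k)%:R *: G (i + k)%N (j + (r - k))%N.
  elim: r i j => [|r IH] i j; first by rewrite big_ord1 scale1r !addn0.
  rewrite iterSr hG (linD (linear_iter r Tl)) !IH [in RHS]big_ord_recl.
  rewrite [X in _ + X = _]big_ord_recl !bin0 !subn0 !addn0 addSnnS addrCA.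
  congr (_ + _); under [X in _ = X]eq_bigr => k _ do
    rewrite /= /bump /= add1n binS natrD scalerDl subSS.
  rewrite big_split /= [X in _ = X + _]big_ord_recr /= bin_small // scale0r addr0.
  rewrite addrC; congr (_ + _); apply: eq_bigr => k _; rewrite ?addSnnS //.
  by rewrite /bump /= add1n subnSK.
rewrite h scaler_sumr; apply: eq_bigr => k _.
by rewrite scalerA fi_bin // -ltnS.
Qed.

(** e^{L} e^{-L} = 1, in divided powers. *)
Lemma exp_cancel_seq (S : lmodType K) (f : nat -> S) r : (0 < r)%N ->
  (forall n, (r <= n)%N -> f n = 0) ->
  \sum_(i < r) fi i *: \sum_(k < r) ((-1) ^+ k * fi k) *: f (i + k)%N = f 0%N.
Proof.
move=> r0 hf; under eq_bigr => i _ do rewrite scaler_sumr.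
rewrite (sum_square_antidiag (F := fun i k =>
  fi i *: (((-1) ^+ k * fi k) *: f (i + k)%N))); last first.
  by move=> i k /hf ->; rewrite !scaler0.
case: r r0 hf => // r _ hf; rewrite big_ord_recl [X in _ + X]big1 ?addr0; last first.
  move=> n _.
  rewrite (eq_bigr (fun i : 'I_(lift ord0 n).+1 =>
    (1 ^+ i / i`!%:R * ((-1) ^+ (lift ord0 n - i) / (lift ord0 n - i)`!%:R)) *:
    f (lift ord0 n))).
    by rewrite -scaler_suml sum_exp_pow subrr expr0n /= mul0r scale0r.
  by move=> i _; rewrite scalerA subnKC // ?expr1n ?mul1r // -ltnS.
by rewrite big_ord1 /= fact0 invr1 mulr1 !scale1r.
Qed.

Lemma iter_comm (S : Type) (f h : S -> S) n x : (forall x, f (h x) = h (f x)) ->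
  iter n f (h x) = h (iter n f x).
Proof. by move=> c; elim: n => //= n ->. Qed.

Lemma iter_comp_comm (S : Type) (f h : S -> S) n x : (forall x, f (h x) = h (f x)) ->
  iter n (fun x => f (h x)) x = iter n f (iter n h x).
Proof.
move=> c; elim: n => //= n ->; congr f.
by rewrite -iter_comm.
Qed.

Section Conjugation.
Variables (V S0 S : lmodType K) (D : V -> S0 -> S).
Variables (Nv : V -> V) (N0 : S0 -> S0) (N1 L : S -> S).
Hypotheses (Nvl : linear Nv) (N0l : linear N0) (N1l : linear N1) (Ll : linear L).
Hypotheses (Dl : forall x, linear (D^~ x)) (Dr : forall u, linear (D u)).
Hypothesis LN : forall z, L (N1 z) = N1 (L z).
Hypothesis ND : forall u x, N1 (D u x) = D (Nv u) x + D u (N0 x).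

(** Conjugation of [D] by [exp (L N)], where [N] acts as a derivation and [L] is
    central: exp (L N) D(u) exp (- L N) = D(exp (L N) u). *)
Lemma exp_conj ru rx r u x : iter ru Nv u = 0 -> iter rx N0 x = 0 ->
  (ru + rx < r)%N ->
  \sum_(i < r) fi i *: iter i (fun z => L (N1 z))
    (\sum_(s < r) ((-1) ^+ s * fi s) *: iter s L (D u (iter s N0 x))) =
  \sum_(i < r) fi i *: iter i L (D (iter i Nv u) x).
Proof.
move=> hu hx hr.
have Li n := linear_iter n Ll.
have step i s : fi i *: iter i N1 (iter s L (D u (iter s N0 x))) =
    \sum_(k < i.+1) (fi k * fi (i - k)) *:
      iter s L (D (iter k Nv u) (iter (s + (i - k)) N0 x)).
  rewrite (iter_leibniz (G := fun k m => iter s L (D (iter k Nv u) (iter m N0 x)))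
    N1l _ i 0 s) // => k m.
  by rewrite -iter_comm // ND (linD (Li _)).
pose F i m := fi i *: (fi m *: \sum_(s < r) ((-1) ^+ s * fi s) *:
  iter (i + (m + s)) L (D (iter i Nv u) (iter (m + s) N0 x))).
transitivity (\sum_(n < r) \sum_(i < n.+1) F i (n - i)%N).
  apply: eq_bigr => i _; rewrite iter_comp_comm //.
  rewrite (lin_sum (linear_iter _ N1l)) (lin_sum (Li _)) scaler_sumr.
  under eq_bigr => s _.
    rewrite (linZ (linear_iter _ N1l)) (linZ (Li _)) scalerA mulrC -scalerA.
    rewrite -(linZ (Li i)) step (lin_sum (Li i)); over.
  rewrite /=; under eq_bigr => s _ do rewrite scaler_sumr.
  rewrite exchange_big; apply: eq_bigr => k _ /=.
  rewrite /F !scaler_sumr; apply: eq_bigr => s _.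
  rewrite (linZ (Li i)) -iterD !scalerA mulrC.
  have hk : (k <= i)%N by rewrite -ltnS.
  congr (_ *: iter _ L (D _ (iter _ N0 x))); last by rewrite addnC.
  by rewrite addnA subnKC.
rewrite -sum_square_antidiag; last first.
  move=> i m him; rewrite /F big1 ?scaler0 // => s _.
  have [hi|hi] := leqP ru i.
    by rewrite (nilp_ge Nvl hu hi) (lin0 (Dl _)) (lin0 (Li _)) scaler0.
  rewrite (nilp_ge N0l hx) ?(lin0 (Dr _)) ?(lin0 (Li _)) ?scaler0 //.
  by apply: leq_trans (leq_addr _ _); lia.
apply: eq_bigr => i _; rewrite /F -scaler_sumr; congr (_ *: _).
rewrite (exp_cancel_seq (f := fun n => iter (i + n) L (D (iter i Nv u) (iter n N0 x)))).
- by rewrite addn0.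
- by apply: leq_ltn_trans hr.
- move=> n hn; rewrite (nilp_ge N0l hx) ?(lin0 (Dr _)) ?(lin0 (Li _)) //; lia.
Qed.

End Conjugation.

(** Splitting L = Lam + ell, where the dependence on [Lam] of the family [H] is
    exp (- Lam N). *)
Lemma exp_split (V S : lmodType K) (Nv : V -> V) (Lam ell : S -> S) (H H0 : V -> S)
  r u : linear Nv -> linear Lam -> linear ell -> H 0 = 0 -> H0 0 = 0 ->
  (forall z, Lam (ell z) = ell (Lam z)) -> (0 < r)%N -> iter r Nv u = 0 ->
  (forall i, H (iter i Nv u) =
    \sum_(k < r) ((-1) ^+ k * fi k) *: iter k Lam (H0 (iter (i + k) Nv u))) ->
  \sum_(i < r) fi i *: iter i (fun z => Lam z + ell z) (H (iter i Nv u)) =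
  \sum_(q < r) fi q *: iter q ell (H0 (iter q Nv u)).
Proof.
move=> Nl Ll el H00 H000 cm r0 hu hH.
have hz i : (r <= i)%N -> iter i Nv u = 0 by exact: nilp_ge.
pose F q p := fi q *: iter q ell (fi p *: iter p Lam (H (iter (q + p) Nv u))).
have Lil i := linear_iter i Ll; have eil i := linear_iter i el.
transitivity (\sum_(n < r) \sum_(q < n.+1) F q (n - q)%N).
  apply: eq_bigr => i _.
  have sl : linear (fun z => Lam z + ell z).
    by move=> c x y; rewrite Ll el scalerDr addrACA.
  have cm' j z : Lam (iter j ell z) = iter j ell (Lam z).
    by rewrite iter_comm // => ?; rewrite cm.
  rewrite (iter_leibniz (G := fun q p => iter q ell (iter p Lam (H (iter i Nv u))))
    sl _ i 0 0) => [|q p].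
    apply: eq_bigr => q _; rewrite /F (linZ (eil _)) scalerA !add0n.
    by rewrite subnKC // -ltnS.
  by rewrite cm' addrC.
rewrite -sum_square_antidiag; last first.
  move=> q p hqp; rewrite /F hz // H00 (lin0 (Lil _)) scaler0.
  by rewrite (lin0 (eil _)) scaler0.
apply: eq_bigr => q _; rewrite /F -scaler_sumr -(lin_sum (eil _)); congr (_ *: iter _ _ _).
under eq_bigr => p _.
  rewrite hH (lin_sum (Lil _)); under eq_bigr => k _ do
    rewrite (linZ (Lil _)) -iterD -addnA.
  over.
rewrite /= (exp_cancel_seq (f := fun n => iter n Lam (H0 (iter (q + n) Nv u)))) //.
  by rewrite addn0.
by move=> n hn; rewrite hz ?H000 ?(lin0 (Lil _)) //; apply: leq_trans (leq_addl _ _).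
Qed.

End DividedPowers.

(** * Formal series along lines *)

Section ShiftOperators.
Variables (R : realType) (S : lmodType R[i]) (sig : S -> S) (sl : linear sig).
Local Notation C := R[i].

(** The expansions of log (1 - s) and (1 - s) ^ n, truncated below s ^ J, at a
    shift operator s. *)
Definition ell J (f : S) : S :=
  \sum_(i < J) ((-1) ^+ i * (bp (0 : C) i)`_1) *: iter i sig f.
Definition pw J (n : C) (f : S) : S :=
  \sum_(i < J) ((-1) ^+ i * (bp n i)`_0) *: iter i sig f.

Let il i : linear (iter i sig) := linear_iter i sl.

Lemma ell_linear J : linear (ell J).
Proof. by apply: linear_fsum => i; apply: linear_fscale. Qed.
Lemma pw_linear J n : linear (pw J n).
Proof. by apply: linear_fsum => i; apply: linear_fscale. Qed.

Lemma comm_ell J (T : S -> S) f : linear T -> (forall z, T (sig z) = sig (T z)) ->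
  T (ell J f) = ell J (T f).
Proof.
move=> Tl c; rewrite /ell (lin_sum Tl); apply: eq_bigr => i _.
by rewrite (linZ Tl) -(iter_comm (f := sig)).
Qed.

Lemma iter_ell i J f : iter i sig (ell J f) =
  \sum_(k < J) ((-1) ^+ k * (bp (0 : C) k)`_1) *: iter (k + i) sig f.
Proof.
rewrite /ell (lin_sum (il i)); apply: eq_bigr => k _.
by rewrite (linZ (il i)) addnC iterD.
Qed.

Lemma iter_ell0 J f : iter J sig f = 0 -> iter J sig (ell J f) = 0.
Proof.
move=> hf; rewrite iter_ell big1 // => i _.
by rewrite (nilp_ge sl hf) ?scaler0 ?leq_addl.
Qed.

Lemma kappa_conv (n : C) q m : \sum_(i < m.+1)
    ((-1) ^+ (m - i) * (bp n (m - i))`_q * ((-1) ^+ i * (bp (0 : C) i)`_1)) =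
  q.+1%:R * ((-1) ^+ m * (bp n m)`_q.+1).
Proof.
rewrite mulrCA bp_coefS mulr_sumr; apply: eq_bigr => i _.
have -> : (-1) ^+ m = (-1) ^+ (m - i) * (-1) ^+ i :> C.
  by rewrite -exprD subnK // -ltnS.
ring.
Qed.

(** (1 - s) ^ n log (1 - s) ^ q / q! has coefficients (-1) ^ j (bp n j)_q. *)
Lemma pw_ell J n q f : iter J sig f = 0 ->
  (q`!%:R)^-1 *: pw J n (iter q (ell J) f) =
  \sum_(j < J) ((-1) ^+ j * (bp n j)`_q) *: iter j sig f.
Proof.
elim: q f => [|q IH] f hf; first by rewrite fact0 invr1 scale1r.
rewrite iterSr factS natrM invfM -scalerA IH ?iter_ell0 //.
have e j : ((-1) ^+ j * (bp n j)`_q) *: iter j sig (ell J f) =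
    \sum_(i < J) ((-1) ^+ j * (bp n j)`_q * ((-1) ^+ i * (bp (0 : C) i)`_1)) *:
       iter (i + j) sig f.
  by rewrite iter_ell scaler_sumr; apply: eq_bigr => i _; rewrite scalerA.
rewrite (eq_bigr _ (fun j _ => e _)) exchange_big /=.
rewrite (sum_square_antidiag (F := fun i j =>
  ((-1) ^+ j * (bp n j)`_q * ((-1) ^+ i * (bp (0 : C) i)`_1)) *: iter (i + j) sig f)).
  rewrite scaler_sumr; apply: eq_bigr => m _.
  rewrite (eq_bigr (fun i : 'I_m.+1 =>
    ((-1) ^+ (m - i) * (bp n (m - i))`_q * ((-1) ^+ i * (bp (0 : C) i)`_1)) *:
    iter m sig f)).
    by rewrite -scaler_suml kappa_conv scalerA mulKf // natS_neq0.
  by move=> i _; rewrite subnKC // -ltnS.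
by move=> i j hij; rewrite (nilp_ge sl hf) ?scaler0.
Qed.

End ShiftOperators.

(** A series in x1 and x2 restricted to the exponents b0 - j of x2, with j a natural
    number; the arguments are j, the exponent of x1 and the exponents of the
    logarithms. *)
Definition lines (R : realType) (M : Type) : Type := nat -> R[i] -> nat -> nat -> M.
HB.instance Definition _ (R : realType) (M : lmodType R[i]) :=
  GRing.Lmodule.copy (lines R M) (nat -> R[i] -> nat -> nat -> M).

Section Lines.
Variables (R : realType) (M : lmodType R[i]).
Local Notation C := R[i].
Local Notation S := (lines R M).

Lemma line_ext (f h : S) : (forall j a k l, f j a k l = h j a k l) -> f = h.
Proof. by move=> e; do 4 apply/funext => ?; exact: e. Qed.

Lemma line_sumE I (r : seq I) (P : pred I) (f : I -> S) j a k l :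
  (\sum_(i <- r | P i) f i) j a k l = \sum_(i <- r | P i) f i j a k l.
Proof. by elim/big_rec2 : _ => // i x y _ <-. Qed.

Lemma lines_add (f h : S) j a k l : (f + h) j a k l = f j a k l + h j a k l.
Proof. by []. Qed.
Lemma lines_scale (c : C) (f : S) j a k l : (c *: f) j a k l = c *: f j a k l.
Proof. by []. Qed.
Lemma lines_zero j a k l : (0 : S) j a k l = 0.
Proof. by []. Qed.
Definition linesE := (lines_add, lines_scale, lines_zero).

Definition tau (f : S) : S := fun j a k l => if k is k'.+1 then f j a k' l else 0.
Definition sig (f : S) : S := fun j a k l => f j.+1 (a + 1) k l.
Definition Lam (c : C) (f : S) : S := tau f + c *: f.

Lemma tau_linear : linear tau.
Proof. by move=> c f h; apply: line_ext => j a [|k] l //=; rewrite /= !linesE /= ?scaler0 ?addr0. Qed.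
Lemma sig_linear : linear sig. Proof. by []. Qed.
Lemma Lam_linear c : linear (Lam c).
Proof.
move=> x f h; rewrite /Lam tau_linear !scalerDr addrACA.
by rewrite !scalerA [c * x]mulrC.
Qed.

Lemma tau_sig f : tau (sig f) = sig (tau f).
Proof. by apply: line_ext => j a [|k] l. Qed.
Lemma Lam_sig c f : Lam c (sig f) = sig (Lam c f).
Proof. by rewrite /Lam tau_sig. Qed.

Lemma iter_sigE i f j a k l : iter i sig f j a k l = f (j + i)%N (a + i%:R) k l.
Proof.
elim: i j a => [|i IH] j a; first by rewrite addn0 addr0.
by rewrite iterS /sig IH addSnnS -natr1 addrAC addrA.
Qed.

End Lines.

Lemma fsum0 (I : choiceType) (M : zmodType) (f : I -> M) : (forall i, f i = 0) ->
  \sum_(i \in [set: I]) f i = 0.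
Proof. by move=> h; rewrite (fsumE (s := [::])) ?big_nil. Qed.

Section LogSeries.
Variables (R : realType).
Local Notation C := R[i].

(** log (x1 - x2) + c, so that log (- x2 + x1) is the instance c = pi i with the
    variables exchanged. *)
Definition log12c (c : C) : fs2 R C^o :=
  fun a b k l => log12 a b k l + c *: mono 0 0 0 0 a b k l.

Lemma nat_inj_C (i j : nat) : i%:R = j%:R :> C -> i = j.
Proof. by move/eqP; rewrite eqr_nat => /eqP. Qed.

Lemma log12_tail (a b : C) k l :
  (forall i : nat, a = - i.+1%:R -> b = i.+1%:R -> k = 0%N -> l = 0%N -> False) ->
  \sum_(j \in [set: nat])
    (j.+1%:R)^-1 *: (mono (- j.+1%:R) j.+1%:R 0 0 a b k l : C^o) = 0.
Proof.
move=> h; apply: fsum0 => i; rewrite /mono; case: eqP => [ea|] /=; last by rewrite scaler0.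
case: eqP => [eb|] /=; last by rewrite scaler0.
case: eqP => [ek|] /=; last by rewrite scaler0.
case: eqP => [el|] /=; last by rewrite scaler0.
by case: (h i).
Qed.

Lemma log12c_coef c (i k l : nat) : log12c c (- i%:R) i%:R k l =
  ((k == 0%N) && (l == 0%N))%:R *
    ((-1) ^+ i * (bp (0 : C) i)`_1 + (i == 0%N)%:R * c) +
  ((k == 1%N) && (l == 0%N) && (i == 0%N))%:R.
Proof.
rewrite /log12c /log12 bp_coef1; case: i => [|i].
  rewrite log12_tail => [|i _ /esym/eqP]; last by rewrite pnatr_eq0.
  rewrite !oppr0 addr0 /mono !eqxx /= mulr0 add0r mul1r andbT addrC.
  by rewrite -[c *: _]/(c * _) mulrC.
have i0 : (i.+1%:R == 0 :> C) = false by rewrite pnatr_eq0.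
rewrite /mono oppr_eq0 i0 /= sub0r andbF addr0 mul0r addr0.
rewrite -[c *: _]/(c * _) mulr0 addr0.
have [/andP[/eqP -> /eqP ->]|kl] := boolP ((k == 0%N) && (l == 0%N)).
  rewrite (fsum_at (i0 := i)) => [|j ji].
    by rewrite !eqxx /= mul1r -[_ *: _]/(_ * _) mulr1 mulrA -exprD addSn addnn exprS
      -signr_odd odd_double mulr1 mulN1r.
  rewrite (inj_eq oppr_inj) eqr_nat eqSS; case: eqP => [E|]; last by rewrite scaler0.
  by case: ji.
rewrite -[X in - X = _]/(\sum_(j \in [set: nat]) (j.+1%:R)^-1 *:
   (mono (- j.+1%:R) j.+1%:R 0 0 (- i.+1%:R) i.+1%:R k l : C^o)).
rewrite log12_tail ?oppr0 ?mul0r // => j _ _ ek el.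
by move: kl; rewrite ek el.
Qed.

Lemma log12c_supp c (a b : C) k l : log12c c a b k l <> 0 ->
  exists i : nat, a = - i%:R /\ b = i%:R.
Proof.
move=> h; apply: contrapT => nex; apply: h; rewrite /log12c /log12 log12_tail.
  have n0 : (a == 0) && (b == 0) = false.
    apply/negP => /andP[/eqP ea /eqP eb]; apply: nex; exists 0%N.
    by rewrite ea eb oppr0.
  by rewrite /mono n0 /= subr0 scaler0 addr0.
by move=> i ea eb _ _; apply: nex; exists i.+1.
Qed.

Lemma pow12_coef n (i k l : nat) : pow12 n (n - i%:R : C) i%:R k l =
  ((k == 0%N) && (l == 0%N))%:R * ((-1) ^+ i * (bp n i)`_0).
Proof.
rewrite /pow12 (fsum_at (i0 := i)) => [|j ji].
  by rewrite /mono !eqxx /= -bp_coef0_cbinom [RHS]mulrC.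
rewrite /mono [i%:R == _]eqr_nat; case: eqP => [_ /=|]; last by rewrite scaler0.
by case: eqP => [E|_]; [case: ji|rewrite /= scaler0].
Qed.

Lemma pow12_supp n (a b : C) k l : pow12 n a b k l <> 0 ->
  exists i : nat, a = n - i%:R /\ b = i%:R.
Proof.
move=> h; apply: contrapT => nex; apply: h; apply: fsum0 => i; rewrite /mono.
case: eqP => [ea /=|]; last by rewrite scaler0.
case: eqP => [eb /=|]; last by rewrite scaler0.
by case: nex; exists i.
Qed.

End LogSeries.

Section LogAction.
Variables (R : realType) (M : lmodType R[i]).
Local Notation C := R[i].
Local Notation S := (lines R M).

Definition line (b0 : C) (F : fs2 R M) : S := fun j a k l => F a (b0 - j%:R) k l.
(** Series with finitely many powers of x2 on the given line: on them
    log(x1 - x2) and (x1 - x2)^n act by finite sums. *)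
Definition short J (f : S) : Prop := forall j a k l, (J <= j)%N -> f j a k l = 0.

Lemma sum_first2 (f : nat -> nat -> M) k l (z x y : C) :
  (\sum_(k' < k.+1) \sum_(l' < l.+1)
    (((k' == 0 :> nat) && (l' == 0 :> nat))%:R * x +
     ((k' == 1 :> nat) && (l' == 0 :> nat))%:R * y) *: f (k - k')%N (l - l')%N) =
  x *: f k l + (if k is k'.+1 then y *: f k' l else 0).
Proof.
have e (k' : nat) : \sum_(l' < l.+1)
    (((k' == 0) && (l' == 0 :> nat))%:R * x +
     ((k' == 1) && (l' == 0 :> nat))%:R * y) *: f (k - k')%N (l - l')%N =
    ((k' == 0)%:R * x + (k' == 1)%:R * y) *: f (k - k')%N l.
  rewrite big_ord_recl /= !andbT subn0 big1 ?addr0 // => i _.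
  by rewrite /bump /= !andbF !mul0r addr0 scale0r.
rewrite (eq_bigr _ (fun k' _ => e _)) big_ord_recl /= mul1r mul0r addr0 subn0.
congr (_ + _); case: k {e} => [|k]; first by rewrite big_ord0.
rewrite big_ord_recl /= mul0r mul1r add0r subSS subn0 big1 ?addr0 // => i _.
by rewrite /bump /= !mul0r addr0 scale0r.
Qed.

Lemma C_natN_inj (i j : nat) : (- i%:R, i%:R) = (- j%:R, j%:R) :> C * C -> i = j.
Proof. by case=> _; exact: nat_inj_C. Qed.

(** On a short line multiplication by log(x1 - x2) = log x1 + log(1 - x2/x1) is
    the shift tau of the power of log x1 plus the logarithm of 1 - sig, where sig
    multiplies by x2/x1. *)
Lemma mul_log12c c J (F : fs2 R M) (a b : C) k l : (0 < J)%N ->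
  (forall j a' k' l', (J <= j)%N -> F a' (b - j%:R) k' l' = 0) ->
  fs2_mul (log12c c) F a b k l =
  (if k is k'.+1 then F a b k' l else 0) + c *: F a b k l +
  \sum_(i < J) ((-1) ^+ i * (bp (0 : C) i)`_1) *: F (a + i%:R) (b - i%:R) k l.
Proof.
move=> J0 hF; rewrite /fs2_mul.
rewrite (fsum_inj (n := J) (e := fun i : nat => (- i%:R, i%:R) : C * C)); first last.
- move=> [p q] hp; rewrite big1 // => k' _; rewrite big1 // => l' _ /=.
  have [->|/eqP/log12c_supp [i [ep eq]]] := eqVneq (log12c c p q k' l') 0.
    by rewrite scale0r.
  have [Ji|iJ] := leqP J i; first by rewrite eq hF ?scaler0.
  by case: (hp i iJ); rewrite ep eq.
- by move=> i j _ _; exact: C_natN_inj.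
rewrite (eq_bigr (fun i : 'I_J =>
    ((-1) ^+ i * (bp (0 : C) i)`_1 + (i == 0 :> nat)%:R * c) *:
       F (a + i%:R) (b - i%:R) k l +
    (if k is k'.+1 then (i == 0 :> nat)%:R *: F (a + i%:R) (b - i%:R) k' l else 0))).
  rewrite (eq_bigr (fun i : 'I_J =>
    ((-1) ^+ i * (bp (0 : C) i)`_1) *: F (a + i%:R) (b - i%:R) k l +
    (((i == 0 :> nat)%:R * c) *: F (a + i%:R) (b - i%:R) k l +
    (if k is k'.+1 then (i == 0 :> nat)%:R *: F (a + i%:R) (b - i%:R) k' l else 0)))).
    rewrite big_split /= addrC; congr (_ + _).
    case: J J0 {hF} => // J _; rewrite big_ord_recl big1 ?addr0 /=.
      by rewrite mul1r subr0 addrC; case: k => // k; rewrite scale1r.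
    by move=> i _; rewrite mul0r scale0r add0r; case: k => // k; rewrite scale0r.
  by move=> i _; rewrite scalerDl addrA.
move=> i _ /=; rewrite opprK.
rewrite -(sum_first2 (fun k l => F (a + i%:R) (b - i%:R) k l)) //.
apply: eq_bigr => k' _; apply: eq_bigr => l' _; congr (_ *: _).
by rewrite log12c_coef -natrM mulnb.
Qed.

Lemma mul_pow12 (c : C) n J (F : fs2 R M) (a b : C) k l :
  (forall j a' k' l', (J <= j)%N -> F a' (b - j%:R) k' l' = 0) ->
  fs2_mul (fun a b k l => c *: pow12 n a b k l) F a b k l =
  \sum_(i < J) (c * ((-1) ^+ i * (bp n i)`_0)) *: F (a - n + i%:R) (b - i%:R) k l.
Proof.
move=> hF; rewrite /fs2_mul.
rewrite (fsum_inj (n := J) (e := fun i : nat => (n - i%:R, i%:R) : C * C)); first last.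
- move=> [p q] hp; rewrite big1 // => k' _; rewrite big1 // => l' _ /=.
  have [->|/eqP/pow12_supp [i [ep eq]]] := eqVneq (pow12 n p q k' l') 0.
    by rewrite scaler0 scale0r.
  have [Ji|iJ] := leqP J i; first by rewrite eq hF ?scaler0.
  by case: (hp i iJ); rewrite ep eq.
- by move=> i j _ _ [] _; exact: nat_inj_C.
apply: eq_bigr => i _ /=; rewrite opprB addrA [a + i%:R - n]addrAC.
set x := c * _; rewrite -[RHS]addr0.
have -> : x *: F (a - n + i%:R) (b - i%:R) k l + 0 =
  x *: F (a - n + i%:R) (b - i%:R) k l +
  (if k is k'.+1 then (0 : C) *: F (a - n + i%:R) (b - i%:R) k' l else 0).
  by case: k => // k; rewrite scale0r.
rewrite -(sum_first2 (fun k l => F (a - n + i%:R) (b - i%:R) k l)) //.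
apply: eq_bigr => k' _; apply: eq_bigr => l' _; congr (_ *: _).
by rewrite pow12_coef mulr0 addr0 -[_ *: _]/(_ * _) mulrCA.
Qed.

Local Notation sg := (@sig R M).

Fact Lop_key : unit. Proof. by []. Qed.
Definition Lop : C -> nat -> S -> S :=
  locked_with Lop_key (fun c J z => Lam c z + ell sg J z).
Lemma LopE c J z : Lop c J z = Lam c z + ell sg J z.
Proof. by rewrite /Lop unlock. Qed.

Lemma short_line_log c J F b : (0 < J)%N -> short J (line b F) ->
  short J (line b (fs2_mul (log12c c) F)).
Proof.
move=> J0 hF j a k l hj; rewrite /line (mul_log12c c (J := J)) //.
  rewrite big1 => [|i _]; last first.
    have := hF (j + i)%N (a + i%:R) k l; rewrite /line natrD opprD addrA => ->.
      by rewrite scaler0.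
    by apply: leq_trans hj _; exact: leq_addr.
  have h k' := hF j a k' l hj; rewrite /line in h.
  by case: k => [|k]; rewrite !h scaler0 !addr0.
move=> i a' k' l' hi; have := hF (j + i)%N a' k' l'.
rewrite /line natrD opprD addrA => -> //.
by apply: leq_trans hj _; exact: leq_addr.
Qed.

Lemma line_log c J F b : (0 < J)%N -> short J (line b F) ->
  line b (fs2_mul (log12c c) F) = Lop c J (line b F).
Proof.
move=> J0 hF; apply: line_ext => j a k l.
rewrite {1}/line (mul_log12c c (J := J)) //; last first.
  move=> i a' k' l' hi; have := hF (j + i)%N a' k' l'.
  rewrite /line natrD opprD addrA => -> //.
  by apply: leq_trans hi _; exact: leq_addl.
rewrite LopE /Lam !linesE /ell line_sumE; congr (_ + _).
apply: eq_bigr => i _; rewrite !linesE iter_sigE /line natrD opprD addrA.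
by [].
Qed.

Lemma line_pow (c : C) n J F b j a k l : short J (line b F) ->
  line b (fs2_mul (fun a b k l => c *: pow12 n a b k l) F) j a k l =
  c *: pw sg J n (line b F) j (a - n) k l.
Proof.
move=> hF; rewrite {1}/line (mul_pow12 c n (J := J)); last first.
  move=> i a' k' l' hi; have := hF (j + i)%N a' k' l'.
  rewrite /line natrD opprD addrA => -> //.
  by apply: leq_trans hi _; exact: leq_addl.
rewrite /pw line_sumE scaler_sumr; apply: eq_bigr => i _.
by rewrite !linesE iter_sigE /line natrD opprD addrA scalerA.
Qed.

(** Coefficientwise application of a map. *)
Definition pt (P Q : Type) (f : P -> Q) (x : lines R P) : lines R Q := fun j a k l => f (x j a k l).

Lemma line_exp_iter c N J F b r : (0 < J)%N -> N 0 = 0 -> short J (line b F) ->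
  let G := iter r (fun G : fs2 R M => fs2_mul (log12c c)
     (fun a b k l => N (G a b k l))) F in
  short J (line b G) /\ line b G =
  iter r (fun f => Lop c J (pt N f)) (line b F).
Proof.
move=> J0 N0 hF; elim: r => [|r [IHs IHe]] //=.
set G := iter r _ F in IHs IHe *.
have hG : short J (line b (fun a b k l => N (G a b k l))).
  by move=> j a k l hj; have := IHs j a k l hj; rewrite /line => ->.
by split; [exact: short_line_log|rewrite (line_log c J0 hG) -IHe].
Qed.

Lemma line_exp c N J F b r : (0 < J)%N -> N 0 = 0 -> short J (line b F) ->
  (forall i, (r <= i)%N ->
    iter i (fun f => Lop c J (pt N f)) (line b F) = 0) ->
  line b (fs2_exp (log12c c) N F) = \sum_(i < r) (i`!%:R)^-1 *:
    iter i (fun f => Lop c J (pt N f)) (line b F).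
Proof.
move=> J0 N0 hF hr; apply: line_ext => j a k l; rewrite {1}/line /fs2_exp line_sumE.
have e i := (line_exp_iter c i J0 N0 hF).2.
have e' i := congr1 (fun f : S => f j a k l) (e i).
rewrite (fsum_nat (n := r)) => [|i hi].
  apply: eq_bigr => i _; exact: (congr1 (fun z => (i`!%:R)^-1 *: z) (e' i)).
by have := e' i; rewrite hr // /line => ->; rewrite scaler0.
Qed.

End LogAction.

Section Swap.
Variables (R : realType) (M : lmodType R[i]).
Local Notation C := R[i].

Lemma mul_swap s (F : fs2 R M) a b k l :
  fs2_mul (swap12 s) F a b k l = fs2_mul s (swap12 F) b a l k.
Proof.
rewrite /fs2_mul (reindex_fsbigT (fun p : C * C => (p.2, p.1))) /=; last first.
  by exists (fun p : C * C => (p.2, p.1)) => -[].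
by apply: eq_fsbigr => p _; rewrite exchange_big.
Qed.

(** Exchanging the variables turns the expansions in x1 of the second product
    into expansions in x2, so that one theory of lines serves both. *)
Lemma exp_swap s N (F : fs2 R M) a b k l :
  fs2_exp (swap12 s) N F a b k l = fs2_exp s N (swap12 F) b a l k.
Proof.
have swapE (G : fs2 R M) : fs2_mul (swap12 s) G = swap12 (fs2_mul s (swap12 G)).
  do 4 apply/funext => ?; exact: mul_swap.
have h r : iter r (fun G : fs2 R M => fs2_mul (swap12 s)
      (fun a b k l => N (G a b k l))) F =
    swap12 (iter r (fun G : fs2 R M => fs2_mul s
      (fun a b k l => N (G a b k l))) (swap12 F)).
  by elim: r => // r IH; rewrite !iterS IH swapE.
by rewrite /fs2_exp; apply: eq_fsbigr => r _; rewrite h.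
Qed.

Lemma log21E : @log21 R = swap12 (log12c (cpii R)).
Proof.
apply/funext => a; apply/funext => b; apply/funext => k; apply/funext => l.
rewrite /log21 /swap12 /log12c; congr (_ + _ *: _); rewrite /mono; congr (_%:R).
by case: (a == 0); case: (b == 0); case: (k == 0%N); case: (l == 0%N).
Qed.

Lemma pow21E n : @pow21 R n =
  swap12 (fun a b k l => cexp (cpii R * n) *: pow12 n a b k l).
Proof. by []. Qed.

End Swap.

(** * The product of the module and twist operators *)

Section LineOperators.
Variables (R : realType) (M : lmodType R[i]).
Local Notation C := R[i].
Local Notation S := (lines R M).
Local Notation sg := (@sig R M).

Lemma Lop_linear (c : C) J : linear (@Lop R M c J).
Proof.
move=> x f h; rewrite !LopE (Lam_linear c x f h).
by rewrite (ell_linear (@sig_linear R M) J x f h) [in RHS]scalerDr; exact: addrACA.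
Qed.

(** The lines that vanish outside a triangle; on them all sums over exponents are
    finite. *)
Definition tri J (f : S) : Prop :=
  forall j a k l, f j a k l <> 0 -> exists i : nat, a = - i%:R /\ (i + j < J)%N.

Lemma tri_short J f : tri J f -> short J f.
Proof.
move=> h j a k l hj; apply: contrapT => /h [i [_ hi]].
by move: hi; rewrite ltnNge (leq_trans hj) ?leq_addl.
Qed.

Lemma tri_lin J c f h : tri J f -> tri J h -> tri J (c *: f + h).
Proof.
move=> hf hh j a k l; rewrite !linesE => ne.
have [E|/eqP/hf //] := eqVneq (f j a k l) 0.
by apply: (hh j a k l) => E'; apply: ne; rewrite E E' scaler0 addr0.
Qed.

Lemma tri0 J : tri J 0. Proof. by []. Qed.

Lemma tri_scale J c f : tri J f -> tri J (c *: f).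
Proof. by move=> hf; rewrite -[_ *: _]addr0; apply: tri_lin => //; exact: tri0. Qed.

Lemma tri_add J f h : tri J f -> tri J h -> tri J (f + h).
Proof. by move=> hf hh; rewrite -[f]scale1r; exact: tri_lin. Qed.

Lemma tri_sum J n (f : 'I_n -> S) : (forall i, tri J (f i)) -> tri J (\sum_i f i).
Proof. by move=> h; elim/big_ind : _ => //; exact: tri_add. Qed.

Lemma tri_sig J f : tri J f -> tri J (sg f).
Proof.
move=> h j a k l /h [i [ea hi]]; exists i.+1; split; last by rewrite addSnnS.
by rewrite -[a](addrK 1) ea -natr1 opprD.
Qed.

Lemma tri_tau J f : tri J f -> tri J (tau f).
Proof. by move=> h j a [|k] l //= /h. Qed.

Lemma tri_Lop J c J' f : tri J f -> tri J (Lop c J' f).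
Proof.
move=> hf; rewrite !LopE /Lam /ell; apply: tri_add.
  by apply: tri_add; [exact: tri_tau|exact: tri_scale].
apply: tri_sum => i; apply: tri_scale; elim: (i : nat) => //= n; exact: tri_sig.
Qed.

Lemma tri_iter J c J' n f : tri J f -> tri J (iter n (Lop c J') f).
Proof. by move=> hf; elim: n => //= n; exact: tri_Lop. Qed.

Lemma short_add J (f h : S) : short J f -> short J h -> short J (f + h).
Proof. by move=> hf hh j a k l hj; rewrite !linesE hf // hh // addr0. Qed.
Lemma short_scale J c (f : S) : short J f -> short J (c *: f).
Proof. by move=> hf j a k l hj; rewrite !linesE hf // scaler0. Qed.
Lemma short_sum J n (f : 'I_n -> S) : (forall i, short J (f i)) -> short J (\sum_i f i).
Proof. by move=> h; elim/big_ind : _ => //; exact: short_add. Qed.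
Lemma short_Lop J c J' (f : S) : short J f -> short J (Lop c J' f).
Proof.
move=> hf; rewrite !LopE /Lam /ell; apply: short_add.
  apply: short_add; last exact: short_scale.
  by move=> j a [|k] l hj //=; rewrite hf.
apply: short_sum => i; apply: short_scale; elim: (i : nat) => //= n IH j a k l hj.
by rewrite /sig IH // (leq_trans hj).
Qed.
Lemma short_iter J c J' n (f : S) : short J f -> short J (iter n (Lop c J') f).
Proof. by move=> hf; elim: n => //= n; exact: short_Lop. Qed.

Lemma short_sig0 J (f : S) : short J f -> iter J sg f = 0.
Proof.
by move=> hf; apply: line_ext => j a k l; rewrite iter_sigE hf // leq_addl.
Qed.

Lemma pt_linear (N : M -> M) : linear N -> linear (@pt R _ _ N).
Proof. by move=> Nl c x y; apply: line_ext => j a k l; rewrite /pt !linesE Nl. Qed.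

Lemma Lop_pt (c : C) J (N : M -> M) (f : S) : linear N -> Lop c J (pt N f) = pt N (Lop c J f).
Proof.
move=> Nl; have pl := pt_linear Nl.
rewrite !LopE [RHS](linD pl) [X in _ = _ + X](comm_ell _ _ pl) // /Lam [in RHS](linD pl) [in RHS](linZ pl).
congr (_ + _ + _); apply: line_ext => j a [|k] l //=.
by rewrite /pt /= (lin0 Nl).
Qed.

End LineOperators.

Section OperatorLines.
Variables (R : realType) (M1 M2 : lmodType R[i]).
Local Notation C := R[i].
Variables (Y : M1 -> fs1 R M2) (Yl : forall a k, linear (fun x => Y x a k)).
Local Notation S1 := (lines R M1).
Local Notation S2 := (lines R M2).

(** The action of a vertex operator in x1 on a line; it commutes with the
    multiplication operators. *)
Definition opl J (f : S1) : S2 := fun j a k l =>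
  \sum_(i < J) \sum_(k' < k.+1) Y (f j (- i%:R) (k - k')%N l) (a + i%:R) k'.

Lemma line_op1 J b F : tri J (line b F) -> line b (fs2_op1 Y F) = opl J (line b F).
Proof.
move=> hF; apply: line_ext => j a k l; rewrite {1}/line /fs2_op1 /opl.
rewrite (fsum_inj (n := J) (e := fun i : nat => a + i%:R)); first last.
- move=> c hc; apply: big1 => k' _.
  have [E|/eqP/hF [i [ei hi]]] := eqVneq (line b F j (a - c) (k - k')%N l) 0.
    by move: E; rewrite /line => ->; rewrite (lin0 (Yl _ _)).
  case: (hc i); first by apply: leq_ltn_trans hi; exact: leq_addr.
  by rewrite -[c](subKr a) ei opprK.
- by move=> i i' _ _ /addrI/nat_inj_C.
apply: eq_bigr => i _; apply: eq_bigr => k' _.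
by rewrite /line opprD addrA subrr add0r.
Qed.

Lemma opl_linear J : linear (opl J).
Proof.
move=> c f h; apply: line_ext => j a k l; rewrite !linesE /opl.
rewrite scaler_sumr -big_split; apply: eq_bigr => i _.
rewrite scaler_sumr -big_split; apply: eq_bigr => k' _.
by rewrite !linesE Yl.
Qed.

Lemma opl_short J f : short J f -> short J (opl J f).
Proof.
move=> hf j a k l hj; rewrite /opl big1 // => i _; apply: big1 => k' _.
by rewrite hf // (lin0 (Yl _ _)).
Qed.

Lemma opl_tau J f : opl J (tau f) = tau (opl J f).
Proof.
apply: line_ext => j a [|k] l; rewrite /opl /=.
  by apply: big1 => i _; rewrite big_ord1 (lin0 (Yl _ _)).
apply: eq_bigr => i _; rewrite big_ord_recr /= subnn (lin0 (Yl _ _)) addr0.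
by apply: eq_bigr => k' _; rewrite subSn // -ltnS.
Qed.

Lemma opl_sig J f : tri J f -> opl J (sig f) = sig (opl J f).
Proof.
move=> hf; apply: line_ext => j a k l; rewrite /sig /opl.
case: J hf => [|J] hf; first by rewrite !big_ord0.
rewrite big_ord_recl [RHS]big_ord_recr /=.
rewrite big1 => [|k' _]; last first.
  suff -> : f j.+1 (- 0 + 1) (k - k')%N l = 0 by rewrite (lin0 (Yl _ _)).
  apply: contrapT => /hf [i [ei _]]; move/eqP: ei.
  by rewrite oppr0 add0r -subr_eq0 opprK -mulrS pnatr_eq0.
rewrite [X in _ = _ + X]big1 => [|k' _]; last first.
  suff -> : f j.+1 (- J%:R) (k - k')%N l = 0 by rewrite (lin0 (Yl _ _)).
  apply: contrapT => /hf [i [/oppr_inj/nat_inj_C <-]].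
  by rewrite ltnS addnS ltnNge leq_addr.
rewrite add0r addr0; apply: eq_bigr => i _; apply: eq_bigr => k' _.
rewrite /bump /= add1n -natr1 opprD subrK -addrA [1 + _]addrC.
by [].
Qed.

Lemma opl_Lop c J J' f : tri J f -> opl J (Lop c J' f) = Lop c J' (opl J f).
Proof.
move=> hf; have ol := opl_linear J.
have hs i : opl J (iter i (@sig R M1) f) = iter i (@sig R M2) (opl J f).
  elim: i => // i IH; rewrite !iterS opl_sig ?IH //.
  by elim: (i) => //= n; exact: tri_sig.
rewrite !LopE [LHS](linD ol); congr (_ + _).
  by rewrite /Lam [LHS](linD ol) [X in _ + X](linZ ol) opl_tau.
rewrite /ell [LHS](lin_sum ol); apply: eq_bigr => i _.
by rewrite [LHS](linZ ol) hs.
Qed.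

Lemma opl_iter c J J' n f : tri J f ->
  opl J (iter n (Lop c J') f) = iter n (Lop c J') (opl J f).
Proof.
by move=> hf; elim: n => //= n <-; rewrite opl_Lop //; exact: tri_iter.
Qed.

End OperatorLines.

Section LineExponentials.
Variables (R : realType) (M : lmodType R[i]) (N : M -> M) (Nl : linear N).
Local Notation C := R[i].
Local Notation fi k := ((k`!%:R : C)^-1).

Lemma iter_pt n (f : lines R M) j a k l :
  iter n (pt N) f j a k l = iter n N (f j a k l).
Proof. by elim: n => //= n <-. Qed.

Lemma ptE (P Q : Type) (f : P -> Q) (x : lines R P) j a k l :
  pt f x j a k l = f (x j a k l).
Proof. by []. Qed.

Lemma iter_LN c J n (f : lines R M) :
  iter n (fun f => Lop c J (pt N f)) f = iter n (Lop c J) (iter n (pt N) f).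
Proof. by apply: iter_comp_comm => x; exact: Lop_pt. Qed.

Lemma iter_LNneg c J n (f : lines R M) :
  iter n (fun f => Lop c J (pt (fun x => - N x) f)) f =
  (-1) ^+ n *: iter n (Lop c J) (iter n (pt N) f).
Proof.
have <- := iter_LN c J n f; elim: n => [|n IH]; first by rewrite scale1r.
rewrite [LHS]/= IH [in RHS]/=; set z := iter n _ f.
have -> : pt (fun x => - N x) ((-1) ^+ n *: z) = (-1) ^+ n.+1 *: pt N z.
  apply: line_ext => j a k l; rewrite linesE !ptE linesE (linZ Nl) exprS mulN1r.
  by rewrite scaleNr.
by rewrite (linZ (Lop_linear c J)).
Qed.

Lemma line_exp_neg c J b (F : fs2 R M) r : (0 < J)%N -> short J (line b F) ->
  iter r (pt N) (line b F) = 0 ->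
  line b (fs2_exp (log12c c) (fun x => - N x) F) =
  \sum_(s < r) ((-1) ^+ s * fi s) *:
    iter s (Lop c J) (iter s (pt N) (line b F)).
Proof.
move=> J0 hF hr; have N0 : - N 0 = 0 by rewrite (lin0 Nl) oppr0.
have E i := iter_LNneg c J i (line b F).
rewrite (line_exp (c := c) J0 N0 hF (r := r)) => [|i hi].
  by apply: eq_bigr => s _; rewrite E scalerA [fi s * _]mulrC.
rewrite E (nilp_ge (pt_linear Nl) hr hi).
by rewrite (lin0 (linear_iter i (Lop_linear c J))) scaler0.
Qed.

Section Conjugation.
Variables (V S0 : lmodType C) (D : V -> S0 -> lines R M).
Variables (Nv : V -> V) (N0 : S0 -> S0).
Hypotheses (Nvl : linear Nv) (N0l : linear N0).
Hypotheses (Dl : forall x, linear (D^~ x)) (Dr : forall u, linear (D u)).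
Hypothesis ND : forall u x, pt N (D u x) = D (Nv u) x + D u (N0 x).

Lemma line_exp_conj c J b (F : fs2 R M) ru rx r u x : (0 < J)%N ->
  iter ru Nv u = 0 -> iter rx N0 x = 0 -> (ru + rx < r)%N -> short J (line b F) ->
  line b F = \sum_(s < r) ((-1) ^+ s * fi s) *:
    iter s (Lop c J) (D u (iter s N0 x)) ->
  line b (fs2_exp (log12c c) N F) =
  \sum_(i < r) fi i *: iter i (Lop c J) (D (iter i Nv u) x).
Proof.
move=> J0 hu hx hr hF eF; have Ll := Lop_linear c J (M := M).
have Nptl := pt_linear Nl.
have nil i y : (ru + rx <= i)%N -> iter rx N0 y = 0 -> iter i (pt N) (D u y) = 0.
  move=> hi hy; apply: (scalerI (_ : fi i != 0)).
    by rewrite invr_eq0 pnatr_eq0 -lt0n fact_gt0.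
  rewrite scaler0.
  have h := iter_leibniz (G := fun k m => D (iter k Nv u) (iter m N0 y)) Nptl.
  have /= -> := h (fun k m => ND _ _) i 0%N 0%N.
  apply: big1 => k _; rewrite !add0n.
  have [hk|hk] := leqP ru k.
    by rewrite (nilp_ge Nvl hu hk) (lin0 (Dl _)) scaler0.
  by rewrite (nilp_ge N0l hy) ?(lin0 (Dr _)) ?scaler0 //; lia.
have key := exp_conj Nvl N0l Nptl Ll Dl Dr (fun z => Lop_pt c J z Nl) ND hu hx hr.
rewrite -key -eF; apply: (line_exp (c := c) J0 (lin0 Nl) hF) => i hi.
have -> := iter_LN c J i (line b F); rewrite eF (lin_sum (linear_iter i Nptl)).
rewrite big1 ?(lin0 (linear_iter i Ll)) // => s _.
rewrite (linZ (linear_iter i Nptl)).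
have -> : iter i (pt N) (iter s (Lop c J) (D u (iter s N0 x))) =
    iter s (Lop c J) (iter i (pt N) (D u (iter s N0 x))).
  rewrite (iter_comm (f := pt N)) // => z.
  by rewrite -(iter_comm (f := Lop c J)) // => ?; rewrite Lop_pt.
rewrite nil ?(lin0 (linear_iter s Ll)) ?scaler0 //; first by lia.
by rewrite -iterD (nilp_ge N0l hx) // leq_addr.
Qed.

End Conjugation.
End LineExponentials.

Section Prod12.
Variables (R : realType) (V W : lmodType R[i]) (A : vsa V) (hA : is_vsa A).
Variables (g : {linear V -> V}) (hg : is_automorphism A g).
Variables (B : twmod V W) (hB : is_twmod A g B).
Local Notation C := R[i].
Local Notation N := (NV g).
Local Notation fi k := ((k`!%:R : C)^-1).
Let Yl w a k : linear (fun u => YW B u w a k) := YW_linear_l hB w a k.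
Let Yr u a k : linear (fun w => YW B u w a k) := YW_linear_r hB u a k.
Let Nl : linear N := N_linear hA hg.
Let NWl : linear (NW B) := NW_linear hB.

Lemma log12E : @log12 R = log12c 0.
Proof.
apply/funext => a; apply/funext => b; apply/funext => k; apply/funext => l.
by rewrite /log12c scale0r addr0.
Qed.

Lemma pow12E n : @pow12 R n = (fun a b k l => 1 *: pow12 n a b k l).
Proof.
apply/funext => a; apply/funext => b; apply/funext => k; apply/funext => l.
by rewrite scale1r.
Qed.

Definition emb2 (M : lmodType C) (x : nat -> nat -> M) : lines R M :=
  fun j a k l => if (a == 0) && (k == 0%N) then x j l else 0.

Definition pt2 (x : nat -> nat -> W) : nat -> nat -> W := fun j l => NW B (x j l).

Lemma pt2_linear : linear pt2.
Proof.
by move=> c x y; apply/funext => j; apply/funext => l; exact: NWl.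
Qed.

Lemma iter_pt2 n x j l : iter n pt2 x j l = iter n (NW B) (x j l).
Proof. by elim: n => //= n <-. Qed.

(** Only finitely many coefficients of the line are nonzero, so one power of N
    kills all of them. *)
Lemma unif_nilp J K (x : nat -> nat -> W) :
  (forall j l, (J <= j)%N || (K <= l)%N -> x j l = 0) ->
  exists r, iter r pt2 x = 0.
Proof.
move=> hx; have [r hr] := choice (NW_nilp hB).
exists (\max_(j < J) \max_(l < K) r (x j l)).
apply/funext => j; apply/funext => l; rewrite iter_pt2.
have [hJ|hJ] := leqP J j.
  by rewrite hx ?hJ // (lin0 (linear_iter _ NWl)).
have [hK|hK] := leqP K l.
  by rewrite hx ?hK ?orbT // (lin0 (linear_iter _ NWl)).
apply: (nilp_ge NWl (hr _)).
apply: leq_trans (leq_bigmax (Ordinal hJ)) => /=.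
exact: (leq_bigmax (F := fun l : 'I_K => r (x j l)) (Ordinal hK)).
Qed.

(** The family u |-> Y(u, x1) x to which the conjugation formula is applied. *)
Definition D12 (u : V) (x : nat -> nat -> W) : lines R W :=
  fun j a k l => YW B u (x j l) a k.

Lemma D12_linl x : linear (D12^~ x).
Proof. by move=> c u v; apply: line_ext => j a k l; rewrite /D12 !linesE Yl. Qed.

Lemma D12_linr u : linear (D12 u).
Proof. by move=> c x y; apply: line_ext => j a k l; rewrite /D12 !linesE -Yr. Qed.

Lemma D12_N u x : pt (NW B) (D12 u x) = D12 (N u) x + D12 u (pt2 x).
Proof.
apply: line_ext => j a k l; rewrite linesE /pt /D12 /pt2.
exact: (NW_YW hA hg hB).
Qed.

(** Conjugation by (x1 - x2)^N gives Y((x1 - x2)^N u, x1), and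
    (x1 - x2)^N x1^{-N} = (1 - x2/x1)^N; the logarithms of x1 cancel, and
    (1 - x2/x1)^{n + N} expands with the polynomials bp n j evaluated at N. *)
Lemma prod12_formula n u v w b J K r a k l : (0 < J)%N ->
  (forall j l, (J <= j)%N -> YWV A B w v (b - j%:R) l = 0) ->
  (forall j l, (K <= l)%N -> YWV A B w v (b - j%:R) l = 0) ->
  (0 < r)%N -> iter r N u = 0 ->
  prod12 A B n u v w a b k l = if k == 0%N then
    \sum_(q < r) \sum_(j < J) ((-1) ^+ j * (bp n j)`_q) *:
      YW B (iter q N u) (YWV A B w v (b - j%:R) l) (a - n + j%:R) 0 else 0.
Proof.
move=> J0 hJ hK r0 hr; pose x j l := YWV A B w v (b - j%:R) l.
have [rx hrx] : exists r, iter r pt2 x = 0.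
  by apply: (unif_nilp (J := J) (K := K)) => j l' /orP[h|h]; [exact: hJ|exact: hK].
pose R0 := (r + rx).+1.
have hxJ s j l' : (J <= j)%N -> iter s pt2 x j l' = 0.
  by move=> hj; rewrite iter_pt2 [x j l']hJ // (lin0 (linear_iter _ NWl)).
have tri_emb y : (forall j l, (J <= j)%N -> y j l = 0) -> tri J (emb2 (M := W) y).
  move=> hy j a' k' l'; rewrite /emb2; case: eqP => [->|] //=.
  case: eqP => [_ ne|] //=; exists 0%N; rewrite oppr0; split => //.
  by rewrite add0n ltnNge; apply/negP => h; apply: ne; exact: hy.
have eF0 : line b (in_x2 (YWV A B w v)) = emb2 x by [].
have emb_iter s : iter s (pt (NW B)) (emb2 x) = emb2 (iter s pt2 x).
  apply: line_ext => j a' k' l'; rewrite iter_pt /emb2 iter_pt2.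
  by case: ifP => // _; rewrite (lin0 (linear_iter _ NWl)).
(* e1 to e4 follow the inner exponential, Y(u, x1), the outer exponential and
   the cancellation of log x1. *)
pose E1 := fs2_exp (@log12 R) (fun x => - NW B x) (in_x2 (YWV A B w v)).
have e1 : line b E1 = \sum_(s < R0) ((-1) ^+ s * fi s) *:
    iter s (Lop 0 J) (emb2 (iter s pt2 x)).
  rewrite /E1 log12E (line_exp_neg (N := NW B) NWl 0 (J := J) (r := R0)) ?eF0 //.
  - by apply: eq_bigr => s _; rewrite emb_iter.
  - exact/tri_short/tri_emb.
  - rewrite emb_iter (nilp_ge pt2_linear hrx) ?leqW ?leq_addl //.
    by apply: line_ext => j a' k' l'; rewrite /emb2; case: ifP.
have t1 : tri J (line b E1).
  by rewrite e1; apply: tri_sum => s; apply/tri_scale/tri_iter/tri_emb/hxJ.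
have opl_emb y : opl (YW B u) J (emb2 y) = D12 u y.
  apply: line_ext => j a' k' l'; rewrite /opl /D12.
  case: (J) J0 => // J' _; rewrite big_ord_recl [X in _ + X]big1 ?addr0 => [|i _].
    rewrite big_ord_recr /= subnn big1 ?add0r => [|i _].
      by rewrite /emb2 oppr0 !eqxx.
    by rewrite /emb2 subn_eq0 [X in _ && X]leqNgt ltn_ord andbF (lin0 (Yr _ _ _)).
  apply: big1 => i' _; rewrite /emb2 oppr_eq0 pnatr_eq0 /=.
  by rewrite (lin0 (Yr _ _ _)).
pose F2 := fs2_op1 (YW B u) E1.
have e2 : line b F2 = \sum_(s < R0) ((-1) ^+ s * fi s) *:
    iter s (Lop 0 J) (D12 u (iter s pt2 x)).
  rewrite (line_op1 (Yr u) t1) e1 (lin_sum (opl_linear (Yr u) J)).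
  apply: eq_bigr => s _; rewrite (linZ (opl_linear (Yr u) J)).
  rewrite (opl_iter (Yr u)) ?opl_emb //; exact/tri_emb/hxJ.
have s2 : short J (line b F2).
  rewrite (line_op1 (Yr u) t1); exact/(opl_short (Yr u))/tri_short.
have e3 := line_exp_conj NWl Nl pt2_linear D12_linl D12_linr D12_N J0 hr hrx
  (ltnSn _) s2 e2.
set F3 := fs2_exp _ _ _ in e3.
have sD u' : short J (D12 u' x).
  by move=> j a' k' l' hj; rewrite /D12 [x j l']hJ // (lin0 (Yr _ _ _)).
have s3 : short J (line b F3).
  by rewrite e3; apply: short_sum => i; apply/short_scale/short_iter/sD.
pose H0 (u' : V) : lines R W :=
  fun j a k l => if k == 0%N then YW B u' (x j l) a 0 else 0.
have eH i : D12 (iter i N u) x = \sum_(m < r) ((-1) ^+ m * fi m) *: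
    iter m (Lam 0) (H0 (iter (i + m) N u)).
  have Lam0 m (f : lines R W) j a' k' l' :
      iter m (Lam 0) f j a' k' l' = if (m <= k')%N then f j a' (k' - m)%N l' else 0.
    elim: m k' => [|m IH] k' /=; first by rewrite subn0.
    rewrite {1}/Lam scale0r addr0 /tau; by case: k' => // k'.
  apply: line_ext => j a' k' l'; rewrite line_sumE /D12.
  rewrite (YW_logE hA hg hB) -iterD addnC.
  rewrite (eq_bigr (fun m : 'I_r => if m == k' :> nat then ((-1) ^+ k' * fi k') *:
      YW B (iter (i + k') N u) (x j l') a' 0 else 0)); last first.
    move=> m _; rewrite linesE Lam0 /H0; have [->|nm] := eqVneq (m : nat) k'.
      by rewrite leqnn subnn.
    case: leqP => [hm|]; last by rewrite scaler0.
    by rewrite subn_eq0 leqNgt ltn_neqAle nm hm /= scaler0.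
  have [hk|hk] := ltnP k' r.
    rewrite (bigD1 (Ordinal hk)) //= eqxx big1 ?addr0 // => m.
    by rewrite -val_eqE /= => /negbTE ->.
  rewrite (nilp_ge Nl hr) ?(lin0 (Yl _ _ _)) ?scaler0; last exact: leq_trans (leq_addl _ _).
  by rewrite big1 // => m _; case: eqP => [e|//]; move: (ltn_ord m); rewrite e ltnNge hk.
have D120 : D12 0 x = 0 by rewrite (lin0 (D12_linl x)).
have H00 : H0 0 = 0.
  by apply: line_ext => j a' k' l'; rewrite /H0; case: ifP => // _; rewrite (lin0 (Yl _ _ _)).
have sl := @sig_linear R W.
have e4 : line b F3 = \sum_(q < r) fi q *: iter q (ell (@sig R W) J) (H0 (iter q N u)).
  have cm z : Lam 0 (ell (@sig R W) J z) = ell (@sig R W) J (Lam 0 z).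
    by rewrite (comm_ell _ _ (Lam_linear 0)) // => y; exact: Lam_sig.
  have <- := exp_split (H := D12^~ x) (H0 := H0) Nl (Lam_linear 0)
    (ell_linear sl J) D120 H00 cm r0 hr eH.
  have rR : (r <= (r + rx).+1)%N by rewrite leqW ?leq_addr.
  rewrite e3 (sum_trunc rR
    (f := fun i => fi i *: iter i (Lop 0 J) (D12 (iter i N u) x))).
    apply: eq_bigr => i _; congr (_ *: iter _ _ _); apply/funext => z.
    by rewrite LopE.
  move=> i hi; rewrite (nilp_ge Nl hr hi) D120.
  by rewrite (lin0 (linear_iter i (Lop_linear 0 J))) scaler0.
have := line_pow 1 n 0%N a k l s3; rewrite -pow12E scale1r.
rewrite {1}/line subr0.
have -> : prod12 A B n u v w a b k l = fs2_mul (pow12 n) F3 a b k l.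
  by rewrite /F3 -log12E.
move=> ->; rewrite e4 (lin_sum (pw_linear sl J n)).
have sH u' : iter J (@sig R W) (H0 u') = 0.
  apply: short_sig0 => j a' k' l' hj; rewrite /H0; case: ifP => // _.
  by rewrite [x j l']hJ // (lin0 (Yr _ _ _)).
have e5 q : pw (@sig R W) J n (fi q *: iter q (ell (@sig R W) J) (H0 (iter q N u))) =
    \sum_(j < J) ((-1) ^+ j * (bp n j)`_q) *: iter j (@sig R W) (H0 (iter q N u)).
  by rewrite (linZ (pw_linear sl J n)) (pw_ell sl n q (sH _)).
rewrite line_sumE; case: ifP => hk; last first.
  apply: big1 => q _; rewrite e5 line_sumE; apply: big1 => j _.
  by rewrite linesE iter_sigE /H0 hk scaler0.
apply: eq_bigr => q _; rewrite e5 line_sumE; apply: eq_bigr => j _.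
by rewrite linesE iter_sigE /H0 hk add0n.
Qed.

End Prod12.

(** * The product of the twist and algebra operators *)

Lemma fsum_cond (I : choiceType) (M : zmodType) (D : set I) (f : I -> M) :
  \sum_(i \in D) f i = \sum_(i \in [set: I]) (if i \in D then f i else 0).
Proof. by rewrite fsbig_mkcond; apply: eq_fsbigr => i _; rewrite patchE. Qed.

Lemma gsubproj_linear (R : realType) (I : choiceType) (M : lmodType R[i])
  (G : grading I M) (D : set I) : linear (gsubproj G D).
Proof.
move=> c x y; rewrite /gsubproj !(fsum_cond D).
have [s [_ [_ hs]]] := gproj_seq G x; have [t [_ [_ ht]]] := gproj_seq G y.
have h i : i \notin undup (s ++ t) -> G i x = 0 /\ G i y = 0.
  by rewrite mem_undup mem_cat negb_or => /andP[/hs -> /ht ->].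
rewrite !(fsumE (undup_uniq (s ++ t))); first last.
- by move=> i /h [hx hy]; rewrite linearP hx hy scaler0 addr0; case: ifP.
- by move=> i /h [-> _]; case: ifP.
- by move=> i /h [_ ->]; case: ifP.
rewrite scaler_sumr -big_split; apply: eq_bigr => i _.
by case: ifP => _ /=; [rewrite linearP|rewrite scaler0 addr0].
Qed.

Section HalfTurn.
Variables (R : realType) (V W : lmodType R[i]) (A : vsa V) (hA : is_vsa A).
Variables (g : {linear V -> V}) (hg : is_automorphism A g).
Variables (B : twmod V W) (hB : is_twmod A g B) (hlb : lower_bounded B).
Local Notation C := R[i].
Local Notation N := (NV g).
Local Notation L := (Lm1W B).
Local Notation fi k := ((k`!%:R : C)^-1).
Let Yl w a k : linear (fun u => YW B u w a k) := YW_linear_l hB w a k.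
Let Yr u a k : linear (fun w => YW B u w a k) := YW_linear_r hB u a k.
Let Nl : linear N := N_linear hA hg.
Let Ll : linear L. Proof. exact: linearP. Qed.

(** The term of degree p in e^{xL(-1)}, after the substitution
    y = e^{pi i} x in a log-free mode. *)
Definition hturn (w : W) (x : V) (b : C) (p : nat) : W :=
  fi p *: iter p L (cexp (cpii R * (b - p%:R)) *: YW B x w (b - p%:R) 0).

(** The log-free part of the twist vertex operator, up to sign. *)
Definition Zs (w : W) (x : V) (b : C) : W := \sum_(p \in [set: nat]) hturn w x b p.

(** The coefficient of (log x)^l in (- log x - pi i)^m / m!. *)
Definition dlog (m l : nat) : C := (-1) ^+ m * fi m * ('C(m, l)%:R * cpii R ^+ (m - l)).

Lemma YW_iterN x w a m : YW B (iter m N x) w a 0 = ((-1) ^+ m * m`!%:R) *: YW B x w a m.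
Proof.
rewrite (YW_logE hA hg hB x w a m) scalerA.
have f0 : m`!%:R != 0 :> C by rewrite pnatr_eq0 -lt0n fact_gt0.
have -> : (-1) ^+ m * m`!%:R * ((-1) ^+ m / m`!%:R) = 1 :> C.
  by rewrite mulrACA -exprMn mulrNN mulr1 expr1n mul1r mulfV.
by rewrite scale1r.
Qed.

Lemma Re_nat_small (b : C) (z : R) : exists P : nat, forall p, (P <= p)%N ->
  complex.Re (b - p%:R) < z.
Proof.
have [n hn] := Re_sub_int b z; exists n.+1 => p hp.
by have := hn p%:Z; apply.
Qed.

Lemma hturn0_shift w x b : exists P, forall m j p, (P <= j + p)%N ->
  hturn w (iter m N x) (b - j%:R) p = 0.
Proof.
have [z hz] := YW_trunc hB hlb x w; have [P hP] := Re_nat_small b z.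
exists P => m j p /hP hp; rewrite /hturn YW_iterN -addrA -opprD -natrD hz //.
by rewrite !scaler0 (lin0 (linear_iter p Ll)) scaler0.
Qed.

Lemma hturn0 w x b : exists P, forall m p, (P <= p)%N -> hturn w (iter m N x) b p = 0.
Proof.
have [P hP] := hturn0_shift w x b; exists P => m p hp.
by have := hP m 0%N p hp; rewrite subr0.
Qed.

Lemma Zs_short w x b : exists J, forall m j, (J <= j)%N ->
  Zs w (iter m N x) (b - j%:R) = 0.
Proof.
have [P hP] := hturn0_shift w x b; exists P => m j hj; apply: fsum0 => p.
by apply: hP; apply: leq_trans hj (leq_addr _ _).
Qed.

Lemma Zs_trunc w x b : exists P0, forall P m, (P0 <= P)%N ->
  Zs w (iter m N x) b = \sum_(p < P) hturn w (iter m N x) b p.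
Proof.
have [P0 h] := hturn0 w x b; exists P0 => P m hP; apply: fsum_nat => p hp.
by apply: h; apply: leq_trans hp.
Qed.

Lemma hturn_linear w b p : linear (fun x => hturn w x b p).
Proof.
apply: linear_fscale => c x y.
have h : linear (fun x => cexp (cpii R * (b - p%:R)) *: YW B x w (b - p%:R) 0).
  exact: linear_fscale.
by rewrite (h c x y) (linear_iter p Ll).
Qed.

Lemma Zs_linear w b : linear (fun x => Zs w x b).
Proof.
move=> c x y; have [P1 h1] := hturn0 w x b; have [P2 h2] := hturn0 w y b.
rewrite /Zs !(fsum_nat (n := maxn P1 P2)); first last.
- move=> p; rewrite geq_max => /andP[/(h1 0%N) p1 /(h2 0%N) p2].
  by rewrite hturn_linear p1 p2 scaler0 addr0.
- by move=> p; rewrite geq_max => /andP[/(h1 0%N) p1 _].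
- by move=> p; rewrite geq_max => /andP[_ /(h2 0%N) p2].
rewrite scaler_sumr -big_split; apply: eq_bigr => p _; exact: hturn_linear.
Qed.

(** By YW_logE the logarithms enter through y^{-N}, with
    log y = log x + pi i. *)
Lemma half_turn_Z w x b l r : iter r N x = 0 ->
  exp_x L (subst_half_turn (YW B x w)) b l =
  \sum_(m < r) dlog m l *: Zs w (iter m N x) b.
Proof.
move=> hr; have [P hP] := hturn0 w x b.
have sE b' : subst_half_turn (YW B x w) b' l =
    \sum_(m < r) dlog m l *: (cexp (cpii R * b') *: YW B (iter m N x) w b' 0).
  rewrite /subst_half_turn (fsum_nat (n := r)) => [|k hk].
    apply: eq_bigr => m _; rewrite (YW_logE hA hg hB) !scalerA /dlog.
    by congr (_ *: _); ring.
  by rewrite (YW_logE hA hg hB) (nilp_ge Nl hr hk) (lin0 (Yl _ _ _)) !scaler0.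
have tE p : fi p *: iter p L (subst_half_turn (YW B x w) (b - p%:R) l) =
    \sum_(m < r) dlog m l *: hturn w (iter m N x) b p.
  rewrite sE (lin_sum (linear_iter p Ll)) scaler_sumr; apply: eq_bigr => m _.
  by rewrite (linZ (linear_iter p Ll)) /hturn !scalerA mulrC.
rewrite /exp_x (fsum_nat (n := P)) => [|p hp]; last first.
  by rewrite tE big1 // => m _; rewrite hP ?scaler0.
rewrite (eq_bigr _ (fun p _ => tE _)) exchange_big; apply: eq_bigr => m _ /=.
by rewrite -scaler_sumr /Zs (fsum_nat (n := P)) // => p hp; exact: hP.
Qed.

Lemma half_turn_linear w b l :
  linear (fun x => exp_x L (subst_half_turn (YW B x w)) b l).
Proof.
move=> c x y; have [r hr] := N_nilp hA hg x; have [s hs] := N_nilp hA hg y.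
have hx := nilp_ge Nl hr (leq_maxl r s); have hy := nilp_ge Nl hs (leq_maxr r s).
rewrite (half_turn_Z w b l hx) (half_turn_Z w b l hy).
rewrite (half_turn_Z w b l (r := maxn r s)); last first.
  by rewrite (linear_iter _ Nl) hx hy scaler0 addr0.
rewrite scaler_sumr -big_split; apply: eq_bigr => m _.
by rewrite (linear_iter _ Nl) (Zs_linear w b c) scalerDr !scalerA mulrC.
Qed.

Lemma YWV_linear w b l : linear (fun v => YWV A B w v b l).
Proof.
move=> c x y; rewrite /YWV.
have h (s t : bool) : linear (fun v => (-1) ^+ (s && t) *:
    exp_x L (subst_half_turn (YW B (gsubproj (Vgr A) [set m : int | odd `|m|%N = s] v)
      (gsubproj (Wgr B) [set i | i.1.2 = t] w))) b l).
  by apply: linear_fscale => c' x' y'; rewrite gsubproj_linear half_turn_linear.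
have H : linear (fun v => \sum_(s : bool) \sum_(t : bool) (-1) ^+ (s && t) *:
    exp_x L (subst_half_turn (YW B (gsubproj (Vgr A) [set m : int | odd `|m|%N = s] v)
      (gsubproj (Wgr B) [set i | i.1.2 = t] w))) b l).
  by apply: linear_fsum => s; apply: linear_fsum => t; exact: h.
exact: H.
Qed.

Lemma YWV_Z sx sw w x b l r : parV A sx x -> parW B sw w -> iter r N x = 0 ->
  YWV A B w x b l = (-1) ^+ (sx && sw) *:
    \sum_(m < r) dlog m l *: Zs w (iter m N x) b.
Proof.
move=> hx hw hr; rewrite -half_turn_Z // /YWV.
have L0 w' : exp_x L (subst_half_turn (YW B 0 w')) b l = 0.
  exact: (lin0 (half_turn_linear w' b l)).
have L0' x' : exp_x L (subst_half_turn (YW B x' 0)) b l = 0.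
  rewrite /exp_x fsum0 // => p; suff -> : subst_half_turn (YW B x' 0) (b - p%:R) l = 0.
    by rewrite (lin0 (linear_iter p Ll)) scaler0.
  by rewrite /subst_half_turn fsum0 // => k; rewrite (lin0 (Yr _ _ _)) scaler0.
rewrite (bigD1 sx) //= (bigD1 sw) //= (gsubprojE hx) (gsubprojE hw).
rewrite big1 => [|t /negbTE nt]; last first.
  by rewrite (gsubproj0 hw) ?L0' ?scaler0 // => i /= -> E; move: nt; rewrite E eqxx.
rewrite big1 ?addr0 // => s /negbTE ns; rewrite big1 // => t _.
by rewrite (gsubproj0 hx) ?L0 ?scaler0 // => i /= -> E; move: ns; rewrite E eqxx.
Qed.

Lemma YWV_short sx sw w x b : parV A sx x -> parW B sw w ->
  exists J, forall j l, (J <= j)%N -> YWV A B w x (b - j%:R) l = 0.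
Proof.
move=> hx hw; have [J hJ] := Zs_short w x b; have [r hr] := N_nilp hA hg x.
exists J => j l hj; rewrite (YWV_Z _ _ hx hw hr) big1 ?scaler0 // => m _.
by rewrite hJ ?scaler0.
Qed.

Lemma YWV_log sx sw w x b l r : parV A sx x -> parW B sw w -> iter r N x = 0 ->
  (r <= l)%N -> YWV A B w x b l = 0.
Proof.
move=> hx hw hr hl; rewrite (YWV_Z _ _ hx hw hr) big1 ?scaler0 // => m _.
by rewrite /dlog bin_small ?mul0r ?mulr0 ?scale0r // (leq_trans (ltn_ord m)).
Qed.

End HalfTurn.

Section Diagonal.
Variables (R : realType) (M1 M2 : lmodType R[i]) (T : M1 -> M2) (Tl : linear T).
Local Notation C := R[i].

Lemma Lop_eval (M : lmodType C) c J (f : lines R M) j a k l :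
  Lop c J f j a k l = (if k is k'.+1 then f j a k' l else 0) + c *: f j a k l +
  \sum_(i < J) ((-1) ^+ i * (bp (0 : C) i)`_1) *: f (j + i)%N (a + i%:R) k l.
Proof.
rewrite LopE /Lam !linesE /ell line_sumE; congr (_ + _); apply: eq_bigr => i _.
by rewrite linesE iter_sigE.
Qed.

(* All the operators act along the diagonals (j, a + j). *)
Lemma diag_Lop c J a (f : lines R M1) (h : lines R M2) :
  (forall j k l, h j (a + j%:R) k l = T (f j (a + j%:R) k l)) ->
  forall j k l, Lop c J h j (a + j%:R) k l = T (Lop c J f j (a + j%:R) k l).
Proof.
move=> e j k l; rewrite !Lop_eval !(linD Tl) (linZ Tl) e (lin_sum Tl).
congr (_ + _ + _); first by case: k => [|k]; rewrite ?e ?(lin0 Tl).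
by apply: eq_bigr => i _; rewrite (linZ Tl) -addrA -natrD e.
Qed.

Lemma diag_iter c J a s (f : lines R M1) (h : lines R M2) :
  (forall j k l, h j (a + j%:R) k l = T (f j (a + j%:R) k l)) ->
  forall j k l, iter s (Lop c J) h j (a + j%:R) k l =
    T (iter s (Lop c J) f j (a + j%:R) k l).
Proof. by move=> e; elim: s => //= s IH; apply: diag_Lop. Qed.

Lemma Lop_wide (M : lmodType C) c J J' (f : lines R M) : short J f -> (J <= J')%N ->
  Lop c J' f = Lop c J f.
Proof.
move=> hf hJ; apply: line_ext => j a k l; rewrite !Lop_eval; congr (_ + _).
rewrite (sum_trunc hJ (f := fun i =>
  ((-1) ^+ i * (bp (0 : C) i)`_1) *: f (j + i)%N (a + i%:R) k l)) // => i hi.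
rewrite hf ?scaler0 //.
by apply: leq_trans hi (leq_addl _ _).
Qed.

Lemma iter_Lop_wide (M : lmodType C) c J J' s (f : lines R M) : short J f ->
  (J <= J')%N -> iter s (Lop c J') f = iter s (Lop c J) f.
Proof.
move=> hf hJ; elim: s => // s IH; rewrite !iterS IH (Lop_wide c _ hJ) //.
exact: short_iter.
Qed.

Lemma iter_Lam_eval (M : lmodType C) c m (f : lines R M) j a k l :
  (forall j a k l, f j a k.+1 l = 0) ->
  iter m (Lam c) f j a k l = ('C(m, k)%:R * c ^+ (m - k)) *: f j a 0 l.
Proof.
move=> hf; elim: m k => [|m IH] k.
  case: k => [|k] /=; first by rewrite mulr1 scale1r.
  by rewrite hf bin0n mul0r scale0r.
rewrite iterS {1}/Lam linesE linesE IH /tau scalerA.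
case: k => [|k].
  by rewrite add0r !bin0 !mul1r !subn0 exprS.
rewrite IH -scalerDl; congr (_ *: _); rewrite binS natrD subSS mulrDl addrC.
congr (_ + _); have [hk|hk] := ltnP k m.
  by rewrite mulrCA -exprS subnSK.
by rewrite bin_small // !mul0r mulr0.
Qed.

End Diagonal.

Section LaurentModes.
Variables (R : realType) (V W : lmodType R[i]) (A : vsa V) (hA : is_vsa A).
Variables (g : {linear V -> V}) (hg : is_automorphism A g).
Local Notation C := R[i].
Local Notation N := (NV g).

Lemma laurent_int (f : int -> V) (n : int) : laurent f (n%:~R : C) 0 = f n.
Proof.
rewrite /laurent /= fsum_cond (fsum_at (i0 := n)) ?mem_set // => i ni.
by case: ifP => // /set_mem /= /int_inj_C.
Qed.

Lemma laurent_nint (f : int -> V) (a : C) : (forall n : int, n%:~R != a) ->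
  laurent f a 0 = 0.
Proof.
move=> h; rewrite /laurent /= fsum_cond fsum0 // => i.
by case: ifP => // /set_mem /= /eqP; rewrite (negbTE (h i)).
Qed.

(** Modes of the vertex operators of V, indexed by all complex numbers to match
    the formal series of W. *)
Definition LY (u v : V) (a : C) : V := laurent (YV A u v) a 0.

Lemma LY_ind (P : (V -> V -> V) -> C -> Prop) a :
  (forall n : int, P (fun u v => YV A u v n) n%:~R) ->
  ((forall n : int, n%:~R != a) -> P (fun _ _ => 0) a) -> P (fun u v => LY u v a) a.
Proof.
move=> h h0; case: (pselect (exists n : int, n%:~R = a)) => [[n <-]|ne].
  have -> : (fun u v => LY u v n%:~R) = (fun u v => YV A u v n) => //.
  by do 2 apply/funext => ?; rewrite /LY laurent_int.
have ne' (n : int) : n%:~R != a by apply/eqP => E; apply: ne; exists n.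
have -> : (fun u v => LY u v a) = (fun _ _ => 0); last exact: h0.
by do 2 apply/funext => ?; rewrite /LY laurent_nint.
Qed.

Lemma LY_linl v a : linear (fun u => LY u v a).
Proof.
apply: (@LY_ind (fun F _ => linear (F^~ v)) a) => [n|_]; first exact: YV_linear_l.
by move=> c x y; rewrite scaler0 addr0.
Qed.

Lemma LY_linr u a : linear (fun v => LY u v a).
Proof.
apply: (@LY_ind (fun F _ => linear (F u)) a) => [n|_]; first exact: YV_linear_r.
by move=> c x y; rewrite scaler0 addr0.
Qed.

Lemma N_LY u v a : N (LY u v a) = LY (N u) v a + LY u (N v) a.
Proof.
apply: (@LY_ind (fun F _ => N (F u v) = F (N u) v + F u (N v)) a) => [n|_].
  exact: N_YV.
by rewrite (lin0 (N_linear hA hg)) addr0.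
Qed.

Lemma LY_parity s t u v a : parV A s u -> parV A t v -> parV A (s (+) t) (LY u v a).
Proof.
move=> hu hv; apply: (@LY_ind (fun F _ => parV A (s (+) t) (F u v)) a) => [n|_].
  exact: YV_parity.
by move=> i _; rewrite linear0.
Qed.

Lemma LY_short ru rv u v a : iter ru N u = 0 -> iter rv N v = 0 ->
  exists J, forall i m j, (J <= j)%N -> LY (iter i N u) (iter m N v) (a - j%:R) = 0.
Proof.
move=> hu hv; have Nl := N_linear hA hg.
have ex i : exists f : nat -> nat, forall m (n : int), n < - (f m)%:Z ->
    YV A (iter i N u) (iter m N v) n = 0.
  have [f hf] := choice (fun m => YV_trunc hA (iter i N u) (iter m N v)).
  by exists f.
have [F hF] := choice ex.
pose J0 := (\max_(i < ru) \max_(m < rv) F i m)%N.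
case: (pselect (exists n : int, n%:~R = a)) => [[n <-]|ne].
  exists (J0 + absz n).+1 => i m j hj.
  have [hi|hi] := leqP ru i.
    by rewrite (nilp_ge Nl hu hi) (lin0 (LY_linl _ _)).
  have [hm|hm] := leqP rv m.
    by rewrite (nilp_ge Nl hv hm) (lin0 (LY_linr _ _)).
  rewrite -[j%:R]/(j%:Z%:~R) -rmorphB /LY laurent_int; apply: hF.
  have hF1 : (F i m <= J0)%N.
    apply: leq_trans (leq_bigmax (Ordinal hi)) => /=.
    exact: (leq_bigmax (F := fun m : 'I_rv => F i m) (Ordinal hm)).
  by lia.
exists 0%N => i m j _; rewrite /LY laurent_nint // => n; apply/eqP => E.
by apply: ne; exists (n + j%:Z); rewrite rmorphD /= E -[j%:Z%:~R]/(j%:R) subrK.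
Qed.

End LaurentModes.

Section Prod21.
Variables (R : realType) (V W : lmodType R[i]) (A : vsa V) (hA : is_vsa A).
Variables (g : {linear V -> V}) (hg : is_automorphism A g).
Variables (B : twmod V W) (hB : is_twmod A g B) (hlb : lower_bounded B).
Local Notation C := R[i].
Local Notation N := (NV g).
Local Notation fi k := ((k`!%:R : C)^-1).
Local Notation ci := (cpii R).
Let Nl : linear N := N_linear hA hg.

Lemma fi_neq0 k : fi k != 0.
Proof. by rewrite invr_eq0 pnatr_eq0 -lt0n fact_gt0. Qed.

Lemma LY_leibniz u v a r : fi r *: iter r N (LY A u v a) =
  \sum_(k < r.+1) (fi k * fi (r - k)) *: LY A (iter k N u) (iter (r - k) N v) a.
Proof.
have h := iter_leibniz (G := fun i j => LY A (iter i N u) (iter j N v) a) Nl.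
by rewrite (h (fun i j => N_LY hA hg _ _ _) r 0%N 0%N).
Qed.

Lemma LY_nilp ru rv u v a n : iter ru N u = 0 -> iter rv N v = 0 ->
  (ru + rv <= n)%N -> iter n N (LY A u v a) = 0.
Proof.
move=> hu hv hn; apply: (scalerI (fi_neq0 n)); rewrite scaler0 LY_leibniz.
apply: big1 => k _; have [hk|hk] := leqP ru k.
  by rewrite (nilp_ge Nl hu hk) (lin0 (LY_linl hA _ _)) scaler0.
rewrite [iter (n - k) N v](nilp_ge Nl hv); last by lia.
by rewrite (lin0 (LY_linr hA _ _)) scaler0.
Qed.

Section Fixed.
Variables (a : C) (w : W) (sgn : C).

(** The family u |-> Y(u, x1) x, restricted to the powers x1^{a - j}. *)
Definition D21 (u x : V) : lines R V := fun j b k l =>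
  if (b == 0) && (k == 0%N) && (l == 0%N) then LY A u x (a - j%:R) else 0.

Lemma D21_linl x : linear (D21^~ x).
Proof.
move=> c u v; apply: line_ext => j b k l; rewrite /D21 !linesE.
by case: ifP => _; [exact: LY_linl|rewrite scaler0 addr0].
Qed.

Lemma D21_linr u : linear (D21 u).
Proof.
move=> c x y; apply: line_ext => j b k l; rewrite /D21 !linesE.
by case: ifP => _; [exact: LY_linr|rewrite scaler0 addr0].
Qed.

Lemma D21_N u x : pt N (D21 u x) = D21 (N u) x + D21 u (N x).
Proof.
apply: line_ext => j b k l; rewrite linesE /pt /D21; case: ifP => _.
  exact: (N_LY hA hg).
by rewrite (lin0 Nl) addr0.
Qed.

(** The log-free part of the twist operator applied to D21. *)
Definition T21 (u x : V) : lines R W := fun j b k l =>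
  if (k == 0%N) && (l == 0%N) then sgn *: Zs B w (LY A u x (a - j%:R)) b else 0.

Lemma T21_linl x : linear (T21^~ x).
Proof.
move=> c u v; apply: line_ext => j b k l; rewrite /T21 !linesE.
case: ifP => _; last by rewrite scaler0 addr0.
by rewrite (LY_linl hA) (Zs_linear hA hg hB hlb) scalerDr !scalerA [sgn * c]mulrC.
Qed.

Lemma T21_linr u : linear (T21 u).
Proof.
move=> c x y; apply: line_ext => j b k l; rewrite /T21 !linesE.
case: ifP => _; last by rewrite scaler0 addr0.
by rewrite (LY_linr hA) (Zs_linear hA hg hB hlb) scalerDr !scalerA [sgn * c]mulrC.
Qed.

(** The twist operator applied to D21, with its logarithms. *)
Definition K21 (u x : V) : lines R W := fun j b k l =>
  if l == 0%N then YWV A B w (LY A u x (a - j%:R)) b k else 0.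

(** The family of which K21 is the twist by e^{- (log x2 + pi i) N} in the
    argument u; see K21_H21. *)
Definition H21 rv (x u : V) : lines R W := \sum_(m < rv)
  ((-1) ^+ m * fi m) *: iter m (Lam ci) (T21 u (iter m N x)).

Lemma Lam_T21 m u x j b k l : iter m (Lam ci) (T21 u x) j b k l =
  if l == 0%N then ('C(m, k)%:R * ci ^+ (m - k)) *:
    (sgn *: Zs B w (LY A u x (a - j%:R)) b) else 0.
Proof.
rewrite iter_Lam_eval //= /T21 eqxx /=; case: ifP => // _.
by rewrite scaler0.
Qed.

(** The dependence on log x2 + pi i is exp (- (log x2 + pi i) N), and N is a
    derivation. *)
Lemma K21_H21 su sv sw ru rv u x : parV A su u -> parV A sv x -> parW B sw w ->
  sgn = (-1) ^+ ((su (+) sv) && sw) -> (0 < ru)%N ->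
  iter ru N u = 0 -> iter rv N x = 0 ->
  K21 u x = \sum_(m < ru) ((-1) ^+ m * fi m) *: iter m (Lam ci) (H21 rv x (iter m N u)).
Proof.
move=> hu hx hw es ru0 hru hrv; pose Rb := (ru + rv)%N.
have Ll m := linear_iter m (@Lam_linear R W ci).
pose F k m := ((-1) ^+ (k + m) * (fi k * fi m)) *:
  iter (k + m) (Lam ci) (T21 (iter k N u) (iter m N x)).
have F0 k m : (ru <= k)%N || (rv <= m)%N -> F k m = 0.
  rewrite /F => /orP[h|h].
    by rewrite (nilp_ge Nl hru h) (lin0 (T21_linl _)) (lin0 (Ll _)) scaler0.
  by rewrite (nilp_ge Nl hrv h) (lin0 (T21_linr _)) (lin0 (Ll _)) scaler0.
transitivity (\sum_(M < Rb) \sum_(k < M.+1) F k (M - k)%N).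
  apply: line_ext => j b k l; rewrite /K21 line_sumE; case: ifP => hl; last first.
    symmetry; apply: big1 => M _; rewrite line_sumE big1 // => k' _.
    by rewrite /F linesE Lam_T21 hl scaler0.
  rewrite (YWV_Z hA hg hB hlb _ _ (LY_parity hA _ hu hx) hw (LY_nilp _ hru hrv (leqnn _))).
  rewrite -es scaler_sumr; apply: eq_bigr => M _.
  have E z : sgn *: (dlog R M k *: z) =
      ((-1) ^+ M * ('C(M, k)%:R * ci ^+ (M - k)) * sgn) *: (fi M *: z) :> W.
    by rewrite !scalerA /dlog; congr (_ *: _); ring.
  have Zl := Zs_linear hA hg hB hlb w b.
  rewrite E -(linZ Zl) LY_leibniz (lin_sum Zl) line_sumE scaler_sumr.
  apply: eq_bigr => k' _; rewrite (linZ Zl) /F linesE Lam_T21 hl.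
  rewrite subnKC -1?ltnS // !scalerA; congr (_ *: _); ring.
rewrite -sum_square_antidiag; last first.
  move=> k m hkm; apply: F0; have [//|hk] := leqP ru k.
  by move: hkm; rewrite /Rb; lia.
have rR : (ru <= Rb)%N by exact: leq_addr.
rewrite (sum_trunc rR (f := fun k => \sum_(m < Rb) F k m)); last first.
  by move=> k hk; apply: big1 => m _; rewrite F0 ?hk.
apply: eq_bigr => k _; have vR : (rv <= Rb)%N by exact: leq_addl.
rewrite (sum_trunc vR (f := F k)); last by move=> m hm; rewrite F0 ?hm ?orbT.
rewrite /H21 (lin_sum (Ll k)) scaler_sumr; apply: eq_bigr => m _.
rewrite (linZ (Ll k)) scalerA -iterD /F exprD; congr (_ *: _).
by rewrite mulrACA.
Qed.

End Fixed.

Lemma swap12E (M : Type) (F : fs2 R M) a b k l : swap12 F a b k l = F b a l k.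
Proof. by []. Qed.

Lemma const_line_short (x : V) b' : exists J0, forall J, (J0 <= J)%N ->
  short J (line b' (swap12 (fs2_const x))).
Proof.
have [J0 h] := Re_nat_small b' 0; exists J0 => J hJ j a k l hj.
rewrite /line swap12E /fs2_const /mono; case: eqP => [E|_]; last by rewrite scale0r.
by have := h j (leq_trans hJ hj); rewrite E ltxx.
Qed.

Lemma iter_const_line (x : V) b' s :
  iter s (pt N) (line b' (swap12 (fs2_const x))) =
  line b' (swap12 (fs2_const (iter s N x))).
Proof.
apply: line_ext => j a k l; rewrite iter_pt /line !swap12E /fs2_const.
by rewrite (linZ (linear_iter s Nl)).
Qed.

Lemma const_exp_line v rv r b' : iter rv N v = 0 -> (rv <= r)%N ->
  exists J0, forall J, (J0 <= J)%N -> (0 < J)%N ->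
  line b' (swap12 (fs2_exp (@log21 R) (fun x => - N x) (fs2_const v))) =
  \sum_(s < r) ((-1) ^+ s * fi s) *:
    iter s (Lop ci J) (line b' (swap12 (fs2_const (iter s N v)))).
Proof.
move=> hv hr; have [J0 h] := const_line_short v b'; exists J0 => J hJ Jp.
have -> : swap12 (fs2_exp (@log21 R) (fun x => - N x) (fs2_const v)) =
    fs2_exp (log12c ci) (fun x => - N x) (swap12 (fs2_const v)).
  do 4 apply/funext => ?; rewrite swap12E log21E; exact: exp_swap.
rewrite (line_exp_neg Nl (J := J) (r := r) ci Jp (h J hJ)).
  by apply: eq_bigr => s _; rewrite iter_const_line.
rewrite iter_const_line (nilp_ge Nl hv hr).
by apply: line_ext => j a k l; rewrite /line swap12E /fs2_const scaler0.
Qed.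

Lemma const_exp_supp v rv a b k l : iter rv N v = 0 -> a <> - b ->
  fs2_exp (@log21 R) (fun x => - N x) (fs2_const v) a b k l = 0.
Proof.
move=> hv hab; have [J0 h] := const_exp_line a hv (leqnn rv).
have := congr1 (fun f : lines R V => f 0%N b l k) (h J0.+1 (leqnSn _) (ltn0Sn _)).
rewrite {1}/line swap12E subr0 => ->; rewrite line_sumE; apply: big1 => s _.
have z0 : linear (fun _ : V => 0 : V) by move=> c x y; rewrite scaler0 addr0.
have key := diag_iter z0 ci J0.+1 s (a := b) (f := 0)
  (h := line a (swap12 (fs2_const (iter s N v)))).
have := key _ 0%N l k; rewrite addr0 linesE => ->; first by rewrite scaler0.
move=> j k' l'; rewrite /line swap12E /fs2_const /mono.
case: eqP => [ea|_]; last by rewrite scale0r.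
case: eqP => [eb|_]; last by rewrite scale0r.
case: hab; move/eqP: ea; rewrite subr_eq0 => /eqP ->.
by move/eqP: eb; rewrite addr_eq0 => /eqP ->; rewrite opprK.
Qed.

(** The inner factor Y(u, x1)(-x2 + x1)^{-N} v on one line. *)
Lemma line_inner u v a ru rv r J : iter ru N u = 0 -> iter rv N v = 0 ->
  (rv <= r)%N -> (0 < J)%N ->
  (forall m j, (J <= j)%N -> LY A u (iter m N v) (a - j%:R) = 0) ->
  line a (swap12 (fs2_op1 (fun v0 => laurent (YV A u v0))
    (fs2_exp (@log21 R) (fun x => - N x) (fs2_const v)))) =
  \sum_(s < r) ((-1) ^+ s * fi s) *: iter s (Lop ci J) (D21 a u (iter s N v)).
Proof.
move=> hu hv hr Jp hJ; set E1 := fs2_exp _ _ _.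
have supp a' b' k' l' : a' <> - b' -> E1 a' b' k' l' = 0.
  exact: (const_exp_supp _ _ hv).
apply: line_ext => j b k l; rewrite /line swap12E /fs2_op1.
have lau0 f (c : C) k' : laurent f c k'.+1 = 0 :> V by [].
have lau00 c k' : laurent (YV A u 0) c k' = 0.
  case: k' => [|k'] //; exact: (lin0 (LY_linr hA u c)).
rewrite (fsum_at (i0 := a - j%:R + b)); last first.
  move=> c hc; apply: big1 => k' _; rewrite supp ?lau00 // => E; apply: hc.
  by rewrite -[c](subKr (a - j%:R)) E opprK.
rewrite big_ord_recl big1 ?addr0 => [|k' _]; last by rewrite lau0.
have -> : a - j%:R - (a - j%:R + b) = - b by rewrite opprD addNKr.
rewrite subn0 -[laurent _ _ _]/(LY A u (E1 (- b) b l k) (a - j%:R + b)).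
have [J0 hE] := const_exp_line (- (b - j%:R)) hv hr.
pose J' := maxn J0 J.
have Jp' : (0 < J')%N by rewrite leq_max Jp orbT.
have := congr1 (fun f : lines R V => f j b k l) (hE J' (leq_maxl _ _) Jp').
rewrite {1}/line swap12E opprB addrAC subrr add0r -/E1 => ->.
rewrite !line_sumE (lin_sum (LY_linr hA u _)); apply: eq_bigr => s _.
rewrite !linesE (linZ (LY_linr hA u _)); congr (_ *: _).
have sD : short J (D21 a u (iter s N v)).
  by move=> j' b' k' l' hj; rewrite /D21 hJ //; case: ifP.
rewrite -(iter_Lop_wide ci s sD (leq_maxr J0 J)) -/J'.
have key := diag_iter (LY_linr hA u (a - j%:R + b)) ci J' s (a := b - j%:R)
  (f := line (j%:R - b) (swap12 (fs2_const (iter s N v))))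
  (h := D21 a u (iter s N v)).
have := key _ j k l; rewrite subrK => -> // j' k' l'.
rewrite /D21 /line swap12E /fs2_const /mono.
have -> : j%:R - b - j'%:R = - (b - j%:R + j'%:R) by ring.
rewrite oppr_eq0.
case: eqP => [e0|ne] /=; last first.
  by rewrite scale0r (lin0 (LY_linr hA _ _)).
rewrite andbC; case: ifP => _; last by rewrite scale0r (lin0 (LY_linr hA _ _)).
rewrite scale1r; congr (LY _ _ _ _).
have -> : a - j%:R + b = a + (b - j%:R) by ring.
by move/eqP: e0; rewrite addr_eq0 => /eqP ->.
Qed.

(** As for the other product, now with log(-x2 + x1) = log x2 + pi i +
    log(1 - x1/x2): conjugation gives Y((-x2 + x1)^N u, x1), and the twist
    operator, which depends on its argument through
    e^{- (log x2 + pi i) N}, cancels the part log x2 + pi i. *)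
Lemma prod21_formula su sv sw n u v w a b k l J ru rv :
  parV A su u -> parV A sv v -> parW B sw w ->
  (0 < ru)%N -> iter ru N u = 0 -> iter rv N v = 0 -> (0 < J)%N ->
  (forall i m j, (J <= j)%N -> LY A (iter i N u) (iter m N v) (a - j%:R) = 0) ->
  prod21 A g B n u v w a b k l = if k == 0%N then cexp (ci * n) *:
    \sum_(q < ru) \sum_(j < J) ((-1) ^+ j * (bp n j)`_q) *:
      \sum_(m < rv) dlog R m l *: ((-1) ^+ ((su (+) sv) && sw) *:
        Zs B w (LY A (iter q N u) (iter m N v) (a - j%:R)) (b - n + j%:R)) else 0.
Proof.
move=> hu hv hw ru0 hru hrv Jp hJ; set sgn := (-1) ^+ _.
pose R0 := (ru + rv).+1.
pose P := fs2_op1 (fun v0 => laurent (YV A u v0))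
    (fs2_exp (@log21 R) (fun x => - N x) (fs2_const v)).
pose Q := fs2_exp (@log21 R) N P.
pose O := fs2_op2 (YWV A B w) Q.
have sD i m : short J (D21 a (iter i N u) (iter m N v)).
  by move=> j' b' k' l' hj; rewrite /D21 hJ //; case: ifP.
have tD i : tri J (D21 a (iter i N u) v).
  move=> j b' k' l'; rewrite /D21; case: eqP => [->|] //= ; case: ifP => // _ ne.
  exists 0%N; rewrite oppr0 add0n; split=> //; rewrite ltnNge; apply/negP => h.
  by apply: ne; exact: (hJ i 0%N).
have rvR : (rv <= R0)%N by rewrite leqW ?leq_addl.
(* eP, eQ and eO follow the inner exponential, the outer one and the twist
   operator; e4 removes log x2 + pi i. *)
have eP := line_inner (a := a) hru hrv rvR Jp (hJ 0%N).
rewrite -/P in eP.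
have sP : short J (line a (swap12 P)).
  by rewrite eP; apply: short_sum => s; apply/short_scale/short_iter/(sD 0%N).
have eQ := line_exp_conj Nl Nl Nl (D21_linl a) (D21_linr a) (D21_N a) Jp hru hrv
  (ltnSn _) sP eP.
have sQ : swap12 Q = fs2_exp (log12c ci) N (swap12 P).
  do 4 apply/funext => ?; rewrite swap12E /Q log21E; exact: exp_swap.
rewrite -sQ in eQ.
have tQ : tri J (line a (swap12 Q)).
  by rewrite eQ; apply: tri_sum => i; exact/tri_scale/tri_iter/tD.
have Yl b' l' : linear (fun x => YWV A B w x b' l').
  exact: (YWV_linear hA hg hB hlb).
have oplD u' : opl (YWV A B w) J (D21 a u' v) = K21 a w u' v.
  apply: line_ext => j b' k' l'; rewrite /opl /K21.
  case: (J) Jp => // J' _; rewrite big_ord_recl [X in _ + X]big1 ?addr0 => [|i _].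
    rewrite big_ord_recr /= subnn big1 ?add0r => [|i _].
      by rewrite /D21 oppr0 !eqxx /=; case: ifP => // _; rewrite (lin0 (Yl _ _)).
    rewrite /D21 subn_eq0 [X in _ && X && _]leqNgt ltn_ord andbF.
    exact: (lin0 (Yl _ _)).
  apply: big1 => i' _; rewrite /D21 oppr_eq0 pnatr_eq0 /=.
  exact: (lin0 (Yl _ _)).
have Ol := opl_linear Yl J.
have eO : line a (swap12 O) = \sum_(i < R0) fi i *:
    iter i (Lop ci J) (K21 a w (iter i N u) v).
  rewrite -[swap12 O]/(fs2_op1 (YWV A B w) (swap12 Q)) (line_op1 Yl tQ) eQ.
  rewrite (lin_sum Ol); apply: eq_bigr => i _.
  by rewrite (linZ Ol) (opl_iter Yl) // oplD.
have sK u' : short J (K21 a w (iter u' N u) v).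
  move=> j b' k' l' hj; rewrite /K21 (hJ u' 0%N) //.
  by case: ifP => // _; rewrite (lin0 (Yl _ _)).
have sO : short J (line a (swap12 O)).
  by rewrite eO; apply: short_sum => i; exact/short_scale/short_iter/sK.
pose H u' := K21 a w u' v; pose H0 := H21 a w sgn rv v.
have Hz : H 0 = 0.
  apply: line_ext => j b' k' l'; rewrite /H /K21 (lin0 (LY_linl hA _ _)).
  by case: ifP => // _; rewrite (lin0 (Yl _ _)).
have H0z : H0 0 = 0.
  rewrite /H0 /H21 big1 // => m _.
  by rewrite (lin0 (T21_linl a w sgn _)) (lin0 (linear_iter m (@Lam_linear R W ci))) scaler0.
have hN i : parV A su (iter i N u) by elim: i => //= i; exact: (N_parity hA hg).
have eH i : H (iter i N u) = \sum_(m < ru) ((-1) ^+ m * fi m) *: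
    iter m (Lam ci) (H0 (iter (i + m) N u)).
  rewrite /H (K21_H21 a (hN i) hv hw (erefl _) ru0 _ hrv).
    by apply: eq_bigr => m _; rewrite -iterD addnC.
  by rewrite -iterD (nilp_ge Nl hru) ?leq_addr.
have sl := @sig_linear R W.
have e4 : line a (swap12 O) =
    \sum_(q < ru) fi q *: iter q (ell (@sig R W) J) (H0 (iter q N u)).
  have cm z : Lam ci (ell (@sig R W) J z) = ell (@sig R W) J (Lam ci z).
    by rewrite (comm_ell _ _ (Lam_linear ci)) // => y; exact: Lam_sig.
  have <- := exp_split (H := H) (H0 := H0) Nl (Lam_linear ci)
    (ell_linear sl J) Hz H0z cm ru0 hru eH.
  have rR : (ru <= R0)%N by rewrite leqW ?leq_addr.
  rewrite eO (sum_trunc rR (f := fun i => fi i *: iter i (Lop ci J) (H (iter i N u)))).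
    apply: eq_bigr => i _; congr (_ *: iter _ _ _); apply/funext => z.
    by rewrite LopE.
  move=> i hi; rewrite (nilp_ge Nl hru hi) Hz.
  by rewrite (lin0 (linear_iter i (Lop_linear ci J))) scaler0.
have H0E u' j b' k' l' : H0 u' j b' k' l' = if l' == 0%N then
    \sum_(m < rv) dlog R m k' *: (sgn *: Zs B w (LY A u' (iter m N v) (a - j%:R)) b')
    else 0.
  rewrite /H0 /H21 line_sumE; case: ifP => hl; last first.
    by apply: big1 => m _; rewrite linesE Lam_T21 hl scaler0.
  by apply: eq_bigr => m _; rewrite linesE Lam_T21 hl scalerA.
have sH q : iter J (@sig R W) (H0 (iter q N u)) = 0.
  apply: short_sig0 => j b' k' l' hj; rewrite H0E; case: ifP => // _.
  by apply: big1 => m _; rewrite hJ // (lin0 (Zs_linear hA hg hB hlb _ _)) !scaler0.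
have -> : prod21 A g B n u v w a b k l =
    fs2_mul (fun a b k l => cexp (ci * n) *: pow12 n a b k l) (swap12 O) b a l k.
  by rewrite /prod21 pow21E mul_swap.
have := line_pow (cexp (ci * n)) n 0%N b l k sO; rewrite {1}/line subr0 => ->.
have pl := pw_linear sl J n.
have e5 q : pw (@sig R W) J n (fi q *: iter q (ell (@sig R W) J) (H0 (iter q N u))) =
    \sum_(j < J) ((-1) ^+ j * (bp n j)`_q) *: iter j (@sig R W) (H0 (iter q N u)).
  by rewrite (linZ pl) (pw_ell sl n q (sH _)).
rewrite e4 (lin_sum pl) line_sumE; case: ifP => hk; last first.
  rewrite big1 ?scaler0 // => q _; rewrite e5 line_sumE; apply: big1 => j _.
  by rewrite linesE iter_sigE H0E hk scaler0.
congr (_ *: _); apply: eq_bigr => q _; rewrite e5 line_sumE.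
by apply: eq_bigr => j _; rewrite linesE iter_sigE H0E hk add0n.
Qed.

End Prod21.

(** * The delta function and the translation operator *)

Section DeltaSum.
Variables (R : realType) (M : lmodType R[i]).
Local Notation C := R[i].
Local Notation fi k := ((k`!%:R : C)^-1).

Lemma iter_d2_delta j (a b : C) k l : iter j (@fs2_d2 R C^o) (@delta21 R) a b k l =
  (j`!%:R * cbinom (b + j%:R) j) *: delta21 a (b + j%:R) k l.
Proof.
have dl (a' b' : C) k' l' : delta21 a' b' k' l'.+1 = 0.
  by apply: fsum0 => n; rewrite /mono !andbF.
have f0 i : i`!%:R != 0 :> C by rewrite pnatr_eq0 -lt0n fact_gt0.
elim: j b l => [|j IH] b l.
  by rewrite fact0 cbinom0 mulr1 scale1r addr0.
rewrite iterS {1}/fs2_d2 !IH dl !scaler0 addr0 scalerA.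
have -> : b + 1 + j%:R = b + j.+1%:R by rewrite -natr1; ring.
have E : cbinom (b + j.+1%:R) j.+1 * j.+1%:R = (b + 1) * cbinom (b + j.+1%:R) j.
  by rewrite mulrC cbinomS; congr (_ * _); rewrite -natr1; ring.
congr (_ *: _); rewrite factS natrM.
transitivity (j`!%:R * (cbinom (b + j.+1%:R) j.+1 * j.+1%:R)); last by ring.
by rewrite E; ring.
Qed.

Lemma delta21_int (n : int) k l :
  delta21 (- n%:~R : C) n%:~R k l = ((k == 0%N) && (l == 0%N))%:R.
Proof.
rewrite /delta21 (fsum_at (i0 := n)); first by rewrite /mono !eqxx.
move=> m nm; rewrite /mono; case: eqP => [/oppr_inj/int_inj_C E|] //.
by case: nm.
Qed.

Lemma delta21_supp (a b : C) k l : delta21 a b k l <> 0 ->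
  exists n : int, a = - n%:~R /\ b = n%:~R.
Proof.
move=> h; apply: contrapT => ne; apply: h; apply: fsum0 => n; rewrite /mono.
case: eqP => [ea|] //=; case: eqP => [eb|] //=.
by case: ne; exists n.
Qed.

Lemma mul_mono_m1 (F : fs2 R C^o) a b k l :
  fs2_mul (mono (-1) 0 0 0) F a b k l = F (a + 1) b k l.
Proof.
rewrite /fs2_mul (fsum_at (i0 := (-1, 0))) => [|[p q] hp].
  rewrite (eq_bigr (fun k' : 'I_k.+1 => \sum_(l' < l.+1)
    (((k' == 0 :> nat) && (l' == 0 :> nat))%:R * (1 : C) +
     ((k' == 1 :> nat) && (l' == 0 :> nat))%:R * 0) *:
      F (a + 1) b (k - k')%N (l - l')%N)).
    rewrite (sum_first2 (fun k l => F (a + 1) b k l)) // scale1r.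
    by case: k => [|k]; rewrite ?scale0r addr0.
  move=> k' _; apply: eq_bigr => l' _; rewrite /mono !eqxx /= opprK subr0.
  by rewrite mulr1 mulr0 addr0.
rewrite big1 // => k' _; rewrite big1 // => l' _; rewrite /mono /=.
case: eqP => [ep|_] /=; last by rewrite scale0r.
case: eqP => [eq|_] /=; last by rewrite scale0r.
by case: hp; rewrite ep eq.
Qed.

(** The k-th derivative of the delta function contributes the binomial
    coefficient of the power of x2, which is fixed by the power of x1. *)
Lemma delta_term j (G : fs1 R M) (a b : C) k l :
  fi j *: fs2_mul (fs2_mul (mono (-1) 0 0 0) (iter j (@fs2_d2 R C^o) (@delta21 R)))
    (in_x2 G) a b k l =
  if (k == 0%N) && `[< exists n : int, a = n%:~R >] then
    cbinom (-1 - a) j *: G (b + a + 1 + j%:R) l else 0.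
Proof.
set D := fs2_mul _ (iter _ _ _).
have DE p q k' l' : D p q k' l' =
    (j`!%:R * cbinom (q + j%:R) j) *: delta21 (p + 1) (q + j%:R) k' l'.
  by rewrite /D mul_mono_m1 iter_d2_delta.
have f0 : j`!%:R != 0 :> C by rewrite pnatr_eq0 -lt0n fact_gt0.
rewrite /fs2_mul (fsum_at (i0 := (a, - a - 1 - j%:R))) => [|[p q] hp]; last first.
  apply: big1 => k' _; apply: big1 => l' _; rewrite /= DE /in_x2.
  case: eqP => [ea|_]; last by rewrite scaler0.
  have ep : p = a by rewrite -[p](subKr a) ea subr0.
  have [->|/eqP/delta21_supp [n [en eq]]] := eqVneq (delta21 (p + 1) (q + j%:R) k' l') 0.
    by rewrite scaler0 scale0r.
  case: hp; rewrite ep; congr pair.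
  rewrite -[q](addrK j%:R) eq -[n%:~R]opprK -en ep; ring.
rewrite /= subrr; have -> : b - (- a - 1 - j%:R) = b + a + 1 + j%:R by ring.
case: (pselect (exists n : int, a = n%:~R)) => [[n ea]|na]; last first.
  rewrite (_ : `[< _ >] = false) ?andbF; last exact/asboolPn.
  rewrite big1 ?scaler0 // => k' _; rewrite big1 // => l' _; rewrite DE.
  have [->|/eqP/delta21_supp [n [en _]]] := eqVneq (delta21 (a + 1)
      (- a - 1 - j%:R + j%:R) k' l') 0; first by rewrite scaler0 scale0r.
  by case: na; exists (- n - 1); rewrite rmorphB rmorphN /= -en addrK.
rewrite (_ : `[< _ >] = true) ?andbT; last by apply/asboolP; exists n.
pose c : C := j`!%:R * cbinom (-1 - a) j.
rewrite (eq_bigr (fun k' : 'I_k.+1 => \sum_(l' < l.+1)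
    (((k' == 0 :> nat) && (l' == 0 :> nat))%:R * c +
     ((k' == 1 :> nat) && (l' == 0 :> nat))%:R * 0) *:
      in_x2 G 0 (b + a + 1 + j%:R) (k - k')%N (l - l')%N)).
  rewrite (sum_first2 (fun k l => in_x2 G 0 (b + a + 1 + j%:R) k l)) //.
  rewrite /in_x2 eqxx /=.
  have -> : (match k with 0%N => 0 | k'.+1 => (0 : C) *:
      (if k' == 0%N then G (b + a + 1 + j%:R) l else 0) end) = 0.
    by case: (k) => // k'; rewrite scale0r.
  rewrite addr0 scalerA /c mulrA mulVf // mul1r.
  by case: ifP => // _; rewrite scaler0.
move=> k' _; apply: eq_bigr => l' _; rewrite DE mulr0 addr0; congr (_ *: _).
rewrite subrK -[_ *: _]/(_ * _) mulrC; congr (_ * _).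
  have -> : a + 1 = - (- n - 1)%:~R by rewrite rmorphB rmorphN /= -ea; ring.
  have -> : - a - 1 = (- n - 1)%:~R by rewrite rmorphB rmorphN /= -ea.
  exact: delta21_int.
by rewrite /c; congr (_ * cbinom _ _); ring.
Qed.

End DeltaSum.

Section TranslationMove.
Variables (R : realType) (V W : lmodType R[i]) (A : vsa V) (hA : is_vsa A).
Variables (g : {linear V -> V}) (hg : is_automorphism A g).
Variables (B : twmod V W) (hB : is_twmod A g B) (hlb : lower_bounded B).
Local Notation C := R[i].
Local Notation N := (NV g).
Local Notation L := (Lm1W B).
Local Notation fi k := ((k`!%:R : C)^-1).
Let Yl w a k : linear (fun u => YW B u w a k) := YW_linear_l hB w a k.
Let Yr u a k : linear (fun w => YW B u w a k) := YW_linear_r hB u a k.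
Let Nl : linear N := N_linear hA hg.
Let Ll : linear L. Proof. exact: linearP. Qed.

(** e^{-xL} y_c(u) e^{xL} is the Taylor expansion of the derivations of y_c(u);
    the nilpotent N shifts the upper index of the binomial coefficients. *)
Lemma YW_iterL u c p z : fi p *: YW B u (iter p L z) c 0 =
  \sum_(q < p.+1) fi (p - q) *:
    iter (p - q) L (YW B (polyact N (bp (- c - 1) q) u) z (c + q%:R) 0).
Proof.
pose T (f : W -> W) : W -> W := fun z => f (L z).
have Tl : linear T by [].
pose G i j : W -> W := fun z => i`!%:R *:
  iter j L (YW B (polyact N (bp (- c - 1) i) u) z (c + i%:R) 0).
have hG i j : T (G i j) = G i.+1 j + G i j.+1.
  apply/funext => y; rewrite /T /G (Lm1W_YW hA hg hB) -[RHS]/(_ + _ : W).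
  have e : c + i%:R + 1 = c + i.+1%:R by rewrite -natr1 addrA.
  rewrite e -addrA addrC.
  rewrite (linD (linear_iter j Ll)) scalerDr; congr (_ + _); last by rewrite -iterSr.
  rewrite factS mulnC natrM -scalerA; congr (_ *: _).
  rewrite -(linZ (linear_iter j Ll)) -(linZ (Yl _ _ _)); congr (iter j L _).
  have -> : i.+1%:R *: polyact N (bp (- c - 1) i.+1) u =
      polyact N (('X + (- c - 1 - i%:R)%:P) * bp (- c - 1) i) u.
    by have <- := polyactZ N i.+1%:R (bp (- c - 1) i.+1) u; rewrite -bpS'.
  rewrite (polyactM Nl) polyactD polyactC polyact_X.
  rewrite (linD (Yl _ _ _)) (linZ (Yl _ _ _)) addrC; congr (_ + _).
  by rewrite -scaleNr [RHS](linZ (Yl _ _ _)); congr (_ *: _); rewrite -natr1; ring.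
have h := congr1 (fun f : W -> W => f z) (iter_leibniz Tl hG p 0 0).
have iT r f y : iter r T f y = f (iter r L y).
  elim: r y => //= r IH y; by rewrite /T IH -iterSr.
have e0 : G 0%N 0%N = fun y => YW B u y c 0.
  apply/funext => y; rewrite /G fact0 scale1r bp0 polyactC scale1r addr0.
  by [].
move: h; rewrite e0.
have -> : (fi p *: iter p T (fun y => YW B u y c 0)) z =
    fi p *: (iter p T (fun y => YW B u y c 0) z) by [].
rewrite iT => ->.
have sE (I : Type) (s : seq I) (F : I -> W -> W) : (\sum_(i <- s) F i) z = \sum_(i <- s) F i z.
  by elim/big_rec2 : _ => // i x y _ <-.
rewrite sE; apply: eq_bigr => k _.
rewrite -[LHS]/(_ *: (_ *: _ : W)) !add0n scalerA mulrAC mulVf ?mul1r //.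
Qed.

Lemma polyact_nilp P r u : iter r N u = 0 ->
  polyact N P u = \sum_(q < r) P`_q *: iter q N u.
Proof.
move=> hr; rewrite (@polyact_wide _ _ _ (maxn r (size P))) ?leq_maxr //.
apply: (sum_trunc (leq_maxl _ _) (f := fun q => P`_q *: iter q N u)) => q hq.
by rewrite (nilp_ge Nl hr hq) scaler0.
Qed.

Lemma cexp_nat (x : C) (m : nat) : cexp (cpii R * (x - m%:R)) = (-1) ^+ m * cexp (cpii R * x).
Proof.
rewrite mulrBr cexpD cexpN cexpMn cexp_pii mulrC; congr (_ * _).
by rewrite -exprVn invrN1.
Qed.

Lemma YW_small x w b : exists P, forall p, (P <= p)%N -> YW B x w (b - p%:R) 0 = 0.
Proof.
have [z hz] := YW_trunc hB hlb x w; have [P hP] := Re_nat_small b z.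
by exists P => p /hP; exact: hz.
Qed.

Definition tcoef (b : C) p : C := cexp (cpii R * b) * ((-1) ^+ p * fi p).

(** Moving e^{x2 L(-1)} to the left of Y(u, x1) replaces x1 by x1 - x2 in the
    expansion at large x1, which absorbs (1 - x2/x1)^{n + N}: the double sum over
    j and q collapses by Chu-Vandermonde to the binomial coefficient of the
    log-free identity. *)
Lemma YW_Zs_coreA n (a : int) b r u x w : iter r N u = 0 -> exists P1, forall P, (P1 <= P)%N ->
  exists K1, forall K, (K1 <= K)%N -> forall J, (K1 <= J)%N ->
  \sum_(q < r) \sum_(j < J) ((-1) ^+ j * (bp n j)`_q) *:
    YW B (iter q N u) (Zs B w x (b - j%:R)) (a%:~R - n + j%:R) 0 =
  \sum_(p < P) tcoef b p *: iter p L (coreA B n a (b - p%:R) K u x w).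
Proof.
move=> hr; have [P1 hP1] := YW_small x w b; exists P1 => P hP; exists P => K hK J hJ.
have hPs j : Zs B w x (b - j%:R) = \sum_(p < J) hturn B w x (b - j%:R) p.
  apply: fsum_nat => p hp; rewrite /hturn -addrA -opprD -natrD hP1.
    by rewrite scaler0 (lin0 (linear_iter p Ll)) scaler0.
  by apply: leq_trans (leq_trans hP hJ) (leq_trans hp (leq_addl _ _)).
pose G j q p : W := (cexp (cpii R * b) * ((-1) ^+ p * fi p)) *: iter p L
  (YW B (polyact N (bp n j * ((-1) ^+ q *: bp (n - a%:~R - j%:R - 1) q)) u)
     (YW B x w (b - (j + q + p)%:R) 0) (a%:~R - n + (j + q)%:R) 0).
have G0 j q p : (P1 <= j + q + p)%N -> G j q p = 0.
  move=> h; rewrite /G hP1 // (lin0 (Yr _ _ _)) (lin0 (linear_iter p Ll)).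
  by rewrite scaler0.
transitivity (\sum_(j < J) \sum_(p < J) \sum_(q < p.+1) G j q (p - q)%N).
  rewrite exchange_big; apply: eq_bigr => j _ /=.
  transitivity ((-1) ^+ j *: YW B (polyact N (bp n j) u) (Zs B w x (b - j%:R))
      (a%:~R - n + j%:R) 0).
    rewrite (polyact_nilp _ hr) (lin_sum (Yl _ _ _)) scaler_sumr.
    by apply: eq_bigr => q _; rewrite (linZ (Yl _ _ _)) scalerA.
  rewrite hPs (lin_sum (Yr _ _ _)) scaler_sumr; apply: eq_bigr => p _.
  rewrite /hturn (linZ (Yr _ _ _)) YW_iterL scaler_sumr; apply: eq_bigr => q _.
  have hq : (q <= p)%N by rewrite -ltnS.
  rewrite (linZ (Yr _ _ _)) (linZ (linear_iter _ Ll)) /G.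
  rewrite (polyactM Nl).
  have -> : - (a%:~R - n + j%:R) - 1 = n - a%:~R - j%:R - 1 :> C by ring.
  have cm : polyact N (bp n j) (polyact N ((-1) ^+ q *: bp (n - a%:~R - j%:R - 1) q) u) =
      (-1) ^+ q *: polyact N (bp (n - a%:~R - j%:R - 1) q) (polyact N (bp n j) u).
    have -> := polyactZ N ((-1) ^+ q) (bp (n - a%:~R - j%:R - 1) q) u.
    by rewrite (linZ (polyact_linear Nl _)) -!(polyactM Nl) mulrC.
  rewrite cm (linZ (Yl _ _ _)) (linZ (linear_iter _ Ll)).
  have -> : a%:~R - n + j%:R + q%:R = a%:~R - n + (j + q)%:R by rewrite natrD addrA.
  have -> : (j + q + (p - q) = j + p)%N by rewrite -addnA subnKC.
  have -> : b - j%:R - p%:R = b - (j + p)%:R by rewrite natrD opprD addrA.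
  rewrite !scalerA; congr (_ *: _).
  rewrite cexp_nat exprD; have e1 : (-1) ^+ p = (-1) ^+ (p - q) * (-1) ^+ q :> C.
    by rewrite -exprD subnK.
  have e2 : (-1) ^+ j * (-1) ^+ j = 1 :> C by rewrite -exprMn mulrNN mulr1 expr1n.
  rewrite e1; transitivity ((-1) ^+ j * (-1) ^+ j * (cexp (cpii R * b) *
    ((-1) ^+ (p - q) * fi (p - q)) * (-1) ^+ q)); first by ring.
  by rewrite e2 mul1r.
transitivity (\sum_(p < J) \sum_(Q < J) \sum_(j < Q.+1) G j (Q - j)%N p).
  rewrite [RHS](eq_bigr (fun p : 'I_J => \sum_(j < J) \sum_(q < J) G j q p)).
    rewrite [RHS]exchange_big; apply: eq_bigr => j _ /=.
    rewrite -(sum_square_antidiag (F := fun q p => G j q p)) => [|q p h].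
      exact: exchange_big.
    by apply: G0; rewrite -addnA; apply: leq_trans (leq_addl _ _); lia.
  move=> p _; rewrite (sum_square_antidiag (F := fun j q => G j q p)) // => j q h.
  by apply: G0; apply: leq_trans (leq_addr _ _); lia.
have QE p Q : \sum_(j < Q.+1) G j (Q - j)%N p = tcoef b p *: iter p L
    (cbinom (a + Q%:Z)%:~R Q *: YW B u (YW B x w (b - p%:R - Q%:R) 0)
       (a%:~R + Q%:R - n) 0).
  have -> : (a + Q%:Z)%:~R = a%:~R + Q%:R :> C by rewrite rmorphD.
  transitivity (tcoef b p *: iter p L (YW B (polyact N (\sum_(j < Q.+1) bp n j *
     ((-1) ^+ (Q - j) *: bp (n - a%:~R - j%:R - 1) (Q - j))) u)
     (YW B x w (b - p%:R - Q%:R) 0) (a%:~R + Q%:R - n) 0)); last first.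
    by rewrite bp_vandermonde polyactC (linZ (Yl _ _ _)).
  have psum_act I (s : seq I) (F : I -> {poly C}) :
      polyact N (\sum_(i <- s) F i) u = \sum_(i <- s) polyact N (F i) u.
    elim: s => [|i s IH]; first by rewrite !big_nil polyact0.
    by rewrite !big_cons polyactD IH.
  rewrite psum_act (lin_sum (Yl _ _ _)) (lin_sum (linear_iter p Ll)) scaler_sumr.
  apply: eq_bigr => j _; rewrite /G subnKC -1?ltnS //.
  congr (_ *: iter p L (YW B _ (YW B x w _ 0) _ 0)); last by ring.
  by rewrite natrD opprD addrA addrAC.
have PJ : (P <= J)%N by [].
have Z0 p Q : (P1 <= p + Q)%N -> YW B x w (b - p%:R - Q%:R) 0 = 0.
  by move=> h; rewrite -addrA -opprD -natrD hP1.
transitivity (\sum_(p < P) \sum_(Q < J) \sum_(j < Q.+1) G j (Q - j)%N p).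
  apply: (sum_trunc PJ (f := fun p => \sum_(Q < J) \sum_(j < Q.+1) G j (Q - j)%N p)).
  move=> p hp; apply: big1 => Q _; rewrite QE Z0 ?(lin0 (Yr _ _ _)) ?scaler0.
    by rewrite (lin0 (linear_iter p Ll)) scaler0.
  by apply: leq_trans (leq_addr _ _); lia.
apply: eq_bigr => p _; rewrite (eq_bigr _ (fun (Q : 'I_J) _ => QE p Q)) -scaler_sumr.
congr (_ *: _); rewrite -(lin_sum (linear_iter p Ll)); congr (iter p L _).
rewrite /coreA; pose f Q := cbinom (a + Q%:Z)%:~R Q *:
  YW B u (YW B x w (b - p%:R - Q%:R) 0) (a%:~R + Q%:R - n) 0.
have f0 Q : (P1 <= Q)%N -> f Q = 0.
  move=> h; rewrite /f Z0 ?(lin0 (Yr _ _ _)) ?scaler0 //.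
  by apply: leq_trans (leq_addl _ _).
have P1J : (P1 <= J)%N by lia. have P1K : (P1 <= K)%N by lia.
by rewrite (sum_trunc P1J f0) -(sum_trunc P1K f0).
Qed.

Lemma bounded_max (m m' : nat) (Q : nat -> nat -> nat -> Prop) :
  (forall i j, exists P0, forall P, (P0 <= P)%N -> Q i j P) ->
  exists P1, forall P, (P1 <= P)%N -> forall i j, (i < m)%N -> (j < m')%N -> Q i j P.
Proof.
move=> h; have [F hF] : exists F : nat -> nat -> nat, forall i j P,
    (F i j <= P)%N -> Q i j P.
  have [f hf] := choice (fun ij : nat * nat => h ij.1 ij.2).
  by exists (fun i j => f (i, j)) => i j; exact: (hf (i, j)).
exists (\max_(i < m) \max_(j < m') F i j) => P hP i j hi hj; apply: hF.
apply: leq_trans hP; apply: leq_trans (leq_bigmax (Ordinal hi)) => /=.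
exact: (leq_bigmax (F := fun j : 'I_m' => F i j) (Ordinal hj)).
Qed.

(** Here e^{x2 L(-1)} already stands on the left; only finite sums are exchanged. *)
Lemma Zs_YV_coreB n (a : int) b r u x w J : iter r N u = 0 ->
  (forall q (j : nat), (J <= j)%N -> YV A (iter q N u) x (a - j%:Z) = 0) ->
  exists P1, forall P, (P1 <= P)%N -> forall K, (J <= K)%N -> (r <= K)%N ->
  cexp (cpii R * n) *: (\sum_(q < r) \sum_(j < J) ((-1) ^+ j * (bp n j)`_q) *:
    Zs B w (YV A (iter q N u) x (a - j%:Z)) (b - n + j%:R)) =
  \sum_(p < P) tcoef b p *: iter p L (coreB A g B n a (b - p%:R) K u x w).
Proof.
move=> hr hJ; have [P1 hP1] := bounded_max r J (fun q j =>
  let: ex_intro P0 h := Zs_trunc hA hg hB hlb w (YV A (iter q N u) x (a - j%:Z))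
    (b - n + j%:R) in ex_intro _ P0 (fun P => h P 0%N)).
exists P1 => P hP K hJK hrK.
rewrite scaler_sumr (eq_bigr (fun q : 'I_r => \sum_(p < P) \sum_(j < J)
  tcoef b p *: iter p L ((bp n j)`_q *: YW B (YV A (iter q N u) x (a - j%:Z)) w
    (b - p%:R - n + j%:R) 0))).
  rewrite exchange_big; apply: eq_bigr => p _ /=.
  rewrite exchange_big /coreB (sum_trunc hJK (f := fun j => \sum_(i < K) (bp n j)`_i *:
     YW B (YV A (iter i N u) x (a - j%:Z)) w (b - p%:R - n + j%:R) 0)); last first.
    by move=> j hj; apply: big1 => i _; rewrite hJ // (lin0 (Yl _ _ _)) scaler0.
  rewrite (lin_sum (linear_iter p Ll)) scaler_sumr; apply: eq_bigr => j _ /=.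
  rewrite (sum_trunc hrK (f := fun i => (bp n j)`_i *:
     YW B (YV A (iter i N u) x (a - j%:Z)) w (b - p%:R - n + j%:R) 0)); last first.
    move=> i hi; rewrite (nilp_ge Nl hr hi) (lin0 (YV_linear_l hA _ _)).
    by rewrite (lin0 (Yl _ _ _)) scaler0.
  by rewrite (lin_sum (linear_iter p Ll)) scaler_sumr.
move=> q _; rewrite exchange_big scaler_sumr; apply: eq_bigr => j _ /=.
rewrite (hP1 P hP q j) //= scalerA scaler_sumr; apply: eq_bigr => p _.
rewrite /hturn; have -> : b - n + j%:R - p%:R = b - p%:R - n + j%:R by ring.
rewrite !(linZ (linear_iter p Ll)) !scalerA; congr (_ *: _).
have -> : b - p%:R - n + j%:R = b + (- n) + j%:R - p%:R by ring.
have -> : cexp (cpii R * (b - n + j%:R - p%:R)) = (-1) ^+ p *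
    (cexp (cpii R * b) * (cexp (cpii R * n))^-1 * (-1) ^+ j).
  by rewrite cexp_nat !mulrDr mulrN !cexpD cexpN cexpMn cexp_pii.
rewrite /tcoef.
have e2 : (-1) ^+ j * (-1) ^+ j = 1 :> C by rewrite -exprMn mulrNN mulr1 expr1n.
transitivity ((-1) ^+ j * (-1) ^+ j * (cexp (cpii R * n) * (cexp (cpii R * n))^-1) *
  (cexp (cpii R * b) * ((-1) ^+ p * fi p) * (bp n j)`_q)); first by ring.
by rewrite e2 mulfV ?cexp_neq0 // !mul1r.
Qed.

(** Again e^{x2 L(-1)} is on the left; by the hypothesis on the modes of u the
    sum over k stops at M. *)
Lemma Zs_modes_coreC n (a : int) b M u x w :
  (forall k, (M <= k)%N -> YW B u w (- n - k%:R - 1) 0 = 0) ->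
  exists P1, forall P, (P1 <= P)%N -> forall K, (M <= K)%N ->
  \sum_(k < M) cbinom (-1 - a%:~R) k *:
    Zs B (YWmode B (n + k%:R) 0 u w) x (b + a%:~R + 1 + k%:R) =
  \sum_(p < P) tcoef b p *: iter p L (coreC B n a (b - p%:R) K u x w).
Proof.
move=> hM; have [P1 hP1] := bounded_max 1 M (fun _ k =>
  let: ex_intro P0 h := Zs_trunc hA hg hB hlb (YWmode B (n + k%:R) 0 u w) x
    (b + a%:~R + 1 + k%:R) in ex_intro _ P0 (fun P => h P 0%N)).
exists P1 => P hP K hMK.
rewrite (eq_bigr (fun k : 'I_M => \sum_(p < P) tcoef b p *: iter p L
  (((-1) ^ (a + 1 + k%:Z) * cbinom (-1 - a%:~R) k) *:
     YW B x (YW B u w (- n - k%:R - 1) 0) (b - p%:R + a%:~R + 1 + k%:R) 0))).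
  rewrite exchange_big; apply: eq_bigr => p _ /=.
  rewrite -scaler_sumr -(lin_sum (linear_iter p Ll)) /coreC.
  rewrite (sum_trunc hMK (f := fun k => ((-1) ^ (a + 1 + k%:Z) * cbinom (-1 - a%:~R) k) *:
     YW B x (YW B u w (- n - k%:R - 1) 0) (b - p%:R + a%:~R + 1 + k%:R) 0)) //.
  by move=> k hk; rewrite hM // (lin0 (Yr _ _ _)) scaler0.
move=> k _; rewrite (hP1 P hP 0%N k) //= scaler_sumr; apply: eq_bigr => p _.
rewrite /hturn /YWmode.
have -> : - (n + k%:R) - 1 = - n - k%:R - 1 :> C by rewrite opprD.
have -> : b + a%:~R + 1 + k%:R - p%:R = b - p%:R + a%:~R + 1 + k%:R by ring.
rewrite !(linZ (linear_iter p Ll)) !scalerA; congr (_ *: _).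
have -> : b - p%:R + a%:~R + 1 + k%:R = b + (a + 1 + k%:Z)%:~R - p%:R.
  by rewrite !rmorphD /= -[k%:Z%:~R]/(k%:R); ring.
rewrite cexp_nat mulrDr cexpD cexpMz cexp_pii /tcoef; ring.
Qed.

End TranslationMove.

(** * The identities for the twist operator *)

Section Main.
Variables (R : realType) (V W : lmodType R[i]) (A : vsa V) (hA : is_vsa A).
Variables (g : {linear V -> V}) (hg : is_automorphism A g).
Variables (B : twmod V W) (hB : is_twmod A g B) (hlb : lower_bounded B).
Local Notation C := R[i].
Local Notation N := (NV g).
Let Yl w a k : linear (fun u => YW B u w a k) := YW_linear_l hB w a k.
Let Yr u a k : linear (fun w => YW B u w a k) := YW_linear_r hB u a k.
Let Nl : linear N := N_linear hA hg.
Let Ll : linear (Lm1W B). Proof. exact: linearP. Qed.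

Lemma iterN_parity s v m : parV A s v -> parV A s (iter m N v).
Proof. by move=> hv; elim: m => //= m; exact: (N_parity hA hg). Qed.

Lemma iterN_Vtw n v m : Vtw g n v -> Vtw g n (iter m N v).
Proof. by move=> hv; elim: m => //= m; exact: (N_Vtw hA hg). Qed.

Lemma prod12_nonint n u v w a b k l su sv sw :
  Vtw g n u -> parV A su u -> parV A sv v -> parW B sw w ->
  (forall z : int, a <> z%:~R) -> prod12 A B n u v w a b k l = 0.
Proof.
move=> hu hsu hsv hsw ha; have [r0 hr0] := N_nilp hA hg u.
have hr : iter r0.+1 N u = 0 by rewrite (nilp_ge Nl hr0).
have [rv hrv] := N_nilp hA hg v.
have [J hJ] := YWV_short hA hg hB hlb b hsv hsw.
have hJ1 j l' : (J.+1 <= j)%N -> YWV A B w v (b - j%:R) l' = 0.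
  by move=> h; apply: hJ; exact: ltnW.
rewrite (prod12_formula hA hg hB n a k l (ltn0Sn J) hJ1 (K := rv) _ (ltn0Sn _) hr).
  case: ifP => // _; apply: big1 => q _; apply: big1 => j _.
  rewrite (YW_exponents hA hg hB (al := n)) ?scaler0 //; first exact: iterN_Vtw.
  move=> z; apply/eqP => E; apply: (ha (z - j%:Z)).
  by rewrite rmorphB /= -E -[j%:Z%:~R]/(j%:R); ring.
by move=> j l' h; exact: (YWV_log hA hg hB hlb _ hsv hsw hrv h).
Qed.

Lemma prod21_nonint n u v w a b k l su sv sw :
  parV A su u -> parV A sv v -> parW B sw w ->
  (forall z : int, a <> z%:~R) -> prod21 A g B n u v w a b k l = 0.
Proof.
move=> hsu hsv hsw ha; have [r0 hr0] := N_nilp hA hg u.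
have hr : iter r0.+1 N u = 0 by rewrite (nilp_ge Nl hr0).
have [rv hrv] := N_nilp hA hg v.
have L0 u' v' (j : nat) : LY A u' v' (a - j%:R) = 0.
  apply: laurent_nint => z; apply/eqP => E; apply: (ha (z + j%:Z)).
  by rewrite rmorphD /= E -[j%:Z%:~R]/(j%:R) subrK.
rewrite (prod21_formula hA hg hB hlb n b k l hsu hsv hsw (ltn0Sn _) hr hrv
  (J := 1) (ltn0Sn _)) //.
case: ifP => // _; rewrite big1 ?scaler0 // => q _; apply: big1 => j _.
rewrite big1 ?scaler0 // => m _.
by rewrite L0 (lin0 (Zs_linear hA hg hB hlb w _)) !scaler0.
Qed.

Lemma delta_sumE n M u v w a b k l : delta_sum A B n M u v w a b k l =
  if (k == 0%N) && `[< exists z : int, a = z%:~R >] then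
    \sum_(j < M) cbinom (-1 - a) j *:
      YWV A B (YWmode B (n + j%:R) 0 u w) v (b + a + 1 + j%:R) l else 0.
Proof.
rewrite /delta_sum (eq_bigr _ (fun j _ => delta_term _ _ _ _ _ _)).
by case: ifP => // _; apply: big1.
Qed.

(** Expanding all three terms in powers of L(-1) and of log x2 + pi i, the
    coefficients form the log-free identity with v replaced by N^m v. The
    logarithm n of the eigenvalue varies in a coset of Z: raising it until u has
    no singular modes on w empties the sum, which is the second identity of the
    theorem. *)
Lemma twist_jacobi n M u v w su sv sw a b k l :
  Vtw g n u -> parV A su u -> parV A sv v -> parW B sw w ->
  (forall j, (M <= j)%N -> YW B u w (- n - j%:R - 1) 0 = 0) ->
  prod12 A B n u v w a b k l -
  (-1) ^+ (su && sw) *: prod21 A g B n u v w a b k l =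
  delta_sum A B n M u v w a b k l.
Proof.
move=> hu hsu hsv hsw hM; rewrite delta_sumE.
case: (pselect (exists z : int, a = z%:~R)) => [[a0 ->]|na]; last first.
  rewrite (_ : `[< _ >] = false) ?andbF; last exact/asboolPn.
  have ha z : a <> z%:~R by move=> E; apply: na; exists z.
  rewrite (prod12_nonint _ _ _ hu hsu hsv hsw ha).
  by rewrite (prod21_nonint _ _ _ _ hsu hsv hsw ha) scaler0 subr0.
rewrite (_ : `[< _ >] = true) ?andbT; last by apply/asboolP; exists a0.
have [r0 hr0] := N_nilp hA hg u; pose r := r0.+1.
have hr : iter r N u = 0 by rewrite (nilp_ge Nl hr0).
have [rv hrv] := N_nilp hA hg v; pose x m := iter m N v.
have [J12 hJ12] := YWV_short hA hg hB hlb b hsv hsw.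
have [J21 hJ21] := LY_short hA hg a0%:~R hr hrv.
have hJ21' m q (j : nat) : (J21 <= j)%N -> YV A (iter q N u) (x m) (a0 - j%:Z) = 0.
  move=> hj; have := hJ21 q m j hj.
  by rewrite -[j%:R]/(j%:Z%:~R) -rmorphB /LY laurent_int.
have [PA hPA] := bounded_max rv 1 (fun m _ =>
  YW_Zs_coreA hA hg hB hlb n a0 b (x m) w hr).
have [PB hPB] := bounded_max rv 1 (fun m _ =>
  Zs_YV_coreB hA hg hB hlb n b w hr (hJ21' m)).
have [PC hPC] := bounded_max rv 1 (fun m _ =>
  Zs_modes_coreC hA hg hB hlb a0 b (x m) hM).
pose P := maxn PA (maxn PB PC).
have lPA : (PA <= P)%N by rewrite leq_maxl.
have lPB : (PB <= P)%N by rewrite /P; lia.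
have lPC : (PC <= P)%N by rewrite /P; lia.
have [KA hKA] : exists KA, forall K, (KA <= K)%N -> forall m, (m < rv)%N ->
    forall J, (KA <= J)%N ->
    \sum_(q < r) \sum_(j < J) ((-1) ^+ j * (bp n j)`_q) *:
      YW B (iter q N u) (Zs B w (x m) (b - j%:R)) (a0%:~R - n + j%:R) 0 =
    \sum_(p < P) tcoef b p *: iter p (Lm1W B) (coreA B n a0 (b - p%:R) K u (x m) w).
  have h m : exists K1, forall K, (K1 <= K)%N -> (m < rv)%N -> forall J, (K1 <= J)%N ->
    \sum_(q < r) \sum_(j < J) ((-1) ^+ j * (bp n j)`_q) *:
      YW B (iter q N u) (Zs B w (x m) (b - j%:R)) (a0%:~R - n + j%:R) 0 =
    \sum_(p < P) tcoef b p *: iter p (Lm1W B) (coreA B n a0 (b - p%:R) K u (x m) w).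
    have [hm|hm] := ltnP m rv; last by exists 0%N.
    have [K1 hK1] := hPA P lPA m 0%N hm (ltn0Sn _).
    by exists K1 => K hK _; exact: hK1.
  have [f hf] := choice h.
  exists (\max_(m < rv) f m) => K hK m hm J hJ.
  have fm : (f m <= \max_(m < rv) f m)%N by exact: (leq_bigmax (Ordinal hm)).
  by apply: hf => //; exact: leq_trans fm _.
have [KC hKC] := bounded_max rv P (fun m p =>
  core_identity hA hg hB hlb w a0 (b - p%:R) hu hsu (iterN_parity m hsv)).
pose K := maxn KA (maxn KC (maxn J21 (maxn r M))).
have [lKA lKC lJ21 lr lM] : [/\ (KA <= K)%N, (KC <= K)%N, (J21 <= K)%N, (r <= K)%N &
    (M <= K)%N] by rewrite /K; split; lia.
pose J := (maxn J12 KA).+1.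
(* The three terms for N^m v, without signs and without the factor in log x2. *)
pose S1 m := \sum_(q < r) \sum_(j < J) ((-1) ^+ j * (bp n j)`_q) *:
  YW B (iter q N u) (Zs B w (x m) (b - j%:R)) (a0%:~R - n + j%:R) 0.
pose S2 m := cexp (cpii R * n) *: (\sum_(q < r) \sum_(j < J21) ((-1) ^+ j * (bp n j)`_q) *:
    Zs B w (YV A (iter q N u) (x m) (a0 - j%:Z)) (b - n + j%:R)).
pose S3 m := \sum_(k < M) cbinom (-1 - a0%:~R) k *:
    Zs B (YWmode B (n + k%:R) 0 u w) (x m) (b + a0%:~R + 1 + k%:R).
have key m : (m < rv)%N -> S1 m - S2 m = (-1) ^+ (su && sv) *: S3 m.
  move=> hm; rewrite /S1 (hKA K) //; last by rewrite /J; lia.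
  rewrite /S2 (hPB P lPB m 0%N hm (ltn0Sn _) K) // /S3 (hPC P lPC m 0%N hm (ltn0Sn _) K) //.
  rewrite -sumrB scaler_sumr; apply: eq_bigr => p _.
  rewrite -scalerBr -(linB (linear_iter p Ll)) (hKC K lKC m p hm) //.
  by rewrite (linZ (linear_iter p Ll)) !scalerA mulrC.
have J0 : (0 < J)%N by [].
have hJ1 j l' : (J <= j)%N -> YWV A B w v (b - j%:R) l' = 0.
  by move=> h; apply: hJ12; rewrite /J in h; lia.
have hlog j l' : (rv <= l')%N -> YWV A B w v (b - j%:R) l' = 0.
  by move=> h; exact: (YWV_log hA hg hB hlb _ hsv hsw hrv h).
have J210 : (0 < J21.+1)%N by [].
have hJ2 i m j : (J21.+1 <= j)%N -> LY A (iter i N u) (iter m N v) (a0%:~R - j%:R) = 0.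
  by move=> h; apply: hJ21; exact: ltnW.
rewrite (prod12_formula hA hg hB n a0%:~R k l J0 hJ1 hlog (ltn0Sn r0) hr).
rewrite (prod21_formula hA hg hB hlb n b k l hsu hsv hsw (ltn0Sn r0) hr hrv J210 hJ2).
case: ifP => hk; last by rewrite scaler0 subr0.
set E1 := (X in X - _ = _); set E2 := (X in _ - _ *: X = _).
have E12 : E1 = \sum_(m < rv) ((-1) ^+ (sv && sw) * dlog R m l) *: S1 m.
  rewrite /E1 /S1; under [RHS]eq_bigr => m _ do rewrite scaler_sumr.
  rewrite [RHS]exchange_big; apply: eq_bigr => q _ /=.
  under [RHS]eq_bigr => m _ do rewrite scaler_sumr.
  rewrite [RHS]exchange_big; apply: eq_bigr => j _ /=.
  rewrite (YWV_Z hA hg hB hlb _ l hsv hsw hrv) (linZ (Yr _ _ _)) (lin_sum (Yr _ _ _)).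
  rewrite !scaler_sumr; apply: eq_bigr => m _.
  by rewrite (linZ (Yr _ _ _)) !scalerA; congr (_ *: _); ring.
have E21 : E2 = \sum_(m < rv) ((-1) ^+ ((su (+) sv) && sw) * dlog R m l) *: S2 m.
  rewrite /E2 /S2 scaler_sumr.
  under [RHS]eq_bigr => m _ do rewrite scalerA scaler_sumr.
  rewrite [RHS]exchange_big; apply: eq_bigr => q _ /=.
  under [RHS]eq_bigr => m _ do rewrite scaler_sumr.
  rewrite [RHS]exchange_big /= big_ord_recr /= [X in _ *: (_ + X)](_ : _ = 0).
    rewrite addr0 scaler_sumr; apply: eq_bigr => j _.
    rewrite !scaler_sumr; apply: eq_bigr => m _.
    rewrite -[j%:R]/(j%:Z%:~R) -rmorphB /LY laurent_int !scalerA; congr (_ *: _).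
    by ring.
  rewrite big1 ?scaler0 // => m _.
  by rewrite hJ21 // (lin0 (Zs_linear hA hg hB hlb w _)) !scaler0.
have hW j : parW B (su (+) sw) (YWmode B (n + j%:R) 0 u w).
  exact: (YW_parity hB).
have E3 : \sum_(j < M) cbinom (-1 - a0%:~R) j *:
      YWV A B (YWmode B (n + j%:R) 0 u w) v (b + a0%:~R + 1 + j%:R) l =
    \sum_(m < rv) ((-1) ^+ (sv && (su (+) sw)) * dlog R m l) *: S3 m.
  rewrite /S3; under [RHS]eq_bigr => m _ do rewrite scaler_sumr.
  rewrite [RHS]exchange_big; apply: eq_bigr => j _ /=.
  rewrite (YWV_Z hA hg hB hlb _ l hsv (hW j) hrv) !scaler_sumr; apply: eq_bigr => m _.
  by rewrite !scalerA; congr (_ *: _); ring.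
rewrite E12 E21 E3 scaler_sumr -sumrB; apply: eq_bigr => m _.
have -> : S1 m = S2 m + (-1) ^+ (su && sv) *: S3 m.
  by rewrite -(key m (ltn_ord m)) addrC subrK.
move: (S2 m) (S3 m) => y z; rewrite scalerDr !scalerA addrAC -scalerBl.
have -> : (-1) ^+ (sv && sw) * dlog R m l -
    (-1) ^+ (su && sw) * ((-1) ^+ ((su (+) sv) && sw) * dlog R m l) = 0.
  rewrite mulrA -signr_addb -mulrBl.
  suff -> : (su && sw) (+) ((su (+) sv) && sw) = sv && sw by rewrite subrr mul0r.
  by case: (su); case: (sv); case: (sw).
rewrite scale0r add0r; congr (_ *: _).
rewrite mulrAC -signr_addb; congr ((-1) ^+ _ * _).
by case: (su); case: (sv); case: (sw).
Qed.

Lemma power_series_modes n M u w : YW0_power_series B (n + M%:R) u w ->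
  forall j, (M <= j)%N -> YW B u w (- n - j%:R - 1) 0 = 0.
Proof.
move=> h j hj; apply/eqP/negP => /negP /h [i E].
have : (i + j.+1)%N = M.
  apply: (@nat_inj_C R); rewrite natrD -E -natr1; ring.
by lia.
Qed.

Lemma delta_sum0 n u v w a b k l : delta_sum A B n 0 u v w a b k l = 0.
Proof. by rewrite /delta_sum big_ord0. Qed.

Lemma fs2_exp0 (M : lmodType C) s (F : fs2 R M) (N0 : M -> M) :
  (forall x, N0 x = 0) -> fs2_exp s N0 F = F.
Proof.
move=> hN; apply/funext => a; apply/funext => b; apply/funext => k; apply/funext => l.
rewrite /fs2_exp (fsum_at (i0 := 0%N)) /= ?fact0 ?invr1 ?scale1r // => -[|r] // _.
rewrite iterS /fs2_mul fsum0 ?scaler0 // => p.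
by apply: big1 => i _; apply: big1 => j _; rewrite hN scaler0.
Qed.

Lemma op1_in_x2 (Y : W -> fs1 R W) (G : fs1 R W) a b k l :
  (forall c m, Y 0 c m = 0) -> fs2_op1 Y (in_x2 G) a b k l = Y (G b l) a k.
Proof.
move=> Y0; rewrite /fs2_op1 (fsum_at (i0 := a)) => [|c hc].
  rewrite big_ord_recr big1 => [|k' _]; rewrite /in_x2 subrr eqxx /=.
    by rewrite subnn add0r.
  by rewrite subn_eq0 leqNgt ltn_ord Y0.
apply: big1 => k' _; rewrite /in_x2; case: eqP => [/eqP E|_] /=; last by rewrite Y0.
by case: hc; move: E; rewrite subr_eq0 => /eqP.
Qed.

(** The formula of prod12_formula with N = 0, where the polynomials bp n j reduce
    to binomial coefficients. *)
Lemma prod12_semisimple n u v w su sv sw a b k l :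
  (forall x, N x = 0) -> parV A su u -> parV A sv v -> parW B sw w ->
  prod12 A B n u v w a b k l = prod12_ss A B n u v w a b k l.
Proof.
move=> N0 hsu hsv hsw; have Y0 c m : YW B u 0 c m = 0 by rewrite (lin0 (Yr _ _ _)).
have [J hJ] := YWV_short hA hg hB hlb b hsv hsw.
have hJ1 j l' : (J.+1 <= j)%N -> YWV A B w v (b - j%:R) l' = 0.
  by move=> h; apply: hJ; exact: ltnW.
have [rv hrv] := N_nilp hA hg v.
have hlog j l' : (rv <= l')%N -> YWV A B w v (b - j%:R) l' = 0.
  by move=> h; exact: (YWV_log hA hg hB hlb _ hsv hsw hrv h).
rewrite (prod12_formula hA hg hB n a k l (ltn0Sn J) hJ1 hlog (ltn0Sn 0) (N0 u)).
rewrite /prod12_ss pow12E (mul_pow12 1 n a k l (J := J.+1)); last first.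
  by move=> j a' k' l' hj; rewrite op1_in_x2 // hJ1.
case: k => [|k] /=.
  by rewrite big_ord1; apply: eq_bigr => j _; rewrite mul1r op1_in_x2.
symmetry; apply: big1 => j _; rewrite op1_in_x2 // (YW_logE hA hg hB) iterS N0.
by rewrite (lin0 (Yl _ _ _)) !scaler0.
Qed.

Lemma prod21_semisimple n u v w a b k l :
  (forall x, N x = 0) ->
  prod21 A g B n u v w a b k l = prod21_ss A B n u v w a b k l.
Proof. by move=> N0; rewrite /prod21 !fs2_exp0 // => x; rewrite N0 oppr0. Qed.

(** If g^n = 1, then y_k = n^{-1} sum_j z^{-jk} g^j v with z a primitive n-th root
    of unity is an eigenvector of eigenvalue z^k, and the y_k add up to v. *)
Lemma finite_order_semisimple : aut_finite_order g -> aut_semisimple g.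
Proof.
case=> n [n0 hn] v; pose z := cexp (2 * cpii R * (n%:R)^-1).
have nC : n%:R != 0 :> C by rewrite pnatr_eq0 -lt0n.
have zn : z ^+ n = 1.
  by rewrite -cexpMn mulfVK //; have := e2_int R 1; rewrite mulr1.
have z0 : z != 0 by exact: cexp_neq0.
have zj j : (0 < j < n)%N -> z ^+ j != 1.
  move=> /andP[j0 jn]; apply/eqP; rewrite -cexpMn -mulrA => /e2_eq1 [m E].
  have {}E : j%:Z%:~R = (m * n%:Z)%:~R :> C.
    by rewrite rmorphM /= -E mulrAC mulVf // mul1r.
  have := congr1 absz (int_inj_C E); rewrite abszM /= => {}E.
  by have := dvdn_leq j0 (_ : n %| j)%N; rewrite E dvdn_mull // leqNgt -E jn => /(_ isT).
have gl := g_linear g.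
pose c j k := z^-1 ^+ (j * k).
pose y k := n%:R^-1 *: \sum_(j < n) c j k *: iter j g v.
have cS j k : c j k = z ^+ k * c j.+1 k.
  by rewrite /c mulSn exprD mulrA -exprMn mulfV // expr1n mul1r.
have cn k : c n k = c 0%N k by rewrite /c mul0n exprM exprVn zn invr1 expr1n.
have shift k : \sum_(j < n) c j.+1 k *: iter j.+1 g v =
               \sum_(j < n) c j k *: iter j g v.
  have [m nm] : exists m, n = m.+1 by exists n.-1; rewrite prednK.
  rewrite [in LHS]nm [in RHS]nm big_ord_recr [in RHS]big_ord_recl /=.
  by rewrite -[g (iter m g v)]/(iter m.+1 g v) -nm hn cn addrC.
exists [seq (z ^+ k, y k) | k <- iota 0 n]; split.
  move=> _ /mapP [k _ ->] /=; rewrite /y (linZ gl) (lin_sum gl) scalerA.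
  rewrite mulrC -scalerA; congr (_ *: _); rewrite -shift scaler_sumr.
  by apply: eq_bigr => j _; rewrite (linZ gl) scalerA -cS.
rewrite big_map /=; have -> : \sum_(k <- iota 0 n) y k = \sum_(k < n) y k.
  by rewrite -[n in iota 0 n]subn0 -/(index_iota 0 n) big_mkord.
rewrite /y -scaler_sumr exchange_big /=.
(* Only j = 0 survives: for 0 < j < n the geometric sum of the powers of the
   nontrivial n-th root of unity z^-j vanishes. *)
have gs j : (0 < j < n)%N -> \sum_(k < n) c j k = 0.
  move=> hj; have q1 : z^-1 ^+ j - 1 != 0.
    by rewrite subr_eq0 exprVn invr_eq1 zj.
  have qn : (z^-1 ^+ j) ^+ n = 1.
    by rewrite -exprM mulnC exprM exprVn zn invr1 expr1n.
  have := subrX1 (z^-1 ^+ j) n; rewrite qn subrr => /esym/eqP; rewrite mulf_eq0 (negbTE q1) /= => /eqP E.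
  by rewrite -[RHS]E; apply: eq_bigr => k _; rewrite /c exprM.
rewrite (bigD1 (Ordinal n0)) //= [X in _ + X]big1 => [|j j0]; last first.
  by rewrite -scaler_suml gs ?scale0r // lt0n ltn_ord andbT.
rewrite addr0 -scaler_suml (eq_bigr (fun=> 1)) => [|k _]; last by rewrite /c mul0n.
by rewrite sumr_const card_ord scalerA mulVf // scale1r.
Qed.

End Main.

Theorem corollary4p8 (R : realType) (V : lmodType R[i]) (A : vsa V)
    (hA : is_vsa A) (g : {linear V -> V}) (hg : is_automorphism A g)
    (W : lmodType R[i]) (B : twmod V W) (hB : is_twmod A g B)
    (hlb : lower_bounded B)
    (alpha : R[i]) (halpha : in_strip alpha)
    (u v : V) (w : W) (su sv sw : bool)
    (hu : Vtw g alpha u) (hsu : parV A su u)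
    (hsv : parV A sv v) (hsw : parW B sw w)
    (M : nat) (hM0 : (0 < M)%N)
    (hM : YW0_power_series B (alpha + M%:R) u w) :
  [/\ (forall a b k l,
         prod12 A B alpha u v w a b k l -
         (-1) ^+ (su && sw) *: prod21 A g B alpha u v w a b k l =
         delta_sum A B alpha M u v w a b k l),
      (forall a b k l,
         prod12 A B (alpha + M%:R) u v w a b k l =
         (-1) ^+ (su && sw) *: prod21 A g B (alpha + M%:R) u v w a b k l),
      (aut_semisimple g ->
         (forall a b k l,
            prod12_ss A B alpha u v w a b k l -
            (-1) ^+ (su && sw) *: prod21_ss A B alpha u v w a b k l =
            delta_sum A B alpha M u v w a b k l) /\
         (forall a b k l,
            prod12_ss A B (alpha + M%:R) u v w a b k l =
            (-1) ^+ (su && sw) *: prod21_ss A B (alpha + M%:R) u v w a b k l)) &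
      (aut_finite_order g -> aut_semisimple g)].
Proof.
have jac a b k l := twist_jacobi hA hg hB hlb a b k l hu hsu hsv hsw
                      (power_series_modes hM).
have huM : Vtw g (alpha + M%:R) u.
  by move: hu; rewrite /Vtw mulrDr cexpD (e2_int R M%:Z) mulr1.
have hM' : YW0_power_series B ((alpha + M%:R) + 0%:R) u w by rewrite addr0.
have loc a b k l : prod12 A B (alpha + M%:R) u v w a b k l =
    (-1) ^+ (su && sw) *: prod21 A g B (alpha + M%:R) u v w a b k l.
  apply: subr0_eq; rewrite -(delta_sum0 A B (alpha + M%:R) u v w a b k l).
  exact: (twist_jacobi hA hg hB hlb a b k l huM hsu hsv hsw
            (power_series_modes hM')).
split; [exact: jac|exact: loc|move=> hss|exact: finite_order_semisimple].
have N0 := N_semisimple hA hg hss.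
have E12 n a b k l := prod12_semisimple hA hg hB hlb n a b k l N0 hsu hsv hsw.
have E21 n a b k l := prod21_semisimple A B n u v w a b k l N0.
by split=> a b k l; rewrite -E12 -E21.
Qed.
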